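(* Let $X$ be the super-Brownian motion with branching mechanism $\psi$ described in the context, with $\lambda_1>0$. For every finite measure $\mu$ on $\mathbb{R}$, under $\mathbb{P}_\mu$ the random measures $X_t+\sqrt{\lambda_1/2}\,t$ converge in distribution (as $t\to+\infty$, in the space of locally finite measures on $\mathbb{R}$ with the vague topology) to $W^h_\infty(X)\,\eta_+(dx)$, and $X_t-\sqrt{\lambda_1/2}\,t$ converge in distribution to $W^h_\infty(X)\,\eta_-(dx)$, where $\eta_\pm(dx):=C_\pm e^{\pm\sqrt{2\lambda_1}x}\,dx$.
   Context: Let $(B_t)_{t\ge0}$ be standard one-dimensional Brownian motion with laws $\Pi_x$ and semigroup $P_t$. The branching mechanism is $\psi(x,\lambda)=-\beta(x)\lambda+\alpha(x)\lambda^2+\int_{(0,\infty)}(e^{-\lambda u}-1+\lambda u)\,\pi(x,du)$, where $\beta$ is continuous with compact support, $\alpha\ge0$ is continuous, compactly supported and not identically zero, and $\pi$ is a kernel from $\mathbb{R}$ to $(0,\infty)$ with $x\mapsto\int u^2\pi(x,du)$ nonnegative, continuous and compactly supported. For a finite measure $\mu$, $\mathbb{P}_\mu$ is the law of the measure-valued Markov process $X$ with $X_0=\mu$ and $\mathbb{P}_\mu[e^{-\langle f,X_t\rangle}]=e^{-\langle u_f(t,\cdot),\mu\rangle}$ for bounded nonnegative measurable $f$, where $u_f$ is the unique nonnegative locally bounded solution of $u_f(t,x)=P_tf(x)-\int_0^tP_s(\psi(\cdot,u_f(t-s,\cdot)))(x)\,ds$. Let $\lambda_1:=\sup\sigma(\tfrac12\Delta+\beta)>0$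 (assumed), with strictly positive bounded continuous eigenfunction $h$, $\int h^2=1$. $W^h_\infty(X)$ is the almost sure limit of the nonnegative martingale $e^{-\lambda_1t}\langle h,X_t\rangle$. Constants: $C_-:=\frac{1}{\sqrt{2\lambda_1}}\int_{\mathbb{R}}\beta(y)h(y)e^{\sqrt{2\lambda_1}y}dy$ and $C_+:=\frac{1}{\sqrt{2\lambda_1}}\int_{\mathbb{R}}\beta(y)h(y)e^{-\sqrt{2\lambda_1}y}dy$. For a locally finite measure $\nu$ and $x\in\mathbb{R}$, $\nu+x$ is defined by $\int f(y)(\nu+x)(dy)=\int f(y+x)\nu(dy)$. *)

(* Defs.v *)
From HB Require Import structures.
From mathcomp Require Import all_boot all_order all_algebra.
From mathcomp Require Import all_classical all_reals all_analysis.
From mathcomp Require Import measurable_realfun.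
Set Implicit Arguments.
Unset Strict Implicit.
Unset Printing Implicit Defensive.
Import Order.TTheory GRing.Theory Num.Theory.
Import numFieldNormedType.Exports.
Local Open Scope classical_set_scope.
Local Open Scope ring_scope.

Section SBM.
Variable R : realType.

Notation leb := (@lebesgue_measure R).
Notation meas := {measure set R -> \bar R}.

Definition compact_supp (f : R -> R) : Prop :=
  exists M : R, forall x, M < `|x| -> f x = 0.

Definition Cc (f : R -> R) : Prop := continuous f /\ compact_supp f.

Definition bnn_meas (f : R -> R) : Prop :=
  measurable_fun setT f /\ (forall x, 0 <= f x) /\ exists M : R, forall x, f x <= M.

Definition gauss (t x : R) : R :=
  expR (- (x ^+ 2) / (2 * t)) / Num.sqrt (2 * pi * t).

Definition bm_sg (t : R) (f : R -> R) (x : R) : R :=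
  if t <= 0 then f x
  else \int[leb]_(y in setT) (f y * gauss t (y - x)).

Definition pairing (nu : meas) (f : R -> R) : R :=
  \int[nu]_(y in setT) f y.

Definition psi (beta alpha : R -> R) (pik : R -> meas) (x l : R) : R :=
  - beta x * l + alpha x * l ^+ 2
  + \int[pik x]_(u in setT) (expR (- (l * u)) - 1 + l * u).

Definition mild_solution (beta alpha : R -> R) (pik : R -> meas)
    (f : R -> R) (u : R -> R -> R) : Prop :=
  measurable_fun setT (fun p : R * R => u p.1 p.2) /\
  (forall t x, 0 <= t -> 0 <= u t x) /\
  (forall T : R, exists M : R, forall t x, 0 <= t <= T -> u t x <= M) /\
  (forall t x, 0 <= t ->
     u t x = bm_sg t f x
             - \int[leb]_(s in `[0, t]%classic)
                  bm_sg s (fun y => psi beta alpha pik y (u (t - s) y)) x).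

(** the Rayleigh quotients of 1/2 Delta + beta on C^1_c test functions with
    unit L^2 norm; its supremum is the top of the spectrum of the
    (Friedrichs) self-adjoint operator 1/2 Delta + beta on L^2(R). *)
Definition rayleigh_values (beta : R -> R) : set R :=
  [set v | exists phi : R -> R,
     (forall x, derivable phi x 1) /\ continuous (derive1 phi) /\
     compact_supp phi /\
     (\int[leb]_(x in setT) ((phi x) ^+ 2)%:E = 1)%E /\
     v = \int[leb]_(x in setT) (beta x * (phi x) ^+ 2 - 2^-1 * (derive1 phi x) ^+ 2)].

Definition top_spectrum (beta : R -> R) : \bar R :=
  ereal_sup [set v%:E | v in rayleigh_values beta].

Definition loc_finite (nu : meas) : Prop :=
  forall M : R, (nu `[(- M)%R, M%R]%classic < +oo)%E.

(** continuity at nu (restricted to locally finite measures) for the vague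
    topology, i.e. the initial topology of the maps nu |-> <f, nu>, f in C_c *)
Definition vague_continuous_at (F : meas -> R) (nu : meas) : Prop :=
  forall e : R, 0 < e ->
  exists (n : nat) (fs : 'I_n -> R -> R) (del : R),
    0 < del /\ (forall i, Cc (fs i)) /\
    forall nu' : meas, loc_finite nu' ->
      (forall i, `|pairing nu' (fs i) - pairing nu (fs i)| < del) ->
      `|F nu' - F nu| < e.

Definition vague_test_fun (F : meas -> R) : Prop :=
  (exists M : R, forall nu, `|F nu| <= M) /\
  (forall nu, loc_finite nu -> vague_continuous_at F nu).

Definition cvg_in_distribution d (Omega : measurableType d)
    (P : probability Omega R) (Y : R -> Omega -> meas) (Z : Omega -> meas) : Prop :=
  forall F : meas -> R, vague_test_fun F ->
    (\int[P]_(w in setT) F (Y t w)) @[t --> +oo] --> \int[P]_(w in setT) F (Z w).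

End SBM.

(* Main.v *)
From HB Require Import structures.
From mathcomp Require Import all_boot all_order all_algebra.
From mathcomp Require Import all_classical all_reals all_analysis.
From mathcomp Require finmap.
From mathcomp Require Import measurable_realfun.
From mathcomp Require Import ring lra.
Require Import Defs.
Import Order.TTheory GRing.Theory Num.Theory.
Import numFieldNormedType.Exports.
Local Open Scope classical_set_scope.
Local Open Scope ring_scope.
Set Implicit Arguments.
Unset Strict Implicit.
Unset Printing Implicit Defensive.

(** With f_t(x) = f(x + s c t), c = sqrt(lam/2), s = 1 or -1, the shifted process satisfies
<f, Y_t> = <f_t, X_t>, and the Laplace functional of X turns its study into that of the mild solution
u_t started from f_t: E exp(-<f_t, X_t>) = E exp(-<u_t(t-r), X_r>) for every fixed r.  The key point is that,
as t grows, u_t(t-r) = e^{-lam r} I h + O(e^{-2 lam r} h) + o(1) uniformly in space, with I = <f, eta_s>.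
For the linear part this combines a spectral gap of the Feynman-Kac semigroup of 1/2 Delta + beta (a Harris
contraction in the weight h + b) with the exact exponential shape of h outside the support of beta, which
makes <h, f_t> = e^{-lam t} I for large t: the speed c balances the spatial decay sqrt(2 lam) of h against
the growth rate lam.  The nonlinear part is supported in a fixed compact set and of second order there, and
a multiple of h is a supersolution for its contribution.
Using the Laplace identity for f, for 2f, and jointly at the times r and t, one gets
E (exp(-<f_t, X_t>) - exp(-I W))^2 -> 0, that is <f, Y_t> -> W <f, eta_s> in probability.  A bounded vaguely
continuous F is then controlled by finitely many test functions, uniformly on {W <= m}. *)

(** * Measurability, domination and Fubini for real-valued integrals *)

Section Integrals.
Variable R : realType.

(** The obstacle is that f_t moves. The ergodic error for the Feynman-Kac semigroup is [e^{l0 r}]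
    times the sup norm of the initial function, with [l0] merely below [lam]; it need not vanish for
    r near t. So P_r f_t is compared with the free heat flow of f_t: their difference is created
    only on the support of [beta], where the heat flow of the distant f_t is of order at most
    [e^{a^2 r/2 - a c t}], for every [a > 0]. With [a^2/2 = l] strictly between [l0] and [lam],
    [a c = sqrt (l lam)] exceeds [l], so this is small up to [r = t]; the free part decays like
    [r^{-1/2}]. All equations are kept in integral form: positivity, comparison and uniqueness come
    from adding a killing rate that makes the zero-order coefficient nonnegative. The law of X
    speaks only of given mild solutions, so their existence has to be proved. Two measure-theoretic
    points: F of a random measure need not be measurable in the sample point, so its expectations
    are compared through lower integrals; W is nonnegative only almost surely and is replaced by
    [max (W, 0)]. *)

Lemma measurable_comp2 d d1 d2 d3 (T : measurableType d) (T1 : measurableType d1)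
    (T2 : measurableType d2) (U : measurableType d3) (F : T1 -> T2 -> U) (a : T -> T1) (b : T -> T2) :
  measurable_fun setT (fun p : T1 * T2 => F p.1 p.2) ->
  measurable_fun setT a -> measurable_fun setT b ->
  measurable_fun setT (fun x => F (a x) (b x)).
Proof.
move=> mF ma mb.
exact: (measurableT_comp (g := fun x => (a x, b x)) mF (measurable_fun_pair ma mb)).
Qed.

Lemma measurable_fst_fst d1 d2 d3 (T1 : measurableType d1) (T2 : measurableType d2)
    (T3 : measurableType d3) : measurable_fun setT (fun q : T1 * T2 * T3 => q.1.1).
Proof. exact: (measurableT_comp measurable_fst measurable_fst). Qed.

Lemma measurable_snd_fst d1 d2 d3 (T1 : measurableType d1) (T2 : measurableType d2)
    (T3 : measurableType d3) : measurable_fun setT (fun q : T1 * T2 * T3 => q.1.2).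
Proof. exact: (measurableT_comp measurable_snd measurable_fst). Qed.

(** [Rintegral] is [fine] of a difference of two Tonelli integrals, hence measurable even at points
    where these are infinite; extending [F] by 0 outside [D] reduces to the whole space. *)
Lemma measurable_Rint d1 d2 (T1 : measurableType d1) (T2 : measurableType d2)
    (m : {sigma_finite_measure set T2 -> \bar R}) (D : set T2) (F : T1 -> T2 -> R) :
  measurable D -> measurable_fun setT (fun p : T1 * T2 => F p.1 p.2) ->
  measurable_fun setT (fun x => \int[m]_(y in D) F x y).
Proof.
move=> mD mF.
under eq_fun do rewrite Rintegral_mkcond.
pose G p := ((fun p : T1 * T2 => F p.1 p.2) \_ (setT `*` D)) p.
have mG : measurable_fun setT (EFin \o G).
  apply/measurable_EFinP; apply/(measurable_restrictT _ _).1.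
    exact: measurableX.
  exact: measurable_funS mF.
rewrite (_ : (fun _ => _) = fine \o (fun x => (\int[m]_y ((EFin \o G)^\+)%E (x, y) - \int[m]_y ((EFin \o G)^\-)%E (x, y))%E)).
  apply: measurableT_comp => //.
  apply: emeasurable_funB.
    apply: (@measurable_fun_fubini_tonelli_F _ _ _ _ _ m (EFin \o G)^\+%E) => //.
    exact: measurable_funepos.
  apply: (@measurable_fun_fubini_tonelli_F _ _ _ _ _ m (EFin \o G)^\-%E) => //.
  exact: measurable_funeneg.
apply/funext => x /=; rewrite /Rintegral; congr fine; rewrite integralE.
have E y : (F x \_ D) y = G (x, y).
  rewrite /G /patch; have -> : ((x, y) \in setT `*` D) = (y \in D) => //.
  by apply/idP/idP; rewrite !inE /=; [case|split].
by congr (_ - _)%E; apply: eq_integral => y _; rewrite ?funeposE ?funenegE /= E.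
Qed.

Lemma integrable_le d (T : measurableType d) (m : {measure set T -> \bar R}) (D : set T)
    (f A : T -> R) : measurable D -> measurable_fun D f ->
  m.-integrable D (EFin \o A) -> (forall x, D x -> `|f x| <= A x) ->
  m.-integrable D (EFin \o f).
Proof.
move=> mD mf iA fA; apply: (le_integrable mD _ _ iA).
  exact/measurable_EFinP.
move=> x Dx /=; rewrite lee_fin; apply: (le_trans (fA _ Dx)); exact: ler_norm.
Qed.

Lemma integrable_cst_fin d (T : measurableType d) (m : {measure set T -> \bar R}) (D : set T)
    (M : R) : measurable D -> (m D < +oo)%E -> m.-integrable D (EFin \o cst M).
Proof.
move=> mD mfin; apply: measurable_bounded_integrable => //.
exact: bounded_cst.
Qed.

Lemma integrable_bdd d (T : measurableType d) (m : {measure set T -> \bar R}) (D : set T)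
    (f : T -> R) (M : R) : measurable D -> (m D < +oo)%E -> measurable_fun D f ->
  (forall x, D x -> `|f x| <= M) -> m.-integrable D (EFin \o f).
Proof.
move=> mD mfin mf fM.
apply: (@integrable_le _ _ m D f (cst M)) => //.
exact: integrable_cst_fin.
Qed.

Lemma integrable_scale d (T : measurableType d) (m : {measure set T -> \bar R}) (D : set T)
    (c : R) (f : T -> R) : measurable D -> m.-integrable D (EFin \o f) ->
  m.-integrable D (EFin \o (fun x => c * f x)).
Proof.
by move=> mD fi; rewrite /comp; under eq_fun do rewrite EFinM; exact: integrableZl.
Qed.

Lemma Rint_abs_le d (T : measurableType d) (m : {measure set T -> \bar R}) (D : set T)
    (f A : T -> R) : measurable D -> measurable_fun D f ->
  m.-integrable D (EFin \o A) -> (forall x, D x -> `|f x| <= A x) ->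
  `|\int[m]_(x in D) f x| <= \int[m]_(x in D) A x.
Proof.
move=> mD mf iA fA.
have if_ := integrable_le mD mf iA fA.
apply: (le_trans (le_normr_Rintegral mD if_)).
apply: le_Rintegral => //.
exact: (integrable_norm if_).
Qed.

Lemma Rint_abs_cst d (T : measurableType d) (m : {measure set T -> \bar R}) (D : set T)
    (f : T -> R) (M : R) : measurable D -> (m D < +oo)%E -> measurable_fun D f ->
  (forall x, D x -> `|f x| <= M) -> `|\int[m]_(x in D) f x| <= M * fine (m D).
Proof.
move=> mD mfin mf fM.
rewrite -Rintegral_cst //; apply: Rint_abs_le => //.
exact: integrable_cst_fin.
Qed.

(** Tonelli turns the bound [A] on the inner integrals of [|F|] into integrability on the product;
    the slicewise hypotheses serve to pass between extended and real inner integrals. It serves for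
    Gaussian kernels, where no bound in product form is at hand. *)
Lemma fubini_gen d1 d2 (T1 : measurableType d1) (T2 : measurableType d2)
    (m1 : {sigma_finite_measure set T1 -> \bar R})
    (m2 : {sigma_finite_measure set T2 -> \bar R})
    (D1 : set T1) (D2 : set T2) (F : T1 -> T2 -> R) (A : T1 -> R) :
  measurable D1 -> measurable D2 ->
  measurable_fun setT (fun p : T1 * T2 => F p.1 p.2) ->
  (forall x, D1 x -> m2.-integrable D2 (EFin \o F x)) ->
  (forall y, D2 y -> m1.-integrable D1 (EFin \o F^~ y)) ->
  m1.-integrable D1 (EFin \o A) ->
  (forall x, D1 x -> \int[m2]_(y in D2) `|F x y| <= A x) ->
  \int[m1]_(x in D1) \int[m2]_(y in D2) F x y =
  \int[m2]_(y in D2) \int[m1]_(x in D1) F x y.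
Proof.
move=> mD1 mD2 mF iFx iFy iA FA.
pose G p := ((fun p : T1 * T2 => F p.1 p.2) \_ (D1 `*` D2)) p.
have mG : measurable_fun setT (EFin \o G).
  apply/measurable_EFinP; apply/(measurable_restrictT _ _).1.
    exact: measurableX.
  exact: measurable_funS mF.
have GE x y : G (x, y) = if (x \in D1) && (y \in D2) then F x y else 0.
  rewrite /G /patch; have -> // : ((x, y) \in D1 `*` D2) = (x \in D1) && (y \in D2).
  by apply/idP/andP; rewrite !inE /=.
have iG : (m1 \x m2)%E.-integrable setT (EFin \o G).
  apply/integrable12ltyP => //.
  apply: (@le_lt_trans _ _ (\int[m1]_(x in D1) `|(A x)%:E|)%E); last first.
    by have /integrableP[] := iA.
  rewrite [leRHS]integral_mkcond; apply: ge0_le_integral => //.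
  - by move=> x _; exact: integral_ge0.
  - apply: (@measurable_fun_fubini_tonelli_F _ _ _ _ _ m2 (abse \o (EFin \o G))) ; last first.
      by move=> x /=; rewrite lee_fin normr_ge0.
    exact: measurableT_comp.
  - apply/(measurable_restrictT _ _).1 => //.
    by apply: measurableT_comp => //; have /integrableP[] := iA.
  - move=> x _; rewrite /patch; case: ifPn => xD; last first.
      rewrite integral0_eq // => y _ /=; rewrite GE (negbTE xD) /=.
      by rewrite normr0.
    have xD' := set_mem xD.
    apply: (@le_trans _ _ (\int[m2]_(y in D2) `|F x y|)%:E).
      rewrite /Rintegral fineK; last first.
        exact: (integrable_fin_num mD2 (integrable_norm (iFx _ xD'))).
      rewrite [leRHS]integral_mkcond le_eqVlt; apply/orP; left; apply/eqP.
      apply: eq_integral => y _ /=; rewrite GE xD /patch /=.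
      by case: ifP; rewrite ?normr0.
    by rewrite /= lee_fin; apply: (le_trans (FA _ xD')); exact: ler_norm.
have FE := Fubini iG.
have LE : (\int[m1]_x \int[m2]_y (EFin \o G) (x, y) =
    \int[m1]_(x in D1) (\int[m2]_(y in D2) F x y)%:E)%E.
  rewrite [RHS]integral_mkcond; apply: eq_integral => x _.
  rewrite /patch; case: ifPn => xD.
    rewrite /Rintegral fineK; last exact: integrable_fin_num (iFx _ (set_mem xD)).
    rewrite [RHS]integral_mkcond; apply: eq_integral => y _ /=.
    by rewrite GE xD /patch /=; case: ifP.
  by rewrite integral0_eq // => y _ /=; rewrite GE (negbTE xD).
have RE : (\int[m2]_y \int[m1]_x (EFin \o G) (x, y) =
    \int[m2]_(y in D2) (\int[m1]_(x in D1) F x y)%:E)%E.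
  rewrite [RHS]integral_mkcond; apply: eq_integral => y _.
  rewrite /patch; case: ifPn => yD.
    rewrite /Rintegral fineK; last exact: integrable_fin_num (iFy _ (set_mem yD)).
    rewrite [RHS]integral_mkcond; apply: eq_integral => x _ /=.
    by rewrite GE yD andbT /patch /=; case: ifP.
  by rewrite integral0_eq // => x _ /=; rewrite GE (negbTE yD) andbF.
by rewrite /Rintegral -LE -RE FE.
Qed.

Lemma fubini_dom d1 d2 (T1 : measurableType d1) (T2 : measurableType d2)
    (m1 : {sigma_finite_measure set T1 -> \bar R})
    (m2 : {sigma_finite_measure set T2 -> \bar R})
    (D1 : set T1) (D2 : set T2) (F : T1 -> T2 -> R) (A : T1 -> R) (B : T2 -> R) :
  measurable D1 -> measurable D2 ->
  measurable_fun setT (fun p : T1 * T2 => F p.1 p.2) ->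
  m1.-integrable D1 (EFin \o A) -> m2.-integrable D2 (EFin \o B) ->
  (forall x y, D1 x -> D2 y -> `|F x y| <= A x * B y) ->
  \int[m1]_(x in D1) \int[m2]_(y in D2) F x y =
  \int[m2]_(y in D2) \int[m1]_(x in D1) F x y.
Proof.
move=> mD1 mD2 mF iA iB FAB.
have iAB x : m2.-integrable D2 (EFin \o (fun y => A x * B y)).
  by rewrite /comp; under eq_fun do rewrite EFinM; exact: integrableZl.
have iFx x : D1 x -> m2.-integrable D2 (EFin \o F x).
  move=> Dx; apply: (@integrable_le _ _ m2 D2 _ (fun y => A x * B y)) => //.
  - exact: measurable_funTS (measurable_fun_pair2 x mF).
  - by move=> y Dy; exact: FAB.
apply: (@fubini_gen _ _ _ _ m1 m2 _ _ _ (fun x => A x * \int[m2]_(y in D2) B y)) => //.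
- move=> y Dy; apply: (@integrable_le _ _ m1 D1 _ (fun x => A x * B y)) => //.
  - exact: measurable_funTS (measurable_fun_pair1 y mF).
  - by rewrite /comp; under eq_fun do rewrite EFinM; exact: integrableZr.
  - by move=> x Dx; exact: FAB.
- by rewrite /comp; under eq_fun do rewrite EFinM; exact: integrableZr.
- move=> x Dx; rewrite -RintegralZl //; apply: le_Rintegral => //.
    exact: (integrable_norm (iFx _ Dx)).
  by move=> y Dy; exact: FAB.
Qed.

End Integrals.

(** * Affine changes of variable for Lebesgue measure *)

Section LebesgueAffine.
Variable R : realType.
Notation leb := (@lebesgue_measure R).

(** [a] times the image of Lebesgue measure under the inverse map assigns to half-open intervals
    their length, so it is Lebesgue measure by uniqueness. *)
Lemma ge0_int_affine (a b : R) (f : R -> \bar R) : 0 < a -> measurable_fun setT f ->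
  (forall x, 0 <= f x)%E ->
  (\int[leb]_x f x = a%:E * \int[leb]_z f (a * z + b)%R)%E.
Proof.
move=> a0 mf f0.
have mphi : measurable_fun setT (fun z : measurableTypeR R => (a * z + b : measurableTypeR R)).
  by apply: measurable_funD => //; exact: measurable_funM.
pose mu' : {measure set (measurableTypeR R) -> \bar R} :=
  mscale (NngNum (ltW a0))
    (measure_function.measure_function_pushforward__canonical__measure_function_Measure leb mphi).
have E A : measurable A -> leb A = mu' A.
  apply: lebesgue_measure_unique => X [[c d] /= _ <-].
  rewrite /mu' /= /mscale /= /pushforward /=.
  have -> : (fun z => a * z + b) @^-1` `]c, d] = `](c - b) / a, (d - b) / a]%classic.
    apply/seteqP; split => z /=; rewrite !in_itv /= ltr_pdivrMr // ler_pdivlMr // => /andP[h1 h2]; apply/andP; split; lra.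
  rewrite !lebesgue_measure_itv /= !lte_fin ltr_pM2r ?invr_gt0 // ltrD2r.
  case: ifP => _; last by rewrite mule0.
  rewrite -!EFinB -EFinM; congr EFin; field; exact: lt0r_neq0.
rewrite [LHS](eq_measure_integral mu'); last by move=> A mA _; exact: E.
rewrite /mu' ge0_integral_mscale //=; congr (_ * _)%E.
by rewrite ge0_integral_pushforward.
Qed.

Lemma Rint_affine (a b : R) (f : R -> R) : 0 < a -> measurable_fun setT f ->
  \int[leb]_z f (a * z + b) = a^-1 * \int[leb]_x f x.
Proof.
move=> a0 mf.
have mphi : measurable_fun setT (fun z : R => a * z + b).
  by apply: measurable_funD => //; exact: measurable_funM.
have mE : measurable_fun setT (EFin \o f) by exact/measurable_EFinP.
have Hp := ge0_int_affine b a0 (measurable_funepos mE) (funepos_ge0 _).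
have Hn := ge0_int_affine b a0 (measurable_funeneg mE) (funeneg_ge0 _).
rewrite /Rintegral [in RHS]integralE [in LHS]integralE.
have -> : (\int[leb]_x (fun z => (f (a * z + b)%R)%:E)^\+ x = \int[leb]_z (EFin \o f)^\+ (a * z + b)%R)%E.
  by apply: eq_integral => z _; rewrite !funeposE.
have -> : (\int[leb]_x (fun z => (f (a * z + b)%R)%:E)^\- x = \int[leb]_z (EFin \o f)^\- (a * z + b)%R)%E.
  by apply: eq_integral => z _; rewrite !funenegE.
rewrite Hp Hn.
set p := (\int[leb]_z _)%E; set n := (\int[leb]_z _)%E.
have p0 : (0 <= p)%E by exact: integral_ge0.
have n0 : (0 <= n)%E by exact: integral_ge0.
have an : a != 0 by exact: lt0r_neq0.
(* Without integrability [p] or [n] may be infinite; then [fine] returns 0 on both sides. *)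
case: p p0 => [p| |] // p0; case: n n0 => [n| |] // n0 /=; rewrite ?gt0_muley ?lte_fin //=; first by field.
all: by rewrite mulr0.
Qed.

Lemma Rint_opp (f : R -> R) : measurable_fun setT f ->
  \int[leb]_z f (- z) = \int[leb]_x f x.
Proof.
move=> mf.
have mE : measurable_fun setT (EFin \o f) by exact/measurable_EFinP.
have H (g : R -> \bar R) : measurable_fun setT g -> (forall x, 0 <= g x)%E ->
    (\int[leb]_x g x = \int[leb]_z g (- z)%R)%E.
  move=> mg g0.
  rewrite [LHS](eq_measure_integral (pushforward leb (-%R : _ -> measurableTypeR R))).
    by rewrite ge0_integral_pushforward.
  by move=> A mA _; exact/esym/lebesgue_measureN.
rewrite /Rintegral [in RHS]integralE [in LHS]integralE.
rewrite (H _ (measurable_funepos mE)) // (H _ (measurable_funeneg mE)) //.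
by congr (fine (_ - _)%E); apply: eq_integral => z _; rewrite ?funeposE ?funenegE.
Qed.

Lemma Rint_shift (b : R) (f : R -> R) : measurable_fun setT f ->
  \int[leb]_z f (z + b) = \int[leb]_x f x.
Proof.
move=> mf; have := Rint_affine b ltr01 mf; rewrite invr1 mul1r => <-.
by apply: eq_Rintegral => z _; rewrite mul1r.
Qed.

End LebesgueAffine.

(** * Integrals over a time interval [[0, t]] *)

Section TimeIntegral.
Variable R : realType.
Notation leb := (@lebesgue_measure R).
Implicit Types (t s r : R) (a b : R -> R).

(* 0 when t < 0. *)
Definition tint t a : R := \int[leb]_(s in `[0, t]%classic) a s.

(** Measurability is required on the whole line, so that the reversed function [s -> a (t - s)]
    stays measurable; boundedness is required only on [[0, t]]. *)
Definition tbd t a := measurable_fun setT a /\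
  exists M : R, forall s, 0 <= s <= t -> `|a s| <= M.

(** Zero extension that turns [tint] into an integral over the line, where translation and
    reflection invariance apply. *)
Definition trunc t a s : R := if (0 <= s) && (s <= t) then a s else 0.

Lemma leb_itv_lty t : (leb `[0%R, t]%classic < +oo)%E.
Proof. by rewrite lebesgue_measure_itv /=; case: ifP => _; rewrite ?ltry. Qed.

Lemma fine_leb_itv t : 0 <= t -> fine (leb `[0%R, t]%classic) = t.
Proof.
move=> t0; rewrite lebesgue_measure_itv /= lte_fin; case: ltP => /= h.
  by rewrite subr0.
by apply/eqP; rewrite eq_le h t0.
Qed.

Lemma tintE t a : tint t a = \int[leb]_s trunc t a s.
Proof.
rewrite /tint Rintegral_mkcond; apply: eq_Rintegral => s _.
by rewrite /patch /trunc mem_setE in_itv.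
Qed.

Lemma measurable_trunc t a : measurable_fun setT a -> measurable_fun setT (trunc t a).
Proof.
move=> ma; apply: measurable_fun_ifT => //.
by apply: measurable_and => //; exact: measurable_fun_ler.
Qed.

Lemma tbd_int t a : tbd t a -> leb.-integrable `[0, t]%classic (EFin \o a).
Proof.
move=> [ma [M aM]]; apply: (@integrable_bdd R _ _ leb _ _ M) => //=.
- by rewrite leb_itv_lty.
- exact: measurable_funTS.
Qed.

Lemma tbd_cst t c : tbd t (cst c).
Proof. by split => //; exists `|c|. Qed.

Lemma tbdD t a b : tbd t a -> tbd t b -> tbd t (fun s => a s + b s).
Proof.
move=> [ma [M aM]] [mb [N bN]]; split; first exact: measurable_funD.
exists (M + N) => s st; apply: (le_trans (ler_normD _ _)).
by apply: lerD; [exact: aM|exact: bN].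
Qed.

Lemma tbdM t a b : tbd t a -> tbd t b -> tbd t (fun s => a s * b s).
Proof.
move=> [ma [M aM]] [mb [N bN]]; split; first exact: measurable_funM.
exists (M * N) => s st; rewrite normrM.
by apply: ler_pM => //; [exact: aM|exact: bN].
Qed.

Lemma tbdN t a : tbd t a -> tbd t (fun s => - a s).
Proof.
move=> [ma [M aM]]; split; first exact: measurableT_comp.
by exists M => s st; rewrite normrN; exact: aM.
Qed.

Lemma tbd_rev t a : tbd t a -> tbd t (fun s => a (t - s)).
Proof.
move=> [ma [M aM]]; split.
  by apply: measurableT_comp => //; exact: measurable_funB.
by exists M => s /andP[s0 st]; apply: aM; rewrite subr_ge0 st lerBlDr lerDl.
Qed.

Lemma tbdS t s a : s <= t -> tbd t a -> tbd s a.
Proof.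
move=> st [ma [M aM]]; split => //; exists M => r /andP[r0 rs].
by apply: aM; rewrite r0 (le_trans rs).
Qed.

Lemma tbd_expR t c : tbd t (fun s => expR (c * s)).
Proof.
split; first by apply: measurableT_comp => //; exact: measurable_funM.
exists (expR (`|c| * t)) => s /andP[s0 st]; rewrite ger0_norm ?expR_ge0 // ler_expR.
by apply: (@le_trans _ _ (`|c| * s)); [rewrite ler_wpM2r // ler_norm | rewrite ler_wpM2l].
Qed.

Lemma eq_tint t a b : (forall s, 0 <= s <= t -> a s = b s) -> tint t a = tint t b.
Proof.
by move=> ab; apply: eq_Rintegral => s; rewrite inE; exact: ab.
Qed.

Lemma tintD t a b : tbd t a -> tbd t b ->
  tint t (fun s => a s + b s) = tint t a + tint t b.
Proof. by move=> ta tb; apply: RintegralD => //; exact: tbd_int. Qed.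

Lemma tintZ t c a : tbd t a -> tint t (fun s => c * a s) = c * tint t a.
Proof. by move=> ta; apply: RintegralZl => //; exact: tbd_int. Qed.

Lemma tintZr t c a : tbd t a -> tint t (fun s => a s * c) = tint t a * c.
Proof. by move=> ta; apply: RintegralZr => //; exact: tbd_int. Qed.

Lemma tintN t a : tbd t a -> tint t (fun s => - a s) = - tint t a.
Proof.
move=> ta; rewrite -mulN1r -tintZ //; apply: eq_tint => s _; by rewrite mulN1r.
Qed.

Lemma tintB t a b : tbd t a -> tbd t b ->
  tint t (fun s => a s - b s) = tint t a - tint t b.
Proof. by move=> ta tb; apply: RintegralB => //; exact: tbd_int. Qed.

Lemma tint_cst t c : 0 <= t -> tint t (cst c) = c * t.
Proof. by move=> t0; rewrite /tint Rintegral_cst // fine_leb_itv. Qed.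

Lemma tint_neg t a : t < 0 -> tint t a = 0.
Proof.
move=> t0; rewrite /tint (_ : `[0, t]%classic = set0) ?Rintegral_set0 //.
by apply/seteqP; split => s //=; rewrite in_itv /= => /andP[s0 st]; move: (le_lt_trans (le_trans s0 st) t0); rewrite ltxx.
Qed.

Lemma tint_le t a b : tbd t a -> tbd t b -> (forall s, 0 <= s <= t -> a s <= b s) ->
  tint t a <= tint t b.
Proof.
move=> ta tb ab; exact: (le_Rintegral _ (tbd_int ta) (tbd_int tb)).
Qed.

Lemma tint_ge0 t a : (forall s, 0 <= s <= t -> 0 <= a s) -> 0 <= tint t a.
Proof. by move=> a0; exact: Rintegral_ge0. Qed.

Lemma tint_abs t a b : measurable_fun setT a -> tbd t b ->
  (forall s, 0 <= s <= t -> `|a s| <= b s) -> `|tint t a| <= tint t b.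
Proof.
move=> ma tb ab; apply: Rint_abs_le => //; first exact: measurable_funTS.
exact: tbd_int.
Qed.

Lemma tint_abs_cst t a (M : R) : 0 <= t -> measurable_fun setT a ->
  (forall s, 0 <= s <= t -> `|a s| <= M) -> `|tint t a| <= M * t.
Proof.
move=> t0 ma aM; rewrite -tint_cst //; apply: tint_abs => //; exact: tbd_cst.
Qed.

Lemma tint_rev t a : measurable_fun setT a -> tint t (fun s => a (t - s)) = tint t a.
Proof.
move=> ma; have mg := measurable_trunc t ma.
rewrite !tintE -(Rint_shift t mg) -[RHS]Rint_opp; last first.
  by apply: measurableT_comp => //; exact: measurable_funD.
apply: eq_Rintegral => s _; rewrite /trunc [- s + t]addrC subr_ge0 lerBlDr lerDl andbC.
by case: ifP.
Qed.

Lemma tint_split s t a : 0 <= s -> 0 <= t -> tbd (s + t) a ->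
  tint (s + t) a = tint s a + tint t (fun r => a (s + r)).
Proof.
move=> s0 t0 ta.
have := @Rintegral_itvB R a (BLeft 0) (BRight (s + t)) s (tbd_int ta).
rewrite !bnd_simp lerDl t0 => /(_ s0 isT) H.
suff <- : tint (s + t) a - tint s a = tint t (fun r => a (s + r)) by rewrite [RHS]addrC subrK.
rewrite {1 2}/tint H.
have ma := ta.1.
rewrite Rintegral_itv_obnd_cbnd; last first.
  apply: (integrableS _ _ _ (tbd_int ta)) => // r /=; rewrite !in_itv /= => /andP[sr ->].
  by rewrite (le_trans s0 (ltW sr)).
rewrite tintE Rintegral_mkcond -(Rint_shift s); last first.
  by apply/(measurable_restrictT _ _).1 => //; exact: measurable_funTS.
apply: eq_Rintegral => z _; rewrite /patch mem_setE in_itv /= /trunc.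
by rewrite lerDr [s + t]addrC lerD2r [s + z]addrC.
Qed.

(** Both sides integrate [F] over the triangle [s, r >= 0], [s + r <= t]; the right one uses the
    outer variable [u = s + r]. After extension by 0 to squares, Fubini puts [r] outside on both
    sides, and the inner integrals differ by the translation by [r]. *)
Lemma tint_tri t (F : R -> R -> R) (M : R) :
  measurable_fun setT (fun p : R * R => F p.1 p.2) ->
  (forall s r, 0 <= s -> 0 <= r -> s + r <= t -> `|F s r| <= M) ->
  tint t (fun s => tint (t - s) (F s)) = tint t (fun u => tint u (fun r => F (u - r) r)).
Proof.
move=> mF FM.
have mc (G : R * R -> R) (b : R * R -> bool) : measurable_fun setT G -> measurable_fun setT b ->
    measurable_fun setT (fun p => if b p then G p else 0).
  by move=> mG mb; apply: measurable_fun_ifT.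
have ic : leb.-integrable `[0, t]%classic (EFin \o cst `|M|).
  by apply: tbd_int; exact: tbd_cst.
have ic1 : leb.-integrable `[0, t]%classic (EFin \o cst (1 : R)).
  by apply: tbd_int; exact: tbd_cst.
have m1 := @measurable_fst _ _ R R.
have m2 := @measurable_snd _ _ R R.
pose G1 s r := if (s + r <= t) && (0 <= r) && (0 <= s) then F s r else 0.
pose G2 u r := if (r <= u) && ((0 <= r) && (u <= t)) then F (u - r) r else 0.
have mG1 : measurable_fun setT (fun p : R * R => G1 p.1 p.2).
  apply: mc => //; repeat apply: measurable_and => //; apply: measurable_fun_ler => //.
  exact: measurable_funD.
have mG2 : measurable_fun setT (fun p : R * R => G2 p.1 p.2).
  apply: mc.
    by apply: (measurable_comp2 mF) => //; exact: measurable_funB.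
  by repeat apply: measurable_and => //; apply: measurable_fun_ler => //.
have b1 s r : `|G1 s r| <= `|M|.
  rewrite /G1; case: ifP => [/andP[/andP[h1 h2] h3]|_]; last by rewrite normr0.
  by apply: (le_trans _ (ler_norm M)); apply: FM.
have b2 s r : `|G2 s r| <= `|M|.
  rewrite /G2; case: ifP => [/andP[h1 /andP[h2 h3]]|_]; last by rewrite normr0.
  by apply: (le_trans _ (ler_norm M)); apply: FM; rewrite ?subr_ge0 // subrK.
transitivity (tint t (fun s => tint t (G1 s))).
  apply: eq_tint => s /andP[s0 st]; rewrite !tintE; apply: eq_Rintegral => r _.
  rewrite /trunc /G1 s0 andbT lerBrDl.
  case: (leP 0 r) => r0 /=; rewrite ?andbF ?andbT ?if_same //=.
  case: (leP (s + r) t) => h; rewrite ?if_same //.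
  by have -> : r <= t by apply: le_trans h; rewrite lerDr.
transitivity (tint t (fun u => tint t (G2 u))); last first.
  apply: eq_tint => s /andP[s0 st]; rewrite !tintE; apply: eq_Rintegral => r _.
  rewrite /trunc /G2 st andbT.
  case: (leP 0 r) => r0 /=; rewrite ?andbF ?andbT ?if_same //=.
  by case: (leP r s) => h; rewrite ?if_same // (le_trans h st).
have swap (G : R -> R -> R) : measurable_fun setT (fun p : R * R => G p.1 p.2) -> (forall s r, `|G s r| <= `|M|) ->
    tint t (fun s => tint t (G s)) = tint t (fun r => tint t (G^~ r)).
  move=> mG GM; rewrite /tint; rewrite (fubini_dom (A := cst `|M|) (B := cst 1));
      [reflexivity|exact: measurable_itv|exact: measurable_itv|exact: mG|exact: ic|exact: ic1|].
  by move=> s r _ _; rewrite mulr1; exact: GM.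
rewrite (swap _ mG1 b1) (swap _ mG2 b2).
apply: eq_tint => r /andP[r0 rt]; rewrite -/(tint t (G1^~ r)) -/(tint t (G2^~ r)).
rewrite !tintE -[RHS](Rint_shift r); last first.
  by apply: measurable_trunc; exact: (measurable_fun_pair1 r mG2).
apply: eq_Rintegral => s _; rewrite /trunc /G1 /G2 r0 lerDr addrK !andbT /=.
case: (leP 0 s) => s0 /=; rewrite ?andbF ?if_same // andbT.
rewrite addr_ge0 //=; case: (leP (s + r) t) => h /=; rewrite ?if_same //.
by have -> : s <= t by apply: le_trans h; rewrite lerDl.
Qed.

Lemma tint_expR (m t : R) : m != 0 -> 0 <= t -> tint t (fun s => expR (m * s)) = (expR (m * t) - 1) / m.
Proof.
move=> m0; rewrite le_eqVlt => /predU1P[<-|t0].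
  by rewrite mulr0 expR0 subrr mul0r /tint set_itv1 Rintegral_set1.
pose G s : R := expR (m * s) / m.
have dG (s : R) : is_derive s 1 G (expR (m * s)).
  rewrite /G; apply: is_derive_eq; rewrite /GRing.scale /=; field; exact: m0.
have cE : continuous (fun s : R => expR (m * s)).
  move=> s; apply: continuous_comp; last exact: continuous_expR.
  exact: mulrl_continuous.
have := @continuous_FTC2 R (fun s => expR (m * s)) G 0 t t0.
have -> : (expR (m * t) - 1) / m = G t - G 0 by rewrite /G mulr0 expR0 mulrBl.
rewrite /tint /Rintegral => -> //.
- exact: continuous_subspaceT.
- split => [s _||].
  + by have [] := dG s.
  + apply: cvg_at_right_filter; apply: differentiable_continuous.
    by apply/derivable1_diffP; have [] := dG 0.
  + apply: cvg_at_left_filter; apply: differentiable_continuous.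
    by apply/derivable1_diffP; have [] := dG t.
- by move=> s _; rewrite derive1E; have [_ ->] := dG s.
Qed.

End TimeIntegral.

Lemma measurable_tint (R : realType) d (T : measurableType d) (t : T -> R) (a : T -> R -> R) :
  measurable_fun setT t -> measurable_fun setT (fun p : T * R => a p.1 p.2) ->
  measurable_fun setT (fun x => tint (t x) (a x)).
Proof.
move=> mt ma; under eq_fun do rewrite tintE.
have /(_ measurableT) := @measurable_Rint R _ _ T (measurableTypeR R) (@lebesgue_measure R) setT (fun x s => trunc (t x) (a x) s).
apply.
apply: measurable_fun_ifT => //.
by apply: measurable_and; apply: measurable_fun_ler => //; exact: measurableT_comp.
Qed.

(** * The Gaussian density and its convolution *)

Section Gauss.
Variable R : realType.
Notation leb := (@lebesgue_measure R).
Implicit Types (t s r x y z : R).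

Lemma gauss_pdf t : 0 < t -> gauss t = normal_pdf 0 (Num.sqrt t).
Proof.
move=> t0; apply/funext => x; rewrite normal_pdfE ?gt_eqF ?sqrtr_gt0 //.
rewrite /normal_peak /normal_fun /gauss subr0 sqr_sqrtr ?ltW // [RHS]mulrC; congr (_ * _).
  by rewrite mulr_natl.
by congr ((Num.sqrt _)^-1); rewrite -mulr_natl; ring.
Qed.

Lemma gauss_ge0 t x : 0 <= gauss t x.
Proof. by rewrite /gauss divr_ge0 ?expR_ge0 ?sqrtr_ge0. Qed.

Lemma measurable_gauss t : measurable_fun setT (gauss t).
Proof.
rewrite /gauss; apply: measurable_funM => //; apply: measurableT_comp => //.
by apply: measurable_funM => //; exact: measurableT_comp.
Qed.

Lemma gauss_int t : 0 < t -> leb.-integrable setT (EFin \o gauss t).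
Proof. by move=> t0; rewrite gauss_pdf //; exact: integrable_normal_pdf. Qed.

Lemma gauss1 t : 0 < t -> \int[leb]_z gauss t z = 1.
Proof.
by move=> t0; rewrite gauss_pdf // /Rintegral integral_normal_pdf.
Qed.

Lemma gauss_shift1 t m : 0 < t -> \int[leb]_z gauss t (z - m) = 1.
Proof. by move=> t0; rewrite (Rint_shift (- m)) ?gauss1 //; exact: measurable_gauss. Qed.

Lemma gauss_opp t x : gauss t (- x) = gauss t x.
Proof. by rewrite /gauss sqrrN. Qed.

Lemma gauss_scale t z : 0 < t -> gauss t (Num.sqrt t * z) = (Num.sqrt t)^-1 * gauss 1 z.
Proof.
move=> t0; have tn : t != 0 by exact: lt0r_neq0.
have -> : gauss t (Num.sqrt t * z) = expR (- (z ^+ 2) / (2 * 1)) / Num.sqrt (2 * pi * t).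
  rewrite /gauss exprMn sqr_sqrtr ?ltW //; congr (expR _ / _); field; exact: tn.
rewrite /gauss !mulr1 sqrtrM ?mulr_ge0 ?pi_ge0 // invfM.
by rewrite [LHS]mulrA [RHS]mulrC.
Qed.

(** Completing the square in [y]: the second factor on the right is the density, at the intermediate
    time, of the Brownian bridge from [x] to [w], with variance [s r / (s + r)]. *)
Lemma gauss_conv s r x w y : 0 < s -> 0 < r ->
  gauss s (y - x) * gauss r (w - y) =
  gauss (s + r) (w - x) * gauss (s * r / (s + r)) (y - (r * x + s * w) / (s + r)).
Proof.
move=> s0 r0; have sr0 : 0 < s + r by rewrite addr_gt0.
have [sn rn srn] : [/\ s != 0, r != 0 & s + r != 0] by rewrite !lt0r_neq0.
rewrite /gauss mulrACA [RHS]mulrACA -!expRD -!invfM; congr (expR _ / _).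
  by field; rewrite sn rn srn.
rewrite -!sqrtrM ?mulr_ge0 ?pi_ge0 ?ltW //; congr (Num.sqrt _).
by field; rewrite srn.
Qed.

Lemma gauss_shift_int t m : 0 < t -> leb.-integrable setT (EFin \o (fun z => gauss t (z - m))).
Proof.
move=> t0; have -> : (fun z => gauss t (z - m)) = normal_pdf m (Num.sqrt t).
  apply/funext => z; rewrite gauss_pdf // !normal_pdfE ?gt_eqF ?sqrtr_gt0 //.
  by rewrite /normal_fun subr0.
exact: integrable_normal_pdf.
Qed.

Lemma gauss_conv_int s r x w : 0 < s -> 0 < r ->
  \int[leb]_y (gauss s (y - x) * gauss r (w - y)) = gauss (s + r) (w - x).
Proof.
move=> s0 r0; have v0 : 0 < s * r / (s + r) by rewrite divr_gt0 ?mulr_gt0 ?addr_gt0.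
under eq_Rintegral do rewrite gauss_conv //.
rewrite RintegralZl //; first by rewrite gauss_shift1 // mulr1.
exact: gauss_shift_int.
Qed.

End Gauss.

(** * The heat semigroup *)

Section Heat.
Variable R : realType.
Notation leb := (@lebesgue_measure R).
Implicit Types (t s r x y z : R) (f g : R -> R).

(** [bm_sg] after the substitution [y = x + sqrt s z]. As [Num.sqrt s] is 0 for [s <= 0], time 0
    needs no separate case, and joint measurability in time and space follows from that of the
    integrand. *)
Definition heat s f x := \int[leb]_z (f (x + Num.sqrt s * z) * gauss 1 z).

Definition bmf f := measurable_fun setT f /\ exists M : R, forall x, `|f x| <= M.

Lemma bmfD f g : bmf f -> bmf g -> bmf (fun x => f x + g x).
Proof.
move=> [mf [M fM]] [mg [N gN]]; split; first exact: measurable_funD.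
by exists (M + N) => x; apply: (le_trans (ler_normD _ _)); exact: lerD.
Qed.

Lemma bmfM f g : bmf f -> bmf g -> bmf (fun x => f x * g x).
Proof.
move=> [mf [M fM]] [mg [N gN]]; split; first exact: measurable_funM.
by exists (M * N) => x; rewrite normrM ler_pM.
Qed.

Lemma bmf_cst c : bmf (fun=> c).
Proof. by split => //; exists `|c|. Qed.

Lemma bmfZ c f : bmf f -> bmf (fun x => c * f x).
Proof. by move=> bf; apply: bmfM => //; exact: bmf_cst. Qed.

Lemma bmfN f : bmf f -> bmf (fun x => - f x).
Proof.
by move=> bf; under eq_fun do rewrite -mulN1r; exact: bmfZ.
Qed.

Lemma bmfB f g : bmf f -> bmf g -> bmf (fun x => f x - g x).
Proof. by move=> bf bg; apply: bmfD => //; exact: bmfN. Qed.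

Lemma measurable_heat_arg s x f : measurable_fun setT f ->
  measurable_fun setT (fun z => f (x + Num.sqrt s * z)).
Proof.
move=> mf; apply: measurableT_comp => //; exact: measurable_funD.
Qed.

Lemma heat_int s x f : bmf f ->
  leb.-integrable setT (EFin \o (fun z => f (x + Num.sqrt s * z) * gauss 1 z)).
Proof.
move=> [mf [M fM]]; apply: (@integrable_le _ _ _ leb _ _ (fun z => M * gauss 1 z)) => //.
- by apply: measurable_funM; [exact: measurable_heat_arg|exact: measurable_gauss].
- by apply: integrable_scale => //; exact: gauss_int.
- by move=> z _; rewrite normrM (ger0_norm (gauss_ge0 _ _)) ler_wpM2r // gauss_ge0.
Qed.

Lemma heatD s x f g : bmf f -> bmf g ->
  heat s (fun y => f y + g y) x = heat s f x + heat s g x.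
Proof.
move=> bf bg; rewrite /heat -RintegralD //; try exact: heat_int.
by apply: eq_Rintegral => z _; rewrite mulrDl.
Qed.

Lemma heatZ s x c f : bmf f -> heat s (fun y => c * f y) x = c * heat s f x.
Proof.
move=> bf; rewrite /heat -RintegralZl //; try exact: heat_int.
by apply: eq_Rintegral => z _; rewrite mulrA.
Qed.

Lemma heatN s x f : bmf f -> heat s (fun y => - f y) x = - heat s f x.
Proof.
move=> bf; under [in LHS]eq_fun do rewrite -mulN1r.
by rewrite heatZ // mulN1r.
Qed.

Lemma heatB s x f g : bmf f -> bmf g ->
  heat s (fun y => f y - g y) x = heat s f x - heat s g x.
Proof. by move=> bf bg; rewrite heatD ?heatN //; exact: bmfN. Qed.

Lemma heat_cst s x c : heat s (fun=> c) x = c.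
Proof.
by rewrite /heat RintegralZl ?gauss1 ?mulr1 //; exact: gauss_int.
Qed.

Lemma heat_le s x f g : bmf f -> bmf g -> (forall y, f y <= g y) -> heat s f x <= heat s g x.
Proof.
move=> bf bg fg; apply: le_Rintegral => //; try exact: heat_int.
by move=> z _; rewrite ler_wpM2r ?gauss_ge0.
Qed.

Lemma heat_ge0 s x f : (forall y, 0 <= f y) -> 0 <= heat s f x.
Proof. by move=> f0; apply: Rintegral_ge0 => z _; rewrite mulr_ge0 ?gauss_ge0. Qed.

Lemma heat_abs s x f (M : R) : measurable_fun setT f -> (forall y, `|f y| <= M) -> `|heat s f x| <= M.
Proof.
move=> mf fM; have bf : bmf f by split => //; exists M.
rewrite ler_norml -{1}(heat_cst s x (- M)) -{2}(heat_cst s x M).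
apply/andP; split; apply: heat_le => //; try exact: bmf_cst.
  by move=> y; have := fM y; rewrite ler_norml => /andP[].
by move=> y; have := fM y; rewrite ler_norml => /andP[].
Qed.

Lemma heat_le0 s f x : s <= 0 -> heat s f x = f x.
Proof.
move=> s0; rewrite /heat ler0_sqrtr //; under eq_Rintegral do rewrite mul0r addr0.
by rewrite RintegralZl ?gauss1 ?mulr1 //; exact: gauss_int.
Qed.

Lemma measurable_heat d (T : measurableType d) (g : T -> R -> R) (s x : T -> R) :
  measurable_fun setT (fun p : T * R => g p.1 p.2) ->
  measurable_fun setT s -> measurable_fun setT x ->
  measurable_fun setT (fun p => heat (s p) (g p) (x p)).
Proof.
move=> mg ms mx.
have /(_ measurableT) := @measurable_Rint R _ _ T (measurableTypeR R) leb setT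
  (fun p z => g p (x p + Num.sqrt (s p) * z) * gauss 1 z).
apply; apply: measurable_funM.
  apply: (measurable_comp2 mg) => //; apply: measurable_funD.
    exact: measurableT_comp.
  apply: measurable_funM => //; apply: measurableT_comp; last exact: measurableT_comp.
  exact: continuous_measurable_fun (@sqrt_continuous R).
by apply: measurableT_comp; [exact: measurable_gauss|].
Qed.

Lemma bmf_heat s f : bmf f -> bmf (heat s f).
Proof.
move=> [mf [M fM]]; split; last by exists M => x; exact: heat_abs.
apply: (@measurable_heat _ _ (fun=> f) (fun=> s) id) => //.
exact: measurableT_comp.
Qed.

Lemma gauss_ub t x : 0 < t -> gauss t x <= (Num.sqrt t)^-1.
Proof.
move=> t0; rewrite /gauss -[leRHS]mul1r ler_pM ?expR_ge0 ?invr_ge0 ?sqrtr_ge0 //.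
  by rewrite -[leRHS]expR0 ler_expR mulNr oppr_le0 divr_ge0 ?sqr_ge0 // mulr_ge0 // ltW.
rewrite lef_pV2 ?posrE ?sqrtr_gt0 ?mulr_gt0 ?pi_gt0 // ler_sqrt ?mulr_ge0 ?pi_ge0 ?(ltW t0) //.
have := pi_ge2 R; nra.
Qed.

Lemma measurable_gauss_shift t x : measurable_fun setT (fun y => gauss t (y - x)).
Proof. by apply: measurableT_comp; [exact: measurable_gauss|exact: measurable_funB]. Qed.

Lemma kernel_int t x f : 0 < t -> bmf f ->
  leb.-integrable setT (EFin \o (fun y => f y * gauss t (y - x))).
Proof.
move=> t0 [mf [M fM]]; apply: (@integrable_le _ _ _ leb _ _ (fun z => M * gauss t (z - x))) => //.
- by apply: measurable_funM => //; exact: measurable_gauss_shift.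
- apply: integrable_scale => //; exact: gauss_shift_int.
- by move=> z _; rewrite normrM (ger0_norm (gauss_ge0 _ _)) ler_wpM2r // gauss_ge0.
Qed.

Lemma heatE t f x : 0 < t -> bmf f ->
  heat t f x = \int[leb]_y (f y * gauss t (y - x)).
Proof.
move=> t0 bf; have st : 0 < Num.sqrt t by rewrite sqrtr_gt0.
have sn : Num.sqrt t != 0 by exact: lt0r_neq0.
have mk : measurable_fun setT (fun y => f y * gauss t (y - x)).
  by apply: measurable_funM; [exact: bf.1|exact: measurable_gauss_shift].
have E z : f (Num.sqrt t * z + x) * gauss t (Num.sqrt t * z + x - x) =
    (Num.sqrt t)^-1 * (f (x + Num.sqrt t * z) * gauss 1 z).
  by rewrite addrK gauss_scale // mulrCA [_ + x]addrC.
apply: (mulfI (invr_neq0 sn)); rewrite -(Rint_affine x st mk).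
under [RHS]eq_Rintegral do rewrite E.
by rewrite RintegralZl //; exact: heat_int.
Qed.

Lemma bm_sg_heat t f x : bmf f -> bm_sg t f x = heat t f x.
Proof.
move=> bf; rewrite /bm_sg; case: leP => t0; first by rewrite heat_le0.
by rewrite heatE.
Qed.

Lemma heat_abs_int t f x : 0 < t -> bmf f ->
  \int[leb]_y `|f y * gauss t (y - x)| = heat t (fun y => `|f y|) x.
Proof.
move=> t0 bf; rewrite heatE //.
  by apply: eq_Rintegral => y _; rewrite normrM (ger0_norm (gauss_ge0 _ _)).
case: bf => mf [M fM]; split; first exact: measurableT_comp.
by exists M => y; rewrite normr_id.
Qed.

Lemma heat_heat s r f x : 0 <= s -> 0 <= r -> bmf f ->
  heat s (heat r f) x = heat (s + r) f x.
Proof.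
rewrite le_eqVlt => /predU1P[<-|s0]; first by rewrite heat_le0 // add0r.
rewrite le_eqVlt => /predU1P[<-|r0] bf.
  by rewrite addr0; congr heat; apply/funext => y; rewrite heat_le0.
have [mf [M fM]] := bf.
have M0 : 0 <= M by apply: le_trans (fM 0).
rewrite (heatE x s0 (bmf_heat r bf)) (heatE x (addr_gt0 s0 r0) bf).
transitivity (\int[leb]_y \int[leb]_w (f w * gauss r (w - y) * gauss s (y - x))).
  apply: eq_Rintegral => y _; rewrite heatE // RintegralZr //; exact: kernel_int.
have mFF : measurable_fun setT (fun p : measurableTypeR R * measurableTypeR R =>
    f p.2 * gauss r (p.2 - p.1) * gauss s (p.1 - x)).
  apply: measurable_funM; last first.
    by apply: measurableT_comp; [exact: measurable_gauss|exact: measurable_funB].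
  apply: measurable_funM; first exact: measurableT_comp.
  by apply: measurableT_comp; [exact: measurable_gauss|exact: measurable_funB].
have b1 y : bmf (fun w => f w * gauss s (y - x)) by apply: bmfM => //; exact: bmf_cst.
pose F y w := f w * gauss r (w - y) * gauss s (y - x).
rewrite -[LHS]/(\int[leb]_(y in setT) \int[leb]_(w in setT) F y w).
rewrite (@fubini_gen R _ _ (measurableTypeR R) (measurableTypeR R) leb leb setT setT F (fun y => M * gauss s (y - x))) //; first last.
- move=> y _; rewrite /F; under eq_Rintegral do rewrite mulrAC.
  rewrite heat_abs_int //; apply: (le_trans (ler_norm _)); apply: heat_abs.
    by apply: measurableT_comp => //; exact: (b1 y).1.
  by move=> w; rewrite normr_id normrM (ger0_norm (gauss_ge0 _ _)) ler_wpM2r ?gauss_ge0.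
- apply: integrable_scale => //; exact: gauss_shift_int.
- move=> w _; have b2 : bmf (fun y => f w * gauss r (w - y)).
    split; first by apply: measurable_funM => //; apply: measurableT_comp; [exact: measurable_gauss|exact: measurable_funB].
    exists (M * (Num.sqrt r)^-1) => y; rewrite normrM (ger0_norm (gauss_ge0 _ _)).
    by apply: ler_pM => //; [exact: gauss_ge0|exact: gauss_ub].
  exact: (kernel_int x s0 b2).
- move=> y _; rewrite /F; under eq_fun do rewrite mulrAC; exact: kernel_int.
apply: eq_Rintegral => w _; rewrite /F.
under eq_Rintegral do rewrite -mulrA [gauss r _ * _]mulrC.
rewrite RintegralZl //; first by rewrite gauss_conv_int.
have b2 : bmf (fun y => gauss r (w - y)).
  split; first by apply: measurableT_comp; [exact: measurable_gauss|exact: measurable_funB].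
  by exists (Num.sqrt r)^-1 => y; rewrite (ger0_norm (gauss_ge0 _ _)) gauss_ub.
by under eq_fun do rewrite mulrC; exact: (kernel_int x s0 b2).
Qed.

(** The kernel is an even function of [y - x]; integrability of [a] lets Fubini apply to a merely
    bounded [g]. *)
Lemma heat_sym t (a g : R -> R) : bmf a -> leb.-integrable setT (EFin \o a) -> bmf g ->
  \int[leb]_x (a x * heat t g x) = \int[leb]_x (heat t a x * g x).
Proof.
move=> ba ia bg; have [t0|t0] := leP t 0.
  by apply: eq_Rintegral => x _; rewrite !heat_le0.
have [ma [N aN]] := ba; have [mg [M gM]] := bg.
have M0 : 0 <= M by apply: le_trans (gM 0).
have N0 : 0 <= N by apply: le_trans (aN 0).
transitivity (\int[leb]_x \int[leb]_y (a x * g y * gauss t (y - x))).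
  apply: eq_Rintegral => x _; rewrite heatE // -RintegralZl //; last exact: kernel_int.
  by apply: eq_Rintegral => y _; rewrite mulrA.
have bag x : bmf (fun y => a x * g y) by apply: bmfZ.
pose F x y := a x * g y * gauss t (y - x).
rewrite -[LHS]/(\int[leb]_(x in setT) \int[leb]_(y in setT) F x y).
rewrite (@fubini_gen R _ _ (measurableTypeR R) (measurableTypeR R) leb leb setT setT F (fun x => M * `|a x|)) //.
- apply: eq_Rintegral => y _; rewrite heatE // -RintegralZr //; last exact: kernel_int.
  apply: eq_Rintegral => x _; rewrite mulrAC; congr (_ * _ * _).
  by rewrite -opprB gauss_opp.
- apply: measurable_funM; last first.
    by apply: measurableT_comp; [exact: measurable_gauss|exact: measurable_funB].
  by apply: measurable_funM; exact: measurableT_comp.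
- by move=> x _; exact: kernel_int.
- move=> y _; apply: (@integrable_le _ _ _ leb _ _ (fun x => M * (Num.sqrt t)^-1 * `|a x|)) => //.
  + apply: measurable_funM; first exact: measurable_funM.
    by apply: measurableT_comp; [exact: measurable_gauss|exact: measurable_funB].
  + apply: integrable_scale => //.
    exact: (integrable_norm ia).
  + move=> x _; rewrite /F /= normrM [X in _ * X](ger0_norm (gauss_ge0 _ _)) normrM.
    rewrite (_ : M / _ * _ = `|a x| * M * (Num.sqrt t)^-1); last by ring.
    apply: ler_pM; rewrite ?mulr_ge0 ?gauss_ge0 ?gauss_ub //.
    exact: ler_wpM2l.
- apply: integrable_scale => //.
  exact: (integrable_norm ia).
- move=> x _; rewrite heat_abs_int //; apply: (le_trans (ler_norm _)); apply: heat_abs.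
    by apply: measurableT_comp => //; exact: (bag x).1.
  by move=> y; rewrite normr_id normrM mulrC ler_wpM2r.
Qed.

Lemma heat_tint a s x (F : R -> R -> R) (M : R) :
  measurable_fun setT (fun p : R * R => F p.1 p.2) ->
  (forall r y, 0 <= r <= s -> `|F r y| <= M) ->
  heat a (fun y => tint s (fun r => F r y)) x = tint s (fun r => heat a (F r) x).
Proof.
move=> mF FM; rewrite /heat.
transitivity (\int[leb]_z tint s (fun r => F r (x + Num.sqrt a * z) * gauss 1 z)).
  apply: eq_Rintegral => z _; rewrite tintZr //; split.
    exact: (measurable_fun_pair1 _ mF).
  by exists M => r rs; exact: FM.
pose G z r := F r (x + Num.sqrt a * z) * gauss 1 z.
rewrite -[LHS]/(\int[leb]_(z in setT) \int[leb]_(r in `[0, s]%classic) G z r).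
rewrite (@fubini_dom R _ _ (measurableTypeR R) (measurableTypeR R) leb leb setT _ G (fun z => M * gauss 1 z) (cst 1)) //.
- apply: measurable_funM.
    apply: (measurable_comp2 mF) => //; apply: measurable_funD => //.
    exact: measurable_funM.
  by apply: measurableT_comp; [exact: measurable_gauss|].
- by apply: integrable_scale => //; exact: gauss_int.
- exact: tbd_int (tbd_cst s 1).
- move=> z r _ rs; rewrite mulr1 normrM (ger0_norm (gauss_ge0 _ _)).
  by rewrite ler_wpM2r ?gauss_ge0 //; exact: FM.
Qed.

(** Completing the square moves the mean of the Gaussian by [a sqrt s] and leaves the exponential
    moment [e^{a^2 s / 2}]. *)
Lemma heat_exp_bound s f x (C a : R) : 0 <= s -> bmf f -> (forall y, `|f y| <= C * expR (a * y)) ->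
  `|heat s f x| <= C * expR (a * x + a ^+ 2 * s / 2).
Proof.
move=> s0 bf fC.
pose A z := C * expR (a * x + a ^+ 2 * s / 2) * gauss 1 (z - a * Num.sqrt s).
have iA : leb.-integrable setT (EFin \o A).
  by rewrite /A; apply: integrable_scale => //; exact: gauss_shift_int.
apply: (@le_trans _ _ (\int[leb]_z A z)); last first.
  by rewrite /A RintegralZl // ?gauss_shift1 ?mulr1 //; exact: gauss_shift_int.
apply: Rint_abs_le => //.
  by have /integrableP[/measurable_EFinP] := heat_int s x bf.
move=> z _; rewrite normrM (ger0_norm (gauss_ge0 _ _)).
apply: (@le_trans _ _ (C * expR (a * (x + Num.sqrt s * z)) * gauss 1 z)).
  by rewrite ler_wpM2r ?gauss_ge0.
rewrite /A le_eqVlt; apply/orP; left; apply/eqP.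
rewrite -!mulrA; congr (_ * _); rewrite /gauss !mulrA -!expRD; congr (expR _ / _).
by have := sqr_sqrtr s0; set q := Num.sqrt s => <-; field.
Qed.

Lemma heat_decay t f x (p q M : R) : 0 < t -> p <= q -> bmf f -> (forall y, `|f y| <= M) ->
  (forall y, ~~ (p <= y <= q) -> f y = 0) ->
  `|heat t f x| <= M * (q - p) / Num.sqrt t.
Proof.
move=> t0 pq bf fM f0; have M0 : 0 <= M by apply: le_trans (fM 0).
rewrite heatE //.
have -> : \int[leb]_y (f y * gauss t (y - x)) =
    \int[leb]_(y in `[p, q]%classic) (f y * gauss t (y - x)).
  rewrite [RHS]Rintegral_mkcond; apply: eq_Rintegral => y _.
  by rewrite /patch mem_setE in_itv /=; case: ifPn => // /f0 ->; rewrite mul0r.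
have lpq : fine (leb `[p, q]%classic) = q - p.
  rewrite lebesgue_measure_itv /= lte_fin; case: ltP => //= h.
  by apply/eqP; rewrite eq_sym subr_eq0 eq_le h pq.
have lfin : (leb `[p, q]%classic < +oo)%E.
  by rewrite lebesgue_measure_itv /=; case: ifP => _; rewrite ?ltry.
rewrite mulrAC -lpq; apply: Rint_abs_cst => //.
- by apply: measurable_funTS; have /integrableP[/measurable_EFinP] := kernel_int x t0 bf.
- move=> y _; rewrite normrM (ger0_norm (gauss_ge0 _ _)).
  by apply: ler_pM => //; [exact: gauss_ge0|exact: gauss_ub].
Qed.

(** For [|x|, |y| <= rho] one has [|y - x| <= 2 rho], and [t] in [1, 2] bounds the exponent below by
    [- 2 rho^2] and the normalisation above by [sqrt (4 pi)]. This feeds the minorisation of the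
    Harris argument. *)
Lemma heat_minor t f x (rho : R) : 1 <= t <= 2 -> bmf f -> (forall y, 0 <= f y) -> `|x| <= rho ->
  expR (- (2 * rho ^+ 2)) / Num.sqrt (4 * pi) *
    \int[leb]_(y in `[- rho, rho]%classic) f y <= heat t f x.
Proof.
move=> /andP[t1 t2] bf f0 xr; have t0 : 0 < t by lra.
have [mf [M fM]] := bf.
have lD : (leb `[(- rho)%R, rho]%classic < +oo)%E.
  by rewrite lebesgue_measure_itv /=; case: ifP => _; rewrite ?ltry.
have if_ : leb.-integrable `[- rho, rho]%classic (EFin \o f).
  by apply: (@integrable_bdd _ _ _ leb _ _ M) => //; exact: measurable_funTS.
rewrite heatE // -RintegralZl //.
have ik := kernel_int x t0 bf.
apply: (@le_trans _ _ (\int[leb]_(y in `[- rho, rho]%classic) (f y * gauss t (y - x)))).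
  apply: le_Rintegral => //.
  - exact: integrable_scale.
  - exact: (integrableS _ _ _ ik).
  - move=> y; rewrite /= in_itv /= => /andP[y1 y2].
    rewrite mulrC ler_wpM2l //; rewrite /gauss; apply: ler_pM; rewrite ?expR_ge0 ?invr_ge0 ?sqrtr_ge0 //.
      rewrite ler_expR mulNr lerN2 ler_pdivrMr; last lra.
      move: xr; rewrite ler_norml => /andP[x1 x2].
      apply: (@le_trans _ _ (4 * rho ^+ 2)); last by have := sqr_ge0 rho; nra.
      have : 0 <= (2 * rho - (y - x)) * (2 * rho + (y - x)) by apply: mulr_ge0; lra.
      by rewrite !expr2; nra.
    rewrite lef_pV2 ?posrE ?sqrtr_gt0 ?mulr_gt0 ?pi_gt0 // ler_sqrt ?mulr_ge0 ?pi_ge0 //.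
    by have := pi_gt0 R; nra.
rewrite Rintegral_mkcond; apply: le_Rintegral => //.
  by rewrite -restrict_EFin; apply/(integrable_mkcond _ _).1 => //; exact: (integrableS _ _ _ ik).
move=> y _; rewrite /patch; case: ifP => // _.
by rewrite mulr_ge0 ?gauss_ge0.
Qed.

End Heat.

Opaque heat tint.

(** * Mild solutions: Duhamel terms, killing, nonnegativity *)

Section Mild.
Variable R : realType.
Implicit Types (t s r x y z T m : R) (f : R -> R) (g v F c : R -> R -> R).

(** The bounds hold on all of [t <= T], negative times included: [heat] is the identity there and
    Duhamel terms vanish, so no sign condition on time is carried along. *)
Definition lbm v := measurable_fun setT (fun p : R * R => v p.1 p.2) /\
  forall T, exists M : R, forall t x, t <= T -> `|v t x| <= M.

Lemma lbm_bmf v t : lbm v -> bmf (v t).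
Proof.
move=> [mv bv]; split; first exact: (measurable_fun_pair2 t mv).
by have [M vM] := bv t; exists M => x; exact: vM.
Qed.

Lemma lbmD g v : lbm g -> lbm v -> lbm (fun t x => g t x + v t x).
Proof.
move=> [mg bg] [mv bv]; split; first exact: measurable_funD.
move=> T; have [M gM] := bg T; have [N vN] := bv T; exists (M + N) => t x tT.
by apply: (le_trans (ler_normD _ _)); apply: lerD; [exact: gM|exact: vN].
Qed.

Lemma lbmM g v : lbm g -> lbm v -> lbm (fun t x => g t x * v t x).
Proof.
move=> [mg bg] [mv bv]; split; first exact: measurable_funM.
move=> T; have [M gM] := bg T; have [N vN] := bv T; exists (M * N) => t x tT.
by rewrite normrM; apply: ler_pM => //; [exact: gM|exact: vN].
Qed.

Lemma lbm_cstt f : bmf f -> lbm (fun=> f).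
Proof.
move=> [mf [M fM]]; split; first exact: measurableT_comp.
by move=> T; exists M => t x _.
Qed.

Lemma lbm_cst (k : R) : lbm (fun _ _ => k).
Proof. by apply: lbm_cstt; exact: bmf_cst. Qed.

Lemma lbmN v : lbm v -> lbm (fun t x => - v t x).
Proof.
move=> [mv bv]; split; first exact: measurableT_comp.
by move=> T; have [M vM] := bv T; exists M => t x tT; rewrite normrN vM.
Qed.

Lemma lbmB g v : lbm g -> lbm v -> lbm (fun t x => g t x - v t x).
Proof. by move=> bg bv; apply: lbmD => //; exact: lbmN. Qed.

Lemma lbmZ k v : lbm v -> lbm (fun t x => k * v t x).
Proof. by move=> bv; apply: lbmM => //; exact: lbm_cst. Qed.

Lemma lbm_shift s v : lbm v -> lbm (fun t => v (s + t)).
Proof.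
move=> [mv bv]; split.
  by apply: (measurable_comp2 mv) => //; exact: measurable_funD.
by move=> T; have [M vM] := bv (s + T); exists M => t x tT; apply: vM; rewrite lerD2l.
Qed.

Lemma lbm_heat f : bmf f -> lbm (fun t => heat t f).
Proof.
move=> [mf [M fM]]; split; last by move=> T; exists M => t x _; exact: heat_abs.
apply: (@measurable_heat _ _ _ (fun=> f)) => //.
exact: measurableT_comp.
Qed.

Definition duh g t x := tint t (fun s => heat s (g (t - s)) x).

Lemma tbd_duh a t x g : lbm g -> tbd t (fun s => heat (a + s) (g (t - s)) x).
Proof.
move=> [mg bg]; split.
  apply: (@measurable_heat R _ R (fun s => g (t - s)) (fun s => a + s) (fun=> x)) => //; last exact: measurable_funD.
  by apply: (measurable_comp2 mg) => //; exact: measurable_funB.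
have [M gM] := bg t; exists M => s /andP[s0 st]; apply: heat_abs.
  exact: (measurable_fun_pair2 _ mg).
by move=> y; apply: gM; rewrite lerBlDr lerDl.
Qed.

Lemma tbd_duh0 t x g : lbm g -> tbd t (fun s => heat s (g (t - s)) x).
Proof. by move=> lg; have := tbd_duh 0 t x lg; under eq_fun do rewrite add0r. Qed.

Lemma lbm_duh g : lbm g -> lbm (duh g).
Proof.
move=> lg; have [mg bg] := lg; split.
  apply: (@measurable_tint R _ _ (fun p : R * R => p.1) (fun p s => heat s (g (p.1 - s)) p.2)).
    exact: measurable_fst.
  apply: (@measurable_heat R _ (R * R * R)%type (fun q => g (q.1.1 - q.2)) snd (fun q => q.1.2)) => //.
    apply: (measurable_comp2 mg); last exact: measurable_snd.
    have A : measurable_fun setT (fun x : R * R * R => x.1.1) by exact: measurable_fst_fst.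
    have B : measurable_fun setT (fun x : R * R * R * R => x.1) by exact: measurable_fst.
    have C : measurable_fun setT (fun x : R * R * R => x.2) by exact: measurable_snd.
    by apply: measurable_funB; [exact: (measurableT_comp A B)|exact: (measurableT_comp C B)].
  exact: measurable_snd_fst.
move=> T; have [M gM] := bg T; exists (`|M| * `|T|) => t x tT.
have [t0|t0] := ltP t 0; first by rewrite /duh tint_neg // normr0 mulr_ge0.
have [ma _] := tbd_duh0 t x lg.
apply: (@le_trans _ _ (`|M| * t)); last by rewrite ler_wpM2l // (le_trans tT) // ler_norm.
apply: tint_abs_cst => // s /andP[s0 st]; apply: heat_abs.
  exact: (measurable_fun_pair2 _ mg).
move=> y; apply: le_trans (ler_norm M); apply: gM.
by rewrite (le_trans _ tT) // lerBlDr lerDl.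
Qed.

Lemma duhD g v t x : lbm g -> lbm v -> duh (fun t x => g t x + v t x) t x = duh g t x + duh v t x.
Proof.
move=> lg lv; rewrite /duh -tintD; [|exact: tbd_duh0|exact: tbd_duh0].
by apply: eq_tint => s _; rewrite heatD //; exact: lbm_bmf.
Qed.

Lemma duhZ k g t x : lbm g -> duh (fun t x => k * g t x) t x = k * duh g t x.
Proof.
move=> lg; rewrite /duh -tintZ; last exact: tbd_duh0.
by apply: eq_tint => s _; rewrite heatZ //; exact: lbm_bmf.
Qed.

Lemma duhN g t x : lbm g -> duh (fun t x => - g t x) t x = - duh g t x.
Proof.
move=> lg; rewrite /duh -tintN; last exact: tbd_duh0.
by apply: eq_tint => s _; rewrite heatN //; exact: lbm_bmf.
Qed.

Lemma duhB g v t x : lbm g -> lbm v -> duh (fun t x => g t x - v t x) t x = duh g t x - duh v t x.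
Proof. by move=> lg lv; rewrite duhD ?duhN //; exact: lbmN. Qed.

Lemma eq_duh g v t x : (forall s y, 0 <= s <= t -> g s y = v s y) -> duh g t x = duh v t x.
Proof.
move=> gv; apply: eq_tint => s /andP[s0 st]; congr (heat s _ x); apply/funext => y.
by apply: gv; rewrite subr_ge0 st lerBlDr lerDl.
Qed.

Lemma duh_ge0 g t x : (forall s y, 0 <= s -> 0 <= g s y) -> 0 <= duh g t x.
Proof.
move=> g0; apply: tint_ge0 => s /andP[s0 st]; apply: heat_ge0 => y.
by apply: g0; rewrite subr_ge0.
Qed.

(** Mild form of [v_t = v''/2 + F] with initial value [f]. The source [F] may be built from [v]
    itself, so one notion covers linear and nonlinear equations. *)
Definition is_sol f F v := forall t x, 0 <= t -> v t x = heat t f x + duh F t x.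

Lemma sol_eq f F G v : is_sol f F v -> (forall s y, 0 <= s -> F s y = G s y) -> is_sol f G v.
Proof.
move=> sv FG t x t0; rewrite (sv t x t0); congr (_ + _).
by apply: eq_duh => s y /andP[s0 _]; exact: FG.
Qed.

Lemma duh_le_tint (b : R -> R) g t x : lbm g -> tbd t b ->
  (forall s y, 0 <= s <= t -> g (t - s) y <= b s) -> duh g t x <= tint t b.
Proof.
move=> lg tb gb; apply: tint_le => //; first exact: tbd_duh0.
move=> s st; rewrite -(heat_cst s x (b s)); apply: heat_le.
- exact: lbm_bmf.
- exact: bmf_cst.
- by move=> y; exact: gb.
Qed.

Lemma sol_prop f F v a s x : bmf f -> lbm F -> is_sol f F v -> 0 <= a -> 0 <= s ->
  heat a (v s) x = heat (a + s) f x + tint s (fun r => heat (a + r) (F (s - r)) x).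
Proof.
move=> bf lF sv a0 s0; have [mF bF] := lF.
have -> : v s = fun y => heat s f y + duh F s y by apply/funext => y; exact: sv.
rewrite heatD; [|exact: bmf_heat|exact: (lbm_bmf s (lbm_duh lF))].
rewrite heat_heat //; congr (_ + _); rewrite /duh.
have [M FM] := bF s.
rewrite (@heat_tint _ a s x (fun r y => heat r (F (s - r)) y) M).
- by apply: eq_tint => r /andP[r0 rs]; rewrite heat_heat //; exact: lbm_bmf.
- apply: (@measurable_heat R _ (R * R)%type (fun p => F (s - p.1)) fst snd) => //.
  apply: (measurable_comp2 mF) => //; apply: measurable_funB => //; exact: measurable_fst_fst.
- move=> r y /andP[r0 rs]; apply: heat_abs; first exact: (measurable_fun_pair2 _ mF).
  by move=> z; apply: FM; rewrite lerBlDr lerDl.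
Qed.

Lemma sol_restart f F v s : bmf f -> lbm F -> is_sol f F v -> 0 <= s ->
  is_sol (v s) (fun r => F (s + r)) (fun r => v (s + r)).
Proof.
move=> bf lF sv s0 a x a0.
have E1 := sol_prop x bf lF sv a0 s0.
have E2 := sv (s + a) x (addr_ge0 s0 a0).
have E3 := tint_split a0 s0 (tbd_duh0 (a + s) x lF).
have F1 : duh (fun r => F (s + r)) a x = tint a (fun r => heat r (F (a + s - r)) x).
  by apply: eq_tint => r _; rewrite addrA [s + a]addrC.
have F2 : tint s (fun r => heat (a + r) (F (s - r)) x) =
    tint s (fun r => heat (a + r) (F (a + s - (a + r))) x).
  by apply: eq_tint => r _; rewrite opprD addrACA subrr add0r.
have E4 : duh F (s + a) x = tint a (fun r => heat r (F (a + s - r)) x) +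
    tint s (fun r => heat (a + r) (F (a + s - (a + r))) x) by rewrite [s + a]addrC.
rewrite [LHS]E2 E1 F1 F2 E4 [s + a]addrC.
move: (heat _ f x) (tint a _) (tint s _) => p q r.
by rewrite [q + r]addrC addrA.
Qed.

(** Killing at rate [m], paid back as a source: the same [v] is represented with the kernel
    [e^{-m s} heat s] and the source [F + m v]. If [F] contains [c v] with [|c| <= m], the new
    coefficient [c + m] is nonnegative, which is the root of positivity and comparison. *)
Lemma sol_killed f F v m t x : bmf f -> lbm F -> lbm v -> is_sol f F v -> 0 < m -> 0 <= t ->
  v t x = expR (- m * t) * heat t f x +
    tint t (fun s => expR (- m * s) * heat s (fun y => F (t - s) y + m * v (t - s) y) x).
Proof.
move=> bf lF lv sv m0 t0; have nm0 : - m != 0 by rewrite oppr_eq0 lt0r_neq0.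
pose q r := heat r (F (t - r)) x.
have tq : tbd t q by exact: tbd_duh0.
have [mq [M qM]] := tq.
have te : tbd t (fun s => expR (- m * s)) by exact: tbd_expR.
have tme : tbd t (fun s => m * expR (- m * s)) by apply: tbdM => //; exact: tbd_cst.
have Hm s : 0 <= s -> tint s (fun r => m * expR (- m * r)) = 1 - expR (- m * s).
  by move=> s0; rewrite tintZ ?tint_expR //; [field; exact: lt0r_neq0|exact: tbd_expR].
rewrite sv // /duh -/q.
have -> : tint t (fun s => expR (- m * s) * heat s (fun y => F (t - s) y + m * v (t - s) y) x) =
    tint t (fun s => expR (- m * s) * q s + (m * expR (- m * s) * heat t f x +
       tint (t - s) (fun r => m * expR (- m * s) * q (s + r)))).
  apply: eq_tint => s /andP[s0 st]; have ts0 : 0 <= t - s by rewrite subr_ge0.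
  rewrite heatD ?heatZ; [|exact: lbm_bmf|exact: lbm_bmf|by apply: bmfZ; exact: lbm_bmf].
  rewrite (sol_prop x bf lF sv s0 ts0) [s + (t - s)]addrC subrK mulrDr; congr (_ + _).
  rewrite tintZ; last by have := tbd_duh s (t - s) x lF; under eq_fun do rewrite -addrA -opprD.
  have -> : tint (t - s) (fun r => heat (s + r) (F (t - s - r)) x) = tint (t - s) (fun r => q (s + r)).
    by apply: eq_tint => r _; rewrite /q opprD addrA.
  by move: (expR _) (heat _ f x) (tint _ _) => e1 p1 r1; ring.
(* Inserting [sol_prop] for [v (t - s)] has produced a double integral of [H] over a triangle; on
   the line [s + r = u] the weights [m e^{-m s}] integrate to [1 - e^{-m u}], which restores the
   unweighted Duhamel term. *)
pose H s r := m * expR (- m * s) * q (s + r).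
have mH : measurable_fun setT (fun p : R * R => H p.1 p.2).
  apply: measurable_funM.
    apply: measurable_funM => //; apply: measurableT_comp => //; exact: measurable_funM.
  by apply: measurableT_comp => //; exact: measurable_funD.
have Hb s r : 0 <= s -> 0 <= r -> s + r <= t -> `|H s r| <= m * M.
  move=> s0 r0 srt; rewrite /H !normrM (gtr0_norm m0) (gtr0_norm (expR_gt0 _)).
  rewrite ler_pM ?mulr_ge0 ?expR_ge0 ?(ltW m0) //; last by apply: qM; rewrite srt addr_ge0.
  rewrite ler_piMr ?(ltW m0) // -[leRHS]expR0 ler_expR mulNr oppr_le0 mulr_ge0 // ltW //.
have tH : tbd t (fun s => tint (t - s) (H s)).
  split; first by apply: measurable_tint => //; exact: measurable_funB.
  exists (m * M * t) => s /andP[s0 st]; have M0 : 0 <= m * M.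
    by apply: le_trans (Hb 0 0 _ _ _) => //; rewrite addr0.
  apply: (@le_trans _ _ (m * M * (t - s))).
    apply: tint_abs_cst; [by rewrite subr_ge0|exact: (measurable_fun_pair2 s mH)|].
    by move=> r /andP[r0 rts]; apply: Hb => //; rewrite addrC -lerBrDr.
  by rewrite ler_wpM2l // lerBlDr lerDl.
rewrite tintD; [|exact: tbdM|by apply: tbdD => //; apply: tbdM => //; exact: tbd_cst].
rewrite tintD //; last by apply: tbdM => //; exact: tbd_cst.
rewrite tintZr // Hm // -/(H _) (tint_tri mH Hb).
have -> : tint t (fun u => tint u (fun r => H (u - r) r)) = tint t (fun u => (1 - expR (- m * u)) * q u).
  apply: eq_tint => u /andP[u0 ut].
  rewrite -(Hm u u0) -(tint_rev u tme.1) -tintZr.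
    by apply: eq_tint => r _; rewrite /H subrK.
  by apply: (tbd_rev (a := fun r => m * expR (- m * r))); exact: tbdS tme.
have -> : tint t (fun u => (1 - expR (- m * u)) * q u) = tint t q - tint t (fun u => expR (- m * u) * q u).
  rewrite -tintB //; last exact: tbdM.
  by apply: eq_tint => u _; rewrite mulrBl mul1r.
by ring.
Qed.

(** Whatever the sign of [c], killing at a rate above [|c|] improves a lower bound [- A e^{a t}] on
    [[0, T]] to [- (A / 2) e^{a t}]; iterating from the bound given by [lbm] forces [v >= 0]. *)
Lemma sol_ge0 f c g v : bmf f -> (forall x, 0 <= f x) -> lbm c -> lbm g -> lbm v ->
  (forall t x, 0 <= t -> 0 <= g t x) ->
  is_sol f (fun t x => c t x * v t x + g t x) v ->
  forall t x, 0 <= t -> 0 <= v t x.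
Proof.
move=> bf f0 lc lg lv g0 sv T x0 T0.
have [mc bc] := lc; have [mv bv] := lv.
have [m0 cm0] := bc T; pose m := `|m0| + 1.
have m1 : 0 < m by rewrite /m; have := normr_ge0 m0; lra.
have cm t x : t <= T -> `|c t x| <= m.
  move=> tT; apply: (le_trans (cm0 _ _ tT)); rewrite /m; have := ler_norm m0; lra.
(* The killed source is at least [- 2 m A e^{a (t - s)}], whose time integral has absolute value at
   most [2 m A e^{a t} / a]; [a = 4 m] makes this [(A / 2) e^{a t}]. *)
pose a := 4 * m; have a0 : 0 < a by rewrite /a; lra.
have lF : lbm (fun t x => c t x * v t x + g t x) by apply: lbmD => //; exact: lbmM.
have step (A : R) : 0 <= A -> (forall t x, 0 <= t <= T -> - (A * expR (a * t)) <= v t x) ->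
    forall t x, 0 <= t <= T -> - (A / 2 * expR (a * t)) <= v t x.
  move=> A0 Av t x /andP[t0 tT].
  rewrite (sol_killed x bf lF lv sv m1 t0).
  apply: (@le_trans _ _ (tint t (fun s => - (2 * m * A * expR (a * (t - s)))))).
    have -> : tint t (fun s => - (2 * m * A * expR (a * (t - s)))) = - (2 * m * A * ((expR (a * t) - 1) / a)).
      have te := tbd_expR t a; have ter := tbd_rev te.
      rewrite tintN ?tintZ //; last by apply: tbdM => //; exact: tbd_cst.
      by rewrite (tint_rev t te.1) tint_expR // lt0r_neq0.
    rewrite lerN2 /a; have e1 := expR_gt0 (4 * m * t).
    have -> : 2 * m * A * ((expR (4 * m * t) - 1) / (4 * m)) = A / 2 * (expR (4 * m * t) - 1).
      by field; exact: lt0r_neq0.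
    by nra.
  rewrite -[leLHS]add0r; apply: lerD; first by rewrite mulr_ge0 ?expR_ge0 ?heat_ge0.
  have lG : lbm (fun t x => c t x * v t x + g t x + m * v t x) by apply: lbmD => //; exact: lbmZ.
  apply: tint_le.
  - apply: tbdN; apply: tbdM; first exact: tbd_cst.
    exact: tbd_rev (tbd_expR t a).
  - apply: tbdM; first exact: tbd_expR.
    exact: (tbd_duh0 t x lG).
  move=> s /andP[s0 st].
  have ts : 0 <= t - s <= T by rewrite subr_ge0 st (le_trans _ tT) // lerBlDr lerDl.
  have K0 : 0 <= 2 * m * A * expR (a * (t - s)) by rewrite !mulr_ge0 ?expR_ge0 ?(ltW m1).
  apply: (@le_trans _ _ (expR (- m * s) * heat s (fun=> - (2 * m * A * expR (a * (t - s)))) x)).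
    rewrite heat_cst mulrN lerN2 ler_piMl // -[leRHS]expR0 ler_expR mulNr oppr_le0 mulr_ge0 // ltW //.
  rewrite ler_wpM2l ?expR_ge0 //; apply: heat_le.
  - exact: bmf_cst.
  - exact: lbm_bmf (t - s) lG.
  move=> y; have := Av (t - s) y ts; have := g0 (t - s) y (proj1 (andP ts)).
  have := cm (t - s) y (proj2 (andP ts)); rewrite ler_norml => /andP[].
  move: (c _ _) (v _ _) (g _ _) (expR_gt0 (a * (t - s))) => c' v' g' e0 c1 c2 g1 v1.
  have h1 : 0 <= (c' + m) * (v' + A * expR (a * (t - s))) by apply: mulr_ge0; lra.
  have h2 : 0 <= (m - c') * (A * expR (a * (t - s))) by apply: mulr_ge0; [lra|rewrite mulr_ge0 // ltW].
  by nra.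
have [M vM] := bv T.
have M0 : 0 <= M by apply: le_trans (vM T 0 (lexx _)).
have base t x : 0 <= t <= T -> - (M * expR (a * t)) <= v t x.
  move=> /andP[t0 tT]; have := vM t x tT; rewrite ler_norml => /andP[h _].
  apply: le_trans h; rewrite lerN2 ler_peMr // -expR0 ler_expR mulr_ge0 // ltW //.
have all n : forall t x, 0 <= t <= T -> - (M / 2 ^+ n * expR (a * t)) <= v t x.
  elim: n => [|n IH]; first by move=> t x tT; rewrite expr0 divr1; exact: base.
  move=> t x tT; have := step (M / 2 ^+ n) (divr_ge0 M0 (exprn_ge0 n (ler0n _ 2))) IH t x tT.
  by rewrite exprSr invfM mulrA.
have TT : 0 <= T <= T by rewrite T0 lexx.
apply/ler_addgt0Pl => e e0.
pose K := M * expR (a * T) / e.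
have K0 : 0 <= K by rewrite /K divr_ge0 ?mulr_ge0 ?expR_ge0 // ltW.
have [n Kn] : exists n : nat, K <= 2 ^+ n.
  have [n nK] : exists n : nat, K <= n%:R.
    by exists (Num.truncn K).+1; rewrite ltW // truncnS_gt.
  exists n; apply: (le_trans nK); rewrite -natrX ler_nat ltnW // ltn_expl //.
have := all n T x0 TT; suff : M / 2 ^+ n * expR (a * T) <= e by lra.
rewrite mulrAC ler_pdivrMr ?exprn_gt0 //.
by move: Kn; rewrite /K ler_pdivrMr // [_ * e]mulrC.
Qed.

End Mild.

Opaque duh.

(** * Comparison, uniqueness and Picard iteration *)

Section Solve.
Variable R : realType.
Implicit Types (t s r x y z T : R) (f : R -> R) (g v w F c : R -> R -> R).

Lemma sol_le f1 f2 c g1 g2 v w : bmf f1 -> bmf f2 -> lbm c -> lbm g1 -> lbm g2 -> lbm v -> lbm w ->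
  is_sol f1 (fun t x => c t x * v t x + g1 t x) v ->
  is_sol f2 (fun t x => c t x * w t x + g2 t x) w ->
  (forall x, f1 x <= f2 x) -> (forall t x, 0 <= t -> g1 t x <= g2 t x) ->
  forall t x, 0 <= t -> v t x <= w t x.
Proof.
move=> b1 b2 lc l1 l2 lv lw sv sw f12 g12 t x t0.
have lF1 : lbm (fun t x => c t x * v t x + g1 t x) by apply: lbmD => //; exact: lbmM.
have lF2 : lbm (fun t x => c t x * w t x + g2 t x) by apply: lbmD => //; exact: lbmM.
rewrite -subr_ge0.
apply: (@sol_ge0 R (fun x => f2 x - f1 x) c (fun t x => g2 t x - g1 t x) (fun t x => w t x - v t x) _ _ lc _ _ _ _ t x t0).
- exact: bmfB.
- by move=> y; rewrite subr_ge0.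
- exact: lbmB.
- exact: lbmB.
- by move=> s y s0; rewrite subr_ge0 g12.
move=> s y s0; rewrite sv // sw // heatB //.
have -> : duh (fun t x => c t x * (w t x - v t x) + (g2 t x - g1 t x)) s y =
   duh (fun t x => (c t x * w t x + g2 t x) - (c t x * v t x + g1 t x)) s y.
  by apply: eq_duh => r z _; rewrite mulrBr opprD addrACA.
rewrite duhB //; move: (heat _ _ _) (heat _ _ _) (duh _ _ _) (duh _ _ _) => p q p' q'.
by rewrite opprD addrACA.
Qed.

Lemma sol_uniq f c g v w : bmf f -> lbm c -> lbm g -> lbm v -> lbm w ->
  is_sol f (fun t x => c t x * v t x + g t x) v ->
  is_sol f (fun t x => c t x * w t x + g t x) w ->
  forall t x, 0 <= t -> v t x = w t x.
Proof.
move=> bf lc lg lv lw sv sw t x t0; apply/eqP; rewrite eq_le.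
by rewrite (sol_le bf bf lc lg lg lv lw sv sw) // (sol_le bf bf lc lg lg lw lv sw sv).
Qed.

(** The sequences [u n - 2 B / 2 ^ n] and [u n + 2 B / 2 ^ n] are monotone and enclose the limit,
    which yields both convergence and the rate. *)
Lemma geometric_cvg (u : nat -> R) (B : R) :
  (forall n, `|u n.+1 - u n| <= B / 2 ^+ n) ->
  exists2 l : R, u n @[n --> \oo] --> l & forall n, `|u n - l| <= 2 * B / 2 ^+ n.
Proof.
move=> uB.
have e n : (2 : R) ^+ n != 0 by rewrite expf_neq0.
have half n : 2 * B / 2 ^+ n.+1 = B / 2 ^+ n.
  by rewrite exprS; field; rewrite e.
have B0 n : 0 <= 2 * B / 2 ^+ n.
  rewrite -mulrA mulr_ge0 //; exact: le_trans (normr_ge0 _) (uB n).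
have st n : u n - 2 * B / 2 ^+ n <= u n.+1 - 2 * B / 2 ^+ n.+1.
  rewrite half; have -> : 2 * B / 2 ^+ n = B / 2 ^+ n + B / 2 ^+ n by field; rewrite e.
  by have := uB n; rewrite ler_norml => /andP[h1 h2]; lra.
have st' n : u n.+1 + 2 * B / 2 ^+ n.+1 <= u n + 2 * B / 2 ^+ n.
  rewrite half; have -> : 2 * B / 2 ^+ n = B / 2 ^+ n + B / 2 ^+ n by field; rewrite e.
  by have := uB n; rewrite ler_norml => /andP[h1 h2]; lra.
pose lo n := u n - 2 * B / 2 ^+ n; pose hi n := u n + 2 * B / 2 ^+ n.
have nlo : nondecreasing_seq lo by apply/nondecreasing_seqP => n; exact: st.
have nhi : nonincreasing_seq hi by apply/nonincreasing_seqP => n; exact: st'.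
have lohi n m : lo n <= hi m.
  have [nm|mn] := leqP n m.
    apply: (le_trans (nlo _ _ nm)); rewrite /lo /hi; have := B0 m; lra.
  apply: le_trans (nhi _ _ (ltnW mn)); rewrite /lo /hi; have := B0 n; lra.
have clo : cvgn lo.
  apply: nondecreasing_is_cvgn => //; exists (hi 0%N) => _ [n _ <-]; exact: lohi.
pose l := limn lo.
have lol n : lo n <= l by exact: nondecreasing_cvgn_le.
have lhi n : l <= hi n by apply: limr_le => //; apply: nearW => m; exact: lohi.
exists l; last first.
  move=> n; rewrite ler_norml; have := lol n; have := lhi n; rewrite /lo /hi => h1 h2; apply/andP; split; lra.
have c0 : (2 * B / 2 ^+ n) @[n --> \oo] --> (0 : R).
  have -> : 0 = 2 * B * 0 :> R by rewrite mulr0.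
  apply: cvgMr; under eq_fun do rewrite -exprVn.
  by apply: cvg_expr; rewrite ger0_norm ?invr_ge0 //; lra.
have : (lo n + 2 * B / 2 ^+ n) @[n --> \oo] --> l + 0 by apply: cvgD.
by rewrite addr0; under eq_fun do rewrite /lo subrK.
Qed.

Lemma cvg_geom0 (K : R) : (K / 2 ^+ n) @[n --> \oo] --> (0 : R).
Proof.
rewrite -[X in _ --> X](mulr0 K); apply: cvgMr; under eq_fun do rewrite -exprVn.
by apply: cvg_expr; rewrite ger0_norm ?invr_ge0 //; lra.
Qed.

Lemma le_geom0 x (K : R) : (forall n, x <= K / 2 ^+ n) -> x <= 0.
Proof.
move=> h; rewrite -(cvg_lim _ (cvg_geom0 K)) //; apply: limr_ge.
  by apply/cvg_ex; exists 0; exact: cvg_geom0.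
exact: nearW.
Qed.

Lemma tint_expR_rev_le a t : 0 < a -> 0 <= t -> tint t (fun s => expR (a * (t - s))) <= expR (a * t) / a.
Proof.
move=> a0 t0; have te := tbd_expR t a.
rewrite (tint_rev t te.1) tint_expR // ?lt0r_neq0 // ler_wpM2r ?invr_ge0 ?(ltW a0) //.
by rewrite lerBlDr lerDl.
Qed.

Lemma picard f (Psi : R -> R -> R -> R) : bmf f ->
  (forall v, lbm v -> lbm (fun t x => Psi t x (v t x))) ->
  (forall T, exists C : R, forall t x l l', t <= T -> `|Psi t x l - Psi t x l'| <= C * `|l - l'|) ->
  exists v, lbm v /\ is_sol f (fun t x => Psi t x (v t x)) v.
Proof.
move=> bf mPsi lPsi.
pose V := fix V n : R -> R -> R := if n is n'.+1 then
   fun t x => heat t f x + duh (fun t x => Psi t x (V n' t x)) t x else fun _ _ => 0.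
have VS n t x : V n.+1 t x = heat t f x + duh (fun t x => Psi t x (V n t x)) t x by [].
have lV n : lbm (V n).
  elim: n => [|n IH]; first exact: lbm_cst.
  by apply: lbmD; [exact: lbm_heat|apply: lbm_duh; exact: mPsi].
have lP n : lbm (fun t x => Psi t x (V n t x)) by exact: mPsi.
have key T : exists B : R, forall n t x, t <= T -> `|V n.+1 t x - V n t x| <= B / 2 ^+ n.
  have [C0 HC0] := lPsi T; pose C := `|C0| + 1.
  have C1 : 0 < C by rewrite /C; have := normr_ge0 C0; lra.
  have HC t x l l' : t <= T -> `|Psi t x l - Psi t x l'| <= C * `|l - l'|.
    move=> tT; apply: (le_trans (HC0 _ _ _ _ tT)); rewrite ler_wpM2r // /C; have := ler_norm C0; lra.
  have [A HA] := (lV 1%N).2 T.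
  have A0 : 0 <= A by exact: le_trans (normr_ge0 _) (HA T 0 (lexx _)).
  (* With the weight [e^{a t}] and [a = 2 C], one Duhamel integral of a [C]-Lipschitz source gains
     the factor [C / a = 1/2], so the iteration contracts on any time horizon. *)
  pose a := 2 * C; have a0 : 0 < a by rewrite /a; lra.
  pose E t := expR (a * Num.max t 0).
  have E1 t : 1 <= E t by rewrite /E -expR0 ler_expR mulr_ge0 ?(ltW a0) // le_max lexx orbT.
  have main n : forall t x, t <= T -> `|V n.+1 t x - V n t x| <= A / 2 ^+ n * E t.
    elim: n => [|n IH] t x tT.
      rewrite expr0 divr1 [V 0%N t x]/= subr0; apply: (le_trans (HA t x tT)).
      by rewrite ler_peMr.
    rewrite !VS; have -> : forall p q r : R, p + q - (p + r) = q - r by move=> *; ring.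
    rewrite -duhB //.
    have [t0|t0] := ltP t 0.
      rewrite [duh _ _ _]tint_neg // normr0 mulr_ge0 //; first by rewrite divr_ge0 ?exprn_ge0.
      by rewrite (le_trans _ (E1 t)).
    have lD : lbm (fun t x => Psi t x (V n.+1 t x) - Psi t x (V n t x)) by exact: lbmB.
    have te : tbd t (fun s => expR (a * (t - s))) by exact: tbd_rev (tbd_expR t a).
    pose k := C * (A / 2 ^+ n).
    have k0 : 0 <= k by rewrite /k mulr_ge0 ?(ltW C1) // divr_ge0 ?exprn_ge0.
    apply: (@le_trans _ _ (tint t (fun s => k * expR (a * (t - s))))).
      apply: tint_abs; [exact: (tbd_duh0 t x lD).1|by apply: tbdM => //; exact: tbd_cst|].
      move=> s /andP[s0 st]; apply: heat_abs; first exact: (lbm_bmf (t - s) lD).1.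
      have tsT : t - s <= T by rewrite (le_trans _ tT) // lerBlDr lerDl.
      move=> y; apply: (le_trans (HC _ _ _ _ tsT)); rewrite /k -mulrA ler_wpM2l ?(ltW C1) //.
      by apply: (le_trans (IH _ _ tsT)); rewrite /E max_l // subr_ge0.
    rewrite tintZ //; apply: (@le_trans _ _ (k * (expR (a * t) / a))).
      by rewrite ler_wpM2l // tint_expR_rev_le.
    rewrite /E max_l // /k /a exprS le_eqVlt; apply/orP; left; apply/eqP; field.
    by rewrite ?expf_neq0 ?lt0r_neq0.
  exists (A * E T) => n t x tT; apply: (le_trans (main n t x tT)).
  rewrite mulrAC ler_wpM2r ?invr_ge0 ?exprn_ge0 // ler_wpM2l // /E ler_expR ler_wpM2l ?(ltW a0) //.
  by rewrite ge_max !le_max tT lexx !orbT.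
(* The limit is chosen point by point; uniqueness of limits transfers the geometric rate to every
   admissible [T] and [B], which makes it uniform in space. *)
have lim t x : {l : R | V n t x @[n --> \oo] --> l & forall T B,
   (forall n t x, t <= T -> `|V n.+1 t x - V n t x| <= B / 2 ^+ n) -> t <= T ->
    forall n, `|V n t x - l| <= 2 * B / 2 ^+ n}.
  apply: cid2; have [B HB] := key t.
  have [l cl _] := geometric_cvg (fun n => HB n t x (lexx _)).
  exists l => // T B' HB' tT n.
  have [l' cl' Hl'] := geometric_cvg (fun n => HB' n t x tT).
  by rewrite (cvg_unique _ cl cl').
pose v t x := s2val (lim t x).
have cv t x : V n t x @[n --> \oo] --> v t x by rewrite /v; case: (lim t x).
have Hv t x T B : (forall n t x, t <= T -> `|V n.+1 t x - V n t x| <= B / 2 ^+ n) -> t <= T ->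
    forall n, `|V n t x - v t x| <= 2 * B / 2 ^+ n.
  by rewrite /v; case: (lim t x) => l /= _ Hl; exact: Hl.
have lv : lbm v.
  split.
    apply: (@measurable_fun_cvg _ _ _ _ (fun n (p : R * R) => V n p.1 p.2)).
      by move=> n; exact: (lV n).1.
    by move=> p _; exact: cv.
  move=> T; have [B HB] := key T; exists (2 * B) => t x tT.
  by have := Hv t x T B HB tT 0%N; rewrite expr0 divr1 /= sub0r normrN.
exists v; split => // t x t0.
have lPv := mPsi _ lv.
have [B HB] := key t; have [C0 HC0] := lPsi t; pose C := `|C0|.
have HC s y l l' : s <= t -> `|Psi s y l - Psi s y l'| <= C * `|l - l'|.
  by move=> st; apply: (le_trans (HC0 _ _ _ _ st)); rewrite ler_wpM2r // ler_norm.
have est n : `|v t x - (heat t f x + duh (fun t x => Psi t x (v t x)) t x)| <=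
    (2 * B + C * (2 * B) * t) / 2 ^+ n.
  have B0 : 0 <= 2 * B.
    by have := Hv t x t B HB (lexx _) 0%N; rewrite expr0 divr1; exact: le_trans.
  have -> : v t x - (heat t f x + duh (fun t x => Psi t x (v t x)) t x) =
     (v t x - V n.+1 t x) + (duh (fun t x => Psi t x (V n t x)) t x - duh (fun t x => Psi t x (v t x)) t x).
    by rewrite VS; move: (v t x) (heat _ _ _) (duh _ _ _) (duh _ _ _) => p q r r'; ring.
  apply: (le_trans (ler_normD _ _)); rewrite mulrDl; apply: lerD.
    rewrite distrC; apply: (le_trans (Hv t x t B HB (lexx _) n.+1)).
    by rewrite ler_wpM2l // lef_pV2 ?posrE ?exprn_gt0 // ler_eXn2l // ltr1n.
  rewrite -duhB // mulrAC; have lD := lbmB (lP n) lPv.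
  rewrite -[X in _ <= X * _]mulrA.
  apply: tint_abs_cst => //; first exact: (tbd_duh0 t x lD).1.
  move=> s /andP[s0 st]; apply: heat_abs; first exact: (lbm_bmf (t - s) lD).1.
  have tst : t - s <= t by rewrite lerBlDr lerDl.
  move=> y; apply: (le_trans (HC _ _ _ _ tst)); apply: ler_wpM2l; first exact: normr_ge0.
  exact: (Hv (t - s) y t B HB tst n).
apply/eqP; rewrite -subr_eq0 -normr_le0; exact: le_geom0 est.
Qed.

End Solve.

(** * Measurability of functions of Caratheodory type *)

Section Caratheodory.
Variable R : realType.
Import HBNNSimple.

(** [l] is approximated by simple functions; for these the composition is measurable value by value,
    and the local Lipschitz bound in [q] gives pointwise convergence. *)
Lemma measurable_caratheodory d (T : measurableType d) (G : T -> R -> R) (K : T -> R) (l : T -> R) :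
  (forall q : R, 0 <= q -> measurable_fun setT (fun p => G p q)) ->
  (forall p q q', 0 <= q -> 0 <= q' -> `|G p q - G p q'| <= K p * (q + q') * `|q - q'|) ->
  measurable_fun setT l -> (forall p, 0 <= l p) ->
  measurable_fun setT (fun p => G p (l p)).
Proof.
move=> mG cG ml l0.
have mEl : measurable_fun setT (EFin \o l) by exact/measurable_EFinP.
pose s := nnsfun_approx measurableT mEl.
have sl p : s n p @[n --> \oo] --> l p.
  have /= := @cvg_nnsfun_approx _ _ _ _ measurableT _ mEl (fun x _ => l0 x) p I.
  by move/fine_cvgP => [_].
apply: (@measurable_fun_cvg _ _ _ _ (fun n p => G p (s n p))).
  move=> n _ B mB; rewrite setTI.
  have -> : (fun p => G p (s n p)) @^-1` B =
      \bigcup_(r in range (s n)) ((s n @^-1` [set r]) `&` ((fun p => G p r) @^-1` B)).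
    apply/seteqP; split => p /=.
      by move=> Bp; exists (s n p) => //; exists p.
    by move=> [r _ [/= -> Br]].
  apply: fin_bigcup_measurable; first exact: fimfunP.
  move=> r [p _ rp]; apply: measurableI; first exact: measurable_funPTI.
  have r0 : 0 <= r by rewrite -rp; exact: fun_ge0.
  by have := mG r r0 measurableT B mB; rewrite setTI.
move=> p _; apply/cvgrPdist_le => e e0.
have s0 n : 0 <= s n p by exact: fun_ge0.
have : (`|K p| * (l p + s n p) * `|l p - s n p|) @[n --> \oo] --> `|K p| * (l p + l p) * `|l p - l p|.
  apply: cvgM; first by apply: cvgMr; apply: cvgD => //; exact: cvg_cst.
  by apply: cvg_norm; apply: cvgB => //; exact: cvg_cst.
rewrite subrr normr0 mulr0 => /cvgrPdist_le /(_ _ e0).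
apply: filterS => n; rewrite sub0r normrN => sn.
apply: (le_trans (cG _ _ _ (l0 p) (s0 n))); apply: le_trans sn.
apply: le_trans (ler_norm _); rewrite !ler_wpM2r ?addr_ge0 ?ler_norm //.
Qed.

End Caratheodory.

(** * The nonlinear part of the branching mechanism *)

Section Branching.
Variable R : realType.
Import HBNNSimple.
Notation meas := {measure set R -> \bar R}.

Lemma Cc_bounded (f : R -> R) : continuous f -> compact_supp f -> exists2 K : R, 0 <= K & forall x, `|f x| <= K.
Proof.
move=> cf [M0 fM0]; pose M := `|M0|.
have fM x : M < `|x| -> f x = 0 by move=> h; apply: fM0; apply: le_lt_trans h; exact: ler_norm.
have MM : - M <= M by rewrite ge0_cp // normr_ge0.
have cnf : {within `[- M, M], continuous (fun x => `|f x|)}.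
  by apply: continuous_subspaceT => x; apply: cvg_norm; exact: cf.
have [c _ cmax] := EVT_max MM cnf.
exists `|f c| => // x; have [xM|xM] := leP `|x| M.
  by apply: cmax; rewrite in_itv /= -ler_norml.
by rewrite fM ?normr0.
Qed.

Definition levy (l u : R) := expR (- (l * u)) - 1 + l * u.

Lemma levy_ge0 l u : 0 <= levy l u.
Proof. by rewrite /levy; have := expR_ge1Dx (- (l * u)); lra. Qed.

Lemma expRN_le (a : R) : 0 <= a -> expR (- a) <= (1 + a)^-1.
Proof.
move=> a0; rewrite expRN lef_pV2 ?posrE ?expR_gt0 ?expR_ge1Dx //; lra.
Qed.

Lemma levy_le l u : 0 <= l -> 0 <= u -> levy l u <= l ^+ 2 * u ^+ 2.
Proof.
move=> l0 u0; rewrite -exprMn /levy; have a0 : 0 <= l * u by exact: mulr_ge0.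
move: (l * u) a0 => a a0; have := expRN_le a0.
suff : (1 + a)^-1 - 1 + a <= a ^+ 2 by lra.
have a1 : 0 < 1 + a by lra.
have -> : (1 + a)^-1 - 1 + a = a ^+ 2 / (1 + a) by field; exact: lt0r_neq0.
rewrite ler_pdivrMr // ler_peMr ?sqr_ge0 //; lra.
Qed.

(** The derivative in [l] is [u (1 - e^{-l u})], between 0 and [l u^2]. The proof is algebraic, in
    the variables [a = (l - l') u] and [b = l' u]. *)
Lemma levy_lip l l' u : 0 <= l' -> l' <= l -> 0 <= u ->
  0 <= levy l u - levy l' u <= (l - l') * l * u ^+ 2.
Proof.
move=> l0 ll u0; rewrite /levy.
have E : expR (- (l * u)) = expR (- (l' * u)) * expR (- ((l - l') * u)).
  by rewrite -expRD; congr expR; ring.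
have -> : (l - l') * l * u ^+ 2 = (l - l') * u * ((l - l') * u + l' * u) by ring.
have -> : expR (- (l * u)) - 1 + l * u - (expR (- (l' * u)) - 1 + l' * u) =
    expR (- (l' * u)) * (expR (- ((l - l') * u)) - 1) + (l - l') * u by rewrite E; ring.
have a0 : 0 <= (l - l') * u by rewrite mulr_ge0 // subr_ge0.
have b0 : 0 <= l' * u by rewrite mulr_ge0.
move: ((l - l') * u) (l' * u) a0 b0 => a b a0 b0.
have e1 := expR_ge1Dx (- a); have e2 := expR_ge1Dx (- b); have e3 := expRN_le a0.
have e4 : expR (- b) <= 1 by rewrite -expR0 ler_expR oppr_le0.
have e5 := expR_gt0 (- b).
have e6 : (1 + a)^-1 <= 1 - a / (1 + a).
  by rewrite le_eqVlt; apply/orP; left; apply/eqP; field; apply: lt0r_neq0; lra.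
have e7 : a * (1 - a) <= a / (1 + a).
  rewrite ler_wpM2l // -[leRHS]mul1r ler_pdivlMr; [nra|lra].
move: (expR (- a)) (expR (- b)) (a / (1 + a)) (1 + a)^-1 e1 e2 e3 e4 e5 e6 e7 => x y z w e1 e2 e3 e4 e5 e6 e7.
apply/andP; split; first by nra.
have : y * (x - 1) <= y * (- (a * (1 - a))) by apply: ler_wpM2l; [exact: ltW|lra].
have : 0 <= a * (b + y - 1) by apply: mulr_ge0; lra.
have : 0 <= (1 - y) * a ^+ 2 by apply: mulr_ge0; [lra|exact: sqr_ge0].
rewrite !expr2; nra.
Qed.

Lemma measurable_levy l : measurable_fun setT (levy l).
Proof.
apply: measurable_funD; last exact: measurable_funM.
by apply: measurable_funB => //; apply: measurableT_comp => //; apply: measurableT_comp.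
Qed.

Variables (alpha : R -> R) (pik : R -> meas).
Hypotheses (acont : continuous alpha) (asupp : compact_supp alpha) (a0 : forall x, 0 <= alpha x).
Hypothesis pmeas : forall A, measurable A -> measurable_fun setT (fun x : R => (pik x A : \bar R)).
Hypothesis pik0 : forall x, pik x `]-oo, 0]%classic = 0%E.
Hypothesis pint : forall x, (\int[pik x]_(u in setT) ((u ^+ 2)%:E) < +oo)%E.
Hypothesis pcont : continuous (fun x => \int[pik x]_(u in setT) u ^+ 2).
Hypothesis psupp : compact_supp (fun x => \int[pik x]_(u in setT) u ^+ 2).

(** [pik x] does not charge the half-line up to 0, so jump integrals are taken over the positive
    half-line, where the bounds on [levy] hold. *)
Let D : set R := `]0, +oo[%classic.
Let mD : measurable D. Proof. exact: measurable_itv. Qed.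

Let mom x : R := \int[pik x]_(u in D) u ^+ 2.

Let compD : setT `\` `]-oo, 0]%classic = D.
Proof.
apply/seteqP; split => x; rewrite /D /= !in_itv /= ?andbT.
  by case: (ltP 0 x) => // x0 [_ []].
by move=> x0; split => // x1; move: (lt_le_trans x0 x1); rewrite ltxx.
Qed.

Let setT_D x (f : R -> R) : measurable_fun setT f -> (forall u, 0 <= f u) ->
  (\int[pik x]_u (f u)%:E = \int[pik x]_(u in D) (f u)%:E)%E.
Proof.
move=> mf f0; rewrite (@ge0_negligible_integral _ _ _ (pik x) setT `]-oo, 0]%classic) //.
- by rewrite compD.
- exact/measurable_EFinP.
- by move=> u _; rewrite lee_fin.
Qed.

Let msq : measurable_fun setT (fun u : R => u ^+ 2).
Proof. exact: measurable_funX. Qed.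

Let momE x : mom x = \int[pik x]_u u ^+ 2.
Proof. by rewrite /mom /Rintegral setT_D // => u; exact: sqr_ge0. Qed.

Let isq x : (pik x).-integrable D (EFin \o (fun u => u ^+ 2)).
Proof.
apply/integrableP; split; first by apply/measurable_EFinP; exact: measurable_funTS.
have := pint x; rewrite setT_D //; last by move=> u; exact: sqr_ge0.
by under eq_integral do rewrite -[(_ ^+ 2)%:E]gee0_abs ?lee_fin ?sqr_ge0 //.
Qed.

Let mom_ge0 x : 0 <= mom x.
Proof. by apply: Rintegral_ge0 => u _; exact: sqr_ge0. Qed.

Definition levy_int x l := \int[pik x]_u levy l u.

Let levy_intE x l : levy_int x l = \int[pik x]_(u in D) levy l u.
Proof. by rewrite /levy_int /Rintegral setT_D //; [exact: measurable_levy|exact: levy_ge0]. Qed.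

Let ilevy x l : 0 <= l -> (pik x).-integrable D (EFin \o levy l).
Proof.
move=> l0; apply: (@integrable_le _ _ _ (pik x) D _ (fun u => l ^+ 2 * u ^+ 2)) => //.
- by apply: measurable_funTS; exact: measurable_levy.
- exact: integrable_scale.
- move=> u; rewrite /D /= in_itv /= andbT => u0.
  by rewrite ger0_norm ?levy_ge0 // levy_le // ltW.
Qed.

Lemma levy_int_lip x l l' : 0 <= l -> 0 <= l' ->
  `|levy_int x l - levy_int x l'| <= mom x * (l + l') * `|l - l'|.
Proof.
wlog ll : l l' / l' <= l => [H|] l0 l'0.
  have [h|h] := leP l' l; first exact: H.
  by rewrite distrC [l + l']addrC [`|l - l'|]distrC; apply: H => //; exact: ltW.
rewrite !levy_intE -RintegralB //; try exact: ilevy.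
apply: (@le_trans _ _ (\int[pik x]_(u in D) ((l - l') * l * u ^+ 2))).
  apply: Rint_abs_le => //.
  - by apply: measurable_funB; apply: measurable_funTS; exact: measurable_levy.
  - exact: integrable_scale.
  - move=> u; rewrite /D /= in_itv /= andbT => /ltW u0.
    by have /andP[h1 h2] := levy_lip l'0 ll u0; rewrite ger0_norm.
rewrite RintegralZl // -/(mom x) (ger0_norm (_ : 0 <= l - l')) ?subr_ge0 //.
have := mom_ge0 x; move: (mom x) => m m0.
have : 0 <= m * (l' * (l - l')) by rewrite !mulr_ge0 // subr_ge0.
by nra.
Qed.

Lemma levy_int0 x : levy_int x 0 = 0.
Proof.
rewrite levy_intE /levy; under eq_Rintegral do rewrite !mul0r oppr0 expR0 subrr addr0.
by rewrite /Rintegral integral0.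
Qed.

Lemma levy_int_ge0 x l : 0 <= levy_int x l.
Proof. by apply: Rintegral_ge0 => u _; exact: levy_ge0. Qed.

(** What remains of [psi] without its linear term [- beta x * l]. *)
Definition nlin x l := alpha x * l ^+ 2 + levy_int x l.

Lemma nlin_ge0 x l : 0 <= nlin x l.
Proof. by apply: addr_ge0; [exact: mulr_ge0 (a0 _) (sqr_ge0 _)|exact: levy_int_ge0]. Qed.

Lemma nlin0 x : nlin x 0 = 0.
Proof. by rewrite /nlin levy_int0 expr0n mulr0 addr0. Qed.

Lemma nlin_lip : exists2 K : R, 0 <= K & forall x l l', 0 <= l -> 0 <= l' ->
  `|nlin x l - nlin x l'| <= K * (l + l') * `|l - l'|.
Proof.
have [K1 K10 HK1] := Cc_bounded acont asupp; have [K2 K20 HK2] := Cc_bounded pcont psupp.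
exists (K1 + K2); first exact: addr_ge0.
move=> x l l' l0 l'0; rewrite /nlin.
have -> : alpha x * l ^+ 2 + levy_int x l - (alpha x * l' ^+ 2 + levy_int x l') =
   alpha x * (l + l') * (l - l') + (levy_int x l - levy_int x l') by ring.
apply: (le_trans (ler_normD _ _)).
have -> : (K1 + K2) * (l + l') * `|l - l'| = K1 * (l + l') * `|l - l'| + K2 * (l + l') * `|l - l'|.
  by ring.
apply: lerD.
  by rewrite !normrM (ger0_norm (addr_ge0 l0 l'0)) !ler_wpM2r ?addr_ge0.
apply: (le_trans (levy_int_lip x l0 l'0)); rewrite !ler_wpM2r ?addr_ge0 // momE.
by have := HK2 x; apply: le_trans; exact: ler_norm.
Qed.

(** The two facts that make the nonlinearity a perturbation: it is of second order, and it vanishes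
    outside a fixed compact set, where both [alpha] and the second moment of [pik x] are 0. *)
Lemma nlin_le : exists2 K : R, 0 <= K & exists2 M : R, 0 <= M &
  forall x l, 0 <= l -> nlin x l <= K * l ^+ 2 /\ (M < `|x| -> nlin x l = 0).
Proof.
have [K K0 HK] := nlin_lip; exists K => //.
have [M1 HM1] := asupp; have [M2 HM2] := psupp.
exists (`|M1| + `|M2|); first exact: addr_ge0.
move=> x l l0; split.
  have := HK x l 0 l0 (lexx _); rewrite nlin0 !subr0 addr0 (ger0_norm (nlin_ge0 _ _)) (ger0_norm l0).
  by rewrite -mulrA -expr2.
move=> xM; have h1 : M1 < `|x|.
  by apply: le_lt_trans xM; have := ler_norm M1; have := normr_ge0 M2; lra.
have h2 : M2 < `|x|.
  by apply: le_lt_trans xM; have := ler_norm M2; have := normr_ge0 M1; lra.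
rewrite /nlin HM1 // mul0r add0r.
have := levy_int_lip x l0 (lexx 0); rewrite levy_int0 momE HM2 // !mul0r !subr0.
by move=> h; apply/eqP; rewrite -normr_le0.
Qed.

(** For a fixed second argument, measurability in [x] comes from that of the kernel through simple
    functions; the Lipschitz bound then allows a measurable second argument. *)
Lemma measurable_nlin d (T : measurableType d) (a l : T -> R) :
  measurable_fun setT a -> measurable_fun setT l -> (forall p, 0 <= l p) ->
  measurable_fun setT (fun p => nlin (a p) (l p)).
Proof.
move=> ma ml l0; apply: measurable_funD.
  apply: measurable_funM; last exact: measurable_funX.
  by apply: measurableT_comp => //; exact: continuous_measurable_fun.
apply: (@measurable_caratheodory R _ T (fun p q => levy_int (a p) q) (fun p => mom (a p))) => //.
  move=> q q0; apply: (measurableT_comp (f := fun x => levy_int x q)) => //.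
  apply: measurableT_comp => //=.
  have mE : measurable_fun setT (EFin \o levy q) by apply/measurable_EFinP; exact: measurable_levy.
  apply: (@measurable_fun_preimage_integral _ _ R R R _ (nnsfun_approx measurableT mE)).
  - by move=> m n mn; exact: nd_nnsfun_approx.
  - by move=> z _; apply: cvg_nnsfun_approx => // u _; rewrite lee_fin levy_ge0.
  - by move=> n r; apply: pmeas; exact: measurable_funPTI.
by move=> p q q' q0 q'0; exact: levy_int_lip.
Qed.

End Branching.

(** * Existence of mild solutions *)

Section Nonlinear.
Variable R : realType.
Notation meas := {measure set R -> \bar R}.
Variables (beta alpha : R -> R) (pik : R -> meas).
Hypotheses (bcont : continuous beta) (bsupp : compact_supp beta).
Hypotheses (acont : continuous alpha) (asupp : compact_supp alpha) (a0 : forall x, 0 <= alpha x).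
Hypothesis pmeas : forall A, measurable A -> measurable_fun setT (fun x : R => (pik x A : \bar R)).
Hypothesis pik0 : forall x, pik x `]-oo, 0]%classic = 0%E.
Hypothesis pint : forall x, (\int[pik x]_(u in setT) ((u ^+ 2)%:E) < +oo)%E.
Hypothesis pcont : continuous (fun x => \int[pik x]_(u in setT) u ^+ 2).
Hypothesis psupp : compact_supp (fun x => \int[pik x]_(u in setT) u ^+ 2).

Lemma clamp_lip (M l l' : R) : 0 <= M ->
  `|Num.max 0 (Num.min l M) - Num.max 0 (Num.min l' M)| <= `|l - l'|.
Proof.
move=> M0; wlog ll : l l' / l' <= l => [H|].
  by have [h|/ltW h] := leP l' l; [exact: H|rewrite distrC (distrC l); exact: H].
have ll' : 0 <= l - l' by rewrite subr_ge0.
rewrite (ger0_norm ll').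
have [h1|/ltW h1] := leP l M; have [h2|/ltW h2] := leP l' M; rewrite ?(max_r M0).
- by have [h3|/ltW h3] := leP 0 l; have [h4|/ltW h4] := leP 0 l'; rewrite ler_norml; apply/andP; split; lra.
- by have [h3|/ltW h3] := leP 0 l; rewrite ler_norml; apply/andP; split; lra.
- by have [h4|/ltW h4] := leP 0 l'; rewrite ler_norml; apply/andP; split; lra.
- by rewrite subrr normr0.
Qed.

Let nl := nlin alpha pik.

Lemma psi_nlin x l : psi beta alpha pik x l = - beta x * l + nlin alpha pik x l.
Proof. by rewrite /psi /nlin addrA. Qed.

(** Picard iteration needs a globally Lipschitz source, so the argument of the nonlinearity is
    clamped to [[0, L t]]; the solution is then shown to stay in this range, where the clamp is the
    identity. *)
Lemma mild_exists f : bmf f -> (forall x, 0 <= f x) ->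
  exists u, [/\ mild_solution beta alpha pik f u, lbm u, (forall t x, 0 <= t -> 0 <= u t x) &
    is_sol f (fun t x => beta x * u t x - nlin alpha pik x (u t x)) u].
Proof.
move=> bf f0; have [mf [L0 fL0]] := bf.
have L00 : 0 <= L0 by exact: le_trans (normr_ge0 _) (fL0 0).
have [B0 B00 HB0] := Cc_bounded bcont bsupp.
pose B := B0 + 1; have B1 : 0 < B by rewrite /B; lra.
have HB x : `|beta x| <= B by apply: (le_trans (HB0 x)); rewrite /B; lra.
have [K K0 HK] := nlin_lip acont asupp pik0 pint pcont psupp.
have nl0 := nlin0 alpha pik0.
(* For [t >= 0], [L] solves the linear equation with the constant potential [B >= |beta|] and
   initial value [L0]; as the nonlinear term only lowers the source, [L] will bound the solution.
   The [max] keeps [L] constant at negative times. *)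
pose L t := L0 * expR (B * Num.max t 0).
have LL s t : s <= t -> L s <= L t.
  move=> st; rewrite /L ler_wpM2l // ler_expR ler_wpM2l ?(ltW B1) //.
  by rewrite ge_max !le_max st lexx !orbT.
have Lge0 t : 0 <= L t by rewrite /L mulr_ge0 ?expR_ge0.
pose clamp t l := Num.max 0 (Num.min l (L t)).
have cl0 t l : 0 <= clamp t l by rewrite /clamp le_max lexx.
have clL t l : clamp t l <= L t by rewrite /clamp ge_max Lge0 ge_min lexx orbT.
have cln t l : l <= 0 -> clamp t l = 0.
  by move=> l0; rewrite /clamp max_l // ge_min l0.
have clid t l : 0 <= l -> l <= L t -> clamp t l = l.
  by move=> l0 lL; rewrite /clamp min_l // max_r.
have clabs t l : clamp t l <= `|l|.
  by rewrite /clamp ge_max normr_ge0 ge_min ler_norm.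
have cllip t l l' : `|clamp t l - clamp t l'| <= `|l - l'|.
  exact: clamp_lip.
pose Psi t x l := beta x * clamp t l - nl x (clamp t l).
have Psilip T : exists2 C, 0 <= C & forall t x l l', t <= T -> `|Psi t x l - Psi t x l'| <= C * `|l - l'|.
  exists (B + K * (L T + L T)).
    by rewrite addr_ge0 ?mulr_ge0 ?addr_ge0 ?(ltW B1).
  move=> t x l l' tT; rewrite /Psi.
  have -> : beta x * clamp t l - nl x (clamp t l) - (beta x * clamp t l' - nl x (clamp t l')) =
    beta x * (clamp t l - clamp t l') - (nl x (clamp t l) - nl x (clamp t l')) by ring.
  apply: (le_trans (ler_normB _ _)); rewrite mulrDl normrM; apply: lerD.
    by apply: ler_pM.
  apply: (le_trans (HK _ _ _ (cl0 t l) (cl0 t l'))).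
  apply: ler_pM => //; first by rewrite mulr_ge0 ?addr_ge0.
  rewrite ler_wpM2l // lerD //; exact: le_trans (clL _ _) (LL _ _ tT).
have Psi0 t x : Psi t x 0 = 0 by rewrite /Psi cln // mulr0 /nl nl0 subrr.
have mL : measurable_fun setT (fun p : R * R => L p.1).
  apply: measurable_funM => //; apply: measurableT_comp => //; apply: measurable_funM => //.
  by apply: measurable_maxr.
have mbeta : measurable_fun setT beta by exact: continuous_measurable_fun.
have lPsi v : lbm v -> lbm (fun t x => Psi t x (v t x)).
  move=> [mv bv].
  have mc : measurable_fun setT (fun p : R * R => clamp p.1 (v p.1 p.2)).
    by apply: measurable_maxr => //; exact: measurable_minr.
  split.
    apply: measurable_funB.
      by apply: measurable_funM => //; exact: measurableT_comp.
    apply: (@measurable_nlin R alpha pik acont pmeas pik0 pint _ (R * R)%type snd) => //.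
  move=> T; have [C C0 HC] := Psilip T; have [M HM] := bv T; exists (C * M) => t x tT.
  have := HC t x (v t x) 0 tT; rewrite Psi0 !subr0 => /le_trans; apply.
  by rewrite ler_wpM2l // HM.
have Psilip' T : exists C : R, forall t x l l', t <= T -> `|Psi t x l - Psi t x l'| <= C * `|l - l'|.
  by have [C _ HC] := Psilip T; exists C.
have [u [lu su]] := picard bf lPsi Psilip'.
have [mu bu] := lu.
have u0 t x : 0 <= t -> 0 <= u t x.
  (* The clamped source is rewritten as [c * u] with a bounded coefficient, to which [sol_ge0]
     applies. The reciprocal of [u] is written [exp (- ln u)] for measurability; [c] may be 0 where
     [u <= 0], because [Psi] vanishes there. *)
  pose c t x := if 0 < u t x then Psi t x (u t x) * expR (- ln (u t x)) else 0.
  have invE s y : 0 < u s y -> expR (- ln (u s y)) = (u s y)^-1 by move=> h; rewrite expRN lnK.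
  have cE s y : c s y * u s y + 0 = Psi s y (u s y).
    rewrite addr0 /c; case: ltP => h; first by rewrite invE // divfK // lt0r_neq0.
    by rewrite mul0r /Psi cln // mulr0 /nl nl0 subrr.
  apply: (sol_ge0 (f := f) (c := c) (g := fun _ _ => 0) bf f0 _ _ lu); last first.
  - by apply: (sol_eq su) => s y _; rewrite cE.
  - by [].
  - exact: lbm_cst.
  split.
    apply: measurable_fun_ifT; first exact: measurable_fun_ltr.
      apply: measurable_funM; first exact: (lPsi u lu).1.
      by apply: measurableT_comp => //; apply: measurableT_comp => //; apply: measurableT_comp.
    exact: measurable_cst.
  move=> T; have [C C0 HC] := Psilip T; exists C => s y sT; rewrite /c.
  case: ltP => h; last by rewrite normr0.
  rewrite invE // normrM normfV (gtr0_norm h) ler_pdivrMr //.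
  by have := HC s y (u s y) 0 sT; rewrite Psi0 !subr0 (gtr0_norm h).
have uL t x : 0 <= t -> u t x <= L t.
  move=> t0; rewrite su //.
  have lP := lPsi u lu.
  have te : tbd t (fun s => expR (B * (t - s))) by exact: tbd_rev (tbd_expR t B).
  have E : L t = L0 + tint t (fun s => B * L0 * expR (B * (t - s))).
    rewrite tintZ // (tint_rev t (tbd_expR t B).1) tint_expR ?lt0r_neq0 // /L max_l //.
    by field; exact: lt0r_neq0.
  rewrite E; apply: lerD.
    by apply: (le_trans (ler_norm _)); exact: heat_abs.
  apply: duh_le_tint => //; first by apply: tbdM => //; exact: tbd_cst.
  move=> s y /andP[s0 st]; rewrite /Psi.
  have ts0 : 0 <= t - s by rewrite subr_ge0.
  have h1 : beta y * clamp (t - s) (u (t - s) y) <= B * L0 * expR (B * (t - s)).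
    have := clL (t - s) (u (t - s) y); rewrite /L max_l // -mulrA => h.
    apply: (@le_trans _ _ (B * clamp (t - s) (u (t - s) y))); last by rewrite ler_wpM2l ?(ltW B1).
    by rewrite ler_wpM2r //; exact: le_trans (ler_norm _) (HB y).
  have h2 : 0 <= nl y (clamp (t - s) (u (t - s) y)) by exact: nlin_ge0.
  by rewrite lerBlDr (le_trans h1) // lerDl.
have PsiE t x : 0 <= t -> Psi t x (u t x) = beta x * u t x - nlin alpha pik x (u t x).
  by move=> t0; rewrite /Psi clid ?u0 ?uL.
have su' : is_sol f (fun t x => beta x * u t x - nlin alpha pik x (u t x)) u.
  by apply: (sol_eq su) => s y s0; exact: PsiE.
exists u; split => //; split => //; split => //; split.
  move=> T; have [M HM] := bu T; exists M => t x /andP[_ tT].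
  exact: le_trans (ler_norm _) (HM _ _ tT).
move=> t x t0; have lP := lPsi u lu.
have E s : 0 <= s <= t -> bm_sg s (fun y => psi beta alpha pik y (u (t - s) y)) x =
    - heat s (fun y => Psi (t - s) y (u (t - s) y)) x.
  move=> /andP[s0 st]; have ts0 : 0 <= t - s by rewrite subr_ge0.
  have -> : (fun y => psi beta alpha pik y (u (t - s) y)) = (fun y => - Psi (t - s) y (u (t - s) y)).
    by apply/funext => y; rewrite psi_nlin PsiE // opprB mulNr addrC.
  have bP := lbm_bmf (t - s) lP.
  by rewrite bm_sg_heat; [exact: heatN|exact: bmfN].
have E2 : tint t (fun s => bm_sg s (fun y => psi beta alpha pik y (u (t - s) y)) x) =
    - duh (fun t x => Psi t x (u t x)) t x.
  by rewrite (eq_tint E) tintN //; exact: (tbd_duh0 t x lP).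
have E3 := su t x t0.
change (u t x = bm_sg t f x - tint t (fun s => bm_sg s (fun y => psi beta alpha pik y (u (t - s) y)) x)).
by rewrite E2 opprK E3 (bm_sg_heat _ _ bf).
Qed.

End Nonlinear.

(** Compactness of a segment with radii varying with the centre. It yields the uniform modulus of a
    test function and, later, finitely many test functions for a vaguely continuous functional. *)
Lemma finite_ball_cover (R : realType) (a b : R) (r : R -> R) : (forall x, 0 < r x) ->
  exists s : seq R, forall x, a <= x <= b -> exists2 c, c \in s & `|x - c| < r c.
Proof.
move=> r0; have := @segment_compact R a b; rewrite compact_cover.
move=> /(_ R setT (fun c => ball c (r c))) [].
- by move=> c _; exact: ball_open.
- by move=> x _; exists x => //; exact: ballxx.
move=> D _ DD; exists (finmap.enum_fset D) => x xab.
have [|c cD] := DD x; first by rewrite /= in_itv.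
by rewrite /ball /= distrC => xc; exists c.
Qed.

(** * Uniform moduli of continuity and derivative comparisons *)

Section Modulus.
Variable R : realType.

(** Uniform continuity in a form that can be integrated against a Gaussian: the quadratic term
    contributes order [s] after a time [s]. *)
Definition unif_modulus (f : R -> R) := forall e : R, 0 < e ->
  exists2 C : R, 0 <= C & forall x y, `|f (x + y) - f x| <= e + C * y ^+ 2.

(** A displacement below the radius of a covering ball is handled by continuity at its centre, a
    larger one by [2 K <= (2 K / r^2) y^2]. The constant [C] sums these coefficients over the finite
    cover. *)
Lemma Cc_unif_modulus (f : R -> R) : continuous f -> compact_supp f -> unif_modulus f.
Proof.
move=> cf sf e e0; have [K K0 fK] := Cc_bounded cf sf; have [M fM] := sf.
have /choice [r Hr] : forall c : R, exists r : R, 0 < r /\ forall x, `|x - c| < 2 * r -> `|f x - f c| < e / 2.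
  move=> c; have /cvgrPdist_lt /(_ (e / 2)) := cf c.
  move=> /(_ (divr_gt0 e0 (ltr0n _ 2))) [r /= r0 Hr]; exists (r / 2); split; first by rewrite divr_gt0.
  move=> x xc; rewrite distrC; apply: Hr; rewrite /= distrC; apply: lt_le_trans xc _; lra.
have r0 c : 0 < r c by have [] := Hr c.
have [s Hs] := finite_ball_cover (- `|M|) `|M| r0.
pose C := \sum_(c <- s) 2 * K / r c ^+ 2.
have t0 c : 0 <= 2 * K / r c ^+ 2 by rewrite divr_ge0 ?sqr_ge0 // mulr_ge0.
have C0 : 0 <= C by apply: sumr_ge0.
have main x y : `|x| <= `|M| -> `|f (x + y) - f x| <= e + C * y ^+ 2.
  move=> xM; have [|c cs xc] := Hs x; first by rewrite -ler_norml.
  have [yr|yr] := ltP `|y| (r c).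
    have h1 : `|f (x + y) - f c| < e / 2.
      apply: (Hr c).2; have := ler_normD (x - c) y; rewrite (_ : x - c + y = x + y - c); last by ring.
      lra.
    have h2 : `|f x - f c| < e / 2 by apply: (Hr c).2; have := r0 c; lra.
    have := ler_normB (f (x + y) - f c) (f x - f c).
    rewrite (_ : f (x + y) - f c - (f x - f c) = f (x + y) - f x); last by ring.
    have : 0 <= C * y ^+ 2 by rewrite mulr_ge0 ?sqr_ge0.
    lra.
  have h1 : 2 * K <= C * y ^+ 2.
    apply: (@le_trans _ _ (2 * K / r c ^+ 2 * y ^+ 2)).
      have [rn yn] : r c != 0 /\ 0 < r c ^+ 2 by rewrite lt0r_neq0 // exprn_gt0.
      rewrite mulrAC ler_pdivlMr // ler_wpM2l ?mulr_ge0 //.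
      by rewrite -(real_normK (num_real y)) ler_sqr ?nnegrE ?(ltW (r0 c)).
    rewrite ler_wpM2r ?sqr_ge0 // /C (big_rem c) //= lerDl; exact: sumr_ge0.
  have := ler_normB (f (x + y)) (f x); have := fK (x + y); have := fK x; lra.
exists C => // x y; have [xM|xM] := leP `|x| `|M|; first exact: main.
have [xyM|xyM] := leP `|x + y| `|M|.
  by have := main (x + y) (- y) xyM; rewrite addrK sqrrN distrC.
rewrite !fM ?subrr ?normr0; last 2 first.
- by apply: le_lt_trans xM; exact: ler_norm.
- by apply: le_lt_trans xyM; exact: ler_norm.
by rewrite addr_ge0 ?(ltW e0) // mulr_ge0 ?sqr_ge0.
Qed.

Lemma unif_modulusB (f g : R -> R) : unif_modulus f -> unif_modulus g -> unif_modulus (fun x => f x - g x).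
Proof.
move=> uf ug e e0; have e2 : 0 < e / 2 by rewrite divr_gt0.
have [C C0 HC] := uf _ e2; have [D D0 HD] := ug _ e2.
exists (C + D) => [|x y]; first exact: addr_ge0.
have := ler_normB (f (x + y) - f x) (g (x + y) - g x); have := HC x y; have := HD x y.
rewrite (_ : f (x + y) - f x - (g (x + y) - g x) = f (x + y) - g (x + y) - (f x - g x)); last by ring.
lra.
Qed.

(** Young's inequality [L |y| <= e + L^2 y^2 / e]. *)
Lemma lip_unif_modulus (f : R -> R) (L : R) : 0 <= L -> (forall x y, `|f (x + y) - f x| <= L * `|y|) -> unif_modulus f.
Proof.
move=> L0 fL e e0; exists (L ^+ 2 / e) => [|x y]; first by rewrite divr_ge0 ?sqr_ge0 ?ltW.
apply: (le_trans (fL x y)); rewrite -(real_normK (num_real y)).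
have := normr_ge0 y; move: `|y| => a a0.
have en : e != 0 by exact: lt0r_neq0.
have -> : L ^+ 2 / e * a ^+ 2 = e * ((L * a) / e) ^+ 2 by field.
have -> : L * a = e * (L * a / e) by field.
have : 0 <= L * a / e by rewrite divr_ge0 ?mulr_ge0 // ltW.
move: (L * a / e) => b b0; have -> : e * b / e = b by field.
have := sqr_ge0 (b - 1); rewrite !expr2 => h.
have : 0 <= e * (1 + b * b - b) by apply: mulr_ge0; [exact: ltW|nra].
lra.
Qed.

Lemma le_of_derive (f df : R -> R) : (forall x : R, is_derive x 1 f (df x)) ->
  (forall x, 0 <= x -> 0 <= df x) -> forall y, 0 <= y -> f 0 <= f y.
Proof.
move=> Hf df0 y y0.
have cf : {within `[0, y], continuous f}.
  apply: continuous_subspaceT => x; apply: differentiable_continuous.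
  by apply/derivable1_diffP; have [] := Hf x.
have [c] := MVT_segment y0 (fun x _ => Hf x) cf.
rewrite in_itv /= => /andP[c0 _] E.
by rewrite -subr_ge0 E subr0 mulr_ge0 // df0.
Qed.

Lemma le_of_derive2 (f df ddf : R -> R) : (forall x : R, is_derive x 1 f (df x)) ->
  (forall x : R, is_derive x 1 df (ddf x)) -> f 0 = 0 -> df 0 = 0 ->
  (forall x, 0 <= x -> 0 <= ddf x) -> forall y, 0 <= y -> 0 <= f y.
Proof.
move=> Hf Hdf f0 df0 ddf0 y y0; rewrite -f0; apply: (le_of_derive Hf) => // x x0.
by rewrite -df0; exact: (le_of_derive Hdf).
Qed.

Lemma is_derive_continuous (f df : R -> R) : (forall x : R, is_derive x 1 f (df x)) -> continuous f.
Proof.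
move=> Hf x; apply: differentiable_continuous.
by apply/derivable1_diffP; have [] := Hf x.
Qed.

Lemma is_derive_affine (f df : R -> R) (a b : R) : (forall x : R, is_derive x 1 f (df x)) ->
  forall x : R, is_derive x 1 (fun y => f (a * y + b)) (a * df (a * x + b)).
Proof.
move=> Hf x.
have Ha : is_derive x (1 : R) (fun y => a * y + b) a.
  by apply: is_derive_eq; rewrite /GRing.scale /= mulr1 addr0.
have := @is_derive1_comp R f (fun y => a * y + b) x (df (a * x + b)) a (Hf _) Ha.
by rewrite mulrC.
Qed.

End Modulus.

(** * Exponential Gaussian integrals *)

Section GaussExp.
Variable R : realType.
Notation leb := (@lebesgue_measure R).

Lemma gauss_expR (a z : R) : expR (a * z) * gauss 1 z = expR (a ^+ 2 / 2) * gauss 1 (z - a).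
Proof.
rewrite /gauss !mulrA -!expRD; congr (expR _ / _); field.
by [].
Qed.

Lemma gauss_expR_integrable (a : R) : leb.-integrable setT (EFin \o (fun z => expR (a * z) * gauss 1 z)).
Proof.
under eq_fun do rewrite gauss_expR.
by apply: integrable_scale => //; exact: gauss_shift_int.
Qed.

Lemma gauss_expR_int (a : R) : \int[leb]_z (expR (a * z) * gauss 1 z) = expR (a ^+ 2 / 2).
Proof.
under eq_Rintegral do rewrite gauss_expR.
by rewrite RintegralZl ?gauss_shift1 ?mulr1 //; exact: gauss_shift_int.
Qed.

(** [2 cosh y - 2], a substitute for [y^2]: it dominates [y^2], its second derivative is itself plus
    2, and its Gaussian integral is explicit. *)
Definition cosh2 (y : R) := expR y + expR (- y) - 2.

Lemma cosh2_integrable (a : R) : leb.-integrable setT (EFin \o (fun z => cosh2 (a * z) * gauss 1 z)).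
Proof.
have -> : EFin \o (fun z => cosh2 (a * z) * gauss 1 z) =
   (fun z => ((expR (a * z) * gauss 1 z)%:E + (expR (- a * z) * gauss 1 z)%:E + ((- 2) * gauss 1 z)%:E)%E).
  by apply/funext => z /=; rewrite -!EFinD -!mulrDl mulNr.
apply: integrableD => //; last by apply: integrable_scale => //; exact: gauss_int.
by apply: integrableD => //; exact: gauss_expR_integrable.
Qed.

Lemma cosh2_int (a : R) : \int[leb]_z (cosh2 (a * z) * gauss 1 z) = 2 * (expR (a ^+ 2 / 2) - 1).
Proof.
have i1 := gauss_expR_integrable a; have i2 := gauss_expR_integrable (- a).
have i3 : leb.-integrable setT (EFin \o (fun z => (- 2) * gauss 1 z)).
  by apply: integrable_scale => //; exact: gauss_int.
transitivity (\int[leb]_z (expR (a * z) * gauss 1 z + expR (- a * z) * gauss 1 z + (- 2) * gauss 1 z)).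
  by apply: eq_Rintegral => z _; rewrite /cosh2 -!mulrDl mulNr.
rewrite RintegralD //; last exact: (integrableD _ i1 i2).
rewrite RintegralD // !gauss_expR_int sqrrN RintegralZl //; last exact: gauss_int.
by rewrite gauss1 //; ring.
Qed.

Lemma is_derive_expRN (x : R) : is_derive x 1 (fun y : R => expR (- y)) (- expR (- x)).
Proof.
have := is_derive_affine (-1) 0 (@is_derive_expR R) x.
rewrite addr0 !mulN1r; congr is_derive.
by apply/funext => y; rewrite addr0 mulN1r.
Qed.

Lemma is_derive_cosh2 (x : R) : is_derive x 1 cosh2 (expR x - expR (- x)).
Proof.
have := is_derive_expRN x => H; rewrite /cosh2.
by apply: is_derive_eq; rewrite subr0.
Qed.

Lemma is_derive_dcosh2 (x : R) : is_derive x 1 (fun y => expR y - expR (- y)) (2 + cosh2 x).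
Proof.
have := is_derive_expRN x => H.
by apply: is_derive_eq; rewrite opprK /cosh2; ring.
Qed.

Lemma cosh2_0 : cosh2 0 = 0.
Proof. by rewrite /cosh2 oppr0 expR0; ring. Qed.

Lemma cosh2_sq (y : R) : y ^+ 2 <= cosh2 y.
Proof.
wlog y0 : y / 0 <= y.
  move=> H; have [/H//|/ltW y0] := leP 0 y.
  have := H (- y); rewrite oppr_ge0 sqrrN /cosh2 opprK => /(_ y0); lra.
have cge x : 0 <= cosh2 x.
  rewrite /cosh2 expRN; have := expR_gt0 x; move: (expR x) => e e0.
  have -> : e + e^-1 - 2 = (e - 1) ^+ 2 / e by field; exact: lt0r_neq0.
  by rewrite divr_ge0 ?sqr_ge0 // ltW.
rewrite -subr_ge0; refine (@le_of_derive2 R (fun y => cosh2 y - y ^+ 2)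
  (fun y => (expR y - expR (- y)) - 2 * y) (fun y => 2 + cosh2 y - 2) _ _ _ _ _ y y0).
- move=> x; have := is_derive_cosh2 x => H; apply: is_derive_eq.
  by rewrite /GRing.scale /=; ring.
- move=> x; have := is_derive_dcosh2 x => H; apply: is_derive_eq.
  by rewrite /GRing.scale /=; ring.
- by rewrite cosh2_0 expr0n subrr.
- by rewrite oppr0 subrr mulr0 subrr.
- by move=> x _; have := cge x; lra.
Qed.

Lemma cosh2_ge0 (y : R) : 0 <= cosh2 y.
Proof. by apply: le_trans (cosh2_sq y); exact: sqr_ge0. Qed.

Lemma cosh2N (y : R) : cosh2 (- y) = cosh2 y.
Proof. by rewrite /cosh2 opprK; ring. Qed.

Lemma cosh2_double (y : R) : cosh2 (2 * y) = cosh2 y ^+ 2 + 4 * cosh2 y.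
Proof.
have -> : 2 * y = y + y by ring.
rewrite /cosh2 !expRN expRD; have := expR_gt0 y.
by move: (expR y) => e e0; field; exact: lt0r_neq0.
Qed.

End GaussExp.

Transparent heat.

(** * Second-order expansion of the heat semigroup *)

Section HeatTaylor.
Variable R : realType.
Notation leb := (@lebesgue_measure R).

Lemma heat_refl (s x : R) (f : R -> R) : measurable_fun setT f ->
  heat s f x = \int[leb]_z (f (x - Num.sqrt s * z) * gauss 1 z).
Proof.
move=> mf; rewrite /heat -[RHS]Rint_opp.
  by apply: eq_Rintegral => z _; rewrite gauss_opp mulrN opprK.
apply: measurable_funM; last exact: measurable_gauss.
by apply: measurableT_comp => //; apply: measurable_funB => //; exact: measurable_funM.
Qed.

(** The modulus at [x] is integrated against the Gaussian with [y^2] replaced by [cosh2 y], whose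
    mean is [2 (e^{s/2} - 1)]. *)
Lemma heat_dev_le (s x e C : R) (f : R -> R) : 0 <= s -> bmf f -> 0 <= C ->
  (forall y, `|f (x + y) - f x| <= e + C * y ^+ 2) ->
  `|heat s f x - f x| <= e + C * (2 * (expR (s / 2) - 1)).
Proof.
move=> s0 bf C0 fe; have bc : bmf (fun=> f x) by exact: bmf_cst.
have q2 : Num.sqrt s ^+ 2 = s by exact: sqr_sqrtr.
rewrite -[X in _ - X](heat_cst s x (f x)) -heatB //.
have i1 := heat_int s x (bmfB bf bc).
have ic := cosh2_integrable (Num.sqrt s).
have ie : leb.-integrable setT (EFin \o (fun z => e * gauss 1 z)) by apply: integrable_scale => //; exact: gauss_int.
have iC := integrable_scale C measurableT ic.
have iD := integrableD measurableT ie iC.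
apply: (@le_trans _ _ (\int[leb]_z (e * gauss 1 z + C * (cosh2 (Num.sqrt s * z) * gauss 1 z)))); last first.
  rewrite RintegralD // RintegralZl ?gauss1 ?mulr1 //; last exact: gauss_int.
  by rewrite RintegralZl // cosh2_int q2.
apply: Rint_abs_le => //.
- by have /integrableP[/measurable_EFinP] := i1.
- move=> z _; rewrite normrM (ger0_norm (gauss_ge0 _ _)) mulrA -mulrDl ler_wpM2r ?gauss_ge0 //.
  by apply: (le_trans (fe _)); rewrite lerD2l ler_wpM2l // cosh2_sq.
Qed.

(* cosh2 y and cosh2 (2 y) dominate the remainder because they do so after two derivatives; their Gaussian
   integrals are explicit. *)
Lemma heat_taylor2 (s x e C : R) (f df g : R -> R) (G : R) : 0 <= s -> bmf f ->
  (forall x : R, is_derive x 1 f (df x)) -> (forall x : R, is_derive x 1 df (2 * g x)) ->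
  0 <= e -> 0 <= C -> `|g x| <= G ->
  (forall y, `|g (x + y) - g x| <= e + C * y ^+ 2) ->
  `|heat s f x - f x - 2 * g x * (expR (s / 2) - 1)| <= 2 * e * (expR (s / 2) - 1) +
     (4 * C + 2 * G) / 12 * ((expR (2 * s) - 1) - 4 * (expR (s / 2) - 1)).
Proof.
move=> s0 bf Hf Hdf e0 C0 gG ge.
have G0 : 0 <= G by exact: le_trans gG.
(* The second derivative of [cosh2 (2 y) - 4 cosh2 y] contains [12 cosh2 y]; times [K] this absorbs
   the coefficient [4 C + 2 G] of [cosh2 y] in the remainder. *)
pose K := (4 * C + 2 * G) / 12; have K0 : 0 <= K by rewrite /K divr_ge0 // addr_ge0 ?mulr_ge0.
(* The symmetric second difference removes the first-order term; since the Gaussian is even, the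
   mean of [q] is [2 (heat s f x - f x)]. *)
pose q y := f (x + y) + f (x - y) - 2 * f x.
pose dq y := df (x + y) - df (x - y).
pose ddq y := 2 * g (x + y) + 2 * g (x - y).
have Hq (y : R) : is_derive y 1 q (dq y).
  have H1 := is_derive_affine 1 x Hf y; have H2 := is_derive_affine (-1) x Hf y.
  have -> : q = (fun y => f (1 * y + x) + f (-1 * y + x) - 2 * f x).
    by apply/funext => z; rewrite /q mul1r mulN1r [x + z]addrC [x - z]addrC.
  by apply: is_derive_eq; rewrite /dq !mul1r !mulN1r [x + y]addrC [x - y]addrC subr0.
have Hdq (y : R) : is_derive y 1 dq (ddq y).
  have H1 := is_derive_affine 1 x Hdf y; have H2 := is_derive_affine (-1) x Hdf y.
  have -> : dq = (fun y => df (1 * y + x) - df (-1 * y + x)).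
    by apply/funext => z; rewrite /dq mul1r mulN1r [x + z]addrC [x - z]addrC.
  by apply: is_derive_eq; rewrite /ddq !mul1r !mulN1r opprK [x + y]addrC [x - y]addrC.
pose F (y : R) := 2 * e * cosh2 y + K * (cosh2 (2 * y) - 4 * cosh2 y).
pose dF (y : R) := 2 * e * (expR y - expR (- y)) + K * (2 * (expR (2 * y) - expR (- (2 * y))) - 4 * (expR y - expR (- y))).
pose ddF (y : R) := 2 * e * (2 + cosh2 y) + K * (4 * (2 + cosh2 (2 * y)) - 4 * (2 + cosh2 y)).
have HF (y : R) : is_derive y 1 F (dF y).
  have H1 := is_derive_cosh2 y.
  have H2 : is_derive y 1 (fun z : R => cosh2 (2 * z)) (2 * (expR (2 * y) - expR (- (2 * y)))).
    by have := is_derive_affine 2 0 (@is_derive_cosh2 R) y; under eq_fun do rewrite addr0; rewrite addr0.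
  exact: is_derive_eq.
have HdF (y : R) : is_derive y 1 dF (ddF y).
  have H1 := is_derive_dcosh2 y.
  have H2 : is_derive y 1 (fun z : R => expR (2 * z) - expR (- (2 * z))) (2 * (2 + cosh2 (2 * y))).
    by have := is_derive_affine 2 0 (@is_derive_dcosh2 R) y; under eq_fun do rewrite addr0; rewrite addr0.
  by apply: is_derive_eq; rewrite /ddF /GRing.scale /=; ring.
have main sg y : sg = 1 \/ sg = -1 -> 0 <= y -> 0 <= F y + sg * (q y - 2 * g x * cosh2 y).
  move=> sgE y0.
  refine (@le_of_derive2 R (fun y => F y + sg * (q y - 2 * g x * cosh2 y))
    (fun y => dF y + sg * (dq y - 2 * g x * (expR y - expR (- y))))
    (fun y => ddF y + sg * (ddq y - 2 * g x * (2 + cosh2 y))) _ _ _ _ _ y y0).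
  - move=> z; have H1 := HF z; have H2 := Hq z; have H3 := is_derive_cosh2 z.
    exact: is_derive_eq.
  - move=> z; have H1 := HdF z; have H2 := Hdq z; have H3 := is_derive_dcosh2 z.
    exact: is_derive_eq.
  - by rewrite /F /q mulr0 cosh2_0 addr0 subr0; ring.
  - by rewrite /dF /dq !mulr0 addr0 subr0 !oppr0 expR0; ring.
  move=> z z0.
  have : `|ddq z - 2 * g x * (2 + cosh2 z)| <= ddF z.
    have h1 := ge z; have h2 := ge (- z); rewrite sqrrN in h2.
    have h3 := cosh2_sq z; have h4 := cosh2_ge0 z.
    rewrite /ddF cosh2_double /ddq.
    have hK : K * 12 = 4 * C + 2 * G by rewrite /K; field.
    rewrite (_ : 2 * g (x + z) + 2 * g (x - z) - 2 * g x * (2 + cosh2 z) =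
      2 * (g (x + z) - g x) + 2 * (g (x - z) - g x) - 2 * g x * cosh2 z); last by ring.
    apply: (le_trans (ler_normB _ _)); apply: (le_trans (lerD (ler_normD _ _) (lexx _))).
    rewrite !normrM (ger0_norm h4) !(@ger0_norm _ 2) //.
    have h5 : `|g x| * cosh2 z <= G * cosh2 z by rewrite ler_wpM2r.
    have h6 : C * z ^+ 2 <= C * cosh2 z by rewrite ler_wpM2l.
    have h7 : 0 <= K * cosh2 z ^+ 2 by rewrite mulr_ge0 ?sqr_ge0.
    have h8 : 0 <= e * cosh2 z by rewrite mulr_ge0.
    have h9 : K * 12 * cosh2 z = (4 * C + 2 * G) * cosh2 z by rewrite hK.
    nra.
  by rewrite ler_norml => /andP[h1 h2]; case: sgE => ->; lra.
have bound y : `|q y - 2 * g x * cosh2 y| <= F y.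
  have [y0|/ltW y0] := leP 0 y.
    by rewrite ler_norml; have := main 1 y (or_introl erefl) y0; have := main (-1) y (or_intror erefl) y0 => h1 h2; apply/andP; split; lra.
  have y0' : 0 <= - y by rewrite oppr_ge0.
  have qE : q y = q (- y) by rewrite /q opprK; ring.
  have FE : F y = F (- y) by rewrite /F mulrN !cosh2N.
  rewrite qE FE -[cosh2 y]cosh2N.
  by rewrite ler_norml; have := main 1 _ (or_introl erefl) y0'; have := main (-1) _ (or_intror erefl) y0' => h1 h2; apply/andP; split; lra.
pose r := Num.sqrt s.
have r2 : r ^+ 2 = s by exact: sqr_sqrtr.
have iq1 := heat_int s x bf.
have mf := bf.1.
have mr : measurable_fun setT (fun z => f (x - r * z)).
  by apply: measurableT_comp => //; apply: measurable_funB => //; exact: measurable_funM.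
have iq2 : leb.-integrable setT (EFin \o (fun z => f (x - r * z) * gauss 1 z)).
  have [M fM] := bf.2.
  apply: (@integrable_le _ _ _ leb _ _ (fun z => M * gauss 1 z)) => //.
  - by apply: measurable_funM => //; exact: measurable_gauss.
  - by apply: integrable_scale => //; exact: gauss_int.
  - by move=> z _; rewrite normrM (ger0_norm (gauss_ge0 _ _)) ler_wpM2r // gauss_ge0.
have ic1 := cosh2_integrable r; have ic2 := cosh2_integrable (2 * r).
have iq12 := integrableD measurableT iq1 iq2.
have ig : leb.-integrable setT (EFin \o (fun z => (- (2 * f x)) * gauss 1 z)).
  by apply: integrable_scale => //; exact: gauss_int.
have iq := integrableD measurableT iq12 ig.
have iqc := integrableD measurableT iq (integrable_scale (- (2 * g x)) measurableT ic1).
have iF1 := integrable_scale (2 * e) measurableT ic1.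
have iF2 := integrable_scale K measurableT ic2.
have iF3 := integrable_scale (- (4 * K)) measurableT ic1.
have iF := integrableD measurableT (integrableD measurableT iF1 iF2) iF3.
have B := @Rint_abs_le _ _ _ leb setT
  (fun z => (f (x + r * z) * gauss 1 z + f (x - r * z) * gauss 1 z + (- (2 * f x)) * gauss 1 z) +
     (- (2 * g x)) * (cosh2 (r * z) * gauss 1 z))
  (fun z => (2 * e) * (cosh2 (r * z) * gauss 1 z) + K * (cosh2 (2 * r * z) * gauss 1 z) + (- (4 * K)) * (cosh2 (r * z) * gauss 1 z))
  measurableT _ iF _.
have {B} : `|2 * (heat s f x) - 2 * f x - 2 * g x * (2 * (expR (s / 2) - 1))| <=
   2 * e * (2 * (expR (s / 2) - 1)) + K * (2 * (expR (2 * s) - 1)) - 4 * K * (2 * (expR (s / 2) - 1)).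
  have -> : 2 * heat s f x - 2 * f x - 2 * g x * (2 * (expR (s / 2) - 1)) =
    \int[leb]_z ((f (x + r * z) * gauss 1 z + f (x - r * z) * gauss 1 z + (- (2 * f x)) * gauss 1 z) +
     (- (2 * g x)) * (cosh2 (r * z) * gauss 1 z)).
    rewrite RintegralD //; last by apply: integrable_scale.
    rewrite RintegralD // RintegralD // RintegralZl //; last exact: gauss_int.
    rewrite RintegralZl // gauss1 // cosh2_int r2 -heat_refl // -/(heat s f x); ring.
  have -> : 2 * e * (2 * (expR (s / 2) - 1)) + K * (2 * (expR (2 * s) - 1)) - 4 * K * (2 * (expR (s / 2) - 1)) =
    \int[leb]_z ((2 * e) * (cosh2 (r * z) * gauss 1 z) + K * (cosh2 (2 * r * z) * gauss 1 z) + (- (4 * K)) * (cosh2 (r * z) * gauss 1 z)).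
    rewrite RintegralD //; last exact: (integrableD measurableT iF1 iF2).
    rewrite RintegralD // !RintegralZl // !cosh2_int exprMn r2.
    have -> : 2 ^+ 2 * s / 2 = 2 * s by field.
    by ring.
  apply: B.
    by have /integrableP[/measurable_EFinP] := iqc.
  move=> z _.
  rewrite [X in `|X|](_ : _ = (f (x + r * z) + f (x - r * z) - 2 * f x - 2 * g x * cosh2 (r * z)) * gauss 1 z); last by ring.
  rewrite normrM (ger0_norm (gauss_ge0 _ _)).
  rewrite [X in _ <= X](_ : _ = F (r * z) * gauss 1 z); last by rewrite /F (mulrA 2 r z); ring.
  rewrite ler_wpM2r ?gauss_ge0 //.
  exact: bound.
rewrite -/K (_ : 2 * heat s f x - 2 * f x - 2 * g x * (2 * (expR (s / 2) - 1)) =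
  2 * (heat s f x - f x - 2 * g x * (expR (s / 2) - 1))); last by ring.
rewrite normrM ger0_norm //; lra.
Qed.

End HeatTaylor.
Opaque heat.

(** * Dynkin's formula for the heat semigroup *)

Section SmallTime.
Variable R : realType.

Lemma expR_small (a : R) : 0 <= a <= 2^-1 -> a <= expR a - 1 <= a + 2 * a ^+ 2.
Proof.
move=> /andP[a0 a1]; have := expR_ge1Dx a; have := expR_ge1Dx (- a); rewrite expRN.
have := expR_gt0 a; move: (expR a) => e e0 h1 h2; apply/andP; split; first by lra.
have : e <= (1 - a)^-1 by rewrite -[e]invrK lef_pV2 ?posrE ?invr_gt0 //; lra.
have : (1 - a)^-1 <= 1 + a + 2 * a ^+ 2.
  rewrite -div1r ler_pdivrMr; last by lra.
  have : 0 <= a ^+ 2 * (1 - 2 * a) by rewrite mulr_ge0 ?sqr_ge0 //; lra.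
  by rewrite !expr2; nra.
lra.
Qed.

(** Here [g] is half the second derivative of [f]. The Taylor estimate and the slow variation of
    [heat r g] over [r <= s] leave an error [o(s)] uniform in [x], as required for summing over many
    short steps. *)
Lemma heat_small_time (f df g : R -> R) : bmf f -> bmf g ->
  (forall x : R, is_derive x 1 f (df x)) -> (forall x : R, is_derive x 1 df (2 * g x)) ->
  unif_modulus g ->
  forall e, 0 < e -> exists2 D, 0 <= D & forall s x, 0 <= s <= 1 ->
    `|heat s f x - f x - tint s (fun r => heat r g x)| <= e * s + D * s ^+ 2.
Proof.
move=> bf bg Hf Hdf ug e e0; have e4 : 0 < e / 4 by rewrite divr_gt0.
have [C C0 HC] := ug _ e4; have [mg [G gG]] := bg.
have G0 : 0 <= G by exact: le_trans (gG 0).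
exists ((4 * C + 2 * G) + G + e + 2 * C) => [|s x /andP[s0 s1]]; first by rewrite !addr_ge0 ?mulr_ge0 ?(ltW e0).
have T := heat_taylor2 s0 bf Hf Hdf (ltW e4) C0 (gG x) (HC x).
have [| p1 p2] := andP (@expR_small (s / 2) _); first by apply/andP; split; lra.
have H : `|tint s (fun r => heat r g x - g x)| <= (e / 4 + C * (2 * (expR (s / 2) - 1))) * s.
  apply: tint_abs_cst => //.
    apply: measurable_funB => //; exact: (measurable_fun_pair1 x (lbm_heat bg).1).
  move=> r /andP[r0 rs]; apply: (le_trans (heat_dev_le r0 bg C0 (HC x))).
  rewrite lerD2l ler_wpM2l // ler_wpM2l // lerD2r ler_expR ler_wpM2r //.
have tg : tbd s (fun r => heat r g x).
  split; first exact: (measurable_fun_pair1 x (lbm_heat bg).1).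
  by exists G => r _; apply: heat_abs.
rewrite tintB // in H; last exact: tbd_cst.
rewrite -[tint s (fun=> g x)]/(tint s (cst (g x))) tint_cst // in H.
have p12 : expR (2 * s) = (1 + (expR (s / 2) - 1)) ^+ 4.
  by rewrite addrC subrK -expRM_natl; congr expR; field.
rewrite p12 in T; move: (expR (s / 2) - 1) p1 p2 T H => p p1 p2 T H.
have -> : heat s f x - f x - tint s (fun r => heat r g x) =
   (heat s f x - f x - 2 * g x * p) - (tint s (fun r => heat r g x) - g x * s) + g x * (2 * p - s) by ring.
apply: (le_trans (ler_normD _ _)); apply: (le_trans (lerD (ler_normB _ _) (lexx _))).
have N : `|g x * (2 * p - s)| <= G * s ^+ 2.
  rewrite normrM; apply: ler_pM => //; rewrite ger0_norm; last lra.
  have : 2 * (s / 2) ^+ 2 * 2 = s ^+ 2 by field.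
  lra.
have pS : p <= s.
  have : 0 <= s * (1 - s) by rewrite mulr_ge0 // subr_ge0.
  have : 2 * (s / 2) ^+ 2 = s * s / 2 by field.
  lra.
have p0 : 0 <= p by lra.
have E1 : (4 * C + 2 * G) / 12 * ((1 + p) ^+ 4 - 1 - 4 * p) <= (4 * C + 2 * G) * s ^+ 2.
  have -> : (1 + p) ^+ 4 - 1 - 4 * p = p ^+ 2 * (6 + 4 * p + p ^+ 2) by ring.
  rewrite -mulrA ler_wpM2l ?addr_ge0 ?mulr_ge0 //.
  have pp : p ^+ 2 <= s ^+ 2 by rewrite ler_sqr ?nnegrE.
  have ss : s ^+ 2 <= 1 by rewrite expr_le1.
  have : p ^+ 2 * (6 + 4 * p + p ^+ 2) <= s ^+ 2 * 12.
    apply: ler_pM; rewrite ?sqr_ge0 ?addr_ge0 ?mulr_ge0 ?sqr_ge0 //; lra.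
  lra.
have E2 : 2 * (e / 4) * p <= e / 2 * s.
  have -> : 2 * (e / 4) = e / 2 by field.
  by rewrite ler_wpM2l // divr_ge0 // ltW.
have E3 : (e / 4 + C * (2 * p)) * s <= e / 4 * s + 2 * C * s ^+ 2.
  have : C * p * s <= C * s * s by rewrite ler_wpM2r // ler_wpM2l.
  rewrite expr2; lra.
have E4 : 0 <= e * s ^+ 2 by rewrite mulr_ge0 ?sqr_ge0 ?ltW.
have E5 : 0 <= e * s by exact: mulr_ge0 (ltW e0) s0.
lra.
Qed.

(** The defect [E] satisfies [E (s + r) = E s + heat s (E r)], hence [|E (n s)|] is at most [n]
    times a uniform bound on [|E s|]. With [s = t / n] the [o(s)] bound makes this arbitrarily
    small, without differentiating in time. *)
Lemma heat_dynkin (f df g : R -> R) : bmf f -> bmf g ->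
  (forall x : R, is_derive x 1 f (df x)) -> (forall x : R, is_derive x 1 df (2 * g x)) ->
  unif_modulus g ->
  forall t x, 0 <= t -> heat t f x = f x + tint t (fun r => heat r g x).
Proof.
move=> bf bg Hf Hdf ug t x t0.
pose E s y := heat s f y - f y - tint s (fun r => heat r g y).
have tb s y : tbd s (fun r => heat r g y).
  split; first exact: (measurable_fun_pair1 y (lbm_heat bg).1).
  by have [mg [G gG]] := bg; exists G => r _; apply: heat_abs.
have lI : lbm (fun s y => tint s (fun r => heat r g y)).
  have := lbm_duh (lbm_cstt bg); congr lbm.
have bE s : bmf (E s).
  apply: bmfB; first by apply: bmfB => //; exact: bmf_heat.
  exact: lbm_bmf lI.
have Eadd s r y : 0 <= s -> 0 <= r -> E (s + r) y = E s y + heat s (E r) y.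
  move=> s0 r0; have [mg [G gG]] := bg.
  rewrite /E heatB; [|by apply: bmfB => //; exact: bmf_heat|exact: lbm_bmf lI].
  rewrite heatB //; last exact: bmf_heat.
  rewrite heat_heat // (tint_split s0 r0 (tb _ _)).
  rewrite (@heat_tint R s r y (fun r y => heat r g y) G).
  - have -> : tint r (fun r0 : R => heat s (heat r0 g) y) = tint r (fun r0 => heat (s + r0) g y).
      by apply: eq_tint => q /andP[q0 _]; rewrite heat_heat.
    by move: (heat _ _ _) (heat _ _ _) (tint _ _) (tint _ _) => *; ring.
  - exact: (lbm_heat bg).1.
  - by move=> q z _; apply: heat_abs.
suff /eqP : E t x = 0 by rewrite /E -addrA -opprD subr_eq0 => /eqP.
apply/eqP; rewrite -normr_le0; apply/ler_addgt0Pl => e e0; rewrite addr0.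
have t1 : 0 < 1 + t by lra.
(* Chosen so that the linear parts of the step errors add up to at most [e / 2]. *)
have e2 : 0 < e / 2 / (1 + t) by rewrite !divr_gt0.
have [D D0 HD] := heat_small_time bf bg Hf Hdf ug e2.
have step s n y : 0 <= s <= 1 -> `|E (n%:R * s) y| <= n%:R * (e / 2 / (1 + t) * s + D * s ^+ 2).
  move=> s01; have /andP[s0 _] := s01; elim: n y => [|n IH] y.
    rewrite !mul0r; suff -> : E 0 y = 0 by rewrite normr0.
    by have := Eadd 0 0 y (lexx _) (lexx _); rewrite addr0 heat_le0 //; lra.
  rewrite -natr1 mulrDl mul1r addrC Eadd //; last by rewrite mulr_ge0.
  rewrite [leRHS]mulrDl mul1r [leRHS]addrC; apply: (le_trans (ler_normD _ _)); apply: lerD; first exact: HD.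
  by apply: heat_abs; [exact: (bE _).1|move=> z; exact: IH].
have [n nt] : exists n : nat, t + D * t ^+ 2 / (e / 2) + 1 <= n%:R.
  by exists (Num.truncn (t + D * t ^+ 2 / (e / 2) + 1)).+1; rewrite ltW // truncnS_gt.
have q1 : 0 <= D * t ^+ 2 / (e / 2) by rewrite !divr_ge0 ?(ltW e0) // mulr_ge0 ?sqr_ge0.
have n0 : 0 < n%:R :> R by lra.
have nn : n%:R != 0 :> R by exact: lt0r_neq0.
have := step (t / n%:R) n x; have -> : n%:R * (t / n%:R) = t by field.
move=> /(_ _)/le_trans; apply.
  by rewrite divr_ge0 //= ler_pdivrMr // mul1r; lra.
have -> : n%:R * (e / 2 / (1 + t) * (t / n%:R) + D * (t / n%:R) ^+ 2) = e / 2 * (t / (1 + t)) + D * t ^+ 2 / n%:R.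
  by field; rewrite nn lt0r_neq0 //; lra.
have h1 : t / (1 + t) <= 1 by rewrite ler_pdivrMr; lra.
have h1' : e / 2 * (t / (1 + t)) <= e / 2 by rewrite ler_piMr // divr_ge0 // ltW.
have h2 : D * t ^+ 2 / n%:R <= e / 2.
  have : D * t ^+ 2 / (e / 2) <= n%:R by lra.
  by rewrite ler_pdivrMr ?divr_gt0 // ler_pdivrMr // [_ / _ * _]mulrC.
lra.
Qed.

End SmallTime.

(** * The ground state as a mild solution *)

Section GroundState.
Variable R : realType.
Notation leb := (@lebesgue_measure R).

Record ground_state (beta : R -> R) (lam : R) (h : R -> R) : Prop := GroundState {
  gs_lam : 0 < lam;
  gs_bcont : continuous beta;
  gs_bsupp : compact_supp beta;
  gs_pos : forall x, 0 < h x;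
  gs_bdd : exists M : R, forall x, h x <= M;
  gs_d1 : forall x : R, derivable h x 1;
  gs_d2 : forall x : R, derivable (derive1 h) x 1;
  gs_ode : forall x, 2^-1 * derive1 (derive1 h) x + beta x * h x = lam * h x;
  gs_norm : \int[leb]_x (h x * h x) = 1 }.

Variables (beta : R -> R) (lam : R) (h : R -> R).
Hypothesis gs : ground_state beta lam h.

Let lam0 : 0 < lam := gs_lam gs.
Let hp : forall x, 0 < h x := gs_pos gs.

Lemma gs_derive (x : R) : is_derive x 1 h (derive1 h x).
Proof. by rewrite derive1E; apply/derivableP; exact: (gs_d1 gs). Qed.

Lemma gs_derive2 (x : R) : is_derive x 1 (derive1 h) (2 * ((lam - beta x) * h x)).
Proof.
have -> : 2 * ((lam - beta x) * h x) = derive1 (derive1 h) x.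
  by have := gs_ode gs x; lra.
by rewrite derive1E; apply/derivableP; exact: (gs_d2 gs).
Qed.

Lemma gs_cont : continuous h.
Proof. exact: is_derive_continuous gs_derive. Qed.

Lemma gs_meas : measurable_fun setT h.
Proof. exact: continuous_measurable_fun gs_cont. Qed.

Lemma gs_bmf : bmf h.
Proof.
split; first exact: gs_meas; have [M hM] := gs_bdd gs.
by exists M => x; rewrite gtr0_norm.
Qed.

Lemma gs_bbmf : bmf beta.
Proof.
split; first exact: continuous_measurable_fun (gs_bcont gs).
have [K _ HK] := Cc_bounded (gs_bcont gs) (gs_bsupp gs); by exists K.
Qed.

Lemma gs_gbmf : bmf (fun x => (lam - beta x) * h x).
Proof.
apply: bmfM; last exact: gs_bmf.
by apply: bmfB; [exact: bmf_cst|exact: gs_bbmf].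
Qed.

(** [h'] is bounded by interpolation: on [[x, x + 1]] some value of [h'] is a difference of values
    of [h], and [h'] varies over this interval by at most the bound on [h''] that the equation
    supplies. *)
Lemma gs_lip : exists2 L, 0 <= L & forall x y, `|h (x + y) - h x| <= L * `|y|.
Proof.
have [_ [K hK]] := gs_bmf; have [_ [G gG]] := gs_gbmf.
have K0 : 0 <= K by exact: le_trans (hK 0).
have G0 : 0 <= G by exact: le_trans (gG 0).
have dK x : `|derive1 h x| <= 2 * K + 2 * G.
  have x1 : x <= x + 1 by rewrite lerDl.
  have [c] := MVT_segment x1 (fun x _ => gs_derive x) (continuous_subspaceT gs_cont).
  rewrite in_itv /= => /andP[xc cx]; rewrite addrAC subrr add0r mulr1 => hc.
  have cd : continuous (derive1 h) by exact: is_derive_continuous gs_derive2.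
  have [z _ hz] := MVT_segment xc (fun x _ => gs_derive2 x) (continuous_subspaceT cd).
  have h1 : `|derive1 h c| <= 2 * K.
    by rewrite -hc; apply: (le_trans (ler_normB _ _)); have := hK x; have := hK (x + 1); lra.
  have h2 : `|derive1 h c - derive1 h x| <= 2 * G.
    rewrite hz normrM (ger0_norm (_ : 0 <= c - x)) ?subr_ge0 //.
    rewrite normrM ger0_norm // -[leRHS]mulr1; apply: ler_pM; rewrite ?mulr_ge0 ?subr_ge0 //.
      by rewrite ler_wpM2l.
    lra.
  have := ler_normB (derive1 h c) (derive1 h c - derive1 h x); rewrite opprB addrC subrK; lra.
exists (2 * K + 2 * G); first by lra.
move=> x y; wlog y0 : x y / 0 <= y.
  move=> H; have [/H//|/ltW y0] := leP 0 y.
  have := H (x + y) (- y); rewrite addrK normrN distrC; apply; lra.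
have xy : x <= x + y by rewrite lerDl.
have [c _ ->] := MVT_segment xy (fun x _ => gs_derive x) (continuous_subspaceT gs_cont).
by rewrite addrAC subrr add0r normrM ler_wpM2r.
Qed.

Lemma gs_dynkin0 t x : 0 <= t -> heat t h x = h x + tint t (fun r => heat r (fun x => (lam - beta x) * h x) x).
Proof.
apply: (heat_dynkin gs_bmf gs_gbmf gs_derive gs_derive2).
have -> : (fun x => (lam - beta x) * h x) = (fun x => lam * h x - beta x * h x).
  by apply/funext => y; rewrite mulrBl.
apply: unif_modulusB.
  have [L L0 hL] := gs_lip; apply: (@lip_unif_modulus _ _ (lam * L)).
    by rewrite mulr_ge0 ?(ltW lam0).
  by move=> y z; rewrite -mulrBr normrM (gtr0_norm lam0) -mulrA ler_wpM2l // ltW.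
apply: Cc_unif_modulus.
  by move=> y; apply: cvgM; [exact: (gs_bcont gs)|exact: gs_cont].
by have [M HM] := gs_bsupp gs; exists M => y /HM ->; rewrite mul0r.
Qed.

(** By Dynkin's formula [h] is a stationary solution with source [- (lam - beta) h]; multiplying its
    representation in [sol_killed] by [e^{m t}] gives the claim. For [m = lam] this is the
    eigenfunction equation; for [m > lam] the extra source makes [e^{m t} h] a supersolution. *)
Lemma gs_sol m : 0 < m ->
  is_sol h (fun t x => beta x * (expR (m * t) * h x) + (m - lam) * (expR (m * t) * h x)) (fun t x => expR (m * t) * h x).
Proof.
move=> m0 t x t0.
pose F (_ : R) x := - ((lam - beta x) * h x).
have lF : lbm F by apply: lbm_cstt; apply: bmfN; exact: gs_gbmf.
have lh : lbm (fun _ => h) by apply: lbm_cstt; exact: gs_bmf.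
have sh : is_sol h F (fun _ => h).
  move=> s y s0; rewrite gs_dynkin0 //.
  have -> : duh F s y = - tint s (fun r => heat r (fun x => (lam - beta x) * h x) y).
    rewrite -tintN; last by have := tbd_duh0 s y (lbm_cstt gs_gbmf).
    by apply: eq_tint => r _; rewrite heatN //; exact: gs_gbmf.
  by rewrite addrK.
rewrite (sol_killed x gs_bmf lF lh sh m0 t0) mulrDr mulrA -expRD mulNr subrr expR0 mul1r; congr (_ + _).
have tF : tbd t (fun s => expR (- m * s) * heat s (fun y => F (t - s) y + m * h y) x).
  apply: tbdM; first exact: tbd_expR.
  by apply: (tbd_duh0 t x (g := fun s y => F s y + m * h y)); apply: lbmD => //; exact: lbmZ.
rewrite -tintZ //; apply: eq_tint => s /andP[s0 st].
have -> : (fun y => beta y * (expR (m * (t - s)) * h y) + (m - lam) * (expR (m * (t - s)) * h y)) =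
  (fun y => expR (m * (t - s)) * (F (t - s) y + m * h y)).
  by apply/funext => y; rewrite /F; ring.
rewrite heatZ; last by apply: bmfD; [exact: lbm_bmf lF|apply: bmfZ; exact: gs_bmf].
by rewrite mulrA -expRD; congr (expR _ * _); ring.
Qed.

End GroundState.

(** * Exact exponential tails of the ground state *)

Section Tails.
Variable R : realType.
Notation leb := (@lebesgue_measure R).

Lemma integrable_opp (f : R -> R) : leb.-integrable setT (EFin \o f) ->
  leb.-integrable setT (EFin \o (fun x => f (- x))).
Proof.
move=> /integrableP[mf fi]; apply/integrableP; split.
  apply/measurable_EFinP; apply: (measurableT_comp (f := f)) => //; exact/measurable_EFinP.
rewrite (_ : \int[leb]_x _ = \int[leb]_x `|(EFin \o f) x|)%E //.
rewrite [RHS](eq_measure_integral (pushforward leb (-%R : _ -> measurableTypeR R))).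
  by rewrite ge0_integral_pushforward //; exact: measurableT_comp.
by move=> A mA _; exact/esym/lebesgue_measureN.
Qed.

Lemma integrable_laplace (k : R) : 0 < k -> leb.-integrable setT (EFin \o (fun x => expR (- (k * `|x|)))).
Proof.
move=> k0; have ip := integrable_exponential_pdf k0; have ip' := integrable_opp ip.
have iS := integrableD measurableT ip ip'.
apply: (@integrable_le _ _ _ leb _ _ (fun x => k^-1 * (exponential_pdf k x + exponential_pdf k (- x)))) => //.
- apply: measurableT_comp => //; apply: measurableT_comp => //; apply: measurable_funM => //.
- exact: integrable_scale.
move=> x _; rewrite ger0_norm ?expR_ge0 //.
have H y : 0 <= y -> expR (- (k * y)) = k^-1 * exponential_pdf k y.
  move=> y0; rewrite exponential_pdfE // mulNr mulrA mulVf ?mul1r //.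
  exact: lt0r_neq0.
have [x0|x0] := leP 0 x.
  rewrite ger0_norm // H // ler_wpM2l ?invr_ge0 ?(ltW k0) // lerDl.
  by apply: exponential_pdf_ge0; exact: ltW.
rewrite ltr0_norm // H ?oppr_ge0 ?(ltW x0) // ler_wpM2l ?invr_ge0 ?(ltW k0) // lerDr.
by apply: exponential_pdf_ge0; exact: ltW.
Qed.

Lemma int_derive_supp (F f : R -> R) (a b : R) : a < b -> continuous f ->
  (forall x : R, is_derive x 1 F (f x)) -> (forall x, ~~ (a <= x <= b) -> f x = 0) ->
  \int[leb]_x f x = F b - F a.
Proof.
move=> ab cf HF f0.
have -> : \int[leb]_x f x = \int[leb]_(x in `[a, b]%classic) f x.
  rewrite [RHS]Rintegral_mkcond; apply: eq_Rintegral => y _.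
  by rewrite /patch mem_setE in_itv /=; case: ifPn => // /f0 ->.
rewrite /Rintegral (@continuous_FTC2 R f F a b ab) //.
- exact: continuous_subspaceT.
- have cF := is_derive_continuous HF; split => [x _||].
  + by have [] := HF x.
  + by apply: cvg_at_right_filter; exact: cF.
  + by apply: cvg_at_left_filter; exact: cF.
- by move=> x _; rewrite derive1E; have [_ ->] := HF x.
Qed.

(* s = 1 selects the right half-line and s = -1 the left one. *)
Lemma cst_of_derive (s : R) (f df : R -> R) (x y : R) : s * s = 1 ->
  (forall x : R, is_derive x 1 f (df x)) -> (forall z, s * x <= s * z -> df z = 0) ->
  s * x <= s * y -> f y = f x.
Proof.
move=> s1 Hf df0 xy; have cf := is_derive_continuous Hf.
have [xley|/ltW ylex] := leP x y.
  have [c] := MVT_segment xley (fun x _ => Hf x) (continuous_subspaceT cf).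
  rewrite in_itv /= => /andP[xc cy] E; apply/eqP; rewrite -subr_eq0 E df0 ?mul0r //.
  have [s0|/ltW s0] := leP 0 s; first by rewrite ler_wpM2l.
  apply: (le_trans xy); rewrite ler_wnM2l //.
have [c] := MVT_segment ylex (fun x _ => Hf x) (continuous_subspaceT cf).
rewrite in_itv /= => /andP[yc cx] E; apply/esym/eqP; rewrite -subr_eq0 E df0 ?mul0r //.
have [s0|/ltW s0] := leP 0 s; last by rewrite ler_wnM2l.
apply: (le_trans xy); rewrite ler_wpM2l //.
Qed.

Lemma is_derive_expRZ (c x : R) : is_derive x 1 (fun y : R => expR (c * y)) (c * expR (c * x)).
Proof.
have := is_derive_affine c 0 (@is_derive_expR R) x.
by under eq_fun do rewrite addr0; rewrite addr0.
Qed.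

Variables (beta : R -> R) (lam : R) (h : R -> R).
Hypothesis gs : ground_state beta lam h.

Definition decay := Num.sqrt (2 * lam).
Notation k := decay.

Lemma decay_gt0 : 0 < k.
Proof. by rewrite sqrtr_gt0 mulr_gt0 // (gs_lam gs). Qed.

Lemma decay_sq : k ^+ 2 = 2 * lam.
Proof. by rewrite sqr_sqrtr // mulr_ge0 // ltW // (gs_lam gs). Qed.

(* gs_coef 1 and gs_coef (-1) are the constants C_+ and C_- of the theorem. *)
Definition gs_coef (s : R) := k^-1 * \int[leb]_y (beta y * h y * expR (- (s * k * y))).

(** The Wronskian of [e^{- s k x}] and [h]: as [k^2 = 2 lam] and [s^2 = 1], its derivative is
    [- 2 beta h e^{- s k x}], so it is constant on each side of the support of [beta]. *)
Let A s x := expR (- (s * k * x)) * (derive1 h x + s * k * h x).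

Let is_derive_A (s x : R) : s * s = 1 ->
  is_derive x 1 (A s) (- 2 * (beta x * h x * expR (- (s * k * x)))).
Proof.
move=> s1; have H1 := gs_derive gs x; have H2 := gs_derive2 gs x.
have H3 : is_derive x 1 (fun y : R => expR (- (s * k * y))) (- (s * k) * expR (- (s * k * x))).
  have -> : (fun y : R => expR (- (s * k * y))) = (fun y => expR (- (s * k) * y)).
    by apply/funext => y; rewrite mulNr.
  have -> : - (s * k * x) = - (s * k) * x by rewrite mulNr.
  exact: is_derive_expRZ.
apply: is_derive_eq; rewrite /GRing.scale /=.
have e1 : s * k * (s * k) = 2 * lam.
  by rewrite mulrACA s1 mul1r -expr2 decay_sq.
rewrite (_ : expR (- (s * k * x)) * (2 * ((lam - beta x) * h x) + s * k * derive1 h x) +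
   (derive1 h x + s * k * h x) * (- (s * k) * expR (- (s * k * x))) =
   expR (- (s * k * x)) * h x * (2 * (lam - beta x) - s * k * (s * k))); last by ring.
by rewrite e1; ring.
Qed.

(** Beyond the support, a nonzero value would give [h] a component growing like [e^{s k x}], against
    its boundedness. *)
Let A_zero (M s : R) : s * s = 1 -> (forall x, M < `|x| -> beta x = 0) -> 0 <= M ->
  forall x, M < s * x -> A s x = 0.
Proof.
move=> s1 bM M0 x xM.
have k0 := decay_gt0.
have nx z : s * x <= s * z -> M < `|z|.
  move=> xz; have := lt_le_trans xM xz => h1; apply: (lt_le_trans h1).
  have -> : `|z| = `|s * z|.
    rewrite normrM; have : `|s| * `|s| = 1 by rewrite -normrM s1 normr1.
    by rewrite -expr2 => /eqP; rewrite sqrp_eq1 // => /eqP ->; rewrite mul1r.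
  exact: ler_norm.
have AE z : s * x <= s * z -> A s z = A s x.
  move=> xz; apply: (cst_of_derive s1 (fun x => is_derive_A x s1)) => // y xy.
  by rewrite bM ?nx // !mul0r mulr0.
set a := A s x.
(* [phi] is [e^{s k y} h] with the growing component removed. It is constant on the half-line, which
   bounds [|a| e^{s k z} / (2 k)] by the bound on [h] plus a constant along [z = x + s n]. *)
pose phi y := expR (s * k * y) * h y - a / (2 * (s * k)) * expR (2 * (s * k) * y).
have sk : s * k != 0.
  by rewrite mulf_neq0 ?(lt0r_neq0 k0) //; apply/eqP => s0; move: s1; rewrite s0 mul0r => /esym/eqP; rewrite oner_eq0.
have Hphi (y : R) : is_derive y 1 phi (expR (2 * (s * k) * y) * (A s y - a)).
  have H1 := gs_derive gs y.
  have H3 (c : R) : is_derive y 1 (fun y : R => expR (c * y)) (c * expR (c * y)).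
    exact: is_derive_expRZ.
  have H4 := H3 (s * k); have H5 := H3 (2 * (s * k)).
  apply: is_derive_eq; rewrite /GRing.scale /= /A.
  have -> : expR (2 * (s * k) * y) = expR (s * k * y) * expR (s * k * y) by rewrite -expRD; congr expR; ring.
  rewrite expRN; have e0 := expR_gt0 (s * k * y); field.
  rewrite (lt0r_neq0 k0) lt0r_neq0 //=.
  by apply/eqP => s0; move: sk; rewrite s0 mul0r eqxx.
have phiE z : s * x <= s * z -> phi z = phi x.
  move=> xz; apply: (cst_of_derive s1 Hphi) => // y xy.
  by rewrite AE // subrr mulr0.
have [K hK] := gs_bdd gs.
have K0 : 0 <= K by apply: le_trans (hK 0); rewrite ltW // (gs_pos gs).
apply/eqP; rewrite -normr_le0 -/a.
have key n : `|a| * (1 + k * n%:R) <= 2 * k * (`|phi x| + K).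
  have xn : s * x <= s * (x + s * n%:R) by rewrite mulrDr mulrA s1 mul1r lerDl.
  have Ez : s * k * (x + s * n%:R) = k * (s * x + n%:R).
    by rewrite mulrDr mulrACA [s * k * x]mulrAC s1 mul1r; ring.
  set z := x + s * n%:R in xn Ez.
  set E := expR (k * (s * x + n%:R)).
  have E1 : 1 + k * n%:R <= E.
    apply: le_trans (expR_ge1Dx _); rewrite lerD2l ler_wpM2l ?(ltW k0) // lerDr.
    by rewrite ltW // (le_lt_trans M0).
  have E0 : 1 <= E.
    rewrite /E -expR0 ler_expR mulr_ge0 ?(ltW k0) // addr_ge0 //.
    by rewrite ltW // (le_lt_trans M0).
  have := phiE z xn; have e2 : 2 * (s * k) * z = 2 * (s * k * z) by ring.
  rewrite {1}/phi e2 Ez -/E.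
  have -> : expR (2 * (k * (s * x + n%:R))) = E * E by rewrite -expRD; congr expR; ring.
  move=> H.
  have en : E != 0 by rewrite lt0r_neq0 // expR_gt0.
  have kn : k != 0 by exact: lt0r_neq0.
  have sn : s != 0 by apply/eqP => s0; move: sk; rewrite s0 mul0r eqxx.
  have H2 : a / (2 * (s * k)) * E = h z - phi x / E.
    have -> : a / (2 * (s * k)) * E = (E * h z - phi x) / E by rewrite -H; field; rewrite en kn sn.
    by field; rewrite ?en ?kn ?sn.
  have H3 : `|a| / (2 * k) * E <= K + `|phi x|.
    have sN : `|s| = 1.
      have : `|s| * `|s| = 1 by rewrite -normrM s1 normr1.
      by rewrite -expr2 => /eqP; rewrite sqrp_eq1 // => /eqP.
    have -> : `|a| / (2 * k) * E = `|a / (2 * (s * k)) * E|.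
      rewrite !normrM normfV !normrM sN mul1r (gtr0_norm k0) (@ger0_norm _ E) ?expR_ge0 // (@ger0_norm _ 2) //.
    rewrite H2; apply: (le_trans (ler_normB _ _)); apply: lerD.
      by rewrite gtr0_norm ?(gs_pos gs).
    rewrite normrM ler_piMr // normfV ger0_norm ?expR_ge0 // invf_le1 //; lra.
  have : `|a| * (1 + k * n%:R) <= `|a| * E by rewrite ler_wpM2l.
  move=> /le_trans; apply.
  have : `|a| / (2 * k) * E * (2 * k) <= (K + `|phi x|) * (2 * k) by rewrite ler_wpM2r // mulr_ge0 // ltW.
  have -> : `|a| / (2 * k) * E * (2 * k) = `|a| * E by field; exact: lt0r_neq0.
  lra.
rewrite leNgt; apply/negP => a0.
pose B := 2 * k * (`|phi x| + K) / (`|a| * k).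
have := truncnS_gt B; set n := (Num.truncn B).+1 => nB.
have := key n; have : B * (`|a| * k) = 2 * k * (`|phi x| + K).
  by rewrite /B divfK // mulf_neq0 ?lt0r_neq0.
have : B * (`|a| * k) < n%:R * (`|a| * k) by rewrite ltr_pM2r // mulr_gt0.
lra.
Qed.

(** To the left of the support, for [s = 1], [A (- s) x = 0] gives [h' = s k h]. Integrating the
    derivative of [A s] across the support, beyond which [A s] is 0, gives [A s x = 2 s I] with [I]
    the integral in [gs_coef]. Together they determine [h x]. *)
Lemma gs_tail (s : R) : s * s = 1 -> exists2 M, 0 <= M &
  forall x, s * x < - M -> h x = gs_coef s * expR (s * k * x).
Proof.
move=> s1; have [M0 bM0] := gs_bsupp gs; pose M := `|M0|.
have k0 := decay_gt0.
have bM x : M < `|x| -> beta x = 0 by move=> h1; apply: bM0; apply: le_lt_trans h1; exact: ler_norm.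
have M0' : 0 <= M by exact: normr_ge0.
have sN : `|s| = 1.
  have : `|s| * `|s| = 1 by rewrite -normrM s1 normr1.
  by rewrite -expr2 => /eqP; rewrite sqrp_eq1 // => /eqP.
have sM1 : M < s * (s * (M + 1)) by rewrite mulrA s1 mul1r; lra.
exists M => // x xM.
have A1 : A (- s) x = 0.
  by apply: (A_zero _ bM) => //; [rewrite mulrNN | rewrite mulNr; lra].
have A2 : A s (s * (M + 1)) = 0 by apply: (A_zero _ bM).
have cf : continuous (fun x => - 2 * (beta x * h x * expR (- (s * k * x)))).
  move=> y; apply: cvgM; first exact: cvg_cst.
  apply: cvgM; first by apply: cvgM; [exact: (gs_bcont gs)|exact: (gs_cont gs)].
  apply: continuous_comp; last exact: continuous_expR.
  by apply: cvgN; apply: cvgM; [exact: cvg_cst|exact: cvg_id].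
pose I := \int[leb]_y (beta y * h y * expR (- (s * k * y))).
have iI : leb.-integrable setT (EFin \o (fun y => beta y * h y * expR (- (s * k * y)))).
  have [Kb Kb0 HK] := Cc_bounded (gs_bcont gs) (gs_bsupp gs); have [K hK] := gs_bdd gs.
  have K0 : 0 <= K by apply: le_trans (hK 0); rewrite ltW // (gs_pos gs).
  apply: (@integrable_le _ _ _ leb _ _ (fun y => Kb * K * expR (2 * k * M) * expR (- (k * `|y|)))) => //.
  - apply: measurable_funM; first by apply: measurable_funM; [exact: (gs_bbmf gs).1|exact: gs_meas gs].
    by apply: measurableT_comp => //; apply: measurableT_comp => //; exact: measurable_funM.
  - by apply: integrable_scale => //; exact: integrable_laplace.
  - move=> y _; have [yM|yM] := ltP M `|y|.
      by rewrite bM // !mul0r normr0 !mulr_ge0 ?expR_ge0.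
    rewrite !normrM -!mulrA; apply: ler_pM => //; rewrite ?mulr_ge0 //; apply: ler_pM => //.
      by rewrite gtr0_norm ?(gs_pos gs).
    rewrite ger0_norm ?expR_ge0 // -expRD ler_expR.
    have : - (s * k * y) <= k * `|y|.
      by apply: (le_trans (ler_norm _)); rewrite normrN !normrM sN mul1r gtr0_norm.
    have : k * `|y| <= k * M by rewrite ler_wpM2l ?(ltW k0).
    lra.
have I2 : - 2 * I = \int[leb]_y (- 2 * (beta y * h y * expR (- (s * k * y)))) by rewrite RintegralZl.
have Ax : A s x = 2 * s * I.
  have [s0|s0] := leP 0 s.
    have sE : s = 1 by rewrite -sN ger0_norm.
    have := @int_derive_supp (A s) _ x (M + 1) _ cf (fun x => is_derive_A x s1).
    rewrite -I2 => H; have : - 2 * I = A s (M + 1) - A s x.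
      apply: H; first by move: xM; rewrite sE; lra.
      move=> y; rewrite negb_and -!ltNge => /orP[yx|yx].
        rewrite bM ?mul0r ?mulr0 // ltr0_norm; move: xM; rewrite sE; lra.
      rewrite bM ?mul0r ?mulr0 // gtr0_norm; lra.
    have sM : s * (M + 1) = M + 1 by rewrite sE mul1r.
    have : 2 * s * I = 2 * I by rewrite sE; ring.
    have : A s (M + 1) = 0 by rewrite -sM.
    lra.
  have sE : s = -1 by move: sN; rewrite ltr0_norm //; lra.
  have := @int_derive_supp (A s) _ (- (M + 1)) x _ cf (fun x => is_derive_A x s1).
  rewrite -I2 => H; have : - 2 * I = A s x - A s (- (M + 1)).
    apply: H; first by move: xM; rewrite sE; lra.
    move=> y; rewrite negb_and -!ltNge => /orP[yx|yx].
      rewrite bM ?mul0r ?mulr0 // ltr0_norm; lra.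
    rewrite bM ?mul0r ?mulr0 // gtr0_norm; move: xM; rewrite sE; lra.
  have sM : s * (M + 1) = - (M + 1) by rewrite sE mulN1r.
  have : 2 * s * I = - 2 * I by rewrite sE; ring.
  have : A s (- (M + 1)) = 0 by rewrite -sM.
  lra.
have dh : derive1 h x = s * k * h x.
  move: A1 => /eqP; rewrite /A mulf_eq0 gt_eqF ?expR_gt0 //= !mulNr subr_eq0 => /eqP //.
move: Ax; rewrite /A dh -mulr2n -[_ *+ 2]mulr_natl.
set E := expR (s * k * x); have E0 : E != 0 by rewrite lt0r_neq0 // expR_gt0.
rewrite expRN -/E => H.
have sn : s != 0 by apply/eqP => s0; move: s1; rewrite s0 mul0r => /esym/eqP; rewrite oner_eq0.
rewrite /gs_coef -/I.
have -> : I = E^-1 * (2 * (s * k * h x)) / (2 * s) by rewrite H; field.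
by field; rewrite E0 sn lt0r_neq0.
Qed.

(** [beta] may change sign, so positivity is read off from the tail formula and [h > 0]. *)
Lemma gs_coef_gt0 s : s * s = 1 -> 0 < gs_coef s.
Proof.
move=> s1; have [M M0 HM] := gs_tail s1.
have := gs_pos gs (- (s * (M + 1))); rewrite HM; first by rewrite pmulr_lgt0 ?expR_gt0.
by rewrite mulrN mulrA s1 mul1r; lra.
Qed.

Lemma gs_decay : exists2 K, 0 < K & forall x, h x <= K * expR (- (k * `|x|)).
Proof.
have [M1 M10 H1] := @gs_tail 1 (mulr1 1); have [M2 M20 H2] : exists2 M, 0 <= M & forall x, -1 * x < - M -> h x = gs_coef (-1) * expR (-1 * k * x).
  by apply: gs_tail; rewrite mulrNN mulr1.
have c1 : 0 < gs_coef 1 by apply: gs_coef_gt0; rewrite mulr1.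
have c2 : 0 < gs_coef (-1) by apply: gs_coef_gt0; rewrite mulrNN mulr1.
have [H hH] := gs_bdd gs; have k0 := decay_gt0.
have H0 : 0 < H by apply: lt_le_trans (hH 0); exact: (gs_pos gs).
pose K3 := H * expR (k * (M1 + M2)); have K30 : 0 < K3 by rewrite mulr_gt0 ?expR_gt0.
move: (gs_coef 1) (gs_coef (-1)) c1 c2 H1 H2 => a b a0 b0 H1 H2.
exists (a + b + K3); first by rewrite !addr_gt0.
move=> x; have [x1|x1] := ltP x (- M1).
  rewrite H1 ?mul1r // ltr0_norm; last by lra.
  by rewrite mulrN opprK ler_wpM2r ?expR_ge0 //; lra.
have [x2|x2] := ltP M2 x.
  rewrite H2 ?mulN1r; last by lra.
  rewrite gtr0_norm; last by lra.
  by rewrite mulNr ler_wpM2r ?expR_ge0 //; lra.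
apply: (@le_trans _ _ (K3 * expR (- (k * `|x|)))); last by rewrite ler_wpM2r ?expR_ge0 //; lra.
rewrite /K3 -mulrA -expRD; apply: (le_trans (hH x)); rewrite ler_peMr ?(ltW H0) // -expR0 ler_expR -mulrBr.
rewrite mulr_ge0 ?(ltW k0) // subr_ge0 ler_norml; apply/andP; split; lra.
Qed.

Lemma gs_integrable : leb.-integrable setT (EFin \o h).
Proof.
have [K K0 hK] := gs_decay.
apply: (@integrable_le _ _ _ leb _ _ (fun x => K * expR (- (k * `|x|)))) => //.
- exact: gs_meas gs.
- by apply: integrable_scale => //; apply: integrable_laplace; exact: decay_gt0.
- by move=> x _; rewrite gtr0_norm ?hK // (gs_pos gs).
Qed.

End Tails.

(** * The inner product on the line *)

Section InnerProduct.
Variable R : realType.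
Notation leb := (@lebesgue_measure R).
Implicit Types (a g f : R -> R) (v : R -> R -> R).

Definition ip a g := \int[leb]_x (a x * g x).

Definition ibmf a := bmf a /\ leb.-integrable setT (EFin \o a).

Lemma ibmfM a g : ibmf a -> bmf g -> ibmf (fun x => a x * g x).
Proof.
move=> [ba ia] bg; split; first exact: bmfM.
have [ma _] := ba; have [mg [M gM]] := bg.
apply: (@integrable_le _ _ _ leb _ _ (fun x => M * `|a x|)) => //.
- exact: measurable_funM.
- by apply: integrable_scale => //; exact: (integrable_norm ia).
- by move=> x _; rewrite normrM mulrC ler_wpM2r.
Qed.

Lemma ip_int a g : ibmf a -> bmf g -> leb.-integrable setT (EFin \o (fun x => a x * g x)).
Proof. by move=> ia bg; have [] := ibmfM ia bg. Qed.

Lemma ipD a g f : ibmf a -> bmf g -> bmf f -> ip a (fun x => g x + f x) = ip a g + ip a f.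
Proof.
move=> ia bg bf; rewrite /ip -RintegralD //; [|exact: ip_int|exact: ip_int].
by apply: eq_Rintegral => x _; rewrite mulrDr.
Qed.

Lemma ipB a g f : ibmf a -> bmf g -> bmf f -> ip a (fun x => g x - f x) = ip a g - ip a f.
Proof.
move=> ia bg bf; rewrite /ip -RintegralB //; [|exact: ip_int|exact: ip_int].
by apply: eq_Rintegral => x _; rewrite mulrBr.
Qed.

Lemma ipZ a g (c : R) : ibmf a -> bmf g -> ip a (fun x => c * g x) = c * ip a g.
Proof.
move=> ia bg; rewrite /ip -RintegralZl //; last exact: ip_int.
by apply: eq_Rintegral => x _; rewrite mulrCA.
Qed.

Lemma ipC a g : ip a g = ip g a.
Proof. by apply: eq_Rintegral => x _; rewrite mulrC. Qed.

Lemma ip_le a g f : ibmf a -> (forall x, 0 <= a x) -> bmf g -> bmf f -> (forall x, g x <= f x) -> ip a g <= ip a f.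
Proof.
move=> ia a0 bg bf gf; apply: le_Rintegral => //; [exact: ip_int|exact: ip_int|].
by move=> x _; rewrite ler_wpM2l.
Qed.

Lemma ip_ge0 a g : (forall x, 0 <= a x) -> (forall x, 0 <= g x) -> 0 <= ip a g.
Proof. by move=> a0 g0; apply: Rintegral_ge0 => x _; rewrite mulr_ge0. Qed.

Lemma ip_abs a g (M : R) : ibmf a -> bmf g -> (forall x, `|g x| <= M) ->
  `|ip a g| <= M * \int[leb]_x `|a x|.
Proof.
move=> ia bg gM; have i := integrable_norm ia.2.
rewrite -RintegralZl //; apply: Rint_abs_le => //.
- by apply: measurable_funM; [exact: ia.1.1|exact: bg.1].
- exact: integrable_scale.
- by move=> x _; rewrite normrM mulrC ler_wpM2r.
Qed.

Lemma ip_mulA a g f : ip a (fun x => g x * f x) = ip (fun x => a x * g x) f.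
Proof. by apply: eq_Rintegral => x _; rewrite mulrA. Qed.

Lemma measurable_ip d (T : measurableType d) a (g : T -> R -> R) :
  measurable_fun setT a -> measurable_fun setT (fun p : T * R => g p.1 p.2) ->
  measurable_fun setT (fun x => ip a (g x)).
Proof.
move=> ma mg; have /(_ measurableT) := @measurable_Rint R _ _ T (measurableTypeR R) leb setT
  (fun p z => a z * g p z).
by apply; apply: measurable_funM => //; exact: measurableT_comp.
Qed.

Lemma ip_heat t a g : ibmf a -> bmf g -> ip a (heat t g) = ip g (heat t a).
Proof.
move=> [ba ia] bg; rewrite /ip heat_sym //; apply: eq_Rintegral => x _; exact: mulrC.
Qed.

Lemma tbd_ip a t v : ibmf a -> lbm v -> tbd t (fun s => ip a (v s)).
Proof.
move=> ia lv; have [mv bv] := lv; split; first exact: measurable_ip ia.1.1 mv.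
have [M vM] := bv t; have [ba i] := ia.
exists (M * \int[leb]_x `|a x|) => s /andP[_ st].
rewrite -RintegralZl //; last exact: (integrable_norm i).
apply: Rint_abs_le => //.
- by apply: measurable_funM; [exact: ba.1|exact: (lbm_bmf s lv).1].
- by apply: integrable_scale => //; exact: (integrable_norm i).
- by move=> x _; rewrite normrM mulrC ler_wpM2r // vM.
Qed.

Transparent tint.
Lemma int_tint (A : R -> R) t v : leb.-integrable setT (EFin \o A) -> measurable_fun setT (fun p : R * R => v p.1 p.2) ->
  (forall s x, 0 <= s <= t -> `|v s x| <= A x) ->
  \int[leb]_x tint t (fun s => v s x) = tint t (fun s => \int[leb]_x v s x).
Proof.
move=> ia mv vM.
rewrite /tint (@fubini_dom R _ _ (measurableTypeR R) (measurableTypeR R) leb leb setT `[0, t]%classic (fun x s => v s x) A (cst 1)) //.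
- by apply: (measurable_comp2 mv).
- exact: tbd_int (tbd_cst t 1).
- by move=> x s _ st; rewrite mulr1 vM.
Qed.
Opaque tint.

Lemma ip_tint a t v (M : R) : ibmf a -> measurable_fun setT (fun p : R * R => v p.1 p.2) ->
  (forall s x, 0 <= s <= t -> `|v s x| <= M) ->
  ip a (fun x => tint t (fun s => v s x)) = tint t (fun s => ip a (v s)).
Proof.
move=> ia mv vM; rewrite /ip -(@int_tint (fun x => M * `|a x|)).
- apply: eq_Rintegral => x _; rewrite tintZ //.
  split; first exact: (measurable_fun_pair1 x mv).
  by exists M => s st; exact: vM.
- by apply: integrable_scale => //; exact: (integrable_norm ia.2).
- by apply: measurable_funM => //; apply: measurableT_comp => //; exact: ia.1.1.
- by move=> s x st; rewrite normrM mulrC ler_wpM2r // vM.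
Qed.

Lemma ip_duh a t v : ibmf a -> lbm v -> ip a (duh v t) = tint t (fun s => ip a (heat s (v (t - s)))).
Proof.
move=> ia lv; have [mv bv] := lv; have [M vM] := bv t.
apply: (@ip_tint a t (fun s => heat s (v (t - s))) M) => //.
  apply: (@measurable_heat R _ (R * R)%type (fun p => v (t - p.1)) fst snd) => //.
  apply: (measurable_comp2 mv) => //; apply: measurable_funB => //; exact: measurable_fst_fst.
move=> s x /andP[s0 st]; apply: heat_abs; first exact: (lbm_bmf _ lv).1.
by move=> y; apply: vM; rewrite lerBlDr lerDl.
Qed.

End InnerProduct.

(** * Duality with the ground state *)

Section Duality.
Variable R : realType.
Notation leb := (@lebesgue_measure R).
Variables (beta : R -> R) (lam : R) (h : R -> R).
Hypothesis gs : ground_state beta lam h.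

Lemma gs_ibmf : ibmf h.
Proof. by split; [exact: (gs_bmf gs)|exact: (gs_integrable gs)]. Qed.

(** With [m = lam + B] and [B >= |beta|] the source in [gs_sol] is nonnegative, so the heat part
    alone is below [e^{m t} h]. This supplies integrable envelopes for Fubini. *)
Lemma gs_heat_le : exists2 m, 0 < m & forall t x, 0 <= t -> heat t h x <= expR (m * t) * h x.
Proof.
have [B B0 HB] := Cc_bounded (gs_bcont gs) (gs_bsupp gs).
have m0 : 0 < lam + B by rewrite ltr_pwDl // (gs_lam gs).
exists (lam + B) => // t x t0; rewrite (gs_sol gs m0) // lerDl.
apply: duh_ge0 => s y s0; rewrite -mulrDl mulr_ge0 //.
  by have := HB y; rewrite ler_norml => /andP[]; lra.
by rewrite mulr_ge0 ?expR_ge0 // ltW // (gs_pos gs).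
Qed.

Lemma lbm_expR (m : R) (b : R -> R) : 0 <= m -> bmf b -> lbm (fun s x => expR (m * s) * b x).
Proof.
move=> m0 bb; apply: lbmM; last exact: lbm_cstt.
split; first by apply: measurableT_comp => //; apply: measurableT_comp => //; exact: measurable_funM.
by move=> T; exists (expR (m * T)) => s x sT; rewrite ger0_norm ?expR_ge0 // ler_expR ler_wpM2l.
Qed.

Lemma gs_heat_sol s x : 0 <= s ->
  heat s h x = expR (lam * s) * h x - duh (fun s x => expR (lam * s) * (h x * beta x)) s x.
Proof.
move=> s0; have := gs_sol gs (gs_lam gs) x s0.
rewrite (_ : duh _ s x = duh (fun s x => expR (lam * s) * (h x * beta x)) s x).
  by move=> ->; rewrite addrK.
by apply: eq_duh => r y _; rewrite subrr mul0r addr0 mulrCA [beta y * _]mulrC.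
Qed.

(** Symmetry moves the heat flow onto [h], where [gs_heat_sol] expands it; an envelope proportional
    to [h] justifies exchanging the integrals. *)
Lemma gs_heat_dual s g : 0 <= s -> bmf g -> ip h (heat s g) =
  expR (lam * s) * ip h g - tint s (fun r => expR (lam * (s - r)) * ip (fun x => h x * beta x) (heat r g)).
Proof.
move=> s0 bg; have ih := gs_ibmf; have bb := gs_bbmf gs; have lam0 := gs_lam gs.
have ib := ibmfM ih bb; set b := fun x => h x * beta x in ib *.
have lE := lbm_expR (ltW lam0) ib.1.
have [mg [G gG]] := bg; have G0 : 0 <= G by exact: le_trans (gG 0).
have [B B0 HB] := Cc_bounded (gs_bcont gs) (gs_bsupp gs).
have [m m0 Hm] := gs_heat_le.
rewrite (ip_heat s ih bg) ipC.
pose v r x := expR (lam * (s - r)) * heat r b x * g x.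
have mv : measurable_fun setT (fun p : R * R => v p.1 p.2).
  apply: measurable_funM; last exact: measurableT_comp.
  apply: measurable_funM; last exact: (lbm_heat ib.1).1.
  by apply: measurableT_comp => //; apply: measurable_funM => //; apply: measurable_funB.
have vA r x : 0 <= r <= s -> `|v r x| <= (expR (lam * s) * (B * expR (m * s)) * G) * h x.
  move=> /andP[r0 rs]; rewrite !normrM (ger0_norm (expR_ge0 _)).
  rewrite [leRHS]mulrAC; apply: ler_pM => //; rewrite ?mulr_ge0 ?expR_ge0 //.
  rewrite -[leRHS]mulrA; apply: ler_pM => //; rewrite ?expR_ge0 //.
    by rewrite ler_expR ler_wpM2l ?(ltW lam0) // lerBlDr lerDl.
  have hb : heat r (fun x => B * h x) x <= B * expR (m * s) * h x.
    rewrite heatZ; last exact: ih.1.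
    rewrite -mulrA ler_wpM2l //; apply: (le_trans (Hm _ _ r0)).
    by rewrite ler_wpM2r ?ler_expR ?ler_wpM2l ?(ltW m0) // ltW // (gs_pos gs).
  have bBh y : `|b y| <= B * h y.
    by rewrite /b normrM (gtr0_norm (gs_pos gs y)) mulrC ler_wpM2r // ltW // (gs_pos gs).
  have bBb : bmf (fun x => B * h x) by apply: bmfZ; exact: ih.1.
  apply: le_trans hb; rewrite ler_norml -heatN //.
  apply/andP; split; apply: heat_le => //; try exact: ib.1.
  - exact: bmfN.
  - by move=> y; have := bBh y; rewrite ler_norml => /andP[].
  - by move=> y; have := bBh y; rewrite ler_norml => /andP[].
have IT := int_tint (integrable_scale (expR (lam * s) * (B * expR (m * s)) * G) measurableT ih.2) mv vA.
have tv x : tbd s (fun r => v r x).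
  split; first exact: (measurable_fun_pair1 x mv).
  by eexists => r; exact: vA.
transitivity (expR (lam * s) * ip h g - \int[leb]_x tint s (fun r => v r x)).
  rewrite -(ipZ _ ih bg) /ip -RintegralB; [|exact: measurableT| |].
  - apply: eq_Rintegral => x _.
    rewrite (gs_heat_sol x s0) mulrBl; congr (_ - _); first by rewrite [RHS]mulrCA mulrA.
    rewrite mulrC -tintZ; last exact: (tbd_duh0 s x lE).
    apply: eq_tint => r /andP[r0 rs]; rewrite heatZ; last exact: ib.1.
    by rewrite /v mulrC.
  - exact: (ip_int ih (bmfZ _ bg)).
  - have iS := integrable_scale (expR (lam * s) * (B * expR (m * s)) * G * s) measurableT ih.2.
    apply: (@integrable_le R _ _ leb _ _ _ measurableT _ iS).
      apply: (measurable_tint (t := fun=> s) (a := fun x r => v r x)); first exact: measurable_cst.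
      by apply: (measurable_comp2 mv); [exact: measurable_snd|exact: measurable_fst].
    move=> x _; rewrite [leRHS]mulrAC; apply: (tint_abs_cst s0 (tv x).1) => r rs; exact: vA.
rewrite IT; congr (_ - _); apply: eq_tint => r /andP[r0 rs].
rewrite (ip_heat r ib bg) ipC -RintegralZl; [|exact: measurableT|]; last first.
  have iS := integrable_scale (expR (- (lam * (s - r)))) measurableT (integrable_scale (expR (lam * s) * (B * expR (m * s)) * G) measurableT ih.2).
  apply: (@integrable_le R _ _ leb _ _ _ measurableT _ iS).
    by apply: measurable_funM; [exact: (bmf_heat r ib.1).1|exact: mg].
  move=> x _; have := vA r x; rewrite r0 rs /v -mulrA normrM (ger0_norm (expR_ge0 _)) => /(_ isT) H.
    by rewrite expRN ler_pdivlMl ?expR_gt0.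
by apply: eq_Rintegral => x _; rewrite /v mulrA.
Qed.

Opaque ip.

(** Formally the time derivative of [<h, v_t>] is [<(1/2 Delta + beta) h, v_t> = lam <h, v_t>]. In
    mild form, the Duhamel formula for [v] and the dual formula for [h] produce time integrals that
    cancel. *)
Lemma gs_ip_sol f v t : bmf f -> lbm v -> is_sol f (fun t x => beta x * v t x) v -> 0 <= t ->
  ip h (v t) = expR (lam * t) * ip h f.
Proof.
move=> bf lv sv t0.
have lam0 := gs_lam gs; have bh := gs_bmf gs; have bb := gs_bbmf gs; have ih := gs_ibmf.
pose b x := h x * beta x.
have ib : ibmf b by exact: ibmfM.
have bE : (fun x => h x * beta x) = b by [].
clearbody b.
have lbv : lbm (fun t x => beta x * v t x) by apply: lbmM => //; exact: lbm_cstt.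
have lf := lbm_heat bf.
pose Q r p := ip b (heat r (fun x => beta x * v p x)).
have mQ : measurable_fun setT (fun q : R * R => Q q.1 q.2).
  apply: (@measurable_ip R _ (R * R)%type b (fun q => heat q.1 (fun x => beta x * v q.2 x))); first exact: ib.1.1.
  apply: (@measurable_heat R _ (R * R * R)%type (fun q => (fun x => beta x * v q.1.2 x)) (fun q => q.1.1) snd) => //.
  - apply: (measurable_comp2 lbv.1); last exact: measurable_snd.
    have A : measurable_fun setT (fun x : R * R * R => x.1.2) by exact: measurable_snd_fst.
    have B : measurable_fun setT (fun x : R * R * R * R => x.1) by exact: measurable_fst.
    exact: (measurableT_comp A B).
  - exact: measurable_fst_fst.
have [M HM] := lbv.2 t.
pose Ib := \int[leb]_x `|b x|.
have bQ r p : p <= t -> `|Q r p| <= M * Ib.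
  move=> pt; have bq := lbm_bmf p lbv.
  apply: (ip_abs ib (bmf_heat r bq)) => x; apply: heat_abs; first exact: bq.1.
  by move=> y; exact: HM.
pose F u r := expR (lam * u) * Q r (t - u - r).
have mF : measurable_fun setT (fun p : R * R => F p.1 p.2).
  apply: measurable_funM.
    by apply: measurableT_comp => //; exact: measurable_funM.
  by apply: (measurable_comp2 mQ) => //; apply: measurable_funB => //; exact: measurable_funB.
have FM u r : 0 <= u -> 0 <= r -> u + r <= t -> `|F u r| <= expR (lam * t) * (M * Ib).
  move=> u0 r0 ur; rewrite normrM ger0_norm ?expR_ge0 //; apply: ler_pM; rewrite ?expR_ge0 //.
    by rewrite ler_expR ler_wpM2l ?(ltW lam0) //; lra.
  by apply: bQ; lra.
have te := tbd_expR t lam.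
have tbv := tbd_rev (tbd_ip t ib lv).
have tbf := tbd_rev (tbd_ip t ib lf).
(* [A] is the Duhamel term of [v] paired with [h]. Duality gives [A = T1 - B]; the triangle identity
   and the Duhamel formula for [v (t - s)] give [B = T1 - T2]; time reversal gives [T3 = T2]. Only
   [e^{lam t} <h, f>] is left. *)
pose A := tint t (fun s => ip h (heat s (fun x => beta x * v (t - s) x))).
pose T1 := tint t (fun s => expR (lam * s) * ip b (v (t - s))).
pose T2 := tint t (fun s => expR (lam * s) * ip b (heat (t - s) f)).
pose T3 := tint t (fun r => expR (lam * (t - r)) * ip b (heat r f)).
pose B := tint t (fun s => tint s (fun r => F (s - r) r)).
have H4 : ip h (heat t f) = expR (lam * t) * ip h f - T3.
  rewrite (gs_heat_dual t0 bf) bE; reflexivity.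
have H1 : ip h (v t) = ip h (heat t f) + A.
  have E : ip h (duh (fun t x => beta x * v t x) t) = A by exact: ip_duh.
  rewrite -E -ipD //; [|exact: bmf_heat|exact: lbm_bmf (lbm_duh lbv)].
  by congr ip; apply/funext => x; exact: sv.
have tA : tbd t (fun s => expR (lam * s) * ip b (v (t - s))) by exact: tbdM.
have tC : tbd t (fun s => tint s (fun r => F (s - r) r)).
  split.
    apply: (measurable_tint (t := id) (a := fun s r => F (s - r) r)); first exact: measurable_id.
    apply: (measurable_comp2 mF); last exact: measurable_snd.
    by apply: measurable_funB; [exact: measurable_fst|exact: measurable_snd].
  exists (expR (lam * t) * (M * Ib) * t) => s /andP[s0 st].
  apply: (@le_trans _ _ (expR (lam * t) * (M * Ib) * s)).
    apply: tint_abs_cst => //.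
      apply: (measurable_comp2 mF) => //; exact: measurable_funB.
    by move=> r /andP[r0 rs]; apply: FM; [rewrite subr_ge0|exact: r0|rewrite subrK].
  rewrite ler_wpM2l // mulr_ge0 ?expR_ge0 //; exact: le_trans (normr_ge0 _) (bQ 0 t (lexx _)).
have H2 : A = T1 - B.
  rewrite /T1 /B -tintB //; apply: eq_tint => s /andP[s0 st].
  rewrite (gs_heat_dual s0 (lbm_bmf (t - s) lbv)) ip_mulA bE.
  have E : tint s (fun r => expR (lam * (s - r)) * ip b (heat r (fun x => beta x * v (t - s) x))) =
      tint s (fun r => F (s - r) r).
    by apply: eq_tint => r _; rewrite /F /Q (_ : t - (s - r) - r = t - s) //; ring.
  exact: (congr1 (fun z => expR (lam * s) * ip b (v (t - s)) - z) E).
have H3 : B = T1 - T2.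
  rewrite /B -(tint_tri mF FM) /T1 /T2 -(tintB tA (tbdM te tbf)).
  apply: eq_tint => s /andP[s0 st]; have ts0 : 0 <= t - s by rewrite subr_ge0.
  have tq : tbd (t - s) (fun r => Q r (t - s - r)).
    split; first by apply: (measurable_comp2 mQ) => //; exact: measurable_funB.
    by exists (M * Ib) => r /andP[r0 rs]; apply: bQ; lra.
  have E : ip b (duh (fun t x => beta x * v t x) (t - s)) = tint (t - s) (fun r => Q r (t - s - r)).
    exact: ip_duh.
  have E0 : tint (t - s) (F s) = expR (lam * s) * tint (t - s) (fun r => Q r (t - s - r)) by exact: tintZ.
  have E1 : ip b (duh (fun t x => beta x * v t x) (t - s)) = ip b (v (t - s)) - ip b (heat (t - s) f).
    rewrite -ipB //; [|exact: lbm_bmf lv|exact: bmf_heat].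
    apply: (congr1 (ip b)); apply/funext => x; rewrite (sv _ x ts0).
    by move: (heat _ _ _) (duh _ _ _) => p q; rewrite addrAC subrr add0r.
  by rewrite E0 -E E1 mulrBr.
have H5 : T3 = T2.
  transitivity (tint t (fun s => expR (lam * (t - s)) * ip b (heat (t - (t - s)) f))).
    by apply: eq_tint => r _; rewrite subKr.
  exact: (tint_rev t (tbdM te tbf).1).
by rewrite H1 H2 H3 H4 H5; clear; move: (ip h f) T1 T2 => *; ring.
Qed.

End Duality.

(** * The Feynman-Kac semigroup *)

Section LinearSemigroup.
Variable R : realType.
Notation leb := (@lebesgue_measure R).
Variable beta : R -> R.
Hypotheses (bcont : continuous beta) (bsupp : compact_supp beta).
Implicit Types (f g : R -> R) (v : R -> R -> R) (t s x m M : R).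

Definition lin_sol f v := lbm v /\ is_sol f (fun t x => beta x * v t x) v.

(* The Feynman-Kac semigroup of 1/2 Delta + beta. *)
Definition Pb f : R -> R -> R :=
  if pselect (exists v, lin_sol f v) is left H then projT1 (cid H) else fun _ _ => 0.

Lemma beta_bmf : bmf beta.
Proof.
split; first exact: continuous_measurable_fun.
have [K _ HK] := Cc_bounded bcont bsupp; by exists K.
Qed.

Lemma lin_sol_exists f : bmf f -> exists v, lin_sol f v.
Proof.
move=> bf; have bb := beta_bmf; have [mb [B HB]] := bb.
apply: (picard (Psi := fun _ x l => beta x * l) bf).
  by move=> v lv; apply: lbmM => //; exact: lbm_cstt.
move=> T; exists B => t x l l' _; rewrite -mulrBr normrM ler_wpM2r //.
Qed.

Lemma PbP f : bmf f -> lin_sol f (Pb f).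
Proof.
by move=> bf; rewrite /Pb; case: pselect => [H|/(_ (lin_sol_exists bf))//]; case: cid.
Qed.

Lemma lbm_Pb f : bmf f -> lbm (Pb f).
Proof. by case/PbP. Qed.

Lemma bmf_Pb f t : bmf f -> bmf (Pb f t).
Proof. by move=> bf; exact: lbm_bmf (lbm_Pb bf). Qed.

Lemma lbm_beta : lbm (fun _ : R => beta).
Proof. exact: lbm_cstt beta_bmf. Qed.

Lemma lbm_betaM v : lbm v -> lbm (fun t x => beta x * v t x).
Proof. by move=> lv; apply: lbmM => //; exact: lbm_beta. Qed.

Lemma lin_sol_addr0 f v : is_sol f (fun t x => beta x * v t x) v ->
  is_sol f (fun t x => beta x * v t x + 0) v.
Proof. by move=> sv; apply: (sol_eq sv) => s y _; rewrite addr0. Qed.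

Lemma PbE f t x : bmf f -> 0 <= t -> Pb f t x = heat t f x + duh (fun t x => beta x * Pb f t x) t x.
Proof. by move=> bf t0; have [_ sv] := PbP bf; exact: sv. Qed.

Lemma Pb_uniq f v : bmf f -> lin_sol f v -> forall t x, 0 <= t -> v t x = Pb f t x.
Proof.
move=> bf [lv sv]; have [lp sp] := PbP bf.
exact: (sol_uniq bf lbm_beta (lbm_cst 0) lv lp (lin_sol_addr0 sv) (lin_sol_addr0 sp)).
Qed.

Lemma Pb_le f g : bmf f -> bmf g -> (forall x, f x <= g x) -> forall t x, 0 <= t -> Pb f t x <= Pb g t x.
Proof.
move=> bf bg fg; have [lv sv] := PbP bf; have [lp sp] := PbP bg.
by apply: (sol_le bf bg lbm_beta (lbm_cst 0) (lbm_cst 0) lv lp (lin_sol_addr0 sv) (lin_sol_addr0 sp)).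
Qed.

Lemma Pb_semigroup f s t x : bmf f -> 0 <= s -> 0 <= t -> Pb f (s + t) x = Pb (Pb f s) t x.
Proof.
move=> bf s0 t0; have [lv sv] := PbP bf.
apply: (Pb_uniq (v := fun t => Pb f (s + t)) (bmf_Pb s bf) _ x t0); split; first exact: lbm_shift.
exact: (sol_restart bf (lbm_betaM lv) sv s0).
Qed.

Lemma PbD f g t x : bmf f -> bmf g -> 0 <= t -> Pb (fun y => f y + g y) t x = Pb f t x + Pb g t x.
Proof.
move=> bf bg t0; have [lv sv] := PbP bf; have [lp sp] := PbP bg.
apply/esym/(Pb_uniq (v := fun t x => Pb f t x + Pb g t x) (bmfD bf bg) _ x t0).
split; first exact: lbmD.
move=> s y s0; rewrite (heatD s y bf bg).
have -> : duh (fun t x => beta x * (Pb f t x + Pb g t x)) s y =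
    duh (fun t x => beta x * Pb f t x) s y + duh (fun t x => beta x * Pb g t x) s y.
  rewrite -duhD; [|exact: lbm_betaM|exact: lbm_betaM].
  by apply: eq_duh => r z _; rewrite mulrDr.
rewrite (sv s y s0) (sp s y s0); clear.
move: (heat _ _ _) (heat _ _ _) (duh _ _ _) (duh _ _ _) => *; ring.
Qed.

Lemma PbZ c f t x : bmf f -> 0 <= t -> Pb (fun y => c * f y) t x = c * Pb f t x.
Proof.
move=> bf t0; have [lv sv] := PbP bf.
apply/esym/(Pb_uniq (v := fun t x => c * Pb f t x) (bmfZ c bf) _ x t0).
split; first exact: lbmZ.
move=> s y s0; rewrite (heatZ s y c bf).
have -> : duh (fun t x => beta x * (c * Pb f t x)) s y = c * duh (fun t x => beta x * Pb f t x) s y.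
  rewrite -duhZ; last exact: lbm_betaM.
  by apply: eq_duh => r z _; rewrite mulrCA.
by rewrite (sv s y s0) mulrDr.
Qed.

Lemma PbN f t x : bmf f -> 0 <= t -> Pb (fun y => - f y) t x = - Pb f t x.
Proof.
move=> bf t0; rewrite -mulN1r -PbZ //; congr (Pb _ t x).
by apply/funext => y; rewrite mulN1r.
Qed.

Lemma PbB f g t x : bmf f -> bmf g -> 0 <= t -> Pb (fun y => f y - g y) t x = Pb f t x - Pb g t x.
Proof. by move=> bf bg t0; rewrite PbD ?PbN //; exact: bmfN. Qed.

Lemma Pb_ge0 f t x : bmf f -> (forall y, 0 <= f y) -> 0 <= t -> 0 <= Pb f t x.
Proof.
move=> bf f0 t0; have b0 : bmf (fun _ : R => 0 : R) by exact: bmf_cst.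
rewrite -(mul0r (Pb f t x)) -PbZ //; apply: Pb_le => //; first exact: bmfZ.
by move=> y; rewrite mul0r.
Qed.

Lemma heat_scaled_sol f m : bmf f ->
  is_sol f (fun t x => m * (expR (m * t) * heat t f x)) (fun t x => expR (m * t) * heat t f x).
Proof.
move=> bf t x t0.
have -> : duh (fun t x => m * (expR (m * t) * heat t f x)) t x =
    tint t (fun s => m * heat t f x * expR (m * (t - s))).
  apply: eq_tint => s /andP[s0 st]; have ts0 : 0 <= t - s by rewrite subr_ge0.
  rewrite heatZ; last by apply: bmfZ; exact: bmf_heat.
  rewrite heatZ; last exact: bmf_heat.
  rewrite heat_heat // [s + (t - s)]addrC subrK; clear; move: (expR _) (heat _ _ _) => *; ring.
have te := tbd_expR t m.
rewrite tintZ; last exact: (tbd_rev te).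
rewrite (tint_rev t te.1); have [->|m0] := eqVneq m 0.
  by rewrite !mul0r expR0 mul1r addr0.
by rewrite tint_expR //; move: (heat _ _ _) (expR _) => *; field.
Qed.

Lemma lbm_exp m : 0 <= m -> lbm (fun s (_ : R) => expR (m * s)).
Proof.
move=> m0; split; first by apply: measurableT_comp => //; apply: measurableT_comp => //; exact: measurable_funM.
by move=> T; exists (expR (m * T)) => s x sT; rewrite ger0_norm ?expR_ge0 // ler_expR ler_wpM2l.
Qed.

(** The Feynman-Kac weight lies between [e^{-B t}] and [e^{B t}]: below by killing at rate [B],
    above by comparison with the constant potential [B]. *)
Lemma Pb_heat_bounds : exists2 B, 0 < B & forall f t x, bmf f -> (forall y, 0 <= f y) -> 0 <= t ->
  expR (- B * t) * heat t f x <= Pb f t x <= expR (B * t) * heat t f x.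
Proof.
have [B0 B00 HB0] := Cc_bounded bcont bsupp; pose B := B0 + 1.
have B1 : 0 < B by rewrite /B; lra.
have HB y : - B <= beta y <= B.
  by have := HB0 y; rewrite ler_norml => /andP[h1 h2]; rewrite /B; apply/andP; split; lra.
exists B => // f t x bf f0 t0; have [lv sv] := PbP bf; have lbv := lbm_betaM lv.
have v0 s y : 0 <= s -> 0 <= Pb f s y by move=> s0; exact: Pb_ge0.
apply/andP; split.
  rewrite (sol_killed x bf lbv lv sv B1 t0) lerDl; apply: tint_ge0 => s /andP[s0 st].
  rewrite mulr_ge0 ?expR_ge0 // heat_ge0 // => y.
  rewrite -mulrDl mulr_ge0 ?v0 ?subr_ge0 //; have /andP[h1 h2] := HB y; lra.
have lw : lbm (fun t x => expR (B * t) * heat t f x).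
  by apply: lbmM; [apply: lbm_exp; exact: ltW|exact: lbm_heat].
have lBb : lbm (fun t x => (B - beta x) * (expR (B * t) * heat t f x)).
  by apply: lbmM => //; apply: lbmB; [exact: lbm_cst|exact: lbm_beta].
apply: (sol_le bf bf lbm_beta (lbm_cst 0) lBb lv lw (lin_sol_addr0 sv) _ (fun=> lexx _) _ x t0).
  apply: (sol_eq (heat_scaled_sol B bf)) => s y _; ring.
move=> s y s0; rewrite !mulr_ge0 ?expR_ge0 ?heat_ge0 // subr_ge0; have /andP[] := HB y; lra.
Qed.

Lemma Pb_abs : exists2 B, 0 < B & forall f t x M, bmf f -> (forall y, `|f y| <= M) -> 0 <= t ->
  `|Pb f t x| <= expR (B * t) * M.
Proof.
have [B B0 HB] := Pb_heat_bounds; exists B => // f t x M bf fM t0.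
have M0 : 0 <= M by exact: le_trans (fM 0).
have bM := bmf_cst M; have /andP[_ h2] := HB _ t x bM (fun=> M0) t0.
rewrite heat_cst in h2; rewrite ler_norml; apply/andP; split.
  rewrite lerNl -PbN //; apply: le_trans h2; apply: Pb_le => //; first exact: bmfN.
  by move=> y; have := fM y; rewrite ler_norml => /andP[]; lra.
apply: le_trans h2; apply: Pb_le => //.
by move=> y; have := fM y; rewrite ler_norml => /andP[].
Qed.

End LinearSemigroup.

(** * Domination by the ground state *)

Section LinearGround.
Variable R : realType.
Variables (beta : R -> R) (lam : R) (h : R -> R).
Hypothesis gs : ground_state beta lam h.
Let bc := gs_bcont gs.
Let bs := gs_bsupp gs.
Notation P := (Pb beta).

Lemma Pb_gs t x : 0 <= t -> P h t x = expR (lam * t) * h x.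
Proof.
move=> t0; apply/esym/(Pb_uniq bc bs (v := fun t x => expR (lam * t) * h x) (gs_bmf gs)) => //; split.
  by apply: lbm_expR; [rewrite ltW // (gs_lam gs)|exact: gs_bmf gs].
by apply: (sol_eq (gs_sol gs (gs_lam gs))) => s y _; rewrite subrr mul0r addr0.
Qed.

Lemma ip_Pb f t : bmf f -> 0 <= t -> ip h (P f t) = expR (lam * t) * ip h f.
Proof.
by move=> bf t0; have [lv sv] := PbP bc bs bf; exact: (gs_ip_sol gs bf lv sv t0).
Qed.

Lemma gs_min (M : R) : exists2 c, 0 < c & forall x, `|x| <= M -> c <= h x.
Proof.
have [M0|M0] := leP 0 M; last first.
  by exists 1 => // x xM; have := normr_ge0 x; lra.
have MM : - M <= M by lra.
have [c cM Hc] := EVT_min MM (continuous_subspaceT (gs_cont gs)).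
exists (h c); first exact: (gs_pos gs).
by move=> x xM; apply: Hc; rewrite in_itv /= -ler_norml.
Qed.

Lemma gs_dom (f : R -> R) (K M : R) : (forall x, `|f x| <= K) -> (forall x, M < `|x| -> f x = 0) ->
  exists2 C, 0 <= C & forall x, `|f x| <= C * h x.
Proof.
move=> fK fM; have [c c0 Hc] := gs_min M.
have K0 : 0 <= K by exact: le_trans (fK 0).
exists (K / c) => [|x]; first by rewrite divr_ge0 // ltW.
have [xM|xM] := leP `|x| M; last by rewrite fM // normr0 mulr_ge0 ?divr_ge0 // ltW // (gs_pos gs).
apply: (le_trans (fK x)); rewrite -mulrA ler_peMr // mulrC ler_pdivlMr // mul1r; exact: Hc.
Qed.

(** With [m = lam + B + 1] the function [e^{m t} h] has a source of at least [e^{m t} h] in its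
    equation, so it dominates its own Duhamel term, and up to the factor [q] that of any source
    bounded by [q h]. *)
Lemma duh_gs_le : exists2 m, 0 < m & forall (G : R -> R -> R) (q t x : R), lbm G -> 0 <= t -> 0 <= q ->
  (forall s y, 0 <= s <= t -> `|G s y| <= q * h y) -> `|duh G t x| <= q * (expR (m * t) * h x).
Proof.
have [B B0 HB] := Cc_bounded bc bs; pose m := lam + B + 1.
have m0 : 0 < m by rewrite /m; have := gs_lam gs; lra.
exists m => // G q t x lG t0 q0 Gq.
have le : lbm (fun t x => expR (m * t) * h x) by apply: lbm_expR; [exact: ltW|exact: gs_bmf gs].
have E : duh (fun t x => expR (m * t) * h x) t x <= expR (m * t) * h x.
  rewrite [leRHS](gs_sol gs m0) //; rewrite -[leLHS]add0r; apply: lerD.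
    by apply: heat_ge0 => y; rewrite ltW // (gs_pos gs).
  have lF : lbm (fun t x => beta x * (expR (m * t) * h x) + (m - lam) * (expR (m * t) * h x)).
    by apply: lbmD; [apply: lbmM => //; exact: (lbm_beta bc bs)|exact: lbmZ].
  rewrite -subr_ge0 -duhB //; apply: duh_ge0 => s y s0.
  have e0 : 0 <= expR (m * s) * h y by rewrite mulr_ge0 ?expR_ge0 // ltW // (gs_pos gs).
  have -> : forall z : R, beta y * z + (m - lam) * z - z = (beta y + (m - lam) - 1) * z by move=> z; ring.
  rewrite mulr_ge0 //.
  by have := HB y; rewrite ler_norml /m => /andP[]; lra.
have lqe : lbm (fun t x => q * (expR (m * t) * h x)) by exact: lbmZ.
apply: (@le_trans _ _ (q * duh (fun t x => expR (m * t) * h x) t x)); last by rewrite ler_wpM2l.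
have gle (G' : R -> R -> R) : lbm G' -> (forall s y, 0 <= s <= t -> G' s y <= q * h y) ->
    duh G' t x <= q * duh (fun t x => expR (m * t) * h x) t x.
  move=> lG' G'q; rewrite -duhZ //.
  Transparent duh. rewrite /duh. Opaque duh.
  apply: tint_le; [exact: (tbd_duh0 t x lG')|exact: (tbd_duh0 t x lqe)|] => s /andP[s0 st].
  have ts : 0 <= t - s <= t by rewrite subr_ge0 st lerBlDr lerDl.
  apply: heat_le; [exact: lbm_bmf lG'|exact: lbm_bmf (t - s) lqe|] => y.
  apply: (le_trans (G'q _ _ ts)); rewrite ler_wpM2l // ler_peMl ?(ltW (gs_pos gs _)) //.
  by rewrite -expR0 ler_expR mulr_ge0 ?(ltW m0) //; case/andP: ts.
rewrite ler_norml lerNl -duhN //; apply/andP; split; apply: gle => //; first exact: lbmN.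
- by move=> s y st; have := Gq s y st; rewrite ler_norml => /andP[]; lra.
- by move=> s y st; have := Gq s y st; rewrite ler_norml => /andP[]; lra.
Qed.

(** The Lyapunov estimate of the Harris argument: the potential acts only on the support of [beta],
    where [h] is bounded below, so the gain over the constant 1 is at most a multiple of [h]. *)
Lemma Pb1_le : exists2 K, 1 <= K & forall x, P (fun=> 1) 1 x <= 1 + K * h x.
Proof.
have b1 : bmf (fun _ : R => 1 : R) by exact: bmf_cst.
have [B B0 HB] := Pb_abs bc bs; have [m m0 Hm] := duh_gs_le.
have [K0 K00 bK] := Cc_bounded bc bs; have [M bM] := bs.
have [C C0 HC] := gs_dom bK bM.
pose K := C * expR B * expR m + 1.
have q0 : 0 <= C * expR B by rewrite mulr_ge0 ?expR_ge0.
exists K => [|x]; first by rewrite /K lerDr mulr_ge0 ?expR_ge0.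
rewrite (PbE bc bs x b1 ler01) heat_cst lerD2l.
have lG := lbm_betaM bc bs (lbm_Pb bc bs b1).
apply: (le_trans (ler_norm _)); apply: (@le_trans _ _ (C * expR B * (expR (m * 1) * h x))).
  apply: Hm => // s y /andP[s0 s1]; rewrite normrM mulrAC; apply: ler_pM => //.
  apply: (le_trans (HB _ s y 1 b1 _ s0)); first by move=> z; rewrite normr1.
  by rewrite mulr1 ler_expR -[leRHS]mulr1 ler_wpM2l // ltW.
rewrite mulr1 mulrA ler_wpM2r ?(ltW (gs_pos gs _)) // /K; lra.
Qed.

End LinearGround.

(** * Spectral gap by a Harris contraction *)

Section Ergodicity.
Variable R : realType.
Notation leb := (@lebesgue_measure R).
Variables (beta : R -> R) (lam : R) (h : R -> R).
Hypothesis gs : ground_state beta lam h.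
Let bc := gs_bcont gs.
Let bs := gs_bsupp gs.
Let lam0 := gs_lam gs.
Let hp := gs_pos gs.
Notation P := (Pb beta).

Let loc r (f : R -> R) := \int[leb]_(y in `[- r, r]%classic) f y.

Let leb_sym_itv r : (leb `[(- r)%R, r]%classic < +oo)%E.
Proof. by rewrite lebesgue_measure_itv /=; case: ifP => _; rewrite ?ltry. Qed.

Let loc_int r f : bmf f -> leb.-integrable `[- r, r]%classic (EFin \o f).
Proof.
move=> [mf [M fM]]; apply: (@integrable_bdd _ _ _ leb _ _ M) => //; last exact: measurable_funTS.
exact: leb_sym_itv.
Qed.

Let locD r f g : bmf f -> bmf g -> loc r (fun x => f x + g x) = loc r f + loc r g.
Proof. by move=> bf bg; rewrite /loc RintegralD //; exact: loc_int. Qed.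

Let locZ r c f : bmf f -> loc r (fun x => c * f x) = c * loc r f.
Proof. by move=> bf; rewrite /loc RintegralZl //; exact: loc_int. Qed.

Let locN r f : bmf f -> loc r (fun x => - f x) = - loc r f.
Proof.
by move=> bf; rewrite -mulN1r -locZ //; apply: eq_Rintegral => x _; rewrite mulN1r.
Qed.

Let loc_le r f g : bmf f -> bmf g -> (forall x, f x <= g x) -> loc r f <= loc r g.
Proof. by move=> bf bg fg; apply: le_Rintegral => //; exact: loc_int. Qed.

Let loc_cst r c : 0 <= r -> loc r (fun=> c) = c * (2 * r).
Proof.
move=> r0; have E : fine (leb `[(- r)%R, r]%classic) = 2 * r.
  rewrite lebesgue_measure_itv /= lte_fin; case: ltP => /= h1; first by ring.
  lra.
by rewrite /loc Rintegral_cst // E.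
Qed.

(** Combines the lower bounds for the Feynman-Kac weight and for the heat kernel on [[- r, r]];
    dividing by the supremum of [h] puts the constant in the form [eps * h x], which suits a
    correction along [h]. *)
Lemma Pb_minor r : 0 < r -> exists2 eps, 0 < eps & forall f x, bmf f -> (forall y, 0 <= f y) -> `|x| <= r ->
  eps * h x * \int[leb]_(y in `[- r, r]%classic) f y <= expR (- lam) * P f 1 x.
Proof.
move=> r0; have [B B0 HB] := Pb_heat_bounds bc bs; have [_ [H hH]] := gs_bmf gs.
have H0 : 0 < H by apply: lt_le_trans (hp 0) _; apply: le_trans (hH 0); exact: ler_norm.
have [c c0 Hc] : exists2 c, 0 < c & forall f x, bmf f -> (forall y, 0 <= f y) -> `|x| <= r -> c * loc r f <= heat 1 f x.
  exists (expR (- (2 * r ^+ 2)) / Num.sqrt (4 * pi)).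
    by rewrite divr_gt0 ?expR_gt0 // sqrtr_gt0 mulr_gt0 ?pi_gt0.
  by move=> f x bf f0 xr; apply: heat_minor => //; rewrite lexx ler1n.
exists (expR (- lam) * expR (- B) * c / H); first by apply: divr_gt0 => //; apply: mulr_gt0 => //; apply: mulr_gt0; exact: expR_gt0.
move=> f x bf f0 xr; have /andP[h1 _] := HB f 1 x bf f0 ler01.
have h2 := Hc f x bf f0 xr.
have l0 : 0 <= loc r f by apply: Rintegral_ge0 => y _.
rewrite -!mulrA ler_wpM2l ?expR_ge0 //; apply: le_trans h1; rewrite mulr1 ler_wpM2l ?expR_ge0 //.
apply: le_trans h2; rewrite ler_wpM2l ?(ltW c0) // mulrA ler_piMl // mulrC ler_pdivrMr // mul1r.
by apply: le_trans (hH x); exact: ler_norm.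
Qed.

Lemma gs_far (eta : R) : 0 < eta -> exists2 r, 0 < r & forall x, r < `|x| -> h x < eta.
Proof.
move=> e0; have [K K0 hK] := gs_decay gs; have k0 := decay_gt0 gs; set k := decay lam in hK k0 *.
exists (K / (eta * k)) => [|x xr]; first by rewrite divr_gt0 // mulr_gt0.
have x0 : 0 <= `|x| := normr_ge0 x.
have d0 : 0 < 1 + k * `|x| by rewrite ltr_pwDl // mulr_ge0 // ltW.
apply: (le_lt_trans (hK x)); apply: (@le_lt_trans _ _ (K / (1 + k * `|x|))).
  by rewrite ler_wpM2l ?(ltW K0) //; apply: expRN_le; rewrite mulr_ge0 // ltW.
rewrite ltr_pdivrMr //; move: xr; rewrite ltr_pdivrMr ?mulr_gt0 // => h1.
have : 0 < eta * 1 by rewrite mulr1.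
lra.
Qed.

(** The minorisation is applied to [a V + f] and [a V - f]. By [2 K b = eps lh] it removes at least
    [2 K b a hx], twice the Lyapunov gain [a b K hx]; the surplus [b K - theta] in the [h] part and
    [1 - gam - theta] in the constant part gives the contraction. Here [lV] and [m] are the local
    masses of [V] and [f], [pV] and [pf] their images at [x]. *)
Lemma harris_inside (a b K eps gam theta hx lh lV pV pf m : R) : 0 <= a -> 0 < hx -> 0 < b -> 1 <= K -> 0 < eps ->
  0 < theta -> lh <= lV -> 2 * K * b = eps * lh -> theta * 8 <= 1 - gam -> theta * 8 <= b -> gam * pV <= hx + b * gam + b * K * hx ->
  eps * hx * (a * lV + m) <= gam * (a * pV + pf) -> eps * hx * (a * lV - m) <= gam * (a * pV - pf) ->
  `|gam * pf - eps * hx * m| <= (1 - theta) * (a * (hx + b)).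
Proof.
move=> a0 h0 b0 K1 eps0 th0 lhV bK th1 th2 TV up dn.
have h1 : a * (gam * pV) <= a * (hx + b * gam + b * K * hx) by rewrite ler_wpM2l.
have h2 : a * hx * (eps * lh) <= a * hx * (eps * lV).
  apply: ler_wpM2l; first by apply: mulr_ge0 => //; exact: ltW.
  by apply: ler_wpM2l lhV; exact: ltW.
rewrite -bK in h2.
have bKb : b * 1 <= b * K by rewrite ler_pM2l.
have h3 : 0 <= a * (hx * (b * K - theta)).
  by apply: mulr_ge0 => //; apply: mulr_ge0; [exact: ltW|lra].
have h4 : 0 <= a * (b * ((1 - gam) - theta)).
  by apply: mulr_ge0 => //; apply: mulr_ge0; [exact: ltW|lra].
by rewrite ler_norml; apply/andP; split; lra.
Qed.

(** Where [h] is at most [eta] no minorisation is used: the Lyapunov gain and the correction along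
    [h] add up to at most [5 a b K eta], which is five eighths of the loss [a b (1 - gam)] of the
    constant part, and [theta (1 + b)] takes one more eighth. *)
Lemma harris_outside (a b K eps gam theta eta hx lh lV pV pf m : R) : 0 <= a -> 0 < hx -> 0 < b -> 0 < K -> 0 < eps ->
  0 < theta -> theta * 8 <= 1 - gam -> lV <= 2 * lh -> 2 * K * b = eps * lh -> K * eta = (1 - gam) / 8 -> eta <= 1 ->
  theta * (8 * (1 + b)) = b * (1 - gam) -> hx <= eta -> gam * pV <= hx + b * gam + b * K * hx ->
  `|gam * pf| <= gam * (a * pV) -> `|m| <= a * lV -> `|gam * pf - eps * hx * m| <= (1 - theta) * (a * (hx + b)).
Proof.
move=> a0 h0 b0 K0 eps0 th0 th1 lVh bK Keta eta1 thE he TV Tf mm.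
apply: (le_trans (ler_normB _ _)); apply: (le_trans (lerD Tf (lexx _))).
have hm : `|eps * hx * m| <= a * hx * (4 * K * b).
  rewrite normrM ger0_norm; last by rewrite mulr_ge0 ?ltW.
  apply: (@le_trans _ _ (eps * hx * (a * (2 * lh)))).
    apply: ler_wpM2l; first by apply: mulr_ge0; exact: ltW.
    by apply: (le_trans mm); apply: ler_wpM2l.
  have -> : 4 * K * b = 2 * (eps * lh) by rewrite -bK; ring.
  by rewrite le_eqVlt; apply/orP; left; apply/eqP; ring.
have h1 : a * (gam * pV) <= a * (hx + b * gam + b * K * hx) by rewrite ler_wpM2l.
have h2 : 0 <= a * (b * (K * (eta - hx))).
  by apply: mulr_ge0 => //; apply: mulr_ge0; [exact: ltW|apply: mulr_ge0; [exact: ltW|lra]].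
have h2' : a * (b * (K * eta)) = a * (b * ((1 - gam) / 8)) by rewrite Keta.
have h3 : 0 <= a * (theta * (1 - hx)).
  by apply: mulr_ge0 => //; apply: mulr_ge0; [exact: ltW|lra].
have h4 : a * (theta * (8 * (1 + b))) = a * (b * (1 - gam)) by rewrite thE.
have h5 : 0 <= a * (b * (1 - gam)) by apply: mulr_ge0 => //; apply: mulr_ge0; [exact: ltW|lra].
lra.
Qed.

(* Harris contraction: h + b is a Lyapunov weight because e^{-lam} P_1 1 <= e^{-lam} + K h, and e^{-lam} P_1
   minorizes a multiple of h on the compact set where h is bounded below. *)
Lemma harris_step : exists rho b, [/\ 0 < rho < 1, 0 < b & forall g c a, bmf g -> 0 <= a ->
  (forall x, `|g x - c * h x| <= a * (h x + b)) ->
  exists c', forall x, `|expR (- lam) * P g 1 x - c' * h x| <= rho * (a * (h x + b))].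
Proof.
have [K K1 HK] := Pb1_le gs; have K0 : 0 < K by lra.
pose gam := expR (- lam); have gam0 : 0 < gam by exact: expR_gt0.
have gam1 : gam < 1 by rewrite /gam -expR0 ltr_expR oppr_lt0.
(* The level of [h] below which terms of order [b K h x] cannot use up the loss [b (1 - gam)] of the
   constant part; [r] is then chosen so that [h] is below it for [|x| > r]. *)
pose eta := (1 - gam) / (8 * K).
have eta0 : 0 < eta by rewrite /eta divr_gt0 ?mulr_gt0 // subr_gt0.
have eta1 : eta <= 1 by rewrite /eta ler_pdivrMr ?mulr_gt0 //; lra.
have Keta : K * eta = (1 - gam) / 8 by rewrite /eta; field; exact: lt0r_neq0.
clearbody eta.
have [r r0 Hr] := gs_far eta0.
have [eps0 eps00 Heps0] := Pb_minor r0.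
have bh := gs_bmf gs.
have mh0 : 0 < loc r h.
  have [c c0 Hc] := gs_min gs r.
  apply: (@lt_le_trans _ _ (loc r (fun=> c))); first by rewrite loc_cst ?(ltW r0) // !mulr_gt0.
  apply: le_Rintegral => //; [exact: loc_int (bmf_cst c)|exact: loc_int|].
  by move=> x; rewrite /= in_itv /= => xr; apply: Hc; rewrite ler_norml.
(* The cap [K / r] ensures [b * (2 * r) <= loc r h], so that the local mass of [V] is at most twice
   that of [h]. *)
pose eps := Num.min eps0 (K / r).
have eps_gt0 : 0 < eps by rewrite /eps lt_min eps00 divr_gt0.
have epsr : eps * r <= K by rewrite -ler_pdivlMr // /eps ge_min lexx orbT.
have Heps f x : bmf f -> (forall y, 0 <= f y) -> `|x| <= r -> eps * h x * loc r f <= gam * P f 1 x.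
  move=> bf f0 xr; apply: le_trans (Heps0 f x bf f0 xr); rewrite ler_wpM2r //.
    by apply: Rintegral_ge0 => y _.
  by rewrite ler_wpM2r ?(ltW (hp x)) // /eps ge_min lexx.
clearbody eps.
(* [b] balances the two mechanisms: the mass [eps * loc r h] supplied by the minorisation is twice
   the Lyapunov gain [K b]. *)
pose b := eps * loc r h / (2 * K).
have b0 : 0 < b by rewrite /b !mulr_gt0 ?invr_gt0 ?mulr_gt0.
have bK : 2 * K * b = eps * loc r h by rewrite /b; field; exact: lt0r_neq0.
have b1 : b * (2 * r) <= loc r h.
  have -> : b * (2 * r) = loc r h * ((eps * r) / K) by rewrite /b; field; exact: lt0r_neq0.
  by rewrite ler_piMr ?(ltW mh0) // ler_pdivrMr // mul1r.
clearbody b.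
pose theta := b * (1 - gam) / (8 * (1 + b)).
have b10 : 0 < 1 + b by lra.
have th0 : 0 < theta by rewrite /theta !mulr_gt0 ?invr_gt0 ?mulr_gt0 ?subr_gt0.
have thE : theta * (8 * (1 + b)) = b * (1 - gam) by rewrite /theta divfK // mulf_neq0 // lt0r_neq0.
clearbody theta.
have th1 : theta * 8 <= 1 - gam.
  have : theta * 8 * b <= b * (1 - gam) by lra.
  by rewrite [_ * b]mulrC ler_pM2l.
have th2 : theta * 8 <= b.
  have : 0 <= theta * b by rewrite mulr_ge0 ?ltW.
  have : 0 <= b * gam by rewrite mulr_ge0 ?ltW.
  lra.
exists (1 - theta), b; split => //; first by apply/andP; split; lra.
move=> g c a bg a0 gca.
pose V x := h x + b; have bV : bmf V by apply: bmfD => //; exact: bmf_cst.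
have V0 x : 0 <= V x by rewrite /V; have := hp x; lra.
pose f x := g x - c * h x.
have bf : bmf f by apply: bmfB => //; exact: bmfZ.
have T1 : forall x, gam * P (fun=> 1) 1 x <= gam + K * h x.
  move=> x; apply: (@le_trans _ _ (gam * (1 + K * h x))); first by rewrite ler_wpM2l ?(ltW gam0).
  rewrite mulrDr mulr1 lerD2l ler_piMl ?(ltW gam1) // mulr_ge0 ?ltW //; exact: hp.
have TV x : gam * P V 1 x <= h x + b * gam + b * K * h x.
  have -> : P V 1 x = P h 1 x + P (fun=> b * 1) 1 x.
    by rewrite -(PbD bc bs x bh (bmf_cst (b * 1)) ler01); congr (Pb _ _ 1 x); apply/funext => y; rewrite mulr1.
  rewrite (PbZ bc bs b x (bmf_cst 1) ler01) (Pb_gs gs x ler01) mulr1 mulrDr mulrA -expRD addNr expR0 mul1r.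
  rewrite -addrA lerD2l mulrCA; have := T1 x => h1.
  have := ler_wpM2l (ltW b0) h1; rewrite mulrDr mulrA; lra.
have aV x : `|f x| <= a * V x by exact: gca.
have baV : bmf (fun x => a * V x) by exact: bmfZ.
have TaV x : P (fun x => a * V x) 1 x = a * P V 1 x by apply: PbZ.
pose m := loc r f.
have mm : `|m| <= a * loc r V.
  rewrite -locZ // ler_norml -locN //; apply/andP; split; apply: loc_le => //; try exact: bmfN.
    by move=> x; have := aV x; rewrite ler_norml => /andP[].
  by move=> x; have := aV x; rewrite ler_norml => /andP[].
have mV : loc r h <= loc r V <= 2 * loc r h.
  have bcb := bmf_cst b; rewrite /V locD // loc_cst ?(ltW r0) //.
  have h1 : 0 <= b * (2 * r) by rewrite !mulr_ge0 ?ltW.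
  by rewrite lerDl h1 /= [leRHS]mulr_natl mulr2n lerD2l.
have Tf x : `|gam * P f 1 x| <= gam * (a * P V 1 x).
  rewrite normrM (gtr0_norm gam0) ler_wpM2l ?(ltW gam0) // -TaV ler_norml.
  rewrite lerNl -(PbN bc bs x bf ler01); apply/andP; split; apply: (Pb_le bc bs) => //; try exact: bmfN.
    by move=> y; have := aV y; rewrite ler_norml lerNl => /andP[].
  by move=> y; have := aV y; rewrite ler_norml => /andP[].
have hx0 x := hp x.
(* The minorised part of [f] is transferred to the coefficient of [h]. *)
exists (c + eps * m) => x.
have -> : expR (- lam) * P g 1 x - (c + eps * m) * h x = gam * P f 1 x - eps * h x * m.
  rewrite /f (PbB bc bs x bg (bmfZ c bh) ler01) (PbZ bc bs c x bh ler01) (Pb_gs gs x ler01) mulr1 mulrBr.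
  have -> : gam * (c * (expR lam * h x)) = c * h x.
    by rewrite /gam expRN; field; rewrite lt0r_neq0 // expR_gt0.
  by rewrite /gam; move: (P g 1 x) => ?; ring.
have [xr|xr] := leP `|x| r.
  have up : eps * h x * (a * loc r V + m) <= gam * (a * P V 1 x + P f 1 x).
    rewrite -TaV -(PbD bc bs x baV bf ler01) -locZ // -locD //; apply: Heps => //; first exact: bmfD.
    by move=> y; rewrite addrC -lerBlDr sub0r; have := aV y; rewrite ler_norml => /andP[].
  have dn : eps * h x * (a * loc r V - m) <= gam * (a * P V 1 x - P f 1 x).
    rewrite -TaV -(PbB bc bs x baV bf ler01) -locZ // -locN // -locD //; last exact: bmfN.
    apply: Heps => //; first exact: bmfB.
    by move=> y; rewrite subr_ge0; have := aV y; rewrite ler_norml => /andP[].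
  exact: (harris_inside a0 (hp x) b0 K1 eps_gt0 th0 (proj1 (andP mV)) bK th1 th2 (TV x) up dn).
exact: (harris_outside a0 (hp x) b0 K0 eps_gt0 th0 th1 (proj2 (andP mV)) bK Keta eta1 thE (ltW (Hr x xr)) (TV x) (Tf x) mm).
Qed.

Lemma gs_ip_h : ip h h = 1.
Proof. Transparent ip. exact: (gs_norm gs). Opaque ip. Qed.

(** [harris_step] gives geometric convergence towards some multiple of [h]. That multiple is
    identified afterwards: the pairing with [h] is multiplied exactly by [e^{lam t}] and
    [<h, h> = 1], so it differs from [<h, g>] by an error of the same geometric order. *)
Lemma Pb_ergodic : exists l0 C, [/\ l0 < lam, 0 <= C & forall g M t x, bmf g -> (forall y, `|g y| <= M) -> 0 <= t ->
  `|P g t x - expR (lam * t) * ip h g * h x| <= C * M * expR (l0 * t)].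
Proof.
have [rho [b [/andP[rho0 rho1] b0 step]]] := harris_step.
have [B B0 HB] := Pb_abs bc bs; have ih := gs_ibmf gs; have bh := gs_bmf gs.
have [_ [H hH]] := bh; have H0 : 0 <= H by exact: le_trans (hH 0).
have iter n g M : bmf g -> 0 <= M -> (forall y, `|g y| <= M) -> exists c, forall x,
    `|expR (- lam * n%:R) * P g n%:R x - c * h x| <= rho ^+ n * (M / b * (h x + b)).
  move=> bg M0 gM; elim: n => [|n [c Hc]].
    exists 0 => x; rewrite mulr0 expR0 mul1r mul0r subr0 expr0 mul1r (PbE bc bs x bg (lexx 0)).
    rewrite heat_le0 // [duh _ 0 x](_ : _ = 0) ?addr0.
      apply: (le_trans (gM x)); rewrite mulrDr divfK ?lt0r_neq0 // lerDr mulr_ge0 ?divr_ge0 ?(ltW b0) // ltW //.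
    Transparent duh tint. rewrite /duh /tint set_itv1 Rintegral_set1. Opaque duh tint.
    by [].
  have bg' : bmf (fun x => expR (- lam * n%:R) * P g n%:R x) by apply: bmfZ; exact: bmf_Pb.
  have a0 : 0 <= rho ^+ n * (M / b) by apply: mulr_ge0; [exact: exprn_ge0 (ltW rho0)|exact: divr_ge0 M0 (ltW b0)].
  have [|c' Hc'] := step _ c _ bg' a0.
    by move=> x; rewrite -mulrA; exact: Hc.
  exists c' => x; have := Hc' x.
  rewrite (PbZ bc bs _ _ (bmf_Pb bc bs _ bg) ler01) -(Pb_semigroup bc bs) ?ler01 // mulrA -expRD exprS -!mulrA.
  have -> : - lam + - lam * n%:R = - lam * n.+1%:R by rewrite -natr1; ring.
  by rewrite natr1.
have [Ih0] : exists2 Ih, 0 <= Ih & ip h (fun x => h x + b) <= Ih.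
  exists `|ip h (fun x => h x + b)|; [exact: normr_ge0|exact: ler_norm].
move=> Ih00 HIh.
pose C := expR B * (1 / b) * (H + b + Ih0 * H).
have C0 : 0 <= C by rewrite /C !mulr_ge0 ?expR_ge0 ?invr_ge0 ?addr_ge0 ?mulr_ge0 // ltW.
have erg n g M x : bmf g -> 0 <= M -> (forall y, `|g y| <= M) ->
    `|P g n%:R x - expR (lam * n%:R) * ip h g * h x| <= expR (lam * n%:R) * (rho ^+ n * (M / b * (H + b + Ih0 * H))).
  move=> bg M0 gM; have [c Hc] := iter n g M bg M0 gM.
  have bV : bmf (fun x => h x + b) by apply: bmfD => //; exact: bmf_cst.
  have rb0 : 0 <= rho ^+ n * (M / b) by apply: mulr_ge0; [exact: exprn_ge0 (ltW rho0)|exact: divr_ge0 M0 (ltW b0)].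
  have bP := bmf_Pb bc bs n%:R bg.
  have Hc2 y : `|expR (- lam * n%:R) * P g n%:R y - c * h y| <= rho ^+ n * (M / b) * (h y + b).
    by rewrite -[leRHS]mulrA; exact: Hc.
  have dc : `|ip h g - c| <= rho ^+ n * (M / b) * Ih0.
    have E : ip h g - c = ip h (fun x => expR (- lam * n%:R) * P g n%:R x - c * h x).
      rewrite ipB //; [|exact: bmfZ|exact: bmfZ].
      rewrite ipZ // ipZ // gs_ip_h (ip_Pb gs) // mulrA -expRD mulNr addNr expR0 mul1r mulr1 //.
    rewrite E; apply: le_trans (ler_wpM2l rb0 HIh); rewrite -ipZ //.
    have bq : bmf (fun x => expR (- lam * n%:R) * P g n%:R x - c * h x).
      by apply: bmfB; exact: bmfZ.
    have bw : bmf (fun x => rho ^+ n * (M / b) * (h x + b)) by exact: bmfZ.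
    have hp' y : 0 <= h y by exact: ltW (hp y).
    rewrite ler_norml; apply/andP; split.
      rewrite lerNl -mulN1r -ipZ //; apply: ip_le => //; first exact: bmfZ.
      by move=> y; have := Hc2 y; rewrite ler_norml => /andP[]; lra.
    by apply: ip_le => // y; have := Hc2 y; rewrite ler_norml => /andP[].
  have -> : P g n%:R x - expR (lam * n%:R) * ip h g * h x =
     expR (lam * n%:R) * ((expR (- lam * n%:R) * P g n%:R x - c * h x) - (ip h g - c) * h x).
    have e1 : expR (lam * n%:R) * expR (- lam * n%:R) = 1 by rewrite -expRD mulNr addrN expR0.
    rewrite mulrBr mulrBr mulrA e1; move: (P g n%:R x) (ip h g) => *; ring.
  rewrite normrM (ger0_norm (expR_ge0 _)) ler_wpM2l ?expR_ge0 //.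
  apply: (le_trans (ler_normB _ _)); rewrite mulrA mulrDr; apply: lerD.
    apply: (le_trans (Hc x)); rewrite mulrA ler_wpM2l // lerD2r.
    by apply: le_trans (hH x); exact: ler_norm.
  by rewrite normrM [leRHS]mulrA; apply: ler_pM.
(* The discrete factor [rho ^ n e^{lam n}] is [e^{l0 n}]; the constant [e^{|l0|}] pays for the
   fractional part of [t], whatever the sign of [l0]. *)
pose l0 := lam + ln rho.
exists l0, (C * expR `|l0|); split.
- by rewrite /l0 gtrDl ln_lt0 // rho0.
- by rewrite mulr_ge0 ?expR_ge0.
move=> g M t x bg gM t0; have M0 : 0 <= M by exact: le_trans (gM 0).
pose n := Num.truncn t; pose r := t - n%:R.
have /andP[nt tn] := truncn_itv t0; rewrite -/n in nt tn.
have r0 : 0 <= r by rewrite subr_ge0.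
have r1 : r <= 1 by move: tn; rewrite -natr1 /r; lra.
have tE : t = r + n%:R by rewrite /r subrK.
have -> : P g t x = P (P g r) n%:R x by rewrite {1}tE (Pb_semigroup bc bs).
have bg' := bmf_Pb bc bs r bg.
have gM' y : `|P g r y| <= expR B * M.
  apply: (le_trans (HB g r y M bg gM r0)); rewrite ler_wpM2r // ler_expR -[leRHS]mulr1 ler_wpM2l ?(ltW B0) //.
have := erg n _ _ x bg' (mulr_ge0 (expR_ge0 B) M0) gM'.
rewrite (ip_Pb gs) // mulrA -expRD -mulrDr [n%:R + r]addrC -tE => /le_trans; apply.
have -> : rho ^+ n = expR (ln rho * n%:R) by rewrite mulrC expRM_natl lnK // posrE.
have e3 : expR (lam * n%:R) * expR (ln rho * n%:R) = expR (l0 * n%:R) by rewrite -expRD -mulrDl.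
rewrite [leLHS](_ : _ = C * M * expR (l0 * n%:R)); last by rewrite -e3 /C; ring.
rewrite [leRHS](_ : _ = C * M * (expR `|l0| * expR (l0 * t))); last by ring.
rewrite ler_wpM2l ?(mulr_ge0 C0 M0) // -expRD ler_expR.
have -> : l0 * n%:R = l0 * t - l0 * r by rewrite /r; ring.
rewrite addrC lerD2r -mulNr; apply: (@le_trans _ _ (`|l0| * r)).
  by rewrite ler_wpM2r // -normrN ler_norm.
by rewrite ler_piMr.
Qed.

End Ergodicity.

(** * The moving test function under the linear flow *)

Section Shift.
Variable R : realType.
Notation leb := (@lebesgue_measure R).

Definition shiftf (a : R) (f : R -> R) (x : R) := f (x + a).

Lemma bmf_shiftf a f : bmf f -> bmf (shiftf a f).
Proof.
move=> [mf [M fM]]; split; last by exists M => x; exact: fM.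
by apply: measurableT_comp => //; exact: measurable_funD.
Qed.

Transparent heat.
Lemma heat_shiftf t a f x : heat t (shiftf a f) x = heat t f (x + a).
Proof. by apply: eq_Rintegral => z _; rewrite /shiftf addrAC. Qed.
Opaque heat.

Variables (beta : R -> R) (lam : R) (h : R -> R).
Hypothesis gs : ground_state beta lam h.
Variables (s : R) (f : R -> R) (Mf : R).
Hypotheses (s1 : s * s = 1) (bf : bmf f) (f0 : forall x, 0 <= f x) (fM : forall x, Mf < `|x| -> f x = 0).
Let k := decay lam.

Definition speed := Num.sqrt (lam / 2).

(* front_mass is the integral of f against eta_+ (s = 1) or eta_- (s = -1). *)
Definition front_mass := gs_coef beta lam h s * \int[leb]_y (f y * expR (s * k * y)).

Let s_abs : `|s| = 1.
Proof.
have : `|s| * `|s| = 1 by rewrite -normrM s1 normr1.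
by rewrite -expr2 => /eqP; rewrite sqrp_eq1 // => /eqP.
Qed.

Lemma speed_gt0 : 0 < speed.
Proof. by rewrite sqrtr_gt0 divr_gt0 // (gs_lam gs). Qed.

(** The balance that fixes the speed: moving by [speed * t] into the tail of [h] costs exactly the
    growth factor [e^{lam t}]. *)
Lemma speed_decay : k * speed = lam.
Proof.
rewrite /k /decay /speed -sqrtrM ?mulr_ge0 ?(ltW (gs_lam gs)) //.
rewrite (_ : 2 * lam * (lam / 2) = lam ^+ 2); last by field.
by rewrite sqrtr_sqr gtr0_norm // (gs_lam gs).
Qed.

Definition front t := shiftf (s * speed * t) f.

Lemma bmf_front t : bmf (front t).
Proof. exact: bmf_shiftf. Qed.

Lemma front_ge0 t x : 0 <= front t x.
Proof. exact: f0. Qed.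

Lemma front_weight_integrable : leb.-integrable setT (EFin \o (fun y => f y * expR (s * k * y))).
Proof.
have [mf [K fK]] := bf; have k0 := decay_gt0 gs.
have K0 : 0 <= K by exact: le_trans (fK 0).
apply: (@integrable_le R _ _ leb _ _ (fun y => K * expR (2 * k * `|Mf|) * expR (- (k * `|y|)))) => //.
- by apply: measurable_funM => //; apply: measurableT_comp => //; exact: measurable_funM.
- by apply: integrable_scale => //; exact: integrable_laplace.
move=> y _; have [yM|yM] := ltP Mf `|y|.
  by rewrite fM // mul0r normr0 !mulr_ge0 ?expR_ge0.
rewrite normrM (ger0_norm (expR_ge0 _)) -[leRHS]mulrA; apply: ler_pM => //; rewrite ?expR_ge0 //.
rewrite -expRD ler_expR.
have h1 : s * k * y <= k * `|y|.
  by apply: (le_trans (ler_norm _)); rewrite !normrM s_abs mul1r gtr0_norm.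
have h2 : k * `|y| <= k * `|Mf|.
  rewrite ler_wpM2l ?(ltW k0) //; apply: (le_trans yM); exact: ler_norm.
lra.
Qed.

(** For large [t] the support of the front lies where [gs_tail] holds, so the pairing is given by a
    formula without error term. *)
Lemma ip_front : exists t0, forall t, t0 <= t -> ip h (front t) = expR (- (lam * t)) * front_mass.
Proof.
have [M M0 HM] := gs_tail gs s1; have c0 := speed_gt0.
exists ((M + `|Mf| + 1) / speed) => t tt0.
have ct : M + `|Mf| + 1 <= speed * t by rewrite mulrC -ler_pdivrMr.
Transparent ip. rewrite /ip. Opaque ip.
have mf := bf.1.
have -> : \int[leb]_x (h x * front t x) = \int[leb]_y (h (y - s * speed * t) * f y).
  rewrite -[RHS](Rint_shift (s * speed * t)).
    by apply: eq_Rintegral => x _; rewrite addrK.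
  apply: measurable_funM => //; apply: measurableT_comp; first exact: gs_meas gs.
  exact: measurable_funB.
have i := front_weight_integrable.
rewrite /front_mass mulrCA mulrA -RintegralZl //; apply: eq_Rintegral => y _.
have [yM|yM] := ltP Mf `|y|; first by rewrite fM // mul0r !mulr0.
rewrite HM.
  have -> : s * decay lam * (y - s * speed * t) = s * k * y - (s * s) * (k * speed) * t by rewrite /k; ring.
  rewrite s1 speed_decay mul1r expRD; move: (expR _) (expR _) (f y) => *; ring.
rewrite mulrBr !mulrA s1 mul1r; have : s * y <= `|Mf|.
  apply: (le_trans (ler_norm _)); rewrite normrM s_abs mul1r; apply: (le_trans yM); exact: ler_norm.
lra.
Qed.

(** By compact support, [f] is below [K e^{a |Mf|} e^{- a s y}] for every [a > 0]; the exponential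
    moment of the heat flow and the shift by [s * speed * t] give the two exponents. The parameter
    [a] stays free until [l] is chosen. *)
Lemma heat_front_exp (a : R) : 0 < a -> exists2 C, 0 <= C & forall t r x, 0 <= r ->
  heat r (front t) x <= C * expR (a * `|x|) * expR (a ^+ 2 / 2 * r - a * speed * t).
Proof.
move=> a0; have [mf [K fK]] := bf; have K0 : 0 <= K by exact: le_trans (fK 0).
exists (K * expR (a * `|Mf|)); first by rewrite mulr_ge0 ?expR_ge0.
move=> t r x r0; rewrite heat_shiftf.
have fe y : `|f y| <= K * expR (a * `|Mf|) * expR (- (a * s) * y).
  have [yM|yM] := ltP Mf `|y|; first by rewrite fM // normr0 !mulr_ge0 ?expR_ge0.
  rewrite -mulrA -expRD; apply: (le_trans (fK y)); rewrite ler_peMr // -expR0 ler_expR.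
  have : s * y <= `|Mf|.
    apply: (le_trans (ler_norm _)); rewrite normrM s_abs mul1r; apply: (le_trans yM); exact: ler_norm.
  move=> h1; have : a * (s * y) <= a * `|Mf| by rewrite ler_wpM2l // ltW.
  lra.
apply: (le_trans (ler_norm _)); apply: (le_trans (heat_exp_bound (x + s * speed * t) r0 bf fe)).
rewrite -[leRHS]mulrA -expRD ler_wpM2l ?mulr_ge0 ?expR_ge0 // ler_expR.
have -> : - (a * s) * (x + s * speed * t) + (- (a * s)) ^+ 2 * r / 2 =
  - (a * (s * x)) - a * speed * t * (s * s) + a ^+ 2 / 2 * r * (s * s) by field.
rewrite s1 !mulr1; have : - (s * x) <= `|x|.
  by apply: (le_trans (ler_norm _)); rewrite normrN normrM s_abs mul1r.
move=> h1; have : a * - (s * x) <= a * `|x| by rewrite ler_wpM2l // ltW.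
rewrite mulrN; lra.
Qed.

Let bc := gs_bcont gs.
Let bs := gs_bsupp gs.
Let lam0 := gs_lam gs.
Let hp := gs_pos gs.
Notation P := (Pb beta).

(** In one unit of time the potential acts only on the support of [beta], where [heat_front_exp]
    controls the flow; [duh_gs_le] and the boundedness of [h] make the bound uniform in space. *)
Lemma Pb_front_step (a : R) : 0 < a -> exists2 C, 0 <= C & forall t n r x, 0 <= r <= 1 ->
  `|P (heat n%:R (front t)) r x - heat r (heat n%:R (front t)) x| <=
    C * expR (a ^+ 2 / 2 * n%:R - a * speed * t).
Proof.
move=> a0; have [C1 C10 HC1] := heat_front_exp a0.
have [B B0 HB] := Pb_heat_bounds bc bs; have [m m0 Hm] := duh_gs_le gs.
have [Kb Kb0 bK] := Cc_bounded bc bs; have [Mb bM] := bs.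
have [C2 C20 HC2] := gs_dom gs bK bM; have [_ [H hH]] := gs_bmf gs.
have H0 : 0 <= H by exact: le_trans (hH 0).
pose C3 := C2 * (expR B * (C1 * expR (a * `|Mb|) * expR (a ^+ 2 / 2))).
have C30 : 0 <= C3 by rewrite /C3 !mulr_ge0 ?expR_ge0.
exists (C3 * (expR m * H)) => [|t n r x /andP[r0 r1]]; first by rewrite !mulr_ge0 ?expR_ge0.
have bft := bmf_front t; have bg := bmf_heat n%:R bft; have g0 y : 0 <= heat n%:R (front t) y.
  by apply: heat_ge0 => z; exact: front_ge0.
have lG := lbm_betaM bc bs (lbm_Pb bc bs bg).
rewrite (PbE bc bs x bg r0) addrAC subrr add0r.
set e := expR (a ^+ 2 / 2 * n%:R - a * speed * t); have e0 : 0 <= e by exact: expR_ge0.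
apply: (@le_trans _ _ (C3 * e * (expR (m * r) * h x))).
  apply: Hm => //; first by rewrite mulr_ge0.
  move=> q y /andP[q0 qr]; have q1 := le_trans qr r1.
  have [yM|yM] := ltP Mb `|y|.
    by rewrite bM // mul0r normr0 !mulr_ge0 // ltW.
  have -> : C3 * e * h y = C2 * h y * (expR B * (C1 * expR (a * `|Mb|) * expR (a ^+ 2 / 2) * e)) by rewrite /C3; ring.
  rewrite normrM; apply: ler_pM => //.
  have /andP[_ h2] := HB _ q y bg g0 q0.
  rewrite ger0_norm; last exact: Pb_ge0.
  apply: (le_trans h2); apply: ler_pM; rewrite ?expR_ge0 ?heat_ge0 //.
    by rewrite ler_expR -[leRHS]mulr1 ler_wpM2l // ltW.
  rewrite heat_heat //; apply: (le_trans (HC1 _ _ _ _)); first exact: addr_ge0.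
  rewrite -!mulrA ler_wpM2l // -!expRD ler_expR /e.
  have h3 : a * `|y| <= a * `|Mb|.
    rewrite ler_wpM2l ?(ltW a0) //; apply: (le_trans yM); exact: ler_norm.
  have h4 : a ^+ 2 / 2 * q <= a ^+ 2 / 2 * 1 by rewrite ler_wpM2l // divr_ge0 // sqr_ge0.
  rewrite mulrDr; lra.
rewrite -mulrA [e * _]mulrC mulrA ler_wpM2r // ler_wpM2l //; apply: ler_pM; rewrite ?expR_ge0 ?(ltW (hp _)) //.
  by rewrite ler_expR -[leRHS]mulr1 ler_wpM2l // ltW.
by apply: le_trans (hH x); exact: ler_norm.
Qed.

(** The difference of the two flows is built up in unit steps. Each creates a term of size
    [e^{l n - a speed t}] by [Pb_front_step], to which [Pb_ergodic] applies from then on; because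
    [l0 < l], the accumulated ergodic errors behave like a geometric sum dominated by its latest
    terms. *)
Lemma Pb_front_expansion : exists a C, [/\ 0 < a, lam < a ^+ 2, a ^+ 2 / 2 < a * speed, 0 <= C &
  forall t r x, 0 <= r -> `|P (front t) r x - heat r (front t) x -
     h x * (expR (lam * r) * ip h (front t) - ip h (heat r (front t)))| <= C * expR (a ^+ 2 / 2 * r - a * speed * t)].
Proof.
have lam00 := gs_lam gs.
have [l0 [Ce [l0lam Ce0 erg]]] := Pb_ergodic gs.
pose p := Num.max l0 (lam / 2).
have pl : p < lam by rewrite /p gt_max l0lam /=; lra.
have p0 : l0 <= p by rewrite /p le_max lexx.
have p2 : lam / 2 <= p by rewrite /p le_max lexx orbT.
clearbody p.
(* Three demands on [l], the future [a ^ 2 / 2]: above [l0] for the geometric sum, above [lam / 2]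
   so that squared errors grow faster than [e^{lam r}], below [lam] so that
   [a * speed = sqrt (l lam)] exceeds [l]. *)
pose l := (lam + p) / 2; have [l1 l2 l3] : [/\ l0 < l, lam < 2 * l & l < lam] by rewrite /l; split; lra.
clearbody l.
have l4 : 0 < l by lra.
pose a := Num.sqrt (2 * l); have a0 : 0 < a by rewrite sqrtr_gt0 mulr_gt0.
have a2 : a ^+ 2 = 2 * l by rewrite sqr_sqrtr // mulr_ge0 // ltW.
have a2l : a ^+ 2 / 2 = l by rewrite a2; field.
have al : l < a * speed.
  rewrite /a /speed -sqrtrM ?mulr_ge0 ?(ltW l4) //.
  rewrite -[X in X < _]gtr0_norm // -sqrtr_sqr ltr_sqrt; last by rewrite !mulr_gt0 ?invr_gt0.
  have -> : 2 * l * (lam / 2) = l * lam by field.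
  by rewrite expr2 ltr_pM2l.
clearbody a.
have [C2 C20 HD] := Pb_front_step a0; rewrite a2l in HD.
have ih := gs_ibmf gs; have [_ [H hH]] := gs_bmf gs; have H0 : 0 <= H by exact: le_trans (hH 0).
have bft t := bmf_front t.
pose z n t x := P (front t) n%:R x - heat n%:R (front t) x.
have bz n t : bmf (z n t) by apply: bmfB; [exact: bmf_Pb|exact: bmf_heat].
pose D n t r x := P (heat n%:R (front t)) r x - heat r (heat n%:R (front t)) x.
have bD n t r : bmf (D n t r).
  by apply: bmfB; [apply: bmf_Pb => //; exact: bmf_heat|apply: bmf_heat; exact: bmf_heat].
have zS n t r x : 0 <= r -> P (front t) (n%:R + r) x - heat (n%:R + r) (front t) x = P (z n t) r x + D n t r x.
  move=> r0; rewrite /z /D (Pb_semigroup bc bs) // (PbB bc bs x (bmf_Pb bc bs n%:R (bft t)) (bmf_heat n%:R (bft t)) r0).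
  by rewrite heat_heat // [r + _]addrC; move: (P _ r x) (P _ r x) (heat _ _ x) => *; ring.
(* The solution of [A e^{l0} + Ce C2 = A e^l], the recursion for the error constant over one
   step. *)
pose A := Ce * C2 / (expR l - expR l0).
have dl : 0 < expR l - expR l0 by rewrite subr_gt0 ltr_expR.
have A0 : 0 <= A by rewrite /A divr_ge0 ?mulr_ge0 // ltW.
have AE : A * expR l0 + Ce * C2 = A * expR l by rewrite /A; field; exact: lt0r_neq0.
clearbody A.
(* The extra time [m] belongs to the induction, since the contributions of earlier steps keep
   evolving under [P]. *)
have claim n t m x : 0 <= m -> `|P (z n t) m x - expR (lam * m) * ip h (z n t) * h x| <=
    A * expR (l0 * m) * expR (l * n%:R - a * speed * t).
  elim: n m x => [|n IH] m x m0.
    have z0 y : z 0%N t y = 0.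
      rewrite /z (PbE bc bs y (bft t) (lexx 0)) addrAC subrr add0r.
      Transparent duh tint. rewrite /duh /tint set_itv1 Rintegral_set1. Opaque duh tint.
      by [].
    have -> : z 0%N t = (fun y => 0 * front t y) by apply/funext => y; rewrite z0 mul0r.
    rewrite (PbZ bc bs _ _ (bft t) m0) ipZ // !mul0r mulr0 mul0r subrr normr0.
    by rewrite !mulr_ge0 ?expR_ge0.
  have zE : z n.+1 t = (fun y => P (z n t) 1 y + D n t 1 y).
    by apply/funext => y; rewrite -zS // natr1.
  have bPz := bmf_Pb bc bs 1 (bz n t).
  rewrite zE (PbD bc bs x bPz (bD n t 1) m0) -(Pb_semigroup bc bs x (bz n t) ler01 m0).
  rewrite ipD // (ip_Pb gs (bz n t) ler01).
  have -> : P (z n t) (1 + m) x + P (D n t 1) m x - expR (lam * m) * (expR (lam * 1) * ip h (z n t) + ip h (D n t 1)) * h x =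
     (P (z n t) (1 + m) x - expR (lam * (1 + m)) * ip h (z n t) * h x) +
     (P (D n t 1) m x - expR (lam * m) * ip h (D n t 1) * h x).
    rewrite [lam * (1 + m)]mulrDr expRD; move: (P _ _ x) (P _ _ x) (ip _ _) (ip _ _) => *; ring.
  apply: (le_trans (ler_normD _ _)).
  have h1 := IH (1 + m) x (addr_ge0 ler01 m0).
  have i01 : (0 : R) <= 1 <= (1 : R) by rewrite lexx ler01.
  have h2 := erg _ _ m x (bD n t 1) (fun y => HD t n 1 y i01) m0.
  apply: (le_trans (lerD h1 h2)).
  set q := expR (l * n%:R - a * speed * t).
  have -> : expR (l * n.+1%:R - a * speed * t) = expR l * q by rewrite -expRD -natr1; congr expR; ring.
  have -> : expR (l0 * (1 + m)) = expR l0 * expR (l0 * m) by rewrite -expRD; congr expR; ring.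
  rewrite [leRHS](_ : _ = (A * expR l) * (expR (l0 * m) * q)); last by ring.
  by rewrite -AE le_eqVlt; apply/orP; left; apply/eqP; ring.
pose Ih := \int[leb]_x `|h x|.
have Ih0 : 0 <= Ih by apply: Rintegral_ge0 => x _.
pose C := A * expR `|l0| + C2 * (1 + H * Ih).
exists a, C; split => //; first by rewrite a2.
- by rewrite a2l.
- by rewrite /C addr_ge0 ?mulr_ge0 ?expR_ge0 // addr_ge0 ?mulr_ge0.
move=> t tau x t0; rewrite a2l.
pose n := Num.truncn tau; pose r := tau - n%:R.
have /andP[nt tn] := truncn_itv t0; rewrite -/n in nt tn.
have r0 : 0 <= r by rewrite subr_ge0.
have r1 : r <= 1 by move: tn; rewrite -natr1 /r; lra.
have tE : tau = n%:R + r by rewrite /r addrC subrK.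
have r01 : 0 <= r <= 1 by rewrite r0.
clearbody r.
have E1 : P (front t) tau x - heat tau (front t) x = P (z n t) r x + D n t r x by rewrite tE zS.
have E2 : expR (lam * tau) * ip h (front t) - ip h (heat tau (front t)) = expR (lam * r) * ip h (z n t) + ip h (D n t r).
  rewrite -(ip_Pb gs (bft t) t0) -(ip_Pb gs (bz n t) r0) -ipB //; [|exact: bmf_Pb|exact: bmf_heat].
  rewrite -ipD //; last exact: bmf_Pb.
  apply: (congr1 (ip h)); apply/funext => y; rewrite tE; exact: (zS n t r y r0).
rewrite E1 E2.
have h1 := claim n t r x r0.
have h2 := HD t n r x r01.
have h3 := ip_abs ih (bD n t r) (fun y => HD t n r y r01).
have -> : P (z n t) r x + D n t r x - h x * (expR (lam * r) * ip h (z n t) + ip h (D n t r)) =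
  (P (z n t) r x - expR (lam * r) * ip h (z n t) * h x) + D n t r x - h x * ip h (D n t r).
  by move: (P _ _ x) (ip _ _) (ip _ _) (D _ _ _ _) => *; ring.
apply: (le_trans (ler_normB _ _)); apply: (le_trans (lerD (ler_normD _ _) (lexx _))).
rewrite normrM.
have h4 : `|h x| * `|ip h (D n t r)| <= H * (C2 * expR (l * n%:R - a * speed * t) * Ih) by apply: ler_pM.
have h5 : A * expR (l0 * r) * expR (l * n%:R - a * speed * t) <= A * expR `|l0| * expR (l * n%:R - a * speed * t).
  rewrite ler_wpM2r ?expR_ge0 // ler_wpM2l // ler_expR.
  by apply: (le_trans (ler_norm _)); rewrite normrM (ger0_norm r0) ler_piMr.
apply: (@le_trans _ _ (C * expR (l * n%:R - a * speed * t))).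
  apply: (le_trans (lerD (lerD h1 h2) h4)); rewrite [leRHS](_ : _ = A * expR `|l0| * expR (l * n%:R - a * speed * t) +
      C2 * expR (l * n%:R - a * speed * t) + H * (C2 * expR (l * n%:R - a * speed * t) * Ih)); last by rewrite /C; ring.
  by rewrite !lerD2r.
rewrite ler_wpM2l //; first by rewrite /C addr_ge0 ?mulr_ge0 ?expR_ge0 // addr_ge0 ?mulr_ge0.
by rewrite ler_expR lerD2r ler_wpM2l // ltW.
Qed.

End Shift.

(** * Linear combinations of solutions *)

Section SolComb.
Variable R : realType.

Lemma sol_comb (a b : R) (c g1 g2 v1 v2 : R -> R -> R) : lbm c -> lbm g1 -> lbm g2 -> lbm v1 -> lbm v2 ->
  is_sol (fun=> 0) (fun t x => c t x * v1 t x + g1 t x) v1 ->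
  is_sol (fun=> 0) (fun t x => c t x * v2 t x + g2 t x) v2 ->
  is_sol (fun=> 0) (fun t x => c t x * (a * v1 t x + b * v2 t x) + (a * g1 t x + b * g2 t x))
    (fun t x => a * v1 t x + b * v2 t x).
Proof.
move=> lc l1 l2 m1 m2 s1 s2 t x t0.
have k1 := lbmD (lbmM lc m1) l1; have k2 := lbmD (lbmM lc m2) l2.
have E : duh (fun t x => c t x * (a * v1 t x + b * v2 t x) + (a * g1 t x + b * g2 t x)) t x =
   a * duh (fun t x => c t x * v1 t x + g1 t x) t x + b * duh (fun t x => c t x * v2 t x + g2 t x) t x.
  rewrite -(duhZ a t x k1) -(duhZ b t x k2) -(duhD t x (lbmZ a k1) (lbmZ b k2)).
  by apply: eq_duh => r y _; ring.
rewrite (s1 t x t0) (s2 t x t0) E heat_cst !add0r; reflexivity.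
Qed.

End SolComb.

(** * Asymptotics of the nonlinear equation *)

Section Asymptotics.
Variable R : realType.
Notation leb := (@lebesgue_measure R).
Notation meas := {measure set R -> \bar R}.
Variables (beta : R -> R) (lam : R) (h : R -> R).
Hypothesis gs : ground_state beta lam h.
Variables (s : R) (f : R -> R) (Mf : R).
Hypotheses (s1 : s * s = 1) (bf : bmf f) (f0 : forall x, 0 <= f x) (fM : forall x, Mf < `|x| -> f x = 0).
Let bc := gs_bcont gs.
Let bs := gs_bsupp gs.
Let hp := gs_pos gs.
Notation P := (Pb beta).
Notation ft := (front lam s f).
Notation I := (front_mass beta lam h s f).
Notation c := (speed lam).

Let lam0 : 0 < lam. Proof. exact: gs_lam gs. Qed.

Lemma front_mass_ge0 : 0 <= I.
Proof.
rewrite /front_mass mulr_ge0 ?(ltW (gs_coef_gt0 gs s1)) //.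
by apply: Rintegral_ge0 => y _; rewrite mulr_ge0 ?expR_ge0.
Qed.

Lemma heat_front_decay : exists2 C, 0 <= C & forall t r x, 0 < r -> heat r (ft t) x <= C / Num.sqrt r.
Proof.
have [mf [K fK]] := bf; have K0 : 0 <= K by exact: le_trans (fK 0).
exists (K * (`|Mf| - - `|Mf|)); first by rewrite mulr_ge0 // opprK addr_ge0.
move=> t r x r0; rewrite heat_shiftf; apply: (le_trans (ler_norm _)).
apply: heat_decay => //; first by have := normr_ge0 Mf; lra.
move=> y; rewrite -ler_norml -ltNge => yM; apply: fM; apply: le_lt_trans yM; exact: ler_norm.
Qed.

(** The exponents [a] and [b] are [a ^ 2 / 2] and [a * speed] of the preceding expansion. The first
    bound, local in space, is meant for the nonlinear term; in the second, uniform in space, the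
    heat flow of the front contributes order [r^{-1/2}]. *)
Lemma Pb_front_cvg (N : R) : exists a b C, [/\ lam < 2 * a, a < b, 0 <= C,
  (forall t r x, 0 <= r -> `|x| <= N ->
     P (ft t) r x <= C * (expR (lam * r) * ip h (ft t) + expR (a * r - b * t))) &
  (forall t r x, 0 < r ->
     `|P (ft t) r x - expR (lam * r) * ip h (ft t) * h x| <= C * ((Num.sqrt r)^-1 + expR (a * r - b * t)))].
Proof.
have [a [C1 [a0 a1 a2 C10 HC1]]] := Pb_front_expansion gs s1 bf f0 fM.
have [C2 C20 HC2] := heat_front_exp lam s1 bf fM a0.
have [C3 C30 HC3] := heat_front_decay.
have ih := gs_ibmf gs; have [_ [H hH]] := gs_bmf gs; have H0 : 0 <= H by exact: le_trans (hH 0).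
pose Ih := \int[leb]_x `|h x|.
have Ih0 : 0 <= Ih by apply: Rintegral_ge0 => x _.
have bft t : bmf (ft t) by exact: bmf_front.
have ft0 t y : 0 <= ft t y by exact: front_ge0.
have ipf0 t : 0 <= ip h (ft t).
  by apply: ip_ge0 => // y; exact: ltW (hp y).
have heat0 t r y : 0 <= heat r (ft t) y by exact: heat_ge0.
have ipr0 t r : 0 <= ip h (heat r (ft t)).
  by apply: ip_ge0 => // y; exact: ltW (hp y).
pose C := C2 * expR (a * `|N|) + H + C1 + C3 * (1 + H * Ih).
have C22 : 0 <= C2 * expR (a * `|N|) by rewrite mulr_ge0 ?expR_ge0.
have C33 : 0 <= C3 * (H * Ih) by rewrite !mulr_ge0.
have C0 : 0 <= C by rewrite /C mulrDr mulr1; lra.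
exists (a ^+ 2 / 2), (a * c), C; split => //; first by rewrite mulrC divfK ?pnatr_eq0.
- move=> t r x r0 xN; have := HC1 t r x r0.
  rewrite ler_norml => /andP[_ h1].
  have h2 := HC2 t r x r0.
  set q := expR (a ^+ 2 / 2 * r - a * c * t) in h1 h2 *; have q0 : 0 <= q by exact: expR_ge0.
  set e := expR (lam * r) * ip h (ft t) in h1 *; have e0 : 0 <= e by rewrite mulr_ge0 ?expR_ge0.
  have h3 : C2 * expR (a * `|x|) * q <= C2 * expR (a * `|N|) * q.
    rewrite ler_wpM2r // ler_wpM2l // ler_expR ler_wpM2l ?(ltW a0) //.
    apply: (le_trans xN); exact: ler_norm.
  have h4 : h x * e <= H * e by rewrite ler_wpM2r //; apply: le_trans (hH x); exact: ler_norm.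
  have h5 : 0 <= h x * ip h (heat r (ft t)) by rewrite mulr_ge0 // ltW.
  have h6 : 0 <= (C - H) * e.
    by rewrite mulr_ge0 // /C mulrDr mulr1; lra.
  have h7 : 0 <= (C - C1 - C2 * expR (a * `|N|)) * q.
    by rewrite mulr_ge0 // /C mulrDr mulr1; lra.
  rewrite mulrBr in h1; rewrite mulrDr; lra.
move=> t r x r0; have h1 := HC1 t r x (ltW r0).
set q := expR (a ^+ 2 / 2 * r - a * c * t) in h1 *; have q0 : 0 <= q by exact: expR_ge0.
have h2 := HC3 t r x r0.
have sr0 : 0 <= (Num.sqrt r)^-1 by rewrite invr_ge0 sqrtr_ge0.
have h3 : ip h (heat r (ft t)) <= C3 / Num.sqrt r * Ih.
  apply: (le_trans (ler_norm _)); apply: ip_abs => //; first exact: bmf_heat.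
  by move=> y; rewrite ger0_norm // HC3.
have -> : P (ft t) r x - expR (lam * r) * ip h (ft t) * h x =
  (P (ft t) r x - heat r (ft t) x - h x * (expR (lam * r) * ip h (ft t) - ip h (heat r (ft t)))) +
   heat r (ft t) x - h x * ip h (heat r (ft t)).
  by move: (P _ _ x) (heat _ _ x) (ip _ _) (ip _ _) => *; ring.
apply: (le_trans (ler_normB _ _)); apply: (le_trans (lerD (ler_normD _ _) (lexx _))).
rewrite (ger0_norm (heat0 _ _ _)) normrM (ger0_norm (ipr0 _ _)).
have h4 : `|h x| * ip h (heat r (ft t)) <= H * (C3 / Num.sqrt r * Ih) by apply: ler_pM.
have h5 : 0 <= (C - C1) * q.
  by rewrite mulr_ge0 // /C mulrDr mulr1; lra.
have h6 : 0 <= (C - C3 * (1 + H * Ih)) * (Num.sqrt r)^-1.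
  by rewrite mulr_ge0 // /C mulrDr mulr1; lra.
lra.
Qed.

(** The equations of [e^{m t} h] and [e^{lam t} h] are subtracted and divided by [m - lam]: the
    initial values cancel and the extra source becomes exactly [e^{m t} h]. *)
Lemma gs_diff_sol m : lam < m ->
  is_sol (fun=> 0) (fun t x => beta x * ((expR (m * t) - expR (lam * t)) / (m - lam) * h x) + expR (m * t) * h x)
    (fun t x => (expR (m * t) - expR (lam * t)) / (m - lam) * h x).
Proof.
have lam00 := gs_lam gs; move=> ml t x t0; have m0 : 0 < m by lra.
have ml0 : m - lam != 0 by rewrite subr_eq0 gt_eqF.
have E1 := gs_sol gs m0 x t0; have E2 := gs_sol gs lam0 x t0.
have lm : lbm (fun t x => expR (m * t) * h x) by apply: lbm_expR; [exact: ltW|exact: gs_bmf gs].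
have ll : lbm (fun t x => expR (lam * t) * h x) by apply: lbm_expR; [exact: ltW|exact: gs_bmf gs].
have lbm1 := lbm_betaM bc bs lm; have lbl := lbm_betaM bc bs ll.
have l1 := lbmD lbm1 (lbmZ (m - lam) lm).
have l2 := lbmD lbl (lbmZ (lam - lam) ll).
have l12 := lbmB l1 l2.
have E3 : duh (fun t x => beta x * ((expR (m * t) - expR (lam * t)) / (m - lam) * h x) + expR (m * t) * h x) t x =
  (m - lam)^-1 * (duh (fun t x => beta x * (expR (m * t) * h x) + (m - lam) * (expR (m * t) * h x)) t x
    - duh (fun t x => beta x * (expR (lam * t) * h x) + (lam - lam) * (expR (lam * t) * h x)) t x).
  rewrite -(duhB t x l1 l2) -(duhZ _ t x l12); apply: eq_duh => r y _.
  rewrite subrr mul0r addr0; field; exact: ml0.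
rewrite heat_cst add0r E3.
have -> : (expR (m * t) - expR (lam * t)) / (m - lam) * h x = (m - lam)^-1 * (expR (m * t) * h x - expR (lam * t) * h x).
  by field.
by rewrite E1 E2 opprD addrACA subrr add0r.
Qed.

Variables (alpha : R -> R) (pik : R -> meas).
Hypotheses (acont : continuous alpha) (asupp : compact_supp alpha) (a0 : forall x, 0 <= alpha x).
Hypothesis pmeas : forall A, measurable A -> measurable_fun setT (fun x : R => (pik x A : \bar R)).
Hypothesis pik0 : forall x, pik x `]-oo, 0]%classic = 0%E.
Hypothesis pint : forall x, (\int[pik x]_(u in setT) ((u ^+ 2)%:E) < +oo)%E.
Hypothesis pcont : continuous (fun x => \int[pik x]_(u in setT) u ^+ 2).
Hypothesis psupp : compact_supp (fun x => \int[pik x]_(u in setT) u ^+ 2).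
Notation nl := (nlin alpha pik).

Definition nl_sol g u := [/\ lbm u, (forall t x, 0 <= t -> 0 <= u t x) &
  is_sol g (fun t x => beta x * u t x - nl x (u t x)) u].

(** The [max] is there because [lbm] concerns negative times too, where [u] has no sign. *)
Lemma lbm_nlin u : lbm u -> (forall t x, 0 <= t -> 0 <= u t x) -> lbm (fun t x => nl x (Num.max 0 (u t x))).
Proof.
move=> lu u0; have [mu bu] := lu.
have [K K0 [M M0 HK]] := nlin_le acont asupp a0 pik0 pint pcont psupp.
have mx0 (l : R) : 0 <= Num.max 0 l by rewrite le_max lexx.
split.
  apply: (@measurable_nlin R alpha pik acont pmeas pik0 pint _ (R * R)%type snd (fun p => Num.max 0 (u p.1 p.2))) => //.
  exact: measurable_maxr.
move=> T; have [L HL] := bu T; exists (K * L ^+ 2) => t x tT.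
have [h1 _] := HK x _ (mx0 (u t x)).
rewrite ger0_norm; last exact: nlin_ge0.
apply: (le_trans h1); rewrite ler_wpM2l // ler_sqr ?nnegrE //; last exact: le_trans (HL t x tT).
by rewrite ge_max (le_trans _ (HL t x tT)) //= (le_trans (ler_norm _) (HL t x tT)).
Qed.

(** The gap between the linear flow and [u] solves the linear equation with the source [nl x u],
    quadratic and supported in a fixed compact set; an explicit multiple of [h] dominates it. At
    time [t - r] the part [e^{2 lam (t - r)} e^{- 2 lam t}] leaves the term with [C]; all other
    errors vanish as [t] grows. *)
Lemma nl_sol_cvg : exists2 C, 0 <= C & forall r e, 0 <= r -> 0 < e ->
  exists T, forall t u, T <= t -> nl_sol (ft t) u ->
  forall x, `|u (t - r) x - I * expR (- (lam * r)) * h x| <= e + C * expR (- (2 * lam * r)) * h x.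
Proof.
have [Kn Kn0 [Mn Mn0 HKn]] := nlin_le acont asupp a0 pik0 pint pcont psupp.
have [a [b [C [al ab C0 Hup Hcv]]]] := Pb_front_cvg Mn.
have lam00 := gs_lam gs; have a00 : 0 < a by lra.
have [t1 Ht1] := ip_front gs s1 bf fM.
have I0 := front_mass_ge0.
have [hm hm0 Hhm] := gs_min gs Mn.
have [_ [H hH]] := gs_bmf gs; have H0 : 0 <= H by exact: le_trans (hH 0).
(* [q] collects [u <= C (I e1 + e2)], [(I e1 + e2)^2 <= 2 (I^2 + 1) (e1^2 + e2^2)], and [h >= hm] on
   the compact set carrying the nonlinearity. *)
pose q := Kn * (C ^+ 2 * (2 * (I ^+ 2 + 1))) / hm.
have q0 : 0 <= q by rewrite /q divr_ge0 ?(ltW hm0) // !mulr_ge0 ?sqr_ge0 // addr_ge0 ?sqr_ge0.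
have qhm : Kn * (C ^+ 2 * (2 * (I ^+ 2 + 1))) = q * hm by rewrite /q divfK // lt0r_neq0.
clearbody q.
have main t u r x : t1 <= t -> nl_sol (ft t) u -> 0 <= r ->
    0 <= P (ft t) r x - u r x <= q * (expR (2 * lam * (r - t)) / lam + expR (2 * (a * r - b * t)) / (2 * a - lam)) * h x.
  move=> tt1 [lu u0 su] r0.
  have bft : bmf (ft t) by exact: bmf_front.
  have [lv sv] := PbP bc bs bft.
  have ln := lbm_nlin lu u0.
  have su' : is_sol (ft t) (fun t x => beta x * u t x + - nl x (Num.max 0 (u t x))) u.
    by apply: (sol_eq su) => z y z0; rewrite max_r // u0.
  have uP z y : 0 <= z -> u z y <= P (ft t) z y.
    move=> z0; apply: (sol_le bft bft (lbm_beta bc bs) (lbmN ln) (lbm_cst 0) lu lv su' (lin_sol_addr0 sv)) => //.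
    by move=> z' y' z'0; rewrite oppr_le0; apply: nlin_ge0.
  rewrite subr_ge0 uP //=.
  pose G z y := q * expR (- (2 * lam * t)) * (expR (2 * lam * z) * h y) + q * expR (- (2 * b * t)) * (expR (2 * a * z) * h y).
  have nG z y : 0 <= z -> nl y (Num.max 0 (u z y)) <= G z y.
    move=> z0; rewrite max_r ?u0 //; have [h1 h2] := HKn y (u z y) (u0 _ _ z0).
    have [yM|yM] := leP `|y| Mn; last first.
      have hy := ltW (hp y); rewrite h2 // /G; apply: addr_ge0; apply: mulr_ge0; by rewrite ?mulr_ge0 ?expR_ge0.
    apply: (le_trans h1).
    have h3 : u z y <= C * (I * expR (lam * (z - t)) + expR (a * z - b * t)).
      apply: (le_trans (uP _ _ z0)); apply: (le_trans (Hup t z y z0 yM)).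
      rewrite Ht1 // mulrA -expRD ler_wpM2l // lerD2r mulrC le_eqVlt; apply/orP; left; apply/eqP; congr (_ * expR _).
      ring.
    set e1 := expR (lam * (z - t)) in h3; set e2 := expR (a * z - b * t) in h3.
    have e10 : 0 <= e1 by exact: expR_ge0.
    have e20 : 0 <= e2 by exact: expR_ge0.
    have h4 : u z y ^+ 2 <= C ^+ 2 * (2 * (I ^+ 2 + 1)) * (e1 ^+ 2 + e2 ^+ 2).
      apply: (@le_trans _ _ ((C * (I * e1 + e2)) ^+ 2)).
        by rewrite ler_sqr ?nnegrE ?u0 // mulr_ge0 // addr_ge0 // mulr_ge0.
      rewrite exprMn -mulrA ler_wpM2l ?sqr_ge0 //.
      have := sqr_ge0 (I * e1 - e2); have := sqr_ge0 e1; have := sqr_ge0 (I * e2); rewrite !expr2.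
      lra.
    have -> : G z y = q * h y * (e1 ^+ 2 + e2 ^+ 2).
      rewrite /G.
      have -> : e1 ^+ 2 = expR (- (2 * lam * t)) * expR (2 * lam * z).
        by rewrite /e1 expr2 -!expRD; congr expR; ring.
      have -> : e2 ^+ 2 = expR (- (2 * b * t)) * expR (2 * a * z).
        by rewrite /e2 expr2 -!expRD; congr expR; ring.
      move: (expR _) (expR _) (expR _) (expR _) => *; ring.
    apply: (@le_trans _ _ (Kn * (C ^+ 2 * (2 * (I ^+ 2 + 1)) * (e1 ^+ 2 + e2 ^+ 2)))); first by rewrite ler_wpM2l.
    rewrite mulrA ler_wpM2r ?addr_ge0 ?sqr_ge0 //.
    rewrite qhm; by rewrite ler_wpM2l // Hhm.
  (* By [gs_diff_sol] with [m = 2 lam] and [m = 2 a], [S] is the solution with source [G] and zero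
     initial value; both rates exceed [lam], the second by the choice of [a]. *)
  pose S z y := q * expR (- (2 * lam * t)) * ((expR (2 * lam * z) - expR (lam * z)) / (2 * lam - lam) * h y) +
     q * expR (- (2 * b * t)) * ((expR (2 * a * z) - expR (lam * z)) / (2 * a - lam) * h y).
  have bh := gs_bmf gs.
  have le m : lam < m -> lbm (fun t x => expR (m * t) * h x) by move=> ml; apply: lbm_expR => //; lra.
  have lV m : lam < m -> lbm (fun t x => (expR (m * t) - expR (lam * t)) / (m - lam) * h x).
    move=> ml; have ll : lbm (fun t x => expR (lam * t) * h x) by apply: lbm_expR => //; exact: ltW.
    have := lbmZ ((m - lam)^-1) (lbmB (le m ml) ll); congr lbm.
    by apply/funext => z; apply/funext => y; rewrite -mulrBl mulrA [_^-1 * _]mulrC.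
  have l2 : lam < 2 * lam by lra.
  have lS : lbm S by apply: lbmD; apply: lbmZ; exact: lV.
  have lG : lbm G by apply: lbmD; apply: lbmZ; apply: le.
  have b0 : bmf (fun _ : R => 0 : R) by exact: bmf_cst.
  have sS : is_sol (fun=> 0) (fun z y => beta y * S z y + G z y) S.
    exact: (sol_comb _ _ (lbm_beta bc bs) (le _ l2) (le _ al) (lV _ l2) (lV _ al) (gs_diff_sol l2) (gs_diff_sol al)).
  have lw : lbm (fun z y => P (ft t) z y - u z y) by exact: lbmB.
  have sw : is_sol (fun=> 0) (fun z y => beta y * (P (ft t) z y - u z y) + nl y (Num.max 0 (u z y))) (fun z y => P (ft t) z y - u z y).
    move=> z y z0; rewrite (sv z y z0) (su' z y z0) heat_cst add0r.
    have lbv := lbm_betaM bc bs lv; have lbu := lbmD (lbm_betaM bc bs lu) (lbmN ln).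
    have E : duh (fun z y => beta y * (P (ft t) z y - u z y) + nl y (Num.max 0 (u z y))) z y =
      duh (fun z' x => beta x * P (ft t) z' x) z y - duh (fun t x => beta x * u t x + - nl x (Num.max 0 (u t x))) z y.
      rewrite -(duhB z y lbv lbu); apply: eq_duh => z' y' _; ring.
    rewrite E; move: (heat _ _ _) (duh _ _ _) (duh _ _ _) => *; ring.
  apply: (le_trans (sol_le b0 b0 (lbm_beta bc bs) ln lG lw lS sw sS (fun=> lexx _) nG x r0)).
  rewrite /S mulrDr mulrDl; apply: lerD.
    have -> : 2 * lam * (r - t) = - (2 * lam * t) + 2 * lam * r by ring.
    have -> : 2 * lam - lam = lam by ring.
    rewrite expRD -!mulrA ler_wpM2l // ler_wpM2l ?expR_ge0 //.
    by rewrite ler_wpM2r ?mulr_ge0 ?invr_ge0 ?(ltW lam0) ?(ltW (hp _)) // lerBlDr lerDl expR_ge0.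
  have -> : 2 * (a * r - b * t) = - (2 * b * t) + 2 * a * r by ring.
  rewrite expRD -!mulrA ler_wpM2l // ler_wpM2l ?expR_ge0 //.
  have a2l : 0 <= 2 * a - lam by lra.
  by rewrite ler_wpM2r ?mulr_ge0 ?invr_ge0 ?(ltW (hp _)) // lerBlDr lerDl expR_ge0.
have a2l : 0 < 2 * a - lam by lra.
have ba0 : 0 < b - a by lra.
exists (q / lam) => [|r e r0 e0]; first by rewrite divr_ge0 // ltW.
pose C' := C + C + q / (2 * a - lam) * H.
have qH0 : 0 <= q / (2 * a - lam) * H by apply: mulr_ge0 => //; apply: divr_ge0 => //; exact: ltW.
have C'E : C' = C + (C + q / (2 * a - lam) * H) by rewrite /C' addrA.
clearbody C'.
have C'0 : 0 <= C' by rewrite C'E; lra.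
have C'e : 0 <= C' / e by rewrite divr_ge0 // ltW.
(* The square makes [C' / sqrt (t - r) <= e], the last summand makes [C' e^{- (b - a) t} <= e]; as
   [C'] is the sum of the coefficients of both errors, their total is at most [e]. *)
exists (Num.max t1 (r + (C' / e) ^+ 2 + 1 + (C' / e + 1) / (b - a))) => t u.
rewrite ge_max => /andP[tt1 tr] su x.
have p1 : 0 <= (C' / e + 1) / (b - a) by apply: divr_ge0; [lra|exact: ltW].
have p2 : 0 <= (C' / e) ^+ 2 by exact: sqr_ge0.
have tr0 : 0 < t - r by lra.
have /andP[w1 w2] := main t u (t - r) x tt1 su (ltW tr0).
have := Hcv t (t - r) x tr0; rewrite Ht1 // mulrA -expRD.
have -> : lam * (t - r) + - (lam * t) = - (lam * r) by ring.
rewrite [expR _ * I]mulrC => v1.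
have sq : C' / e <= Num.sqrt (t - r).
  rewrite -[leLHS]ger0_norm // -sqrtr_sqr ler_sqrt; [lra|exact: ltW].
have s0 : 0 < Num.sqrt (t - r) by rewrite sqrtr_gt0.
have ex : C' / e <= expR ((b - a) * t).
  apply: le_trans (expR_ge1Dx _); have : (C' / e + 1) / (b - a) <= t by lra.
  by rewrite ler_pdivrMr // mulrC; lra.
have ex2 : expR (a * (t - r) - b * t) <= expR (- ((b - a) * t)).
  rewrite ler_expR; have : 0 <= a * r by rewrite mulr_ge0 // ltW.
  lra.
have small X : C' / e <= X -> 0 < X -> C' * X^-1 <= e.
  by move=> h1 X0; rewrite ler_pdivrMr // mulrC -ler_pdivrMr.
have m1 := small _ sq s0; have m2 := small _ ex (expR_gt0 _).
rewrite -expRN in m2.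
set y1 := (Num.sqrt (t - r))^-1 in v1 m1.
set y2 := expR (a * (t - r) - b * t) in v1 w2 ex2.
have y20 : 0 <= y2 by exact: expR_ge0.
have m2' : C' * y2 <= e by apply: le_trans m2; rewrite ler_wpM2l.
have y21 : y2 <= 1.
  apply: (le_trans ex2); rewrite -expR0 ler_expR oppr_le0 mulr_ge0 ?(ltW ba0) //; lra.
have E2 : expR (2 * (a * (t - r) - b * t)) <= y2.
  have -> : expR (2 * (a * (t - r) - b * t)) = y2 * y2 by rewrite -expRD; congr expR; ring.
  by rewrite ler_piMl.
have E3 : q * (expR (2 * (a * (t - r) - b * t)) / (2 * a - lam)) * h x <= q / (2 * a - lam) * H * y2.
  rewrite [leRHS](_ : _ = q * (y2 / (2 * a - lam)) * H); last by ring.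
  apply: ler_pM; rewrite ?(ltW (hp x)) //.
  - by rewrite mulr_ge0 // divr_ge0 ?expR_ge0 // ltW.
  - by rewrite ler_wpM2l // ler_wpM2r // invr_ge0 ltW.
  - by apply: le_trans (hH x); exact: ler_norm.
have E4 : q * (expR (2 * lam * (t - r - t)) / lam) * h x = q / lam * expR (- (2 * lam * r)) * h x.
  have -> : 2 * lam * (t - r - t) = - (2 * lam * r) by ring.
  ring.
have -> : u (t - r) x - I * expR (- (lam * r)) * h x =
  (P (ft t) (t - r) x - I * expR (- (lam * r)) * h x) - (P (ft t) (t - r) x - u (t - r) x).
  by move: (P _ _ x) => *; ring.
apply: (le_trans (ler_normB _ _)); rewrite (ger0_norm w1).
rewrite [q * (_ + _)]mulrDr [(_ + _) * h x]mulrDl E4 in w2.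
apply: (le_trans (lerD v1 w2)).
have : C * y1 + (C + q / (2 * a - lam) * H) * y2 <= e.
  have k0 : 0 <= C + q / (2 * a - lam) * H by rewrite addr_ge0.
  have [y12|/ltW y21'] := leP y1 y2.
    apply: le_trans m2'; rewrite C'E [leRHS]mulrDl lerD2r ler_wpM2l //.
  apply: le_trans m1; rewrite C'E [leRHS]mulrDl lerD2l ler_wpM2l //.
move: E3.
move: (q * (expR _ / _) * h x) (q / lam * _ * h x) (q / _ * H) => X Y Z h1.
rewrite [C * (_ + _)]mulrDr [(_ + _) * y2]mulrDl; lra.
Qed.

End Asymptotics.

(** * Expectations of bounded variables *)

Section BoundedExpectation.
Variables (R : realType) (d : measure_display) (T : measurableType d) (P : probability T R).
Implicit Types (Y Z : T -> R).

Definition brv Z := measurable_fun setT Z /\ exists M : R, forall w, `|Z w| <= M.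

Lemma brv_int Z : brv Z -> P.-integrable setT (EFin \o Z).
Proof.
move=> [mZ [M ZM]]; apply: (@integrable_bdd _ _ _ P _ _ M) => //.
exact: (le_lt_trans (@probability_le1 _ _ _ P _ measurableT) (ltry 1)).
Qed.

Lemma brvD Y Z : brv Y -> brv Z -> brv (fun w => Y w + Z w).
Proof.
move=> [mY [M YM]] [mZ [N ZN]]; split; first exact: measurable_funD.
by exists (M + N) => w; apply: (le_trans (ler_normD _ _)); exact: lerD.
Qed.

Lemma brvM Y Z : brv Y -> brv Z -> brv (fun w => Y w * Z w).
Proof.
move=> [mY [M YM]] [mZ [N ZN]]; split; first exact: measurable_funM.
by exists (M * N) => w; rewrite normrM ler_pM.
Qed.

Lemma brv_cst (c : R) : brv (fun=> c).
Proof. by split => //; exists `|c|. Qed.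

Lemma brvN Z : brv Z -> brv (fun w => - Z w).
Proof.
move=> bZ; have -> : (fun w => - Z w) = (fun w => -1 * Z w) by apply/funext => w; rewrite mulN1r.
by apply: brvM => //; exact: brv_cst.
Qed.

Lemma brvB Y Z : brv Y -> brv Z -> brv (fun w => Y w - Z w).
Proof. by move=> bY bZ; apply: brvD => //; exact: brvN. Qed.

Lemma brv_expRN Z : measurable_fun setT Z -> (forall w, 0 <= Z w) -> brv (fun w => expR (- Z w)).
Proof.
move=> mZ Z0; split; first by apply: measurableT_comp => //; exact: measurableT_comp.
by exists 1 => w; rewrite ger0_norm ?expR_ge0 // -expR0 ler_expR oppr_le0.
Qed.

Lemma brv_min1 Z : measurable_fun setT Z -> (forall w, 0 <= Z w) -> brv (fun w => Num.min 1 (Z w)).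
Proof.
move=> mZ Z0; split; first exact: measurable_minr.
by exists 1 => w; rewrite ger0_norm ?ge_min ?lexx // le_min ler01 Z0.
Qed.

Lemma expect_le Y Z : brv Y -> brv Z -> (forall w, Y w <= Z w) -> \int[P]_w Y w <= \int[P]_w Z w.
Proof. by move=> bY bZ YZ; apply: le_Rintegral => //; exact: brv_int. Qed.

Lemma expectD Y Z : brv Y -> brv Z -> \int[P]_w (Y w + Z w) = \int[P]_w Y w + \int[P]_w Z w.
Proof. by move=> bY bZ; rewrite RintegralD //; exact: brv_int. Qed.

Lemma expectZ (c : R) Z : brv Z -> \int[P]_w (c * Z w) = c * \int[P]_w Z w.
Proof. by move=> bZ; rewrite RintegralZl //; exact: brv_int. Qed.

Lemma expect_cst (c : R) : \int[P]_w c = c.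
Proof. by rewrite Rintegral_cst // [X in fine X](_ : _ = 1%E) ?mulr1 //; exact: (@probability_setT _ _ _ P). Qed.

Lemma expect_cvg (Z_ : nat -> T -> R) Z (M : R) : (forall n, measurable_fun setT (Z_ n)) ->
  measurable_fun setT Z -> (forall n w, `|Z_ n w| <= M) ->
  {ae P, forall w, Z_ n w @[n --> \oo] --> Z w} ->
  (\int[P]_w Z_ n w) @[n --> \oo] --> \int[P]_w Z w.
Proof.
move=> mZn mZ ZM cZ.
have D1 n : measurable_fun setT (fun w => (Z_ n w)%:E) by apply/measurable_EFinP.
have D2 : measurable_fun setT (EFin \o Z) by apply/measurable_EFinP.
have D3 : {ae P, forall w, setT w -> (fun n => (Z_ n w)%:E) @ \oo --> (EFin \o Z) w}.
  apply: filterS cZ => w Zw _; apply/fine_cvgP; split => //.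
  exact: nearW.
have D4 : P.-integrable setT (cst M%:E) by exact: brv_int (brv_cst M).
have D5 : {ae P, forall w n, setT w -> (`|(Z_ n w)%:E| <= cst M%:E w)%E}.
  by apply: aeW => w n _; rewrite lee_fin.
have [iZ _ H] := @dominated_convergence _ _ _ P setT measurableT (fun n w => (Z_ n w)%:E) (EFin \o Z) (cst M%:E) D1 D2 D3 D4 D5.
have E : (\int[P]_w (EFin \o Z) w = (\int[P]_w Z w)%:E)%E.
  by rewrite /Rintegral fineK //; exact: (integrable_fin_num _ iZ).
move: H; rewrite E => /fine_cvgP[_].
exact.
Qed.

Lemma expRN_dist (a b : R) : 0 <= a -> 0 <= b -> `|expR (- a) - expR (- b)| <= Num.min 1 `|a - b|.
Proof.
wlog ab : a b / b <= a => [H|] a0 b0.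
  have [h1|/ltW h1] := leP b a; first exact: H.
  by rewrite distrC [`|a - b|]distrC; exact: H.
have -> : expR (- a) = expR (- b) * expR (- (a - b)) by rewrite -expRD; congr expR; ring.
have e1 : expR (- b) <= 1 by rewrite -expR0 ler_expR oppr_le0.
have e2 : expR (- (a - b)) <= 1 by rewrite -expR0 ler_expR oppr_le0 subr_ge0.
have e3 := expR_ge1Dx (- (a - b)); have e4 := expR_gt0 (- b); have e5 := expR_gt0 (- (a - b)).
rewrite distrC -{1}[expR (- b)]mulr1 -mulrBr ger0_norm; last by rewrite mulr_ge0 ?subr_ge0 // ltW.
rewrite (@ger0_norm _ (a - b)) ?subr_ge0 // le_min; apply/andP; split.
  apply: mulr_ile1; rewrite ?subr_ge0 ?(ltW e4) //; lra.
apply: (@le_trans _ _ (1 - expR (- (a - b)))); last lra.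
by rewrite ler_piMl // subr_ge0.
Qed.

Let square_le (u v z z2 D : R) : z2 = z * z -> u - z2 <= D -> - (z * (v - z)) <= D ->
  u + (-2) * (z * v) + z2 <= 3 * D.
Proof. by move=> -> *; lra. Qed.

(** The square is expanded; in the two terms containing [A] the transform identities replace [2 A]
    by [U2] and [A] by [U1], which are pointwise close to [2 y] and [y]. The rest cancels up to
    [min 1 dl], counted once for [U2] and twice for the cross term. *)
Lemma expect_sq_le (A y U1 U2 dl : T -> R) :
  measurable_fun setT A -> measurable_fun setT y -> measurable_fun setT U1 -> measurable_fun setT U2 -> measurable_fun setT dl ->
  (forall w, 0 <= A w) -> (forall w, 0 <= y w) -> (forall w, 0 <= U1 w) -> (forall w, 0 <= U2 w) -> (forall w, 0 <= dl w) ->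
  \int[P]_w (expR (- y w) * expR (- A w)) = \int[P]_w (expR (- y w) * expR (- U1 w)) ->
  \int[P]_w expR (- (2 * A w)) = \int[P]_w expR (- U2 w) ->
  (forall w, `|U1 w - y w| <= dl w) -> (forall w, `|U2 w - 2 * y w| <= dl w) ->
  \int[P]_w ((expR (- A w) - expR (- y w)) ^+ 2) <= 3 * \int[P]_w Num.min 1 (dl w).
Proof.
move=> mA my mU1 mU2 mdl A0 y0 U10 U20 dl0 L1' L2' c1 c2.
have bA := brv_expRN mA A0; have by_ := brv_expRN my y0.
have bU1 := brv_expRN mU1 U10; have bU2 := brv_expRN mU2 U20.
have A20 w : 0 <= 2 * A w by rewrite mulr_ge0.
have y20 w : 0 <= 2 * y w by rewrite mulr_ge0.
have b2A : brv (fun w => expR (- (2 * A w))) by exact: (brv_expRN (measurable_funM (measurable_cst _) mA) A20).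
have b2y : brv (fun w => expR (- (2 * y w))) by exact: (brv_expRN (measurable_funM (measurable_cst _) my) y20).
have bmin := brv_min1 mdl dl0.
have sq2 (z : R) : expR (- z) ^+ 2 = expR (- (2 * z)) by rewrite expr2 -expRD; congr expR; ring.
have -> : \int[P]_w ((expR (- A w) - expR (- y w)) ^+ 2) =
    \int[P]_w (expR (- (2 * A w)) + (-2) * (expR (- y w) * expR (- A w)) + expR (- (2 * y w))).
  apply: eq_Rintegral => w _; rewrite sqrrB !sq2; ring.
have bm2 : brv (fun w => (-2) * (expR (- y w) * expR (- A w))) by apply: brvM; [exact: brv_cst|exact: brvM].
have bm3 : brv (fun w => (-2) * (expR (- y w) * expR (- U1 w))) by apply: brvM; [exact: brv_cst|exact: brvM].
have E1 : \int[P]_w (expR (- (2 * A w)) + (-2) * (expR (- y w) * expR (- A w)) + expR (- (2 * y w))) =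
   \int[P]_w (expR (- U2 w) + (-2) * (expR (- y w) * expR (- U1 w)) + expR (- (2 * y w))).
  rewrite (expectD (brvD b2A bm2) b2y) (expectD b2A bm2) (expectZ _ (brvM by_ bA)) L2' L1'.
  by rewrite (expectD (brvD bU2 bm3) b2y) (expectD bU2 bm3) (expectZ _ (brvM by_ bU1)).
rewrite E1 -(expectZ 3 bmin); apply: expect_le.
- exact: brvD (brvD bU2 bm3) b2y.
- exact: brvM (brv_cst 3) bmin.
move=> w.
have q1 : `|expR (- U2 w) - expR (- (2 * y w))| <= Num.min 1 (dl w).
  apply: (le_trans (expRN_dist (U20 w) (y20 w))); rewrite le_min !ge_min lexx /=.
  by rewrite c2 orbT.
have q2 : `|expR (- U1 w) - expR (- y w)| <= Num.min 1 (dl w).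
  apply: (le_trans (expRN_dist (U10 w) (y0 w))); rewrite le_min !ge_min lexx /=.
  by rewrite c1 orbT.
have q3 : expR (- (2 * y w)) = expR (- y w) * expR (- y w) by rewrite -expRD; congr expR; ring.
have q4 : expR (- y w) <= 1 by rewrite -expR0 ler_expR oppr_le0.
have q5 : `|expR (- y w) * (expR (- U1 w) - expR (- y w))| <= Num.min 1 (dl w).
  rewrite normrM (ger0_norm (expR_ge0 _)); apply: le_trans q2.
  by apply: ler_piMl q4; exact: normr_ge0.
apply: (square_le q3 (le_trans (ler_norm _) q1)).
by apply: le_trans (ler_norm _) _; rewrite normrN.
Qed.

Lemma expect_near0 (Z_ : nat -> T -> R) (e : R) : 0 < e -> (forall n, measurable_fun setT (Z_ n)) ->
  (forall n w, 0 <= Z_ n w <= 1) -> {ae P, forall w, Z_ n w @[n --> \oo] --> 0} ->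
  \forall n \near \oo, \int[P]_w Z_ n w <= e.
Proof.
move=> e0 mZ Z01 cZ.
have := @expect_cvg Z_ (fun=> 0) 1 mZ (measurable_cst _) _ cZ.
rewrite expect_cst => H; have {H} := H (fun n w => _).
move=> H; have : (\int[P]_w Z_ n w) @[n --> \oo] --> 0.
  by apply: H => n w; have /andP[a b] := Z01 n w; rewrite ger0_norm.
move=> /cvgrPdist_le/(_ _ e0) K; near=> n.
have : `|0 - \int[P]_w Z_ n w| <= e by near: n.
by rewrite sub0r normrN; apply: le_trans; exact: ler_norm.
Unshelve. all: end_near. Qed.

Lemma cvg_min1_0 (u : nat -> R) : (forall n, 0 <= u n) -> u n @[n --> \oo] --> 0 -> Num.min 1 (u n) @[n --> \oo] --> 0.
Proof.
move=> u0 cu; apply: (@squeeze_cvgr _ _ _ _ (fun=> 0) u); [|exact: cvg_cst|exact: cu].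
by apply: nearW => n; rewrite le_min ler01 u0 ge_min lexx orbT.
Qed.

Lemma min1D (a b : R) : 0 <= a -> 0 <= b -> Num.min 1 (a + b) <= Num.min 1 a + Num.min 1 b.
Proof.
move=> a0 b0; rewrite /Num.min; case: ltP => h1; case: ltP => h2; case: ltP => h3; lra.
Qed.

End BoundedExpectation.

(** * Pairings with finite measures *)

Section Pairing.
Variable R : realType.
Notation meas := {measure set R -> \bar R}.
Implicit Types (nu : meas) (f g : R -> R).
Import HBNNSimple.

Lemma pairing_integrable nu g : (nu setT < +oo)%E -> bmf g -> nu.-integrable setT (EFin \o g).
Proof. by move=> fnu [mg [M gM]]; exact: (@integrable_bdd _ _ _ nu _ _ M). Qed.

Lemma pairingD nu f g : (nu setT < +oo)%E -> bmf f -> bmf g -> pairing nu (fun x => f x + g x) = pairing nu f + pairing nu g.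
Proof. by move=> fnu bf bg; rewrite /pairing RintegralD //; exact: pairing_integrable. Qed.

Lemma pairingB nu f g : (nu setT < +oo)%E -> bmf f -> bmf g -> pairing nu (fun x => f x - g x) = pairing nu f - pairing nu g.
Proof. by move=> fnu bf bg; rewrite /pairing RintegralB //; exact: pairing_integrable. Qed.

Lemma pairingZ nu (c : R) f : (nu setT < +oo)%E -> bmf f -> pairing nu (fun x => c * f x) = c * pairing nu f.
Proof. by move=> fnu bf; rewrite /pairing RintegralZl //; exact: pairing_integrable. Qed.

Lemma pairing_ge0 nu f : (forall x, 0 <= f x) -> 0 <= pairing nu f.
Proof. by move=> f0; apply: Rintegral_ge0 => x _. Qed.

Lemma pairing_abs nu f g : (nu setT < +oo)%E -> bmf f -> bmf g -> (forall x, `|f x| <= g x) -> `|pairing nu f| <= pairing nu g.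
Proof. by move=> fnu bf bg fg; apply: Rint_abs_le => //; [exact: bf.1|exact: pairing_integrable]. Qed.

Lemma measurable_pairing d (T : measurableType d) (X : T -> meas) g :
  (forall A, measurable A -> measurable_fun setT (fun w => (X w A : \bar R))) ->
  measurable_fun setT g -> (forall x, 0 <= g x) -> measurable_fun setT (fun w => pairing (X w) g).
Proof.
move=> mX mg g0; apply: measurableT_comp => //=.
have mE : measurable_fun setT (EFin \o g) by apply/measurable_EFinP.
apply: (@measurable_fun_preimage_integral _ _ T R R _ (nnsfun_approx measurableT mE)).
- by move=> m n mn; exact: nd_nnsfun_approx.
- by move=> z _; apply: cvg_nnsfun_approx => // u _; rewrite lee_fin.
- by move=> n r; apply: mX; exact: measurable_funPTI.
Qed.

End Pairing.

(** * Measures with exponential density *)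

Section ExpMeasure.
Variable R : realType.
Notation leb := (@lebesgue_measure R).
Import HBNNSimple.
Variables (c k : R).

Let g (x : R) := `|c| * expR (k * x).

Let g0 x : 0 <= g x. Proof. exact: mulr_ge0 (normr_ge0 c) (expR_ge0 _). Qed.

Let mg : measurable_fun setT g.
Proof.
apply: measurable_funM => //; apply: measurableT_comp => //; exact: measurable_funM.
Qed.

Let mgE (A : set R) : measurable_fun A (EFin \o g).
Proof. by apply: measurable_funTS; apply/measurable_EFinP. Qed.

(** The absolute value makes this a measure for every real [c]; it is applied to a positive
    [gs_coef]. *)
Definition exp_measure (A : set R) : \bar R := (\int[leb]_(x in A) (`|c| * expR (k * x))%:E)%E.

Let exp_measure0 : exp_measure set0 = 0%E.
Proof. exact: integral_set0. Qed.

Let exp_measure_ge0 A : (0 <= exp_measure A)%E.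
Proof. by apply: integral_ge0 => x _; rewrite lee_fin; exact: g0. Qed.

Let exp_measure_additive : semi_sigma_additive exp_measure.
Proof.
move=> F mF tF mUF; rewrite /exp_measure ge0_integral_bigcup //.
- by apply: is_cvg_ereal_nneg_natsum_cond => n _ _; exact: exp_measure_ge0.
- exact: mgE.
Qed.

HB.instance Definition _ := isMeasure.Build _ _ _ exp_measure exp_measure0 exp_measure_ge0 exp_measure_additive.

Lemma exp_measure_nnsfun (h : {nnsfun R >-> R}) : (\int[exp_measure]_x (h x)%:E = \int[leb]_x (h x * g x)%:E)%E.
Proof.
transitivity (\sum_(y \in range h) \int[leb]_x (y * \1_(h @^-1` [set y]) x * g x)%:E)%E; last first.
  rewrite -ge0_integral_fsum//; last 2 first.
  - move=> y; apply/measurable_EFinP; apply: measurable_funM mg.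
    by apply: measurable_funM.
  - move=> y x _; rewrite EFinM; apply: mule_ge0; last by rewrite lee_fin; exact: g0.
    exact: nnfun_muleindic_ge0.
  by apply: eq_integral => x _; rewrite fsumEFin // fimfunE mulr_fsuml.
rewrite integralT_nnsfun sintegralE; apply: eq_fsbigr => y _.
have mA : measurable (h @^-1` [set y]) by exact: measurable_sfunP.
have [y0|y0] := leP 0 y; last first.
  rewrite preimage_nnfun0 // measure0 mule0 integral0_eq // => x _.
  by rewrite indic0 mulr0 mul0r.
transitivity (y%:E * \int[leb]_(x in h @^-1` [set y]) (g x)%:E)%E; first by [].
rewrite integral_mkcond -ge0_integralZl //.
- apply: eq_integral => x _; rewrite patchE indicE; case: ifPn => _; first by rewrite mulr1 EFinM.
  by rewrite mulr0 mul0r mule0.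
- by apply/(measurable_restrictT _ mA); exact: mgE.
- by move=> x _; rewrite patchE; case: ifPn => // _; rewrite lee_fin; exact: g0.
Qed.

Lemma ge0_integral_exp_measure (f : R -> R) : measurable_fun setT f -> (forall x, 0 <= f x) ->
  (\int[exp_measure]_x (f x)%:E = \int[leb]_x (f x * (`|c| * expR (k * x)))%:E)%E.
Proof.
move=> mf f0; have mfE : measurable_fun setT (EFin \o f) by apply/measurable_EFinP.
pose u := nnsfun_approx measurableT mfE.
have cu x : (u n x)%:E @[n --> \oo] --> (f x)%:E.
  by apply: (@cvg_nnsfun_approx _ _ _ _ _ _ mfE) => // y _; rewrite lee_fin.
have ndu x : {homo (fun n => u n x) : a b / (a <= b)%N >-> a <= b}.
  by move=> a b ab; have /lefP := nd_nnsfun_approx measurableT mfE ab; exact.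
have A1 : (\int[exp_measure]_x (u n x)%:E @[n --> \oo] --> \int[exp_measure]_x (f x)%:E)%E.
  have -> : (\int[exp_measure]_x (f x)%:E = \int[exp_measure]_x (limn (fun n => (u n x)%:E)))%E.
    by apply: eq_integral => x _; apply/esym/cvg_lim.
  apply: cvg_monotone_convergence => //.
  - by move=> n; exact/measurable_EFinP.
  - by move=> n x _; rewrite lee_fin.
  - by move=> x _ a b ab; rewrite lee_fin; exact: ndu.
have mug n : measurable_fun setT (fun x => u n x * g x) by exact: (measurable_funM (@measurable_funPT _ _ _ _ (u n)) mg).
have A2 : (\int[leb]_x (u n x * g x)%:E @[n --> \oo] --> \int[leb]_x (f x * g x)%:E)%E.
  have -> : (\int[leb]_x (f x * g x)%:E = \int[leb]_x (limn (fun n => (u n x * g x)%:E)))%E.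
    apply: eq_integral => x _; apply/esym/cvg_lim => //.
    rewrite EFinM; under eq_fun do rewrite EFinM; exact: cvgeZr.
  apply: cvg_monotone_convergence => //.
  - by move=> n; apply/measurable_EFinP; exact: mug.
  - by move=> n x _; rewrite lee_fin; apply: mulr_ge0; [|exact: g0].
  - by move=> x _ a b ab; rewrite lee_fin; apply: ler_wpM2r; [exact: g0|exact: ndu].
move: A1; under eq_fun do rewrite exp_measure_nnsfun; move=> A1.
exact: (cvg_unique _ A1 A2).
Qed.

Lemma exp_measure_loc_finite : loc_finite exp_measure.
Proof.
move=> M; have : leb.-integrable `[- M, M]%classic (EFin \o g).
  apply: continuous_compact_integrable; first exact: segment_compact.
  apply: continuous_subspaceT => x; apply: cvgMl_tmp.
  have l : k * y @[y --> (x : R)] --> k * x by apply: cvgMl_tmp; exact: cvg_id.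
  exact: (cvg_comp _ _ l (@continuous_expR R _)).
move=> /integrableP[_]; apply: le_lt_trans; rewrite le_eqVlt; apply/orP; left; apply/eqP.
by apply: eq_integral => x _ /=; rewrite (ger0_norm (g0 x)).
Qed.

End ExpMeasure.

(** * Arbitrary bounded integrands and convergence in probability *)

Section ArbitraryExpectation.
Variables (R : realType) (d : measure_display) (T : measurableType d) (P : probability T R).
Import HBNNSimple.

(** The integral of a nonnegative function is a supremum over simple functions below it, so
    monotonicity holds without measurability; this is what allows [F] composed with a random measure
    as an integrand. *)
Lemma ge0_le_integral_any (f g : T -> \bar R) : (forall x, 0 <= f x)%E -> (forall x, f x <= g x)%E ->
  (\int[P]_x f x <= \int[P]_x g x)%E.
Proof.
move=> f0 fg; rewrite !ge0_integralTE //; last by move=> x; exact: le_trans (fg x).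
apply: le_ereal_sup => _ [h hf <-]; exists h => // x; exact: le_trans (hf x) (fg x).
Qed.

Lemma expect_fin (Z : T -> R) : brv Z -> (\int[P]_w (Z w)%:E = (\int[P]_w Z w)%:E)%E.
Proof. by move=> bZ; rewrite /Rintegral fineK //; exact: (integrable_fin_num measurableT (brv_int P bZ)). Qed.

(** A simple function [h] below [f1] is replaced by [max (h - G) 0], which is measurable and below
    [f2]. *)
Lemma ge0_expect_close (f1 f2 G : T -> R) (M : R) : brv G -> (forall w, 0 <= G w) ->
  (forall w, 0 <= f1 w <= M) -> (forall w, 0 <= f2 w) -> (forall w, f1 w <= f2 w + G w) ->
  (\int[P]_w (f1 w)%:E <= \int[P]_w (f2 w)%:E + (\int[P]_w G w)%:E)%E.
Proof.
move=> bG G0 f1M f20 H.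
rewrite [leLHS]ge0_integralTE; last by move=> w; rewrite lee_fin; have /andP[] := f1M w.
apply: ge_ereal_sup => _ [h /= hf <-].
have hf1 w : h w <= f1 w by rewrite -lee_fin.
have hM w : h w <= M by apply: le_trans (hf1 w) _; have /andP[] := f1M w.
have bh : brv h by split => //; exists M => w; rewrite ger0_norm.
pose g w := Num.max (h w - G w) 0.
have bg : brv g.
  split; first by apply: measurable_maxr => //; exact: (brvB bh bG).1.
  exists M => w; rewrite ger0_norm /g ?le_max ?lexx ?orbT // ge_max; apply/andP; split.
    by have := hM w; have := G0 w; lra.
  by apply: le_trans (hM w).
have g2 : ((\int[P]_w g w)%:E <= \int[P]_w (f2 w)%:E)%E.
  rewrite -expect_fin //; apply: ge0_le_integral_any => w; rewrite lee_fin /g ?le_max ?lexx ?orbT //.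
  by rewrite ge_max f20 andbT; have := hf1 w; have := H w; lra.
rewrite -integralT_nnsfun (expect_fin bh).
apply: le_trans (leeD g2 (lexx _)).
rewrite -EFinD lee_fin -(expectD P bg bG); apply: expect_le => // [|w]; first exact: brvD.
by rewrite -lerBlDr /g le_max lexx.
Qed.

(* For arbitrary f1 and f2 the integral is the difference of the lower integrals of the positive and the
   negative part, and lower integrals are monotone. *)
Lemma expect_close (f1 f2 G : T -> R) (M : R) : brv G -> (forall w, `|f1 w| <= M) -> (forall w, `|f2 w| <= M) ->
  (forall w, `|f1 w - f2 w| <= G w) -> `|\int[P]_w f1 w - \int[P]_w f2 w| <= 2 * \int[P]_w G w.
Proof.
move=> bG M1 M2 H; have G0 w : 0 <= G w by apply: le_trans (H w).
pose pos (f : T -> R) w := Num.max (f w) 0.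
have pos0 f w : 0 <= pos f w by rewrite le_max lexx orbT.
have posM f : (forall w, `|f w| <= M) -> forall w, 0 <= pos f w <= M.
  move=> fM w; rewrite pos0 ge_max (le_trans (ler_norm _) (fM w)) /=.
  exact: le_trans (fM w).
have posfin f : (forall w, `|f w| <= M) -> (\int[P]_w (pos f w)%:E \is a fin_num)%E.
  move=> fM; rewrite ge0_fin_numE; last by apply: integral_ge0 => w _; rewrite lee_fin.
  apply: (@le_lt_trans _ _ (\int[P]_w M%:E)%E).
    by apply: ge0_le_integral_any => w; rewrite lee_fin //; have /andP[] := posM f fM w.
  by rewrite (expect_fin (brv_cst _ M)) ltry.
have dec f : (forall w, `|f w| <= M) ->
    \int[P]_w f w = fine (\int[P]_w (pos f w)%:E) - fine (\int[P]_w (pos (fun w => - f w) w)%:E).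
  move=> fM; have fM' w : `|- f w| <= M by rewrite normrN.
  rewrite -fineB ?posfin // /Rintegral integralE; congr (fine (_ - _)%E).
    by apply: eq_integral => w _; rewrite funeposE /pos EFin_max.
  by apply: eq_integral => w _; rewrite funenegE /pos EFin_max.
have cmp f g : (forall w, `|f w| <= M) -> (forall w, `|g w| <= M) -> (forall w, `|f w - g w| <= G w) ->
    fine (\int[P]_w (pos f w)%:E) <= fine (\int[P]_w (pos g w)%:E) + \int[P]_w G w.
  move=> fM gM fg; rewrite -lee_fin EFinD (fineK (posfin _ fM)) (fineK (posfin _ gM)).
  apply: (ge0_expect_close bG G0 (posM f fM) (pos0 g)) => w.
  rewrite ge_max; apply/andP; split; last by rewrite addr_ge0.
  have : g w <= pos g w by rewrite le_max lexx.
  by have := fg w; have := ler_norm (f w - g w); lra.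
have N1 w : `|- f1 w| <= M by rewrite normrN.
have N2 w : `|- f2 w| <= M by rewrite normrN.
have H' w : `|f2 w - f1 w| <= G w by rewrite distrC.
have HN w : `|- f1 w - - f2 w| <= G w by rewrite opprK addrC.
have HN' w : `|- f2 w - - f1 w| <= G w by rewrite opprK addrC.
have c1 := cmp _ _ M1 M2 H; have c2 := cmp _ _ M2 M1 H'.
have c3 := cmp _ _ N1 N2 HN; have c4 := cmp _ _ N2 N1 HN'.
rewrite (dec _ M1) (dec _ M2) ler_norml.
move: c1 c2 c3 c4; move: (fine _) (fine _) (fine _) (fine _) (\int[P]_w G w) => a b c e g.
by move=> *; apply/andP; split; lra.
Qed.

(* G dominates the indicator of the exceptional event, so that expectations replace probabilities. *)
Definition in_prob (Q : R -> T -> Prop) := forall eta, 0 < eta -> exists S, forall t, S <= t ->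
  exists G : T -> R, [/\ brv G, (forall w, 0 <= G w), \int[P]_w G w <= eta & forall w, Q t w \/ 1 <= G w].

Lemma in_prob_imp (Q Q' : R -> T -> Prop) : (forall t w, Q t w -> Q' t w) -> in_prob Q -> in_prob Q'.
Proof.
move=> QQ H eta eta0; have [S HS] := H eta eta0; exists S => t /HS[G [G1 G2 G3 G4]].
by exists G; split => // w; have [/QQ|] := G4 w; [left|right].
Qed.

Lemma in_probI (Q Q' : R -> T -> Prop) : in_prob Q -> in_prob Q' -> in_prob (fun t w => Q t w /\ Q' t w).
Proof.
move=> H H' eta eta0; have eta2 : 0 < eta / 2 by rewrite divr_gt0.
have [S HS] := H _ eta2; have [S' HS'] := H' _ eta2.
exists (Num.max S S') => t; rewrite ge_max => /andP[/HS[G [G1 G2 G3 G4]] /HS'[K [K1 K2 K3 K4]]].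
exists (fun w => G w + K w); split.
- exact: brvD.
- by move=> w; rewrite addr_ge0.
- by rewrite expectD //; lra.
move=> w; have [q|g] := G4 w; last by right; have := K2 w; lra.
by have [q'|k] := K4 w; [left|right; have := G2 w; lra].
Qed.

Lemma in_prob_all (I : eqType) (s : seq I) (Q : I -> R -> T -> Prop) :
  (forall i, i \in s -> in_prob (Q i)) -> in_prob (fun t w => forall i, i \in s -> Q i t w).
Proof.
elim: s => [|j s IH] H.
  move=> eta eta0; exists 0 => t _; exists (fun=> 0); split => //.
  - exact: brv_cst.
  - by rewrite expect_cst ltW.
  - by move=> w; left.
have H1 : in_prob (Q j) by apply: H; rewrite inE eqxx.
have H2 : in_prob (fun t w => forall i, i \in s -> Q i t w).
  by apply: IH => i si; apply: H; rewrite inE si orbT.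
apply: in_prob_imp (in_probI H1 H2) => t w [q1 q2] i.
by rewrite inE => /orP[/eqP ->|]; [|exact: q2].
Qed.

Lemma expRN_gap (a b K del : R) : b <= K -> 0 < del -> del <= `|a - b| ->
  expR (- K) * (1 - expR (- del)) <= `|expR (- a) - expR (- b)|.
Proof.
move=> bK del0 ab; have e1 : expR (- del) < 1 by rewrite -expR0 ltr_expR oppr_lt0.
apply: (@le_trans _ _ (expR (- b) * (1 - expR (- del)))).
  by apply: ler_wpM2r; [rewrite subr_ge0 ltW|rewrite ler_expR lerN2].
have -> : expR (- a) = expR (- b) * expR (- (a - b)) by rewrite -expRD; congr expR; ring.
rewrite -{3}[expR (- b)]mulr1 -mulrBr normrM gtr0_norm ?expR_gt0 //.
apply: ler_wpM2l; first exact: expR_ge0.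
have [ab0|ab0] := leP 0 (a - b).
  rewrite ger0_norm // in ab.
  have : expR (- (a - b)) <= expR (- del) by rewrite ler_expR lerN2.
  by have := ler_norm (- (expR (- (a - b)) - 1)); rewrite normrN; lra.
rewrite ltr0_norm // in ab.
have e2 : 1 + del <= expR (- (a - b)).
  by apply: le_trans (expR_ge1Dx _); lra.
have e3 := expR_ge1Dx (- del).
by have := ler_norm (expR (- (a - b)) - 1); lra.
Qed.

(** [G] is [min 1 (B / (j + 1))]: its expectation tends to 0 by dominated convergence, and it equals
    1 once [B] exceeds [K = j + 1]. *)
Lemma tail_small (B : T -> R) (eta : R) : 0 < eta -> measurable_fun setT B -> (forall w, 0 <= B w) ->
  exists2 K : R, 0 < K & exists G : T -> R,
    [/\ brv G, (forall w, 0 <= G w), \int[P]_w G w <= eta & forall w, B w <= K \/ 1 <= G w].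
Proof.
move=> eta0 mB B0.
have n3 : \forall j \near \oo, \int[P]_w (Num.min 1 (j.+1%:R^-1 * B w)) <= eta.
  apply: expect_near0 => //.
  - by move=> j; apply: measurable_minr => //; exact: measurable_funM.
  - by move=> j w; rewrite le_min ler01 ge_min lexx /= andbT mulr_ge0.
  apply: aeW => w; apply: cvg_min1_0; first by move=> j; rewrite mulr_ge0.
  rewrite -(mul0r (B w)); apply: cvgMr_tmp; exact: cvg_harmonic.
have [j Hj] := filter_ex n3.
have j0 : (0 : R) < j.+1%:R by [].
have b0 w : 0 <= j.+1%:R^-1 * B w by rewrite mulr_ge0.
exists j.+1%:R => //; exists (fun w => Num.min 1 (j.+1%:R^-1 * B w)); split => //.
- by apply: brv_min1 => //; exact: measurable_funM.
- by move=> w; rewrite le_min ler01 b0.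
move=> w; have [h|/ltW h] := leP (B w) j.+1%:R; [by left|right].
by rewrite le_min lexx mulrC ler_pdivlMr // mul1r.
Qed.

(** Chebyshev's inequality in terms of dominating variables: where the event fails and [B <= K], the
    squared difference divided by the squared gap of [expRN_gap] is at least 1. *)
Lemma in_prob_laplace (A : R -> T -> R) (B : T -> R) (del : R) :
  (forall t, measurable_fun setT (A t)) -> (forall t w, 0 <= A t w) -> measurable_fun setT B -> (forall w, 0 <= B w) ->
  (forall eta, 0 < eta -> exists S, forall t, S <= t -> \int[P]_w ((expR (- A t w) - expR (- B w)) ^+ 2) <= eta) ->
  0 < del -> in_prob (fun t w => `|A t w - B w| < del).
Proof.
move=> mA A0 mB B0 H del0 eta eta0; have eta2 : 0 < eta / 2 by rewrite divr_gt0.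
have [K K0 [G [G1 G2 G3 G4]]] := tail_small eta2 mB B0.
pose c := (expR (- K) * (1 - expR (- del))) ^+ 2.
have g0 : 0 < expR (- K) * (1 - expR (- del)).
  by rewrite mulr_gt0 ?expR_gt0 // subr_gt0 -expR0 ltr_expR oppr_lt0.
have c0 : 0 < c by rewrite exprn_gt0.
have [S HS] := H _ (mulr_gt0 c0 eta2); exists S => t /HS Ht.
have bD : brv (fun w => (expR (- A t w) - expR (- B w)) ^+ 2).
  have b := brvB (brv_expRN (mA t) (A0 t)) (brv_expRN mB B0).
  by under eq_fun do rewrite expr2; exact: brvM.
have bE : brv (fun w => c^-1 * (expR (- A t w) - expR (- B w)) ^+ 2) by apply: brvM bD; exact: brv_cst.
have ci : 0 < c^-1 by rewrite invr_gt0.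
exists (fun w => c^-1 * (expR (- A t w) - expR (- B w)) ^+ 2 + G w); split.
- exact: brvD.
- by move=> w; rewrite addr_ge0 // mulr_ge0 ?sqr_ge0 // ltW.
- rewrite expectD // expectZ //.
  have : c^-1 * \int[P]_w (expR (- A t w) - expR (- B w)) ^+ 2 <= eta / 2 by rewrite mulrC ler_pdivrMr // mulrC.
  lra.
move=> w; have s0 : 0 <= c^-1 * (expR (- A t w) - expR (- B w)) ^+ 2 by rewrite mulr_ge0 ?sqr_ge0 // ltW.
have [h|h] := ltP (`|A t w - B w|) del; [by left|right].
have [BK|g] := G4 w; last by lra.
have q := expRN_gap BK del0 h.
have : 1 <= c^-1 * (expR (- A t w) - expR (- B w)) ^+ 2.
  rewrite mulrC ler_pdivlMr // mul1r -[leRHS]real_normK ?num_real // /c.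
  by rewrite lerXn2r ?nnegrE // ltW.
by have := G2 w; lra.
Qed.

End ArbitraryExpectation.

(** * From Laplace functionals to vague convergence in distribution *)

Section VagueConvergence.
Variable R : realType.
Notation meas := {measure set R -> \bar R}.
Implicit Types (nu : meas) (f : R -> R).

Lemma Cc_integrable nu f : loc_finite nu -> Cc f -> nu.-integrable setT (EFin \o f).
Proof.
move=> fnu [cf [M fM]]; have [K K0 fK] := Cc_bounded cf (ex_intro _ M fM).
have mD : measurable (`[- M, M]%classic : set R) by [].
have -> : EFin \o f = (EFin \o f) \_ `[- M, M]%classic.
  apply/funext => x; rewrite patchE; case: ifPn => // /negP xM /=; rewrite fM //.
  rewrite ltNge; apply/negP => xM'; apply: xM; rewrite inE /= in_itv /=.
  by rewrite -ler_norml.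
rewrite -integrable_mkcond //; apply: (@integrable_bdd _ _ _ nu _ _ K) => //.
by apply: measurable_funTS; exact: continuous_measurable_fun.
Qed.

Lemma CcD f g : Cc f -> Cc g -> Cc (fun x => f x + g x).
Proof.
move=> [cf [M fM]] [cg [N gN]]; split; first by move=> x; apply: cvgD; [exact: cf|exact: cg].
by exists (Num.max M N) => x; rewrite gt_max => /andP[/fM -> /gN ->]; rewrite addr0.
Qed.

Lemma CcZ c f : Cc f -> Cc (fun x => c * f x).
Proof.
move=> [cf [M fM]]; split; first by move=> x; apply: cvgMl_tmp; exact: cf.
by exists M => x /fM ->; rewrite mulr0.
Qed.

Lemma Cc_abs f : Cc f -> Cc (fun x => `|f x|).
Proof.
move=> [cf [M fM]]; split; first by move=> x; apply: cvg_norm; exact: cf.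
by exists M => x /fM ->; rewrite normr0.
Qed.

Lemma Cc_split f : Cc f -> exists f1 f2 : R -> R,
  [/\ Cc f1, Cc f2, forall x, 0 <= f1 x, forall x, 0 <= f2 x & f = (fun x => f1 x - f2 x)].
Proof.
move=> cf; exists (fun x => 2^-1 * (`|f x| + f x)), (fun x => 2^-1 * (`|f x| + (-1) * f x)); split.
- by apply: CcZ; apply: CcD => //; exact: Cc_abs.
- by apply: CcZ; apply: CcD; [exact: Cc_abs|exact: CcZ].
- by move=> x; rewrite mulr_ge0 //; have := ler_norm (- f x); rewrite normrN; lra.
- by move=> x; rewrite mulr_ge0 //; have := ler_norm (f x); lra.
by apply/funext => x; field.
Qed.

Lemma CcB_pairing nu f g : loc_finite nu -> Cc f -> Cc g ->
  pairing nu (fun x => f x - g x) = pairing nu f - pairing nu g.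
Proof. by move=> fnu cf cg; rewrite /pairing RintegralB //; exact: Cc_integrable. Qed.

Lemma eq_pairing nu nu' f : (forall A, measurable A -> nu A = nu' A) -> pairing nu f = pairing nu' f.
Proof.
by move=> H; rewrite /pairing /Rintegral; congr fine; apply: eq_measure_integral => A mA _; exact: H.
Qed.

Lemma pairing_pushforward nu nu' (phi f : R -> R) : measurable_fun setT phi ->
  (forall A, measurable A -> nu' A = nu (phi @^-1` A)) -> measurable_fun setT f -> (forall x, 0 <= f x) ->
  pairing nu' f = pairing nu (f \o phi).
Proof.
move=> mphi H mf f0.
pose m2 : meas := measure_function.measure_function_pushforward__canonical__measure_function_Measure nu mphi.
rewrite (@eq_pairing nu' m2) //; rewrite /pairing /Rintegral; congr fine.
rewrite ge0_integral_pushforward //; first exact/measurable_EFinP.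
by move=> y _; rewrite lee_fin.
Qed.

(** The absolute value gives a measure for every real [c], so that no proof of sign is carried in
    the type. *)
Definition abs_scale (c : R) nu : meas := mscale (`|c|%:nng)%R nu.

Lemma abs_scale_loc_finite c nu : loc_finite nu -> loc_finite (abs_scale c nu).
Proof. by move=> fnu M; rewrite /abs_scale /= /mscale /=; apply: lte_mul_pinfty. Qed.

Lemma pairing_abs_scale c nu f : loc_finite nu -> Cc f -> pairing (abs_scale c nu) f = `|c| * pairing nu f.
Proof.
move=> fnu; have pos g : Cc g -> (forall x, 0 <= g x) -> pairing (abs_scale c nu) g = `|c| * pairing nu g.
  move=> cg g0; rewrite /pairing /Rintegral ge0_integral_mscale //.
  - by rewrite fineM //; exact: (integrable_fin_num measurableT (Cc_integrable fnu cg)).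
  - by apply/measurable_EFinP; apply: continuous_measurable_fun; exact: cg.1.
  - by move=> x _; rewrite lee_fin.
move=> /Cc_split[f1 [f2 [c1 c2 p1 p2 ->]]].
rewrite (CcB_pairing (abs_scale_loc_finite c fnu) c1 c2) (CcB_pairing fnu c1 c2) !pos //; ring.
Qed.

(** Measures that agree on measurable sets have the same pairings, so vague continuity forces [F] to
    identify them. The limit [Z] is described on measurable sets only. *)
Lemma vague_test_ext (F : meas -> R) nu nu' : vague_test_fun F -> loc_finite nu ->
  (forall A, measurable A -> nu' A = nu A) -> F nu' = F nu.
Proof.
move=> [_ Fc] fnu H; apply/eqP; rewrite -subr_eq0 -normr_eq0 eq_le normr_ge0 andbT.
apply/ler_addgt0Pl => e e0; rewrite addr0.
have [n [fs [del [del0 [_ K]]]]] := Fc _ fnu e e0.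
apply: ltW; apply: K => [M|i]; first by rewrite H.
by rewrite (eq_pairing _ H) subrr normr0.
Qed.

(* Compactness of [0, m] makes the vague continuity of F along c |-> c nu uniform, with finitely
   many test functions. *)
Lemma vague_uniform (F : meas -> R) nu (m e : R) : vague_test_fun F -> loc_finite nu -> 0 < e ->
  exists (L : seq R) (n : R -> nat) (fs : forall c, 'I_(n c) -> R -> R) (del : R -> R),
  [/\ forall c, 0 < del c, forall c i, Cc (fs c i) &
    forall c, 0 <= c <= m -> exists2 c0, c0 \in L & forall nu' : meas, loc_finite nu' ->
      (forall i, `|pairing nu' (fs c0 i) - c * pairing nu (fs c0 i)| < del c0) ->
      `|F nu' - F (abs_scale c nu)| < 2 * e].
Proof.
move=> [_ Fc] fnu e0.
have H c : exists p : {n : nat & ('I_n -> R -> R)} * R, [/\ 0 < p.2, forall i, Cc (projT2 p.1 i) &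
    forall nu' : meas, loc_finite nu' ->
      (forall i, `|pairing nu' (projT2 p.1 i) - `|c| * pairing nu (projT2 p.1 i)| < p.2) ->
      `|F nu' - F (abs_scale c nu)| < e].
  have [n [fs [del [del0 [cfs K]]]]] := Fc _ (abs_scale_loc_finite c fnu) e e0.
  exists (existT _ n fs, del); split => // nu' fnu' H; apply: K => // i.
  by rewrite (pairing_abs_scale c fnu (cfs i)); exact: H.
have [g Hg] := choice H.
pose S c := \sum_i `|pairing nu (projT2 (g c).1 i)|.
have S0 c : 0 <= S c by apply: sumr_ge0.
have S1 c : 0 < 1 + S c by have := S0 c; lra.
have d0 c : 0 < (g c).2 by have [] := Hg c.
have [L HL] := @finite_ball_cover R 0 m (fun c => (g c).2 / 2 / (1 + S c))
  (fun c => divr_gt0 (divr_gt0 (d0 c) (ltr0n _ 2)) (S1 c)).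
exists L, (fun c => projT1 (g c).1), (fun c => projT2 (g c).1), (fun c => (g c).2 / 2); split.
- by move=> c; exact: divr_gt0.
- by move=> c i; have [_ + _] := Hg c; exact.
move=> c cm; have [c0 c0L cc0] := HL c cm; exists c0 => // nu' fnu' K.
have [_ cfs Hc0] := Hg c0; have c_ge0 : 0 <= c by have /andP[] := cm.
have small i : `|c * pairing nu (projT2 (g c0).1 i) - `|c0| * pairing nu (projT2 (g c0).1 i)| < (g c0).2 / 2.
  rewrite -mulrBl normrM; have pS : `|pairing nu (projT2 (g c0).1 i)| <= 1 + S c0.
    rewrite /S (bigD1 i) //=; have : 0 <= \sum_(j | j != i) `|pairing nu (projT2 (g c0).1 j)| by apply: sumr_ge0.
    lra.
  apply: (@le_lt_trans _ _ (`|c - c0| * (1 + S c0))); last by rewrite -ltr_pdivlMr.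
  apply: ler_pM => //; rewrite -{1}(ger0_norm c_ge0).
  exact: ler_dist_dist.
have a1 : `|F nu' - F (abs_scale c0 nu)| < e.
  apply: Hc0 => // i; have := K i; have := small i.
  have := ler_distD (c * pairing nu (projT2 (g c0).1 i)) (pairing nu' (projT2 (g c0).1 i)) (`|c0| * pairing nu (projT2 (g c0).1 i)).
  lra.
have a2 : `|F (abs_scale c nu) - F (abs_scale c0 nu)| < e.
  apply: Hc0 => [|i]; first exact: abs_scale_loc_finite.
  rewrite (pairing_abs_scale c fnu (cfs i)) (ger0_norm c_ge0); have := small i; have := d0 c0; lra.
have := ler_distD (F (abs_scale c0 nu)) (F nu') (F (abs_scale c nu)).
by rewrite [`|F (abs_scale c0 nu) - _|]distrC; lra.
Qed.

Variables (d : measure_display) (Omega : measurableType d) (P : probability Omega R).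
Variables (Y : R -> Omega -> meas) (V : Omega -> R) (nu : meas) (Z : Omega -> meas).
Hypothesis Yfin : forall t w, loc_finite (Y t w).
Hypothesis Ymeas : forall t f, Cc f -> (forall x, 0 <= f x) -> measurable_fun setT (fun w => pairing (Y t w) f).
Hypotheses (mV : measurable_fun setT V) (V0 : forall w, 0 <= V w) (nufin : loc_finite nu).
Hypothesis Ylap : forall f, Cc f -> (forall x, 0 <= f x) -> forall eta, 0 < eta -> exists S, forall t, S <= t ->
  \int[P]_w ((expR (- pairing (Y t w) f) - expR (- (V w * pairing nu f))) ^+ 2) <= eta.
Hypothesis ZE : {ae P, forall w, forall A, measurable A -> Z w A = ((V w)%:E * nu A)%E}.

Lemma pairing_in_prob f (del : R) : Cc f -> 0 < del ->
  in_prob P (fun t w => `|pairing (Y t w) f - V w * pairing nu f| < del).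
Proof.
move=> /Cc_split[f1 [f2 [c1 c2 p1 p2 ->]]] del0; have del2 : 0 < del / 2 by rewrite divr_gt0.
have K g : Cc g -> (forall x, 0 <= g x) -> in_prob P (fun t w => `|pairing (Y t w) g - V w * pairing nu g| < del / 2).
  move=> cg g0; apply: in_prob_laplace del2 => [t|t w||w|].
  - exact: Ymeas.
  - exact: pairing_ge0.
  - exact: measurable_funM.
  - by apply: mulr_ge0 => //; exact: pairing_ge0.
  - exact: Ylap.
apply: in_prob_imp (in_probI (K _ c1 p1) (K _ c2 p2)) => t w [].
rewrite (CcB_pairing (Yfin t w) c1 c2) (CcB_pairing nufin c1 c2).
move: (pairing _ _) (pairing _ _) (pairing _ _) (pairing _ _) => a b c e h1 h2.
have -> : e - b - V w * (c - a) = (e - V w * c) - (b - V w * a) by ring.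
by apply: (le_lt_trans (ler_normB _ _)); lra.
Qed.

(** Outside events of small expectation, [V <= m] and [Y t] is close to [V nu] on the finitely many
    test functions of [vague_uniform]; there the values of [F] are close, elsewhere they differ by
    at most [2 M]. *)
Lemma laplace_cvg_in_distribution : cvg_in_distribution P Y Z.
Proof.
move=> F Ft; have [[M0 FM0] _] := Ft.
pose M := `|M0|; have M_ge0 : 0 <= M by exact: normr_ge0.
have FM n : `|F n| <= M by apply: (le_trans (FM0 n)); exact: ler_norm.
(* Almost surely [Z] agrees on measurable sets with the scaled [nu]; the null set is absorbed by
   [expect_close] with [G] equal to [2 M] times its indicator. *)
have -> : \int[P]_w F (Z w) = \int[P]_w F (abs_scale (V w) nu).
  have [N [mN PN sub]] := ZE.
  have bN : brv (\1_N : Omega -> R).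
    by split; [exact: measurable_indic|exists 1 => w; rewrite ger0_norm // indicE; case: (_ \in _)].
  have := @expect_close _ _ _ P (fun w => F (Z w)) (fun w => F (abs_scale (V w) nu)) (fun w => (2 * M) * \1_N w) M
    (brvM (brv_cst _ (2 * M)) bN) (fun w => FM _) (fun w => FM _) _.
  have iN : \int[P]_w (\1_N w : R) = 0 by rewrite /Rintegral integral_indic // setIT; exact: (congr1 fine PN).
  rewrite (expectZ P (2 * M) bN) iN !mulr0 => H.
  apply/eqP; rewrite -subr_eq0 -normr_le0; apply: H => w.
  have [wN|wN] := pselect (N w).
    by rewrite indicE mem_set // mulr1; apply: (le_trans (ler_normB _ _)); have := FM (Z w); have := FM (abs_scale (V w) nu); lra.
  rewrite indicE memNset // mulr0 normr_le0 subr_eq0; apply/eqP.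
  apply: (vague_test_ext Ft (abs_scale_loc_finite _ nufin)) => A mA.
  have Zw : forall A, measurable A -> Z w A = ((V w)%:E * nu A)%E.
    by apply: contrapT => h; apply: wN; exact: sub.
  by rewrite Zw //= /mscale /= ger0_norm.
apply/cvgrPdist_le => e e0.
have M1 : 0 < 16 * (M + 1) by lra.
(* The [+ 1] guards against [M = 0]; the total error is at most [2 (e / 4 + 4 M eta)], hence at most
   [e]. *)
pose eta := e / (16 * (M + 1)); have eta0 : 0 < eta by exact: divr_gt0.
have e80 : 0 < e / 8 by rewrite divr_gt0.
have [m m0 [G1 [bG1 G10 iG1 HG1]]] := tail_small P eta0 mV V0.
have [L [n [fs [del [del0 cfs HL]]]]] := vague_uniform m Ft nufin e80.
have Q : in_prob P (fun t w => forall c, c \in L -> forall i, i \in enum 'I_(n c) ->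
    `|pairing (Y t w) (fs c i) - V w * pairing nu (fs c i)| < del c).
  apply: in_prob_all => c cL; apply: in_prob_all => i _; exact: pairing_in_prob.
have [S HS] := Q _ eta0; exists S; split; first exact: num_real.
move=> t /ltW /HS[G2 [bG2 G20 iG2 HG2]].
have b12 := brvD bG1 bG2.
have bG : brv (fun w => 2 * (e / 8) + 2 * M * (G1 w + G2 w)).
  by apply: brvD; [exact: brv_cst|exact: brvM (brv_cst _ _) b12].
have K : `|\int[P]_w F (Y t w) - \int[P]_w F (abs_scale (V w) nu)| <= 2 * \int[P]_w (2 * (e / 8) + 2 * M * (G1 w + G2 w)).
  apply: (@expect_close _ _ _ P (fun w => F (Y t w)) (fun w => F (abs_scale (V w) nu)) _ M bG) => [w|w|w]; [exact: FM|exact: FM|].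
  have two : `|F (Y t w) - F (abs_scale (V w) nu)| <= 2 * M.
    by apply: (le_trans (ler_normB _ _)); have := FM (Y t w); have := FM (abs_scale (V w) nu); lra.
  have bad : 1 <= G1 w + G2 w -> `|F (Y t w) - F (abs_scale (V w) nu)| <= 2 * (e / 8) + 2 * M * (G1 w + G2 w).
    move=> h; apply: (le_trans two).
    have : 2 * M * 1 <= 2 * M * (G1 w + G2 w) by apply: ler_wpM2l => //; lra.
    lra.
  have [Vm|g] := HG1 w; last by apply: bad; have := G20 w; lra.
  have [q|g] := HG2 w; last by apply: bad; have := G10 w; lra.
  have Vm' : 0 <= V w <= m by rewrite V0.
  have [c0 c0L H] := HL _ Vm'.
  apply: (@le_trans _ _ (2 * (e / 8))).
    by apply: ltW; apply: H => // i; apply: q => //; rewrite mem_enum.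
  by rewrite lerDl mulr_ge0 // ?addr_ge0 // mulr_ge0.
rewrite distrC; apply: (le_trans K).
rewrite (expectD P (brv_cst _ _) (brvM (brv_cst _ (2 * M)) b12)) expect_cst (expectZ P (2 * M) b12) (expectD P bG1 bG2).
have : 2 * M * (\int[P]_w G1 w + \int[P]_w G2 w) <= 2 * (M + 1) * (2 * eta).
  by apply: ler_pM; [lra|rewrite addr_ge0 // ?Rintegral_ge0|lra|lra].
have -> : 2 * (M + 1) * (2 * eta) = e / 4 by rewrite /eta; field; lra.
lra.
Qed.

End VagueConvergence.

(** * The superprocess and its limit *)

Section Superprocess.
Variable R : realType.
Notation leb := (@lebesgue_measure R).
Notation meas := {measure set R -> \bar R}.
Variables (beta alpha : R -> R) (pik : R -> meas) (lam : R) (h : R -> R).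
Hypothesis gs : ground_state beta lam h.
Hypotheses (acont : continuous alpha) (asupp : compact_supp alpha) (a0 : forall x, 0 <= alpha x).
Hypothesis pmeas : forall A, measurable A -> measurable_fun setT (fun x : R => (pik x A : \bar R)).
Hypothesis pik0 : forall x, pik x `]-oo, 0]%classic = 0%E.
Hypothesis pint : forall x, (\int[pik x]_(u in setT) ((u ^+ 2)%:E) < +oo)%E.
Hypothesis pcont : continuous (fun x => \int[pik x]_(u in setT) u ^+ 2).
Hypothesis psupp : compact_supp (fun x => \int[pik x]_(u in setT) u ^+ 2).
Variables (d : measure_display) (Omega : measurableType d) (P : probability Omega R).
Variables (X : R -> Omega -> meas) (W : Omega -> R).
Hypothesis Xfin : forall t w, (X t w setT < +oo)%E.
Hypothesis Xmeas : forall t A, measurable A -> measurable_fun setT (fun w : Omega => (X t w A : \bar R)).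
Hypothesis Xlaw : forall s t : R, 0 <= s <= t ->
   forall f : R -> R, bnn_meas f ->
   forall u : R -> R -> R, mild_solution beta alpha pik f u ->
   forall (n : nat) (r : 'I_n -> R) (g : 'I_n -> R -> R),
     (forall i, 0 <= r i <= s) -> (forall i, bnn_meas (g i)) ->
     (\int[P]_(w in setT)
        (expR (- \sum_(i < n) pairing (X (r i) w) (g i))
         * expR (- pairing (X t w) f))%:E =
      \int[P]_(w in setT)
        (expR (- \sum_(i < n) pairing (X (r i) w) (g i))
         * expR (- pairing (X s w) (u (t - s))))%:E)%E.
Hypothesis Wmeas : measurable_fun setT W.
Hypothesis Wlim : {ae P, forall w,
     (expR (- lam * t) * pairing (X t w) h) @[t --> +oo] --> W w}.
Let bc := gs_bcont gs.
Let bs := gs_bsupp gs.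
Let hp := gs_pos gs.
Let bh := gs_bmf gs.

Lemma bnn_bmf (f : R -> R) : bmf f -> (forall x, 0 <= f x) -> bnn_meas f.
Proof.
move=> [mf [M fM]] f0; split => //; split => //; exists M => x; apply: le_trans (fM x); exact: ler_norm.
Qed.

Lemma laplace_transform (s t : R) (f : R -> R) u : 0 <= s <= t -> bmf f -> (forall x, 0 <= f x) -> mild_solution beta alpha pik f u ->
  \int[P]_w expR (- pairing (X t w) f) = \int[P]_w expR (- pairing (X s w) (u (t - s))).
Proof.
move=> st bf f0 mu.
have e (Q : 'I_0 -> Prop) i : Q i by case: i.
have := Xlaw st (bnn_bmf bf f0) mu (n := 0%N) (r := fun=> 0) (g := fun _ _ => 0) (e _) (e _).
have F (Z : Omega -> R) : (\int[P]_w (expR (- \sum_(i < 0) pairing (X 0 w) (fun=> 0)) * expR (- Z w))%:E = \int[P]_w (expR (- Z w))%:E)%E.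
  by apply: eq_integral => w _; rewrite big_ord0 oppr0 expR0 mul1r.
by rewrite !F /Rintegral => ->.
Qed.

(** The Markov property at time [s], read from the law with a single observation placed at [s]
    itself. *)
Lemma joint_laplace_transform (s t : R) (f g : R -> R) u : 0 <= s <= t -> bmf f -> (forall x, 0 <= f x) -> bmf g -> (forall x, 0 <= g x) ->
  mild_solution beta alpha pik f u ->
  \int[P]_w (expR (- pairing (X s w) g) * expR (- pairing (X t w) f)) =
  \int[P]_w (expR (- pairing (X s w) g) * expR (- pairing (X s w) (u (t - s)))).
Proof.
move=> /andP[s0 st] bf f0 bg g0 mu; have st' : 0 <= s <= t by rewrite s0.
have ss : 0 <= s <= s by rewrite s0 lexx.
have := Xlaw st' (bnn_bmf bf f0) mu (n := 1%N) (r := fun=> s) (g := fun=> g) (fun=> ss) (fun=> bnn_bmf bg g0).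
have F (Z : Omega -> R) : (\int[P]_w (expR (- \sum_(i < 1) pairing (X s w) g) * expR (- Z w))%:E = \int[P]_w (expR (- pairing (X s w) g) * expR (- Z w))%:E)%E.
  by apply: eq_integral => w _; rewrite big_ord1.
by rewrite !F /Rintegral => ->.
Qed.

Let chain_le (eta D M A B E : R) : 0 <= eta -> D <= 3 * M -> M <= A + B -> E <= eta / 8 -> B <= eta / 24 ->
  A <= eta / 24 -> 2 * D + 2 * E <= eta.
Proof. by move=> *; lra. Qed.

Section Front.
Variables (s : R) (f : R -> R) (Mf : R).
Hypotheses (s1 : s * s = 1) (bf : bmf f) (f0 : forall x, 0 <= f x) (fM : forall x, Mf < `|x| -> f x = 0).
Notation I := (front_mass beta lam h s f).

Let f2 x := 2 * f x.
Let bf2 : bmf f2. Proof. exact: bmfZ. Qed.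
Let f20 x : 0 <= f2 x. Proof. by rewrite mulr_ge0. Qed.
Let f2M x : Mf < `|x| -> f2 x = 0. Proof. by move=> /fM; rewrite /f2 => ->; rewrite mulr0. Qed.

Lemma front_mass2 : front_mass beta lam h s (fun x => 2 * f x) = 2 * I.
Proof.
have i := front_weight_integrable gs s1 bf fM.
have E : \int[leb]_y (2 * f y * expR (s * decay lam * y)) = 2 * \int[leb]_y (f y * expR (s * decay lam * y)).
  by rewrite -RintegralZl //; apply: eq_Rintegral => y _; rewrite mulrA.
by rewrite /front_mass E mulrCA.
Qed.

Let p r w := pairing (X r w) h.
Let m r w := pairing (X r w) (cst 1).
(** The approximation of the Laplace variable of the front by what is known at time [r]; along
    integers it tends almost surely to [exp (- I W)]. *)
Let Y r w := expR (- (I * expR (- (lam * r)) * p r w)).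

Let p0 r w : 0 <= p r w.
Proof. by apply: pairing_ge0 => x; exact: ltW (hp x). Qed.

Let m0 r w : 0 <= m r w.
Proof. by apply: pairing_ge0 => x /=. Qed.

Let mp r : measurable_fun setT (p r).
Proof.
apply: measurable_pairing; [exact: Xmeas|exact: bh.1|].
by move=> x; exact: ltW (hp x).
Qed.

Let mm r : measurable_fun setT (m r).
Proof. by apply: measurable_pairing => //; exact: Xmeas. Qed.

Let I0 : 0 <= I.
Proof. exact: (front_mass_ge0 gs s1 f0). Qed.

Let bY r : brv (Y r).
Proof.
apply: brv_expRN; first exact: measurable_funM.
by move=> w; apply: mulr_ge0; [apply: mulr_ge0; [exact: I0|exact: expR_ge0]|exact: p0].
Qed.

(** [U1] and [U2] come from the mild solutions started from the fronts of [f] and of [2 f]; the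
    latter evaluates the transform of [2 A]. The function observed jointly at time [r] is
    [I e^{- lam r} h], which covers the cross term of the square. *)
Lemma front_L2_fixed : exists2 C, 0 <= C & forall r e, 0 <= r -> 0 < e ->
  exists T, forall t, T <= t ->
  \int[P]_w ((expR (- pairing (X t w) (front lam s f t)) - Y r w) ^+ 2) <=
    3 * \int[P]_w Num.min 1 (e * m r w + C * expR (- (2 * lam * r)) * p r w).
Proof.
have [C1 C10 H1] := nl_sol_cvg gs s1 bf f0 fM acont asupp a0 pmeas pik0 pint pcont psupp.
have [C2 C20 H2] := nl_sol_cvg gs s1 bf2 f20 f2M acont asupp a0 pmeas pik0 pint pcont psupp.
exists (C1 + C2) => [|r e r0 e0]; first exact: addr_ge0.
have [T1 HT1] := H1 r e r0 e0; have [T2 HT2] := H2 r e r0 e0.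
exists (Num.max r (Num.max T1 T2)) => t; rewrite !ge_max => /and3P[rt tT1 tT2].
pose g1 := front lam s f t; pose g2 := front lam s f2 t.
have b1 : bmf g1 by exact: bmf_front.
have b2 : bmf g2 by exact: bmf_front.
have g10 x : 0 <= g1 x by exact: front_ge0.
have g20 x : 0 <= g2 x by exact: front_ge0.
have [u1 [ms1 lu1 u10 su1]] := mild_exists bc bs acont asupp a0 pmeas pik0 pint pcont psupp b1 g10.
have [u2 [ms2 lu2 u20 su2]] := mild_exists bc bs acont asupp a0 pmeas pik0 pint pcont psupp b2 g20.
have v1 := HT1 t u1 tT1 (And3 lu1 u10 su1); have v2 := HT2 t u2 tT2 (And3 lu2 u20 su2).
have tr0 : 0 <= t - r by rewrite subr_ge0.
pose U1 w := pairing (X r w) (u1 (t - r)); pose U2 w := pairing (X r w) (u2 (t - r)).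
have bu1 : bmf (u1 (t - r)) by exact: lbm_bmf.
have bu2 : bmf (u2 (t - r)) by exact: lbm_bmf.
have U10 w : 0 <= U1 w by apply: pairing_ge0 => x; exact: u10.
have U20 w : 0 <= U2 w by apply: pairing_ge0 => x; exact: u20.
have mU1 : measurable_fun setT U1 by apply: measurable_pairing; [exact: Xmeas|exact: bu1.1|move=> x; exact: u10].
have mU2 : measurable_fun setT U2 by apply: measurable_pairing; [exact: Xmeas|exact: bu2.1|move=> x; exact: u20].
pose A w := pairing (X t w) g1.
have A0 w : 0 <= A w by exact: pairing_ge0.
have mA : measurable_fun setT A by apply: measurable_pairing; [exact: Xmeas|exact: b1.1|].
pose y w := I * expR (- (lam * r)) * p r w.
have y0 w : 0 <= y w by apply: mulr_ge0; [apply: mulr_ge0; [exact: I0|exact: expR_ge0]|exact: p0].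
have my : measurable_fun setT y by exact: measurable_funM.
pose dl w := e * m r w + (C1 + C2) * expR (- (2 * lam * r)) * p r w.
have dl0 w : 0 <= dl w by rewrite addr_ge0 ?mulr_ge0 ?expR_ge0 ?addr_ge0 ?(ltW e0).
have mdl : measurable_fun setT dl by apply: measurable_funD; exact: measurable_funM.
have rt' : 0 <= r <= t by rewrite r0.
have L2 : \int[P]_w expR (- pairing (X t w) g2) = \int[P]_w expR (- U2 w) := laplace_transform rt' b2 g20 ms2.
have bG : bmf (fun x => I * expR (- (lam * r)) * h x) by exact: bmfZ.
have G0 x : 0 <= I * expR (- (lam * r)) * h x by apply: mulr_ge0; [apply: mulr_ge0; [exact: I0|exact: expR_ge0]|exact: ltW (hp x)].
have L1 := joint_laplace_transform rt' b1 g10 bG G0 ms1.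
have pG w : pairing (X r w) (fun x => I * expR (- (lam * r)) * h x) = y w by rewrite pairingZ.
have L1' : \int[P]_w (expR (- y w) * expR (- A w)) = \int[P]_w (expR (- y w) * expR (- U1 w)).
  under eq_Rintegral do rewrite -pG. under [RHS]eq_Rintegral do rewrite -pG. exact: L1.
have p2 w : pairing (X t w) g2 = 2 * A w by rewrite /A -pairingZ.
have L2' : \int[P]_w expR (- (2 * A w)) = \int[P]_w expR (- U2 w).
  by rewrite -L2; apply: eq_Rintegral => w _; rewrite p2.
have close (u : R -> R) (J C : R) w : bmf u -> 0 <= C -> C <= C1 + C2 ->
    (forall x, `|u x - J * expR (- (lam * r)) * h x| <= e + C * expR (- (2 * lam * r)) * h x) ->
    `|pairing (X r w) u - J * expR (- (lam * r)) * p r w| <= dl w.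
  move=> bu C0 CC Hu; have bJ : bmf (fun x => J * expR (- (lam * r)) * h x) by exact: bmfZ.
  rewrite /p -(pairingZ _ (Xfin r w) bh) -(pairingB (Xfin r w) bu bJ).
  have be := bmf_cst (1 : R); have beh : bmf (fun x => e * 1 + (C1 + C2) * expR (- (2 * lam * r)) * h x).
    by apply: bmfD; exact: bmfZ.
  apply: le_trans (pairing_abs (Xfin r w) (bmfB bu bJ) beh _) _.
    move=> x; apply: (le_trans (Hu x)); rewrite mulr1 lerD2l; apply: ler_wpM2r; first exact: ltW (hp x).
    by apply: ler_wpM2r CC; exact: expR_ge0.
  by rewrite (pairingD (Xfin r w) (bmfZ e be) (bmfZ _ bh)) (pairingZ _ (Xfin r w) be) (pairingZ _ (Xfin r w) bh).
have C1le : C1 <= C1 + C2 by rewrite lerDl.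
have C2le : C2 <= C1 + C2 by rewrite lerDr.
have c1 w : `|U1 w - y w| <= dl w.
  by exact: (close _ I C1 w bu1 C10 C1le v1).
have c2 w : `|U2 w - 2 * y w| <= dl w.
  have -> : 2 * y w = (2 * I) * expR (- (lam * r)) * p r w by rewrite /y; ring.
  by apply: (close _ (2 * I) C2 w bu2 C20 C2le) => x; rewrite -front_mass2; exact: v2.
exact: (expect_sq_le mA my mU1 mU2 mdl A0 y0 U10 U20 dl0 L1' L2' c1 c2).
Qed.

Let Zn (n : nat) w := expR (- (lam * n%:R)) * p n%:R w.

Let Zn_cvg : {ae P, forall w, Zn n w @[n --> \oo] --> W w}.
Proof.
apply: filterS Wlim => w Ww.
have H := cvg_comp (fun n : nat => (n%:R : R)) _ (@cvgr_idn R) Ww.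
by under eq_fun do rewrite /Zn -mulNr; exact: H.
Qed.

Let Zn0 n w : 0 <= Zn n w.
Proof. by apply: mulr_ge0; [exact: expR_ge0|exact: p0]. Qed.

Lemma limit_ge0 : {ae P, forall w, 0 <= W w}.
Proof.
apply: filterS Zn_cvg => w cw.
rewrite -(cvg_lim (@Rhausdorff R) cw); apply: limr_ge; first by apply/cvg_ex; exists (W w).
by apply: nearW => n; exact: Zn0.
Qed.

(** The order of choices matters: an integer time [n] at which the martingale is close to its limit
    and the second-order term is small; then [j], making [1 / (j + 1)] times the total mass at time
    [n] small; only then [t]. *)
Lemma front_L2 eta : 0 < eta -> exists T, forall t, T <= t ->
  \int[P]_w ((expR (- pairing (X t w) (front lam s f t)) - expR (- (I * Num.max (W w) 0))) ^+ 2) <= eta.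
Proof.
move=> eta0; have [C C0 HC] := front_L2_fixed.
have lam0 := gs_lam gs.
pose V w := expR (- (I * Num.max (W w) 0)).
have W0 w : 0 <= I * Num.max (W w) 0 by apply: mulr_ge0; [exact: I0|rewrite le_max lexx orbT].
have mW : measurable_fun setT (fun w => I * Num.max (W w) 0).
  by apply: measurable_funM => //; exact: measurable_maxr.
have bV : brv V by exact: brv_expRN.
have YE n w : Y n%:R w = expR (- (I * Zn n w)) by rewrite /Y /Zn mulrA.
have dm (a b : R) : 0 <= a -> 0 <= b -> 0 <= (expR (- a) - expR (- b)) ^+ 2 <= 1.
  move=> a0' b0'; rewrite sqr_ge0 /= -real_normK ?num_real //.
  by rewrite expr_le1 // (le_trans (expRN_dist a0' b0')) // ge_min lexx.
have n1 : \forall n \near \oo, \int[P]_w ((Y n%:R w - V w) ^+ 2) <= eta / 8.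
  apply: expect_near0; first by rewrite divr_gt0.
  - by move=> n; have [mD _] := brvB (bY n%:R) bV; exact: (measurable_funX 2 mD).
  - move=> n w; rewrite YE; apply: dm (W0 w); apply: mulr_ge0; [exact: I0|exact: Zn0].
  apply: filterS2 Zn_cvg limit_ge0 => w cw Ww0.
  have -> : (fun n : nat => (Y n%:R w - V w) ^+ 2) = (fun n => (expR (- (I * Zn n w)) - expR (- (I * W w))) ^+ 2).
    by apply/funext => n; rewrite YE /V max_l.
  have c1 : expR (- (I * Zn n w)) @[n --> \oo] --> expR (- (I * W w)).
    have c0 : - (I * Zn n w) @[n --> \oo] --> - (I * W w) by apply: cvgN; exact: cvgMl_tmp cw.
    exact: (cvg_comp _ _ c0 (@continuous_expR R _)).
  have c2 : (expR (- (I * Zn n w)) - expR (- (I * W w))) @[n --> \oo] --> 0.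
    by rewrite -(subrr (expR (- (I * W w)))); apply: cvgB => //; exact: cvg_cst.
  have K := cvgM c2 c2; rewrite mul0r in K; exact: K.
have n2 : \forall n \near \oo, \int[P]_w (Num.min 1 (C * expR (- (2 * lam * n%:R)) * p n%:R w)) <= eta / 24.
  have q0 n w : 0 <= C * expR (- (2 * lam * n%:R)) * p n%:R w.
    by apply: mulr_ge0; [apply: mulr_ge0; [exact: C0|exact: expR_ge0]|exact: p0].
  apply: expect_near0; first by rewrite divr_gt0.
  - by move=> n; apply: measurable_minr => //; exact: measurable_funM.
  - by move=> n w; rewrite le_min ler01 q0 ge_min lexx.
  apply: filterS Zn_cvg => w cw; apply: cvg_min1_0; first by move=> n; exact: q0.
  (* The second-order term is [e^{- lam n}] times the convergent martingale, so it tends to 0. *)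
  have -> : (fun n : nat => C * expR (- (2 * lam * n%:R)) * p n%:R w) = (fun n => C * expR (- (lam * n%:R)) * Zn n w).
    apply/funext => n; rewrite /Zn mulrA -[in RHS](mulrA C) -expRD; congr (_ * expR _ * _); ring.
  have e0 : expR (- (lam * n%:R)) @[n --> \oo] --> 0.
    have lt : (fun n : nat => lam * n%:R) @ \oo --> +oo.
      have l1 : lam * x @[x --> +oo] --> +oo by exact: gt0_cvgMry lam0 cvg_id.
      exact: (cvg_comp _ _ (@cvgr_idn R) l1).
    exact: (cvg_comp _ _ lt (@cvgr_expR R)).
  have := cvgM (cvgM (cvg_cst C) e0) cw; rewrite mulr0 mul0r; exact.
have [n [Hn1 Hn2]] : exists n : nat, \int[P]_w ((Y n%:R w - V w) ^+ 2) <= eta / 8 /\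
   \int[P]_w (Num.min 1 (C * expR (- (2 * lam * n%:R)) * p n%:R w)) <= eta / 24.
  have [n Hn] := filter_ex (filterI n1 n2); by exists n.
have n3 : \forall j \near \oo, \int[P]_w (Num.min 1 (j.+1%:R^-1 * m n%:R w)) <= eta / 24.
  apply: expect_near0; first by rewrite divr_gt0.
  - by move=> j; apply: measurable_minr => //; exact: measurable_funM.
  - by move=> j w; rewrite le_min ler01 ge_min lexx /= andbT; apply: mulr_ge0; [rewrite invr_ge0|exact: m0].
  apply: aeW => w; apply: cvg_min1_0; first by move=> j; apply: mulr_ge0; [rewrite invr_ge0|exact: m0].
  rewrite -(mul0r (m n%:R w)); apply: cvgMr_tmp; exact: cvg_harmonic.
have [j Hj] := filter_ex n3.
have j0 : (0 : R) < j.+1%:R^-1 by rewrite invr_gt0.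
have [T HT] := HC n%:R _ (ler0n _ _) j0.
exists T => t /HT HD.
pose A w := expR (- pairing (X t w) (front lam s f t)).
have bA : brv A.
  apply: brv_expRN; last by move=> w; apply: pairing_ge0 => x; exact: front_ge0.
  apply: measurable_pairing; [exact: Xmeas|exact: (bmf_front lam s bf t).1|].
  by move=> x; exact: front_ge0.
have bsq (Z1 Z2 : Omega -> R) : brv Z1 -> brv Z2 -> brv (fun w => (Z1 w - Z2 w) ^+ 2).
  by move=> b1 b2; under eq_fun do rewrite expr2; exact: (brvM (brvB b1 b2) (brvB b1 b2)).
have b1 : brv (fun w => Num.min 1 (j.+1%:R^-1 * m n%:R w)).
  by apply: brv_min1; [exact: measurable_funM|move=> w; apply: mulr_ge0; [exact: ltW|exact: m0]].
have q0 w : 0 <= C * expR (- (2 * lam * n%:R)) * p n%:R w.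
  by apply: mulr_ge0; [apply: mulr_ge0; [exact: C0|exact: expR_ge0]|exact: p0].
have b2 : brv (fun w => Num.min 1 (C * expR (- (2 * lam * n%:R)) * p n%:R w)).
  by apply: brv_min1; [exact: measurable_funM|exact: q0].
have jm0 w : 0 <= j.+1%:R^-1 * m n%:R w by apply: mulr_ge0; [exact: ltW|exact: m0].
have b3 : brv (fun w => Num.min 1 (j.+1%:R^-1 * m n%:R w + C * expR (- (2 * lam * n%:R)) * p n%:R w)).
  by apply: brv_min1; [apply: measurable_funD; exact: measurable_funM|move=> w; exact: addr_ge0].
have K1 := expect_le P b3 (brvD b1 b2) (fun w => min1D (jm0 w) (q0 w)).
rewrite (expectD P b1 b2) in K1.
have c2 := brv_cst Omega (2 : R).
have bAY := bsq _ _ bA (bY n%:R); have bYV := bsq _ _ (bY n%:R) bV.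
have K2 : \int[P]_w ((A w - V w) ^+ 2) <= 2 * \int[P]_w ((A w - Y n%:R w) ^+ 2) + 2 * \int[P]_w ((Y n%:R w - V w) ^+ 2).
  rewrite -(expectZ P 2 bAY) -(expectZ P 2 bYV) -(expectD P (brvM c2 bAY) (brvM c2 bYV)).
  apply: expect_le; [exact: bsq|exact: brvD (brvM c2 bAY) (brvM c2 bYV)|move=> w].
  rewrite -subr_ge0 (_ : _ - _ = (A w - Y n%:R w - (Y n%:R w - V w)) ^+ 2) ?sqr_ge0 //; ring.
apply: (le_trans K2).
(* The budget: [2 * 3 * (eta / 24 + eta / 24) + 2 * (eta / 8)] is at most [eta]. *)
exact: (chain_le (ltW eta0) HD K1 Hn1 Hn2 Hj).
Qed.

End Front.

(** Treats both directions at once: replacing [s = 1] by [s = -1] exchanges the two tails of [h].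
    Pairing the shifted measure with [f] is pairing [X t] with the front, and the limit measure
    pairs with [f] to [front_mass]. *)
Lemma shift_cvg_in_distribution (s : R) (Y : R -> Omega -> meas) (Z : Omega -> meas) : s * s = 1 ->
  (forall t w A, measurable A -> Y t w A = X t w ((fun y => y + s * speed lam * t) @^-1` A)) ->
  {ae P, forall w, forall A, measurable A -> Z w A = ((W w)%:E * (gs_coef beta lam h s)%:E *
     \int[leb]_(x in A) (expR (s * decay lam * x))%:E)%E} ->
  cvg_in_distribution P Y Z.
Proof.
move=> s1 YE ZE; pose c := gs_coef beta lam h s; have c0 : 0 < c by exact: (gs_coef_gt0 gs s1).
pose k := s * decay lam; pose nu : meas := exp_measure c k.
have mphi t : measurable_fun setT (fun y : R => y + s * speed lam * t) by exact: measurable_funD.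
have nuE f : Cc f -> (forall x, 0 <= f x) -> pairing nu f = front_mass beta lam h s f.
  move=> [cf [M fM]] f0; have mf := continuous_measurable_fun cf.
  have bf : bmf f by split => //; have [K _ fK] := Cc_bounded cf (ex_intro _ M fM); exists K.
  rewrite /pairing /Rintegral (ge0_integral_exp_measure c k mf f0) /front_mass.
  rewrite -RintegralZl //; last exact: (front_weight_integrable gs s1 bf fM).
  apply: eq_Rintegral => x _; rewrite gtr0_norm // mulrCA; reflexivity.
have YX t w f : Cc f -> (forall x, 0 <= f x) -> pairing (Y t w) f = pairing (X t w) (front lam s f t).
  move=> [cf _] f0; apply: (pairing_pushforward (mphi t) (YE t w)) => //; exact: continuous_measurable_fun.
have Yfin t w : loc_finite (Y t w).
  move=> M; rewrite YE //; apply: le_lt_trans (Xfin t w); apply: le_measure; rewrite ?inE //.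
  by rewrite -[_ @^-1` _]setTI; exact: mphi.
have ff t f : Cc f -> bmf (front lam s f t).
  move=> [cf sf]; apply: bmf_front; split; first exact: continuous_measurable_fun.
  by have [K _ fK] := Cc_bounded cf sf; exists K.
apply: (@laplace_cvg_in_distribution R d Omega P Y (fun w => Num.max (W w) 0) nu Z Yfin).
- move=> t f cf f0; under eq_fun do rewrite (YX t _ f cf f0).
  by apply: measurable_pairing; [exact: Xmeas|exact: (ff t f cf).1|move=> x; exact: front_ge0].
- exact: measurable_maxr.
- by move=> w; rewrite le_max lexx orbT.
- exact: exp_measure_loc_finite.
- move=> f cf f0 eta eta0; have [M fM] := cf.2.
  have bf : bmf f.
    split; first exact: (continuous_measurable_fun cf.1).
    by have [K _ fK] := Cc_bounded cf.1 cf.2; exists K.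
  have [T HT] := front_L2 s1 bf f0 fM eta0; exists T => t /HT; rewrite (nuE f cf f0).
  by under eq_Rintegral do rewrite -(YX t _ f cf f0) mulrC.
apply: filterS2 limit_ge0 ZE => w W0 Zw A mA; rewrite (Zw A mA) max_l // -muleA; congr (_ * _)%E.
transitivity (\int[leb]_(x in A) (c%:E * (expR (k * x))%:E))%E.
  rewrite ge0_integralZl //; last by rewrite lee_fin ltW.
  apply: measurable_funTS; apply/measurable_EFinP; apply: measurableT_comp => //; exact: measurable_funM.
by apply: eq_integral => x _; rewrite gtr0_norm // EFinM.
Qed.

End Superprocess.

Theorem theorem1p2 (R : realType)
  (beta alpha : R -> R) (pik : R -> {measure set R -> \bar R})
  (lam1 : R) (h : R -> R)
  (d : measure_display) (Omega : measurableType d) (P : probability Omega R)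
  (mu : {measure set R -> \bar R})
  (X : R -> Omega -> {measure set R -> \bar R}) (W : Omega -> R)
  (Yp Ym : R -> Omega -> {measure set R -> \bar R})
  (Zp Zm : Omega -> {measure set R -> \bar R}) :
  (* branching mechanism *)
  continuous beta -> compact_supp beta ->
  continuous alpha -> compact_supp alpha -> (forall x, 0 <= alpha x) ->
  (exists x, alpha x != 0) ->
  (forall A, measurable A -> measurable_fun setT (fun x : R => (pik x A : \bar R))) ->
  (forall x, pik x `]-oo, 0]%classic = 0%E) ->
  (forall x, (\int[pik x]_(u in setT) ((u ^+ 2)%:E) < +oo)%E) ->
  continuous (fun x => \int[pik x]_(u in setT) u ^+ 2) ->
  compact_supp (fun x => \int[pik x]_(u in setT) u ^+ 2) ->
  (* principal eigenvalue and eigenfunction *)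
  top_spectrum beta = lam1%:E -> 0 < lam1 ->
  (forall x, 0 < h x) -> continuous h -> (exists M : R, forall x, h x <= M) ->
  (forall x, derivable h x 1) -> (forall x, derivable (derive1 h) x 1) ->
  (forall x, 2^-1 * derive1 (derive1 h) x + beta x * h x = lam1 * h x) ->
  (\int[@lebesgue_measure R]_(x in setT) ((h x) ^+ 2)%:E = 1)%E ->
  (* the initial finite measure *)
  (mu setT < +oo)%E ->
  (* X is a process of finite random measures with law P_mu *)
  (forall t w, (X t w setT < +oo)%E) ->
  (forall t A, measurable A -> measurable_fun setT (fun w : Omega => (X t w A : \bar R))) ->
  {ae P, forall w, forall A, measurable A -> X 0 w A = mu A} ->
  (forall s t : R, 0 <= s <= t ->
   forall f : R -> R, bnn_meas f ->
   forall u : R -> R -> R, mild_solution beta alpha pik f u ->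
   forall (n : nat) (r : 'I_n -> R) (g : 'I_n -> R -> R),
     (forall i, 0 <= r i <= s) -> (forall i, bnn_meas (g i)) ->
     (\int[P]_(w in setT)
        (expR (- \sum_(i < n) pairing (X (r i) w) (g i))
         * expR (- pairing (X t w) f))%:E =
      \int[P]_(w in setT)
        (expR (- \sum_(i < n) pairing (X (r i) w) (g i))
         * expR (- pairing (X s w) (u (t - s))))%:E)%E) ->
  (* W^h_infty(X) *)
  measurable_fun setT W ->
  {ae P, forall w,
     (expR (- lam1 * t) * pairing (X t w) h) @[t --> +oo] --> W w} ->
  (* shifted measures X_t + sqrt(lam1/2) t and X_t - sqrt(lam1/2) t *)
  (forall t w A, measurable A ->
     Yp t w A = X t w ((fun y => y + Num.sqrt (lam1 / 2) * t) @^-1` A)) ->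
  (forall t w A, measurable A ->
     Ym t w A = X t w ((fun y => y - Num.sqrt (lam1 / 2) * t) @^-1` A)) ->
  (* limits W eta_+ and W eta_- *)
  {ae P, forall w, forall A, measurable A ->
     Zp w A = ((W w)%:E *
       ((Num.sqrt (2 * lam1))^-1 *
        \int[@lebesgue_measure R]_(y in setT)
           (beta y * h y * expR (- (Num.sqrt (2 * lam1) * y))))%:E *
       \int[@lebesgue_measure R]_(x in A) (expR (Num.sqrt (2 * lam1) * x))%:E)%E} ->
  {ae P, forall w, forall A, measurable A ->
     Zm w A = ((W w)%:E *
       ((Num.sqrt (2 * lam1))^-1 *
        \int[@lebesgue_measure R]_(y in setT)
           (beta y * h y * expR (Num.sqrt (2 * lam1) * y)))%:E *
       \int[@lebesgue_measure R]_(x in A) (expR (- (Num.sqrt (2 * lam1) * x)))%:E)%E} ->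
  cvg_in_distribution P Yp Zp /\ cvg_in_distribution P Ym Zm.
Proof.
move=> bcont bsupp acont asupp a0 _ pmeas pik0 pint pcont psupp _ lam0 hp hcont hbdd hd1 hd2 hode hnorm.
move=> _ Xfin Xmeas _ Xlaw Wmeas Wlim YpE YmE ZpE ZmE.
have gs : ground_state beta lam1 h.
  have e : (\int[@lebesgue_measure R]_x (h x * h x)%:E = 1)%E.
    by rewrite -hnorm; apply: eq_integral => x _; rewrite expr2.
  have hn : \int[@lebesgue_measure R]_x (h x * h x) = 1 by rewrite /Rintegral e.
  exact: (GroundState lam0 bcont bsupp hp hbdd hd1 hd2 hode hn).
have K (s : R) := @shift_cvg_in_distribution R beta alpha pik lam1 h gs acont asupp a0 pmeas pik0 pint pcont psupp
  d Omega P X W Xfin Xmeas Xlaw Wmeas Wlim s.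
pose k := Num.sqrt (2 * lam1).
have k1 : 1 * Num.sqrt (2 * lam1) = Num.sqrt (2 * lam1) by exact: mul1r.
have kN1 : -1 * k = - k by exact: mulN1r.
split.
  apply: (K 1) => [|t w A mA|]; first by rewrite mulr1.
    rewrite YpE //; congr (X t w _).
    by rewrite mul1r.
  apply: filterS ZpE => w Zw A mA; rewrite (Zw A mA) /gs_coef /decay k1; reflexivity.
apply: (K (-1)) => [|t w A mA|]; first by rewrite mulrNN mulr1.
  by rewrite YmE // /speed mulN1r mulNr.
have C2 : gs_coef beta lam1 h (-1) = k^-1 * \int[@lebesgue_measure R]_y (beta y * h y * expR (k * y)).
  rewrite /gs_coef /decay -/k kN1; apply: (congr1 (fun z => k^-1 * z)).
  by apply: eq_Rintegral => x _; rewrite mulNr opprK.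
have E2 A : (\int[@lebesgue_measure R]_(x in A) (expR (- (k * x)))%:E =
    \int[@lebesgue_measure R]_(x in A) (expR (-1 * decay lam1 * x))%:E)%E.
  by apply: eq_integral => x _; rewrite /decay -/k kN1 mulNr.
apply: filterS ZmE => w Zw A mA; rewrite (Zw A mA) C2 E2; reflexivity.
Qed.
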